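(* For $\gamma>0$, let $D=D_\gamma>0$ be the number solving the equation $$D^{2\gamma+2}=\sum_{j=1}^m (n_j^2\varepsilon_j^2)\wedge (n_jD).$$ (Global risk.) Take $\gamma=\alpha$. Whenever, for some $\kappa>0$, $\delta_j\lesssim \left(n_j^{1/2}\varepsilon_j^2(D\vee 1)^{-1}\right)^{1+\kappa}$ for all $j=1,\dots,m$, the global minimax risk satisfies $$\inf_{\hat f\in\mathcal M(\boldsymbol\varepsilon,\boldsymbol\delta)}\ \sup_{f\in\mathcal B^{\alpha,R}_{p,q}}\mathbb E_f\|\hat f-f\|_2^2\asymp \left(M_N D^{-2\alpha}\right)\wedge 1,$$ where $M_N\ge 1$ is a sequence of order at most $\log(N)\log(1/\min_{j\in[m]}\delta_j)$. (Pointwise risk.) Take $\gamma=\nu=\alpha-1/p$ and let $x_0\in(0,1)$. Whenever $\sum_{j=1}^m n_j\delta_j\to 0$, the pointwise minimax risk satisfies $$\inf_{\hat f\in\mathcal M(\boldsymbol\varepsilon,\boldsymbol\delta)}\ \sup_{f\in\mathcal B^{\alpha,R}_{p,q}}\mathbb E_f|\hat f(x_0)-f(x_0)|^2\asymp \left(M_N D^{-2\nu}\right)\wedge 1,$$ for a sequence $M_N\ge1$ of order at most $\log(N)$.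
   Context: Data. There are $m$ servers; server $j$ holds $n_j$ observations $Z^{(j)}=(Z^{(j)}_i)_{i=1}^{n_j}$, $Z_i^{(j)}=(Y_i^{(j)},X_i^{(j)})\in\mathcal Z=\mathbb R\times[0,1]$. All $N=\sum_{j=1}^m n_j$ observations are i.i.d. from $P_f$, under which $X_i^{(j)}\sim U[0,1]$, $Y_i^{(j)}=f(X_i^{(j)})+\xi_i^{(j)}$, with $\xi_i^{(j)}\sim N(0,1)$ independent of $X_i^{(j)}$. Privacy. Server $j$ outputs a randomized transcript $T^{(j)}$ in a standard Borel space $(\mathcal T,\mathscr T)$, drawn from a conditional law $\mathbb P(\cdot\mid Z^{(j)})$ depending only on $Z^{(j)}$ (no interaction between servers). It is $(\varepsilon_j,\delta_j)$-differentially private if $\mathbb P(T^{(j)}\in A\mid Z^{(j)}=z)\le e^{\varepsilon_j}\mathbb P(T^{(j)}\in A\mid Z^{(j)}=z')+\delta_j$ for all $A\in\mathscr T$ and all $z,z'\in\mathcal Z^{n_j}$ differing in at most one of their $n_j$ entries. Here $0<\varepsilon_j\le C_\varepsilon$ for a fixed constant $C_\varepsilon>0$, and $(\boldsymbol\varepsilon,\boldsymbol\delta)=\{(\varepsilon_j,\delta_j)\}_{j=1}^m$. $\mathcal M(\boldsymbol\varepsilon,\boldsymbol\delta)$ is the class of distributed estimation protocols: transcript mechanisms, with $T^{(j)}$ being $(\varepsilon_j,\delta_j)$-differentially private for each $j$, together with an estimator $\hat f$ which is a (function-valued) function of $T=(T^{(1)},\dots,T^{(m)})$. $\mathbb E_f$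 is expectation under the joint law of data and transcripts when data are drawn from $P_f$. Function class. $p\ge2$, $q\ge1$, $\nu:=\alpha-1/p>1/2$, and $R>0$ is a constant. Let $\{\psi_{lk}\}$, $l\ge l_0$, be a Cohen–Daubechies–Vial compactly supported $A$-regular orthonormal wavelet basis of $L_2[0,1]$ with $A>\alpha$ (level $l_0$ denotes the father wavelets; levels $l>l_0$ contain $2^l$ wavelets, $k=0,\dots,2^l-1$, with $\psi_{lk}(x)=2^{l/2}\psi(2^lx-k)$ away from the boundary), and $f_{lk}=\langle f,\psi_{lk}\rangle$. Then $\|f\|_{\mathcal B^\alpha_{p,q}}=\big(\sum_{l\ge l_0}(2^{l(\alpha+1/2-1/p)}\|(f_{lk})_k\|_p)^q\big)^{1/q}$ (supremum over $l$ if $q=\infty$), and $\mathcal B^{\alpha,R}_{p,q}=\{f\in L_2[0,1]:\|f\|_{\mathcal B^\alpha_{p,q}}\le R\}$. Asymptotics. Statements are asymptotic in $m$, the $n_j$ and $(\boldsymbol\varepsilon,\boldsymbol\delta)$, with $N\to\infty$. $a\lesssim b$ means $a\le Cb$ for a constant $C>0$ not depending on $m,n_j,\varepsilon_j,\delta_j$ (it may depend on the fixed quantities, such as $\alpha,p,q,R,\kappa,C_\varepsilon$ and the wavelet basis); $a\asymp b$ means $a\lesssim b$ and $b\lesssim a$. $a\wedge b=\min(a,b)$, $a\vee b=\max(a,b)$, $[m]=\{1,\dots,m\}$.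
   Formalization: In the global part the bound on M_N is read as order at most max(1, log(N) log(1/min δ_j)), because δ_j is not assumed bounded away from 1 and, e.g. for δ_j = 1, M_N ≥ 1 of order at most log(N) log(1/min δ_j) = 0 is impossible. *)

(* Defs.v *)
From HB Require Import structures.
From mathcomp Require Import all_boot all_order all_algebra.
From mathcomp Require Import all_classical all_reals all_analysis.
From mathcomp Require Import measurable_realfun.

Set Implicit Arguments.
Unset Strict Implicit.
Unset Printing Implicit Defensive.
Import Order.TTheory GRing.Theory Num.Theory.
Import numFieldNormedType.Exports.

Local Open Scope classical_set_scope.
Local Open Scope ring_scope.

Section cons_tuple.
Context d (T : measurableType d) (n : nat).

Definition cons_tuple (x : T * n.-tuple T) : n.+1.-tuple T :=
  [the n.+1.-tuple T of x.1 :: x.2].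

Lemma measurable_cons_tuple : measurable_fun setT cons_tuple.
Proof. exact: measurable_cons. Qed.

HB.instance Definition _ := @isMeasurableFun.Build _ _ _ _
  cons_tuple measurable_cons_tuple.

End cons_tuple.

(* The product Q_0 x ... x Q_(n-1), as a law on n-tuples. *)
Fixpoint prod_prob d (T : measurableType d) (R : realType) (n : nat) :
    ('I_n -> probability T R) -> probability (n.-tuple T) R :=
  match n with
  | 0 => fun=> \d_([tuple] : 0.-tuple T)
  | n'.+1 => fun Q =>
      distribution (Q ord0 \x prod_prob (fun i => Q (lift ord0 i)))%E
                   (@cons_tuple d T n')
  end.

(* The law of a draw from K z when z is itself drawn from P. *)
Definition mixture d d' (X : measurableType d) (Y : measurableType d')
    (R : realType) (P : probability X R) (K : R.-pker X ~> Y) :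
    set Y -> \bar R :=
  fun A => (\int[P]_z K z A)%E.

Section mixture_probability.
Context d d' (X : measurableType d) (Y : measurableType d') (R : realType)
  (P : probability X R) (K : R.-pker X ~> Y).

Let mixture0 : mixture P K set0 = 0%E.
Proof. by rewrite /mixture; apply: integral0_eq => z _; rewrite measure0. Qed.

Let mixture_ge0 A : (0 <= mixture P K A)%E.
Proof. exact: integral_ge0. Qed.

Let mixture_sigma_additive : semi_sigma_additive (mixture P K).
Proof.
move=> U mU tU mUU; rewrite [X in _ --> X](_ : _ =
  \int[P]_z (\sum_(n <oo) K z (U n)))%E; last first.
  apply: eq_integral => z _.
  by apply/esym/cvg_lim => //; exact/measure_semi_sigma_additive.
apply/cvg_closeP; split.
  by apply: is_cvg_nneseries => n _; rewrite integral_ge0.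
rewrite closeE// integral_nneseries// => n.
exact: measurable_kernel.
Qed.

HB.instance Definition _ := isMeasure.Build _ _ _ (mixture P K)
  mixture0 mixture_ge0 mixture_sigma_additive.

Let mixture_setT : mixture P K setT = 1%E.
Proof.
rewrite /mixture (eq_integral (cst 1%E)); last by move=> z _; exact: prob_kernel.
rewrite integral_cst//. rewrite mul1e. exact: probability_setT.
Qed.

HB.instance Definition _ := Measure_isProbability.Build _ _ _
  (mixture P K) mixture_setT.

End mixture_probability.

(* Isomorphic to a Polish space with its Borel sigma-algebra. *)
Definition standard_borel d (T : measurableType d) (R : realType) : Prop :=
  exists (X : completePseudoMetricType R) (g : T -> X),
    [/\ hausdorff_space X,
        (exists2 S : set X, countable S & dense S),
        bijective g
      & forall B : set T,
          measurable B <-> <<s [set U : set X | open U] >> (g @` B)].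

Section regression.
Context {R : realType}.

Local Notation mR := (measurableTypeR R).

(* (X, xi) |-> (Y, X) with Y = f X + xi *)
Definition observe (f : {mfun R >-> R}) (u : mR * mR) : R * R :=
  (f u.1 + u.2, u.1).

Lemma measurable_observe (f : {mfun R >-> R}) :
  measurable_fun setT (observe f).
Proof.
apply/measurable_fun_pairP; split => /=; last exact: (@measurable_fst _ _ mR mR).
apply: measurable_funD; last exact: (@measurable_snd _ _ mR mR).
have mf : measurable_fun setT (f : mR -> R) by exact: (@measurable_funPT _ _ R R f).
apply: (measurableT_comp mf); exact: (@measurable_fst _ _ mR mR).
Qed.

HB.instance Definition _ f := @isMeasurableFun.Build _ _ _ _
  (observe f) (measurable_observe f).

Definition P_ (f : {mfun R >-> R}) : probability (R * R)%type R :=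
  distribution (uniform_prob (@ltr01 R) \x normal_prob (0 : R) 1)%E (observe f).

End regression.

Record setting (R : realType) := Setting {
  servers : nat ;
  nobs : 'I_servers -> nat ;
  eps : 'I_servers -> R ;
  del : 'I_servers -> R }.

Definition total_obs (R : realType) (s : setting R) : nat :=
  (\sum_(j < servers s) nobs j)%N.

Definition valid_setting (R : realType) (Ceps : R) (s : setting R) : Prop :=
  forall j : 'I_(servers s),
    [/\ (0 < nobs j)%N, 0 < eps j <= Ceps & 0 <= del j].

Section privacy.
Context {R : realType}.

(* The sample space is (R x [0,1])^n inside (R x R)^n; a mechanism is a kernel
   on the latter, but only its restriction to the former is constrained. *)
Definition sample_space (n : nat) : set (n.-tuple (R * R)%type) :=
  [set z | forall i, 0 <= (tnth z i).2 <= 1].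

Definition neighbours (n : nat) (z z' : n.-tuple (R * R)%type) : bool :=
  (#|[pred i | tnth z i != tnth z' i]| <= 1)%N.

Definition diff_private (n : nat) d (T : measurableType d)
    (K : R.-pker (n.-tuple (R * R)%type) ~> T) (e delta : R) : Prop :=
  forall z z', sample_space z -> sample_space z' -> neighbours z z' ->
  forall A, measurable A -> (K z A <= (expR e)%:E * K z' A + delta%:E)%E.

Record protocol (s : setting R) := Protocol {
  tdisp : measure_display ;
  transcript : measurableType tdisp ;
  mechanism : forall j : 'I_(servers s),
    R.-pker ((nobs j).-tuple (R * R)%type) ~> transcript ;
  estimator : (servers s).-tuple transcript -> R -> R ;
  measurable_estimator :
    measurable_fun setT (fun u : (servers s).-tuple transcript * R =>
                           estimator u.1 u.2) }.

Arguments mechanism [s] p j : rename.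
Arguments estimator [s] p _ _ : rename.

Definition private_protocol (s : setting R) (Q : protocol s) : Prop :=
  standard_borel (transcript Q) R /\
  forall j, diff_private (mechanism Q j) (eps j) (del j).

(* The estimator sees the data through the transcripts only, so the marginal
   law of the transcripts is all that the risks need from the joint law. *)
Definition transcript_law (s : setting R) (Q : protocol s)
    (f : {mfun R >-> R}) : probability ((servers s).-tuple (transcript Q)) R :=
  prod_prob (fun j : 'I_(servers s) =>
    mixture (prod_prob (fun _ : 'I_(nobs j) => P_ f)) (mechanism Q j)
      : probability _ _).

Definition global_risk (s : setting R) (Q : protocol s) (f : {mfun R >-> R}) :
    \bar R :=
  (\int[transcript_law Q f]_t
     \int[lebesgue_measure]_(x in `[0%R, 1%R])
        ((estimator Q t x - f x) ^+ 2)%:E)%E.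

Definition pointwise_risk (x0 : R) (s : setting R) (Q : protocol s)
    (f : {mfun R >-> R}) : \bar R :=
  (\int[transcript_law Q f]_t ((estimator Q t x0 - f x0) ^+ 2)%:E)%E.

Definition minimax (F : set {mfun R >-> R}) (s : setting R)
    (risk : protocol s -> {mfun R >-> R} -> \bar R) : \bar R :=
  ereal_inf [set x | exists2 Q : protocol s, private_protocol Q &
                       x = ereal_sup [set risk Q f | f in F]].

End privacy.

Arguments mechanism {R} [s] p j : rename.
Arguments estimator {R} [s] p _ _ : rename.

(* [cdv_S] is the number of vanishing moments, which is also the number of
   boundary functions at each end.  The boundary functions live on [0, +oo),
   the right-hand ones being reflected. *)
Record cdv_system (R : realType) := CDV {
  cdv_S : nat ;
  taps : nat -> R ;
  phi : R -> R ;
  psi : R -> R ;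
  edgeL : nat -> nat -> R ;
  edgeR : nat -> nat -> R ;
  psiL : nat -> R -> R ;
  psiR : nat -> R -> R }.

Section wavelets.
Context {R : realType}.
Local Notation mu := (@lebesgue_measure R).

(* Linear combinations of the S functions
   y |-> \sum_(n < 2S-1) C(n, r) g (y + n - S + 1), r < S, on [0, +oo). *)
Definition edge_scaling (S : nat) (a : nat -> nat -> R) (g : R -> R) (k : nat)
    (y : R) : R :=
  \sum_(r < S) a k r *
    \sum_(n < (2 * S).-1) 'C(n, r)%:R * g (y + n%:R - S%:R + 1).

Definition at_level (S : nat) (gL : nat -> R -> R) (g : R -> R)
    (gR : nat -> R -> R) (j k : nat) (x : R) : R :=
  2 `^ (j%:R / 2) *
  (if (k < S)%N then gL k (2 ^+ j * x)
   else if (k < 2 ^ j - S)%N then g (2 ^+ j * x - k%:R)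
   else gR (2 ^ j - k.+1)%N (2 ^+ j * (1 - x))).

Variable W : cdv_system R.
Local Notation S := (cdv_S W).

Definition father : nat -> nat -> R -> R :=
  at_level S (edge_scaling S (edgeL W) (phi W)) (phi W)
             (edge_scaling S (edgeR W) (fun t => phi W (1 - t))).

Definition mother : nat -> nat -> R -> R := at_level S (psiL W) (psi W) (psiR W).

(* The mother wavelets of levels l > l0 complement the span of the 2^(l0+1)
   father wavelets of resolution l0+1, which are indexed as level l0. *)
Definition nwav (l0 l : nat) : nat := (2 ^ (if l == l0 then l0.+1 else l))%N.

Definition wavelet (l0 l k : nat) : R -> R :=
  if l == l0 then father l0.+1 k else mother l k.

Definition coef (l0 : nat) (f : R -> R) (l k : nat) : R :=
  \int[mu]_(x in `[0, 1]) (f x * wavelet l0 l k x).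

Definition square_integrable (f : R -> R) : Prop :=
  (\int[mu]_(x in `[0%R, 1%R]) ((f x) ^+ 2)%:E < +oo)%E.

Definition class_C (A : nat) (g : R -> R) : Prop :=
  (forall i x, (i < A)%N -> derivable (derive1n i g) x 1) /\ continuous (derive1n A g).

(* A Daubechies multiresolution analysis on the line, with phi and psi
   supported in [1 - S, S]. *)
Definition daubechies (A : nat) : Prop :=
  [/\ (A <= S)%N /\ class_C A (phi W),
      (forall x, ~~ (1 - S%:R <= x <= S%:R) -> phi W x = 0),
      \int[mu]_x phi W x = 1 /\
      (forall k : int, \int[mu]_x (phi W x * phi W (x - k%:~R)) = (k == 0)%:R),
      (forall x, phi W x = Num.sqrt 2 *
         \sum_(i < 2 * S) taps W i * phi W (2 * x - i%:R + S%:R - 1)) /\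
      (forall x, psi W x = Num.sqrt 2 *
         \sum_(i < 2 * S) (-1) ^+ (i + S.+1) * taps W (2 * S - i.+1)
                          * phi W (2 * x - i%:R + S%:R - 1))
    & forall r, (r < S)%N -> \int[mu]_x (x ^+ r * psi W x) = 0].

Definition cdv_basis (A l0 : nat) : Prop :=
  [/\ daubechies A /\ (2 * S <= 2 ^ l0.+1)%N,
      (exists B : R, forall k y, (k < S)%N -> B < y ->
         psiL W k y = 0 /\ psiR W k y = 0),
      (forall j k, (l0 < j)%N -> (k < 2 ^ j)%N -> exists c : nat -> R,
         forall x, 0 <= x <= 1 ->
         mother j k x = \sum_(i < 2 ^ j.+1) c i * father j.+1 i x),
      (forall l k l' k', (l0 <= l)%N -> (l0 <= l')%N ->
         (k < nwav l0 l)%N -> (k' < nwav l0 l')%N ->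
         \int[mu]_(x in `[0, 1]) (wavelet l0 l k x * wavelet l0 l' k' x) =
           ((l == l') && (k == k'))%:R)
    & forall f : {mfun R >-> R}, square_integrable f ->
        (forall l k, (l0 <= l)%N -> (k < nwav l0 l)%N -> coef l0 f l k = 0) ->
        (\int[mu]_(x in `[0%R, 1%R]) ((f x) ^+ 2)%:E)%E = 0%E].

(* 1 / p, with 1 / +oo = 0 *)
Definition invp (p : \bar R) : R := fine (p^-1)%E.

Definition lp_norm (p : \bar R) (n : nat) (a : nat -> R) : R :=
  match p with
  | r%:E => (\sum_(k < n) `|a k| `^ r) `^ r^-1
  | _ => \big[Num.max/0]_(k < n) `|a k|
  end.

Definition besov_norm (alpha : R) (p q : \bar R) (l0 : nat) (f : R -> R) :
    \bar R :=
  let b l := (2 `^ (l%:R * (alpha + 1 / 2 - invp p)) *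
              lp_norm p (nwav l0 l) (coef l0 f l))%:E in
  (match q with
   | r%:E => (\sum_(l0 <= l <oo) (b l `^ r)) `^ (r^-1)%R
   | _ => ereal_sup [set b l | l in [set l | (l0 <= l)%N]]
   end)%E.

(* Elements of L_2[0,1] are represented by measurable functions on the line,
   whose values outside [0,1] play no role. *)
Definition besov_ball (alpha : R) (p q : \bar R) (l0 : nat) (rad : R) :
    set {mfun R >-> R} :=
  [set f : {mfun R >-> R} | square_integrable f /\
     (besov_norm alpha p q l0 f <= rad%:E)%E].

(* Point values refer to the continuous representative, which exists as
   alpha - 1/p > 0. *)
Definition besov_ball_cont (alpha : R) (p q : \bar R) (l0 : nat) (rad : R) :
    set {mfun R >-> R} :=
  [set f : {mfun R >-> R} | besov_ball alpha p q l0 rad f /\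
     {within `[0%R, 1%R], continuous f}].

End wavelets.

Definition solves_rate (R : realType) (gamma : R) (s : setting R) (D : R) :
    Prop :=
  0 < D /\
  D `^ (2 * gamma + 2) = \sum_(j < servers s)
    Num.min ((nobs j)%:R ^+ 2 * eps j ^+ 2) ((nobs j)%:R * D).

(* log (1 / min_j delta_j), computed in the extended reals so that it is +oo
   when some delta_j is 0 *)
Definition log_inv_del (R : realType) (s : setting R) : \bar R :=
  lne (\big[Order.min/+oo%E]_(j < servers s) (del j)%:E)^-1%E.

Definition between (R : realType) (c C : R) (x : \bar R) (r : R) : Prop :=
  ((c * r)%:E <= x <= (C * r)%:E)%E.

(* Main.v *)
(** Lower bounds: the zero function is compared with bumps of height [h], a multiple of
    [D^-gamma], on sets of measure [w], a multiple of [1/D]: one bump at [x0] for the pointwise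
    risk (Le Cam), about [D] disjoint bumps with arbitrary signs for the global one (Assouad).
    The transcript of a server with [n] observations separates two such hypotheses by at most a
    multiple of [n h^2 w], because it depends on the sample only, and of
    [(n eps h w)^2 + n delta h w], because replacing the observations one at a time by draws
    from the other law affects each of them with probability of order [h w].  Under the
    assumption on [delta] of the global bound, the separation is cut at a level [M]: below [M]
    the last term gains a factor [M], and the excess is controlled by a moment of the likelihood
    ratio whose order depends on [kappa].  The equation for [D] makes these quantities add up to
    a constant over the servers.

    Upper bounds: with [2^n] of order [D], each server releases its empirical wavelet
    coefficients of level below [n], computed from responses clipped at [tau], where [tau^2] is of
    order [ln N], plus Laplace noise; this is even [(eps_j, 0)]-private.  The estimator averages
    the servers with weights proportional to [min(n_j^2 eps_j^2, n_j D)], and only the noise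
    term feels the logarithm.  If all [delta_j] exceed 1/2, then [log (1 / min delta_j)] leaves no
    room for a logarithm, but the assumption on [delta_j] then forces [eps_j^2 sqrt n_j] to
    dominate [D], and the noise is negligible. *)
From HB Require Import structures.
Require Import Defs.
From mathcomp Require Import all_boot all_order all_algebra.
From mathcomp Require Import all_classical all_reals all_analysis.
From mathcomp Require Import measurable_realfun.
From mathcomp Require Import zify ring lra.
Set Implicit Arguments.
Unset Strict Implicit.
Unset Printing Implicit Defensive.
Import Order.TTheory GRing.Theory Num.Theory.
Import numFieldNormedType.Exports.
Local Open Scope classical_set_scope.
Local Open Scope ring_scope.

(** * Product laws and mixtures *)

(** Two transcript laws are compared through their densities [1 + s] and [1 - s] with respect to
    their mean [kap], and their separation is the [kap]-mean of [s ^ 2]. This quantity never exceeds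
    one, and it tensorises through the product of the [1 - s ^ 2], so that no chain rule is
    required. It is estimated by self-absorption: the test function [s] distinguishes the two laws
    by exactly twice the unknown separation, while group privacy or Young's inequality bounds this
    difference by known terms plus a fraction of the unknown itself. Moments of likelihood ratios
    are of even order [2 (k + 1)], so that they are polynomials in a signed variable whose linear
    term integrates to zero; [k] is taken with [k kappa >= 1], which makes the excess above the cut
    quadratic in the privacy budget.

    In the upper bounds, clipping does not increase the sampling variance, and the projection kernel
    enters that variance in mean square only; this is why the logarithm is confined to the noise.
    Integrals are kept nonnegative wherever possible, by moving terms across an inequality or by
    quantifying over shifts. *)

Section prod_prob_integral.
Context d (T : measurableType d) (R : realType).
Local Open Scope ereal_scope.

Lemma integral_prod_prob0 (Q : 'I_0 -> probability T R) (f : 0.-tuple T -> \bar R) :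
  measurable_fun setT f -> \int[prod_prob Q]_z f z = f [tuple].
Proof. by move=> mf; rewrite /= integral_dirac// diracT mul1e. Qed.

Lemma ge0_integral_prod_probS n (Q : 'I_n.+1 -> probability T R)
    (f : n.+1.-tuple T -> \bar R) :
  measurable_fun setT f -> (forall z, 0 <= f z) ->
  \int[prod_prob Q]_z f z =
  \int[Q ord0]_x \int[prod_prob (fun i : 'I_n => Q (lift ord0 i))]_z f (Defs.cons_tuple (x, z)).
Proof.
move=> mf f0 /=.
rewrite ge0_integral_distribution//.
have mfc : measurable_fun [set: (T * n.-tuple T)%type] (f \o @Defs.cons_tuple d T n).
  apply: (measurableT_comp mf); exact: Defs.measurable_cons_tuple.
by rewrite (fubini_tonelli1 _ mfc)// => z; exact: f0.
Qed.

Lemma ge0_integral_prod_probS2 n (Q : 'I_n.+1 -> probability T R)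
    (f : n.+1.-tuple T -> \bar R) :
  measurable_fun setT f -> (forall z, 0 <= f z) ->
  \int[prod_prob Q]_z f z =
  \int[prod_prob (fun i : 'I_n => Q (lift ord0 i))]_z \int[Q ord0]_x f (Defs.cons_tuple (x, z)).
Proof.
move=> mf f0 /=.
rewrite ge0_integral_distribution//.
have mfc : measurable_fun [set: (T * n.-tuple T)%type] (f \o @Defs.cons_tuple d T n).
  apply: (measurableT_comp mf); exact: Defs.measurable_cons_tuple.
by rewrite (fubini_tonelli2 _ mfc)// => z; exact: f0.
Qed.

Lemma measurable_cons_l n (x : T) : measurable_fun setT (fun z : n.-tuple T => Defs.cons_tuple (x, z)).
Proof. apply: measurableT_comp => //; exact: Defs.measurable_cons_tuple. Qed.

Lemma measurable_cons_r n (z : n.-tuple T) : measurable_fun setT (fun x : T => Defs.cons_tuple (x, z)).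
Proof. apply: measurableT_comp => //; exact: Defs.measurable_cons_tuple. Qed.

Lemma measurable_int_cons_l n (Q : probability T R) (f : n.+1.-tuple T -> \bar R) :
  measurable_fun setT f -> (forall z, 0 <= f z) ->
  measurable_fun setT (fun z => \int[Q]_x f (Defs.cons_tuple (x, z))).
Proof.
move=> mf f0.
apply: (@measurable_fun_fubini_tonelli_G _ _ T (n.-tuple T) R Q (fun xz => f (Defs.cons_tuple xz))) => //.
apply: measurableT_comp => //; exact: Defs.measurable_cons_tuple.
Qed.

Lemma measurable_int_cons_r n (Q : probability (n.-tuple T) R) (f : n.+1.-tuple T -> \bar R) :
  measurable_fun setT f -> (forall z, 0 <= f z) ->
  measurable_fun setT (fun x => \int[Q]_z f (Defs.cons_tuple (x, z))).
Proof.
move=> mf f0.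
apply: (@measurable_fun_fubini_tonelli_F _ _ T (n.-tuple T) R Q (fun xz => f (Defs.cons_tuple xz))) => //.
apply: measurableT_comp => //; exact: Defs.measurable_cons_tuple.
Qed.

Lemma tnth_cons0 n (x : T) (z : n.-tuple T) : tnth (Defs.cons_tuple (x, z)) ord0 = x.
Proof. by []. Qed.

Lemma tnth_consS n (x : T) (z : n.-tuple T) i : tnth (Defs.cons_tuple (x, z)) (lift ord0 i) = tnth z i.
Proof. by rewrite (tnth_nth x) /= -tnth_nth. Qed.

Lemma measurable_prod_tnth n (w : 'I_n -> T -> R) :
  (forall i, measurable_fun setT (w i)) ->
  measurable_fun setT (fun z : n.-tuple T => (\prod_i w i (tnth z i))%R).
Proof.
move=> mw; apply: measurable_prod => i _.
exact: measurableT_comp (mw i) (measurable_tnth i).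
Qed.

Lemma measurable_sum_tnth n (w : 'I_n -> T -> R) :
  (forall i, measurable_fun setT (w i)) ->
  measurable_fun setT (fun z : n.-tuple T => (\sum_i w i (tnth z i))%R).
Proof.
move=> mw; apply: measurable_sum => i.
exact: measurableT_comp (mw i) (measurable_tnth i).
Qed.

Lemma prod_prob_density n (P mu : 'I_n -> probability T R) (w : 'I_n -> T -> R) :
  (forall i, measurable_fun setT (w i)) -> (forall i t, (0 <= w i t)%R) ->
  (forall i (g : T -> \bar R), measurable_fun setT g -> (forall t, 0 <= g t) ->
     \int[P i]_t g t = \int[mu i]_t (g t * (w i t)%:E)) ->
  forall F : n.-tuple T -> \bar R, measurable_fun setT F -> (forall z, 0 <= F z) ->
  \int[prod_prob P]_z F z =
  \int[prod_prob mu]_z (F z * (\prod_i w i (tnth z i))%:E).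
Proof.
elim: n P mu w => [|n IH] P mu w mw w0 Pw F mF F0.
  rewrite !integral_prod_prob0//; last by under eq_fun do rewrite big_ord0 mule1.
  by rewrite big_ord0 mule1.
have mpr : measurable_fun setT (fun z : n.+1.-tuple T => (\prod_i w i (tnth z i))%:E).
  by apply/measurable_EFinP; exact: measurable_prod_tnth.
have pr0 k (v : 'I_k -> T -> R) (z : k.-tuple T) : (forall i t, (0 <= v i t)%R) -> (0 <= \prod_i v i (tnth z i))%R.
  by move=> v0; apply: prodr_ge0.
rewrite ge0_integral_prod_probS// [RHS]ge0_integral_prod_probS//; last 2 first.
- exact: emeasurable_funM.
- by move=> z; rewrite mule_ge0// lee_fin pr0.
rewrite Pw//; last 2 first.
- by apply: measurable_int_cons_r.
- by move=> x; apply: integral_ge0.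
apply: eq_integral => x _.
rewrite (IH _ (fun i : 'I_n => mu (lift ord0 i)) (fun i => w (lift ord0 i)))//; last 2 first.
- by move=> i; exact: Pw.
- exact: measurableT_comp mF (measurable_cons_l x).
have mI : measurable_fun setT (fun z : n.-tuple T => F (Defs.cons_tuple (x, z)) *
     (\prod_i w (lift ord0 i) (tnth z i))%:E).
  apply: emeasurable_funM; first exact: measurableT_comp mF (measurable_cons_l x).
  by apply/measurable_EFinP; exact: (measurable_prod_tnth (w := fun i => w (lift ord0 i))).
rewrite -ge0_integralZr//; last 2 first.
- by move=> z _; rewrite mule_ge0// lee_fin (pr0 _ (fun i => w (lift ord0 i))).
- by rewrite lee_fin.
apply: eq_integral => z _.
rewrite big_ord_recl tnth_cons0.
have -> : (\prod_(i < n) w (lift ord0 i) (tnth (Defs.cons_tuple (x, z)) (lift ord0 i)) =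
   \prod_(i < n) w (lift ord0 i) (tnth z i))%R.
  by apply: eq_bigr => i _; rewrite tnth_consS.
by rewrite EFinM -muleA [in RHS](muleC (w ord0 x)%:E).
Qed.

(** An inequality is enough: it carries lower bounds on the mean of [1 - s ^ 2] at each server to
    the product law. *)
Lemma prod_prob_prod_ge n (mu : 'I_n -> probability T R) (g : 'I_n -> T -> R) (a : 'I_n -> R) :
  (forall i, measurable_fun setT (g i)) -> (forall i t, (0 <= g i t)%R) ->
  (forall i, (0 <= a i)%R) ->
  (forall i, (a i)%:E <= \int[mu i]_t (g i t)%:E) ->
  (\prod_i a i)%:E <= \int[prod_prob mu]_z (\prod_i g i (tnth z i))%:E.
Proof.
elim: n mu g a => [|n IH] mu g a mg g0 a0 ag.
  rewrite integral_prod_prob0; first by rewrite !big_ord0.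
  by apply/measurable_EFinP; exact: measurable_prod_tnth.
have mpr : measurable_fun setT (fun z : n.+1.-tuple T => (\prod_i g i (tnth z i))%:E).
  by apply/measurable_EFinP; exact: measurable_prod_tnth.
have mpr' : measurable_fun setT (fun z : n.-tuple T => (\prod_i g (lift ord0 i) (tnth z i))%:E).
  by apply/measurable_EFinP; apply: (measurable_prod_tnth (w := fun i => g (lift ord0 i))).
rewrite ge0_integral_prod_probS//; last by move=> z; rewrite lee_fin prodr_ge0.
have -> : \int[mu ord0]_x \int[prod_prob (fun i : 'I_n => mu (lift ord0 i))]_z
     (\prod_i g i (tnth (Defs.cons_tuple (x, z)) i))%:E =
   \int[mu ord0]_x ((g ord0 x)%:E * \int[prod_prob (fun i : 'I_n => mu (lift ord0 i))]_z
     (\prod_i g (lift ord0 i) (tnth z i))%:E).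
  apply: eq_integral => x _.
  rewrite -ge0_integralZl//; last 2 first.
  - by move=> z _; rewrite lee_fin prodr_ge0.
  - by rewrite lee_fin.
  apply: eq_integral => z _.
  rewrite big_ord_recl tnth_cons0 EFinM.
  by congr (_ * _%:E); apply: eq_bigr => i _; rewrite tnth_consS.
rewrite ge0_integralZr//; last 3 first.
- exact/measurable_EFinP.
- by move=> x _; rewrite lee_fin.
- by apply: integral_ge0 => z _; rewrite lee_fin prodr_ge0.
rewrite big_ord_recl EFinM.
apply: lee_pmul => //; rewrite ?lee_fin ?prodr_ge0//.
exact: (IH _ (fun i => g (lift ord0 i)) (fun i => a (lift ord0 i))).
Qed.

(* [g] has mean zero and variance at most [v] under [Q]; quantifying over the shifts [c]
   avoids integrals of signed functions. *)
Definition spread (Q : probability T R) (g : T -> R) (v : R) :=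
  forall c : R, \int[Q]_t ((g t + c) ^+ 2)%:E <= (v + c ^+ 2)%:E.

End prod_prob_integral.

Section spread_prod.
Context d (T : measurableType d) (R : realType).
Local Open Scope ereal_scope.

Lemma measurable_sqr_add d' (U : measurableType d') (g : U -> R) (c : R) : measurable_fun setT g ->
  measurable_fun setT (fun t => ((g t + c) ^+ 2)%:E).
Proof.
by move=> mg; apply/measurable_EFinP; apply: measurable_funX; apply: measurable_funD.
Qed.

(** The inequality for the head coordinate is used with the sum of the other coordinates plus [c] as
    the shift. Centring is thus built into the quantifier over shifts, and the variances add. *)
Lemma spread_prod_prob n (Q : 'I_n -> probability T R) (g : 'I_n -> T -> R) (v : 'I_n -> R) :
  (forall i, measurable_fun setT (g i)) ->
  (forall i, spread (Q i) (g i) (v i)) ->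
  spread (prod_prob Q) (fun z => \sum_i g i (tnth z i))%R (\sum_i v i)%R.
Proof.
elim: n Q g v => [|n IH] Q g v mg Qg c.
  rewrite integral_prod_prob0; first by rewrite !big_ord0 !add0r.
  by apply: measurable_sqr_add; exact: measurable_sum_tnth.
rewrite ge0_integral_prod_probS2//; last 2 first.
- by apply: measurable_sqr_add; exact: measurable_sum_tnth.
- by move=> z; rewrite lee_fin sqr_ge0.
have mg' : measurable_fun setT (fun z : n.-tuple T => \sum_(i < n) g (lift ord0 i) (tnth z i))%R.
  exact: (measurable_sum_tnth (w := fun i => g (lift ord0 i))).
apply: (@le_trans _ _ (\int[prod_prob (fun i : 'I_n => Q (lift ord0 i))]_z
   ((v ord0)%:E + ((\sum_(i < n) g (lift ord0 i) (tnth z i) + c) ^+ 2)%:E))).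
  apply: ge0_le_integral => //.
  - by move=> z _; apply: integral_ge0 => x _; rewrite lee_fin sqr_ge0.
  - apply: (@measurable_int_cons_l _ T R n (Q ord0) (fun z => ((\sum_(i < n.+1) g i (tnth z i) + c) ^+ 2)%:E)).
      by apply: measurable_sqr_add; exact: measurable_sum_tnth.
    by move=> z; rewrite lee_fin sqr_ge0.
  - by apply: emeasurable_funD => //; exact: measurable_sqr_add.
  - move=> z _; rewrite -EFinD.
    apply: le_trans (Qg ord0 (\sum_(i < n) g (lift ord0 i) (tnth z i) + c)%R).
    rewrite le_eqVlt; apply/orP; left; apply/eqP; apply: eq_integral => x _.
    rewrite big_ord_recl tnth_cons0 -addrA; congr ((_ + (_ + _)) ^+ 2)%:E.
    by apply: eq_bigr => i _; rewrite tnth_consS.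
have v0 : (0 <= v ord0)%R.
  have := Qg ord0 0%R; rewrite expr0n addr0 -lee_fin; apply: le_trans.
  by apply: integral_ge0 => x _; rewrite lee_fin sqr_ge0.
rewrite ge0_integralD//; last 2 first.
- by move=> z _; rewrite lee_fin sqr_ge0.
- exact: measurable_sqr_add.
rewrite integral_cst// big_ord_recl -addrA EFinD; apply: leeD.
  by rewrite [X in _ * X]probability_setT mule1.
exact: (IH _ (fun i => g (lift ord0 i)) (fun i => v (lift ord0 i))).
Qed.

Lemma spread_scale (Q : probability T R) (g : T -> R) (v a : R) : measurable_fun setT g ->
  spread Q g v -> spread Q (fun t => a * g t)%R (a ^+ 2 * v)%R.
Proof.
move=> mg Qg c.
have [->|a0] := eqVneq a 0%R.
  rewrite expr0n/= mul0r add0r.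
  under eq_integral do rewrite mul0r add0r.
  by rewrite integral_cst// [X in _ * X]probability_setT mule1.
have -> : (a ^+ 2 * v + c ^+ 2 = a ^+ 2 * (v + (c / a) ^+ 2))%R.
  by field.
rewrite EFinM.
have -> : \int[Q]_t ((a * g t + c) ^+ 2)%:E = \int[Q]_t ((a ^+ 2)%:E * ((g t + c / a) ^+ 2)%:E).
  apply: eq_integral => t _; rewrite -EFinM -exprMn mulrDr; congr (_%:E).
  by rewrite mulrCA divff// mulr1.
rewrite ge0_integralZl//; last 3 first.
- exact: measurable_sqr_add.
- by move=> t _; rewrite lee_fin sqr_ge0.
- by rewrite lee_fin sqr_ge0.
by apply: lee_wpmul2l => //; rewrite lee_fin sqr_ge0.
Qed.

End spread_prod.

Section precomposition.
Context d d' d'' (X : measurableType d) (X' : measurableType d') (Y : measurableType d'') (R : realType).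
Context (K : R.-pker X' ~> Y) (h : X -> X') (mh : measurable_fun setT h).

(** The proof of measurability is an argument, so that the kernel structure can be inferred from the
    term. *)
Definition precomp of measurable_fun setT h : X -> {measure set Y -> \bar R} := fun x => K (h x).

Let measurable_precomp U : measurable U -> measurable_fun setT (precomp mh ^~ U).
Proof.
move=> mU; have := measurable_kernel K U mU => mK.
exact: (measurableT_comp mK mh).
Qed.

HB.instance Definition _ := @isKernel.Build _ _ X Y R (precomp mh) measurable_precomp.

Let precomp_prob x : precomp mh x setT = 1%E.
Proof. exact: prob_kernel. Qed.

HB.instance Definition _ := @Kernel_isProbability.Build _ _ X Y R (precomp mh) precomp_prob.

End precomposition.

Section spread_mixture.
Context d d' (X : measurableType d) (Y : measurableType d') (R : realType).
Local Open Scope ereal_scope.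

Lemma ge0_integral_mixture (P : probability X R) (K : R.-pker X ~> Y) (f : Y -> \bar R) :
  measurable_fun setT f -> (forall y, 0 <= f y) ->
  \int[mixture P K]_y f y = \int[P]_x \int[K x]_y f y.
Proof.
move=> mf f0.
(* The mixture is a composition of kernels starting from the one-point space, to which the
   integration formula for composed kernels applies. *)
pose l : R.-pker unit ~> X := kprobability (@measurable_cst _ _ unit (pprobability X R) setT P).
pose k : R.-pker (unit * X)%type ~> Y := precomp K (@measurable_snd _ _ unit X).
rewrite -[RHS](@integral_kcomp _ _ _ unit X Y R l k tt f f0 mf).
exact: eq_measure_integral.
Qed.

(** The law of total variance: [v1] bounds the conditional variance around the conditional mean [m],
    and [v2] the variance of [m]. *)
Lemma spread_mixture (P : probability X R) (K : R.-pker X ~> Y) (g : Y -> R) (m : X -> R)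
   (v1 v2 : R) : measurable_fun setT g -> measurable_fun setT m ->
  (forall x c, \int[K x]_y ((g y - m x + c) ^+ 2)%:E <= (v1 + c ^+ 2)%:E) ->
  spread P m v2 -> spread (mixture P K : probability _ _) g (v1 + v2)%R.
Proof.
move=> mg mm Kg Pm c.
rewrite ge0_integral_mixture//; last 2 first.
- exact: measurable_sqr_add.
- by move=> y; rewrite lee_fin sqr_ge0.
have v10 : (0 <= v1)%R.
  have := Kg point 0%R; rewrite expr0n addr0 -lee_fin; apply: le_trans.
  by apply: integral_ge0 => y _; rewrite lee_fin sqr_ge0.
apply: (@le_trans _ _ (\int[P]_x (v1%:E + ((m x + c) ^+ 2)%:E))).
  apply: ge0_le_integral => //.
  - by move=> x _; apply: integral_ge0 => y _; rewrite lee_fin sqr_ge0.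
  - apply: measurable_fun_integral_kernel => //.
    + by move=> U mU; exact: measurable_kernel.
    + by move=> y; rewrite lee_fin sqr_ge0.
    + exact: measurable_sqr_add.
  - by apply: emeasurable_funD => //; exact: measurable_sqr_add.
  - move=> x _; rewrite -EFinD; apply: le_trans (Kg x (m x + c)%R).
    apply: ge0_le_integral => //.
    + by move=> y _; rewrite lee_fin sqr_ge0.
    + exact: measurable_sqr_add.
    + apply/measurable_EFinP/measurable_funX; apply: measurable_funD => //.
      exact: measurable_funB.
    + by move=> y _; rewrite lee_fin addrA subrK.
rewrite ge0_integralD//; last 2 first.
- by move=> z _; rewrite lee_fin sqr_ge0.
- exact: measurable_sqr_add.
rewrite integral_cst// [X in v1%:E * X]probability_setT mule1 -addrA EFinD.
by rewrite leeD2l.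
Qed.

End spread_mixture.

(** * Group privacy and separation of transcripts *)

Import HBNNSimple.

Section affine_integral.
Context d (T : measurableType d) (R : realType) (P : probability T R).
Local Open Scope ereal_scope.

Lemma int_prob_cst (c : R) : \int[P]_t c%:E = c%:E.
Proof. by rewrite integral_cst// [X in _ * X]probability_setT mule1. Qed.

Lemma int_affine (g : T -> \bar R) (a c : R) : measurable_fun setT g -> (forall t, 0 <= g t) ->
  (0 <= a)%R -> (0 <= c)%R ->
  \int[P]_t (a%:E * g t + c%:E) = a%:E * \int[P]_t g t + c%:E.
Proof.
move=> mg g0 a0 c0; rewrite ge0_integralD//.
- by rewrite ge0_integralZl// int_prob_cst.
- by move=> t _; rewrite mule_ge0.
- exact: emeasurable_funM.
Qed.

Lemma int_realD (f g : T -> R) : measurable_fun setT f -> measurable_fun setT g ->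
   (forall x, 0 <= f x)%R -> (forall x, 0 <= g x)%R ->
  \int[P]_x (f x + g x)%:E = \int[P]_x (f x)%:E + \int[P]_x (g x)%:E.
Proof.
move=> mf mg f0 g0; under eq_integral do rewrite EFinD.
rewrite ge0_integralD//; try by move=> x _; rewrite lee_fin.
- exact/measurable_EFinP.
- exact/measurable_EFinP.
Qed.

Lemma int_realZ (w : R) (f : T -> R) : (0 <= w)%R -> measurable_fun setT f ->
  (forall x, 0 <= f x)%R ->
  \int[P]_x (w * f x)%:E = w%:E * \int[P]_x (f x)%:E.
Proof.
move=> w0 mf f0; under eq_integral do rewrite EFinM.
rewrite ge0_integralZl//; last by move=> x _; rewrite lee_fin.
exact/measurable_EFinP.
Qed.

End affine_integral.

Section expectation_bounded.
Context d (T : measurableType d) (R : realType).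
Implicit Types (P : probability T R) (f g : T -> R).

Definition Ex P f : R := fine (\int[P]_t (f t)%:E)%E.

(** Nonnegativity and boundedness keep the integral finite, so that [Ex] never returns the default
    value of [fine] and the computations take place in the reals. *)
Definition bdd f (M : R) := measurable_fun setT f /\ forall t, 0 <= f t <= M.

Lemma ExE P f M : bdd f M -> (\int[P]_t (f t)%:E = (Ex P f)%:E)%E /\ 0 <= Ex P f <= M.
Proof.
move=> [mf f0].
have i0 : (0 <= \int[P]_t (f t)%:E)%E.
  by apply: integral_ge0 => t _; rewrite lee_fin; case/andP: (f0 t).
have iM : (\int[P]_t (f t)%:E <= M%:E)%E.
  apply: (@le_trans _ _ (\int[P]_t (cst M%:E t))%E).
    apply: ge0_le_integral => //.
    - by move=> t _; rewrite lee_fin; case/andP: (f0 t).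
    - exact/measurable_EFinP.
    - by move=> t _; rewrite lee_fin; case/andP: (f0 t).
  by rewrite integral_cst//= [X in (_ * X)%E]probability_setT mule1.
have fi : (\int[P]_t (f t)%:E)%E \is a fin_num.
  by rewrite ge0_fin_numE//; apply: le_lt_trans iM (ltry _).
rewrite /Ex; split; first by rewrite fineK.
by rewrite -!lee_fin fineK// i0 iM.
Qed.

Lemma Ex_eq P f M : bdd f M -> (\int[P]_t (f t)%:E = (Ex P f)%:E)%E.
Proof. by move=> /(ExE P)[]. Qed.

Lemma Ex_ge0 P f M : bdd f M -> 0 <= Ex P f.
Proof. by move=> /(ExE P)[_ /andP[]]. Qed.

Lemma bddD f g M M' : bdd f M -> bdd g M' -> bdd (fun t => f t + g t) (M + M').
Proof.
move=> [mf f0] [mg g0]; split; first exact: measurable_funD.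
by move=> t; move/andP: (f0 t) => [? ?]; move/andP: (g0 t) => [? ?]; rewrite addr_ge0//= lerD.
Qed.

Lemma bddM f g M M' : bdd f M -> bdd g M' -> bdd (fun t => f t * g t) (M * M').
Proof.
move=> [mf f0] [mg g0]; split; first exact: measurable_funM.
by move=> t; move/andP: (f0 t) => [? ?]; move/andP: (g0 t) => [? ?]; rewrite mulr_ge0//= ler_pM.
Qed.

Lemma bdd_cst c : 0 <= c -> bdd (cst c) c.
Proof. by move=> c0; split => // t; rewrite c0 lexx. Qed.

Lemma Ex_cst P c : 0 <= c -> Ex P (cst c) = c.
Proof.
move=> c0; rewrite /Ex.
have -> : (\int[P]_t (cst c t)%:E = \int[P]_t (cst c%:E t))%E by [].
by rewrite integral_cst//= [X in (_ * X)%E]probability_setT mule1.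
Qed.

Lemma ExD P f g M M' : bdd f M -> bdd g M' -> Ex P (fun t => f t + g t) = Ex P f + Ex P g.
Proof.
move=> bf bg.
apply/EFin_inj; rewrite -(Ex_eq _ (bddD bf bg)) EFinD -(Ex_eq _ bf) -(Ex_eq _ bg).
rewrite -ge0_integralD//.
- by move=> t _; rewrite lee_fin; case: bf => _ /(_ t)/andP[].
- by apply/measurable_EFinP; case: bf.
- by move=> t _; rewrite lee_fin; case: bg => _ /(_ t)/andP[].
- by apply/measurable_EFinP; case: bg.
Qed.

Lemma ExZ P f M c : 0 <= c -> bdd f M -> Ex P (fun t => c * f t) = c * Ex P f.
Proof.
move=> c0 bf.
apply/EFin_inj; rewrite -(Ex_eq _ (bddM (bdd_cst c0) bf)) EFinM -(Ex_eq _ bf).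
rewrite -ge0_integralZl//.
- by apply/measurable_EFinP; case: bf.
- by move=> t _; rewrite lee_fin; case: bf => _ /(_ t)/andP[].
Qed.

Lemma Ex_le P f g M M' : bdd f M -> bdd g M' -> (forall t, f t <= g t) -> Ex P f <= Ex P g.
Proof.
move=> bf bg fg; rewrite -lee_fin -(Ex_eq _ bf) -(Ex_eq _ bg).
apply: ge0_le_integral => //.
- by move=> t _; rewrite lee_fin; case: bf => _ /(_ t)/andP[].
- by apply/measurable_EFinP; case: bf.
- by apply/measurable_EFinP; case: bg.
- by move=> t _; rewrite lee_fin.
Qed.

End expectation_bounded.

Section split_density.
Context d (T : measurableType d) (R : realType).

Definition mean_measure (Q0 Q1 : probability T R) : set T -> \bar R :=
  mscale (2^-1)%:nng (measure_add Q0 Q1).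

HB.instance Definition _ (Q0 Q1 : probability T R) :=
  Measure.on (mean_measure Q0 Q1).

Lemma mean_measureE Q0 Q1 A : mean_measure Q0 Q1 A = ((2^-1)%:E * (Q0 A + Q1 A))%E.
Proof. by rewrite -measure_addE. Qed.

Let mean_measure_setT Q0 Q1 : mean_measure Q0 Q1 setT = 1%E.
Proof.
rewrite mean_measureE !probability_setT -EFinD -EFinM.
by congr (_%:E); field.
Qed.

HB.instance Definition _ (Q0 Q1 : probability T R) :=
  Measure_isProbability.Build _ _ _ (mean_measure Q0 Q1) (mean_measure_setT Q0 Q1).

(** Adding the two formulas shows that [kap] is the mean of the two laws; [s] is the difference of
    their densities over the sum. The [kap]-mean of [s ^ 2] is the Vincze-Le Cam divergence. *)
Definition splits (Q0 Q1 kap : probability T R) (s : T -> R) :=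
  [/\ measurable_fun setT s, (forall t, -1 <= s t <= 1),
      (forall g : T -> \bar R, measurable_fun setT g -> (forall t, 0 <= g t)%E ->
        (\int[Q1]_t g t = \int[kap]_t (g t * (1 + s t)%:E))%E) &
      (forall g : T -> \bar R, measurable_fun setT g -> (forall t, 0 <= g t)%E ->
        (\int[Q0]_t g t = \int[kap]_t (g t * (1 - s t)%:E))%E)].

Lemma splits_exists (Q0 Q1 : probability T R) : exists kap s, splits Q0 Q1 kap s.
Proof.
pose m : probability T R := mean_measure Q0 Q1.
have mE A : (m A = (2^-1)%:E * (Q0 A + Q1 A))%E.
  exact: mean_measureE.
have d1 : Q1 `<< m.
  apply/null_content_dominatesP => A mA mA0.
  have /eqP := etrans (esym (mE A)) mA0.
  by rewrite mule_eq0 eqe invr_eq0 pnatr_eq0/= padde_eq0// => /andP[_ /eqP].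
have d0 : Q0 `<< m.
  apply/null_content_dominatesP => A mA mA0.
  have /eqP := etrans (esym (mE A)) mA0.
  by rewrite mule_eq0 eqe invr_eq0 pnatr_eq0/= padde_eq0// => /andP[/eqP].
pose f1 := Radon_Nikodym_SigmaFinite.f Q1 m.
pose f0 := Radon_Nikodym_SigmaFinite.f Q0 m.
have f10 := Radon_Nikodym_SigmaFinite.f_ge0 d1.
have f00 := Radon_Nikodym_SigmaFinite.f_ge0 d0.
have if1 := Radon_Nikodym_SigmaFinite.f_integrable d1.
have if0 := Radon_Nikodym_SigmaFinite.f_integrable d0.
have mf1 : measurable_fun setT f1 by exact: measurable_int if1.
have mf0 : measurable_fun setT f0 by exact: measurable_int if0.
have ff1 := Radon_Nikodym_SigmaFinite.f_fin_num d1.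
have ff0 := Radon_Nikodym_SigmaFinite.f_fin_num d0.
have sum2 : ae_eq m setT (fun t => f0 t + f1 t)%E (cst 2%:E).
  apply: integral_ae_eq => //.
  - exact: integrableD.
  - move=> E _ mE'; rewrite integralD//; last 2 first.
    + exact: integrableS if0.
    + exact: integrableS if1.
    rewrite -(Radon_Nikodym_SigmaFinite.f_integral d0)//.
    rewrite -(Radon_Nikodym_SigmaFinite.f_integral d1)//.
    rewrite integral_cst//= mE muleA -EFinM.
    by rewrite divff// mul1e.
(* The truncation changes [f1 - 1] on a null set only, and makes the bounds on [s] hold at every
   point. *)
pose s t : R := Num.max (-1) (Num.min 1 (fine (f1 t) - 1)).
have ms : measurable_fun setT s.
  apply: measurable_maxr => //; apply: measurable_minr => //.
  by apply: measurable_funB => //; exact: measurableT_comp.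
have es1 : ae_eq m setT (fun t => (1 + s t)%:E) f1.
  apply: filterS sum2 => t /(_ I) /= h _.
  have [x ex] : exists x, f1 t = x%:E by exists (fine (f1 t)); rewrite fineK//; exact: ff1.
  have [y ey] : exists y, f0 t = y%:E by exists (fine (f0 t)); rewrite fineK//; exact: ff0.
  have a1 : 0 <= x by rewrite -lee_fin -ex; exact: f10.
  have a0 : 0 <= y by rewrite -lee_fin -ey; exact: f00.
  have {}h : y + x = 2 by apply: EFin_inj; rewrite EFinD -ey -ex.
  rewrite /s ex /=; congr (_%:E).
  rewrite min_r; last by lra.
  by rewrite max_r; lra.
have es0 : ae_eq m setT (fun t => (1 - s t)%:E) f0.
  apply: filterS2 sum2 es1 => t /(_ I) /= h /(_ I) /= e1 _.
  have [y ey] : exists y, f0 t = y%:E by exists (fine (f0 t)); rewrite fineK//; exact: ff0.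
  have {}h : y + (1 + s t) = 2 by apply: EFin_inj; rewrite EFinD -ey e1.
  by rewrite ey; congr (_%:E); lra.
exists m, s; split => //.
- by move=> t; rewrite /s le_max lexx/= ge_max ge_min lexx/= andbT; lra.
- move=> g mg g0.
  rewrite -(Radon_Nikodym_SigmaFinite.change_of_variables d1)//.
  apply: ae_eq_integral => //.
  + exact: emeasurable_funM.
  + apply: emeasurable_funM => //; apply/measurable_EFinP; exact: measurable_funD.
  + by apply: filterS es1 => t /(_ I)/= h _; rewrite h.
- move=> g mg g0.
  rewrite -(Radon_Nikodym_SigmaFinite.change_of_variables d0)//.
  apply: ae_eq_integral => //.
  + exact: emeasurable_funM.
  + apply: emeasurable_funM => //; apply/measurable_EFinP; exact: measurable_funB.
  + by apply: filterS es0 => t /(_ I)/= h _; rewrite h.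
Qed.

End split_density.

Section dp_functions.
Context d (T : measurableType d) (R : realType).

(** A Neyman-Pearson argument: the excess of [mu] over [e] times [nu] has a positive density exactly
    on [A]. Replacing [f] by [M] on [A] and by zero elsewhere can only increase the excess, so the
    hypothesis is applied to the single event [A]. *)
Lemma dp_Ex (mu nu : probability T R) (e delta M : R) (f : T -> R) :
  0 <= e -> 0 <= M -> bdd f M ->
  (forall A, measurable A -> (mu A <= e%:E * nu A + delta%:E)%E) ->
  Ex mu f <= e * Ex nu f + delta * M.
Proof.
move=> e0 M0 bf dp.
have [kap [s [ms s1 smu snu]]] := splits_exists nu mu.
pose A := [set t | e * (1 - s t) < 1 + s t].
have mA : measurable A.
  rewrite /A -[X in measurable X]setTI.
  have mD : measurable_fun setT (fun t => 1 + s t - e * (1 - s t)).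
    apply: measurable_funB; first exact: measurable_funD.
    by apply: measurable_funM => //; exact: measurable_funB.
  have -> : [set t | e * (1 - s t) < 1 + s t] =
            (fun t => 1 + s t - e * (1 - s t)) @^-1` `]0, +oo[.
    by apply/seteqP; split => t /=; rewrite in_itv/= andbT subr_gt0.
  by apply: mD.
have bA : bdd (\1_A : T -> R) 1.
  split; first exact: measurable_indic.
  by move=> t; rewrite indicE; case: (_ \in _); rewrite ?lexx ?ler01.
have bp : bdd (fun t => 1 + s t) 2.
  split; first exact: measurable_funD.
  by move=> t; have /andP[? ?] := s1 t; apply/andP; split; lra.
have bq : bdd (fun t => 1 - s t) 2.
  split; first exact: measurable_funB.
  by move=> t; have /andP[? ?] := s1 t; apply/andP; split; lra.
have cmu g N : bdd g N -> Ex mu g = Ex kap (fun t => g t * (1 + s t)).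
  move=> bg; rewrite /Ex smu//; first by apply/measurable_EFinP; case: bg.
  by move=> t; rewrite lee_fin; case: bg => _ /(_ t)/andP[].
have cnu g N : bdd g N -> Ex nu g = Ex kap (fun t => g t * (1 - s t)).
  move=> bg; rewrite /Ex snu//; first by apply/measurable_EFinP; case: bg.
  by move=> t; rewrite lee_fin; case: bg => _ /(_ t)/andP[].
have pw t : f t * (1 + s t) + e * (M * (\1_A t * (1 - s t))) <=
            e * (f t * (1 - s t)) + M * (\1_A t * (1 + s t)).
  have /andP[f0 fM] : 0 <= f t <= M by case: bf.
  have /andP[s_1 s_2] := s1 t.
  rewrite indicE; case: (boolP (t \in A)) => /=; rewrite ?mul1r ?mul0r ?mulr0 ?addr0.
    rewrite inE /A /= => h.
    have : 0 <= (M - f t) * (1 + s t - e * (1 - s t)) by apply: mulr_ge0; lra.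
    by lra.
  rewrite notin_setE /A /= => /negP; rewrite -leNgt => h.
  have : 0 <= f t * (e * (1 - s t) - (1 + s t)) by apply: mulr_ge0; lra.
  by lra.
have key : Ex mu f + e * (M * Ex nu \1_A) <= e * Ex nu f + M * Ex mu \1_A.
  rewrite (cmu _ _ bf) (cnu _ _ bf) (cmu _ _ bA) (cnu _ _ bA).
  have b1 := bddM bf bp; have b2 := bddM bf bq; have b3 := bddM bA bp; have b4 := bddM bA bq.
  have M3 := bddM (bdd_cst T M0) b3; have M4 := bddM (bdd_cst T M0) b4.
  have e4 := bddM (bdd_cst T e0) M4; have e2 := bddM (bdd_cst T e0) b2.
  rewrite -(ExZ kap M0 b3) -(ExZ kap M0 b4) -(ExZ kap e0 b2) -(ExZ kap e0 M4).
  rewrite -(ExD kap b1 e4) -(ExD kap e2 M3).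
  exact: (Ex_le kap (bddD b1 e4) (bddD e2 M3)).
have dA : Ex mu \1_A <= e * Ex nu \1_A + delta.
  rewrite -lee_fin EFinD EFinM -(Ex_eq _ bA) -(Ex_eq _ bA) !integral_indic// !setIT.
  exact: dp.
have : M * Ex mu \1_A <= M * (e * Ex nu \1_A + delta) by exact: ler_wpM2l.
by lra.
Qed.

End dp_functions.

Section likelihood_ratio.
Context (R : realType).
Local Notation Z := (R * R)%type.

Definition likelihood (P0 P1 : probability Z R) (L : Z -> R) (tau : R) :=
  [/\ measurable_fun setT L, (forall x, 0 <= L x),
      (forall g : Z -> \bar R, measurable_fun setT g -> (forall x, 0 <= g x)%E ->
        (\int[P1]_x g x = \int[P0]_x (g x * (L x)%:E))%E) &
      (\int[P0]_x `|L x - 1|%:E <= tau%:E)%E].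

Lemma likelihood_int1 P0 P1 L tau : likelihood P0 P1 L tau -> (\int[P0]_x (L x)%:E = 1)%E.
Proof.
move=> [mL L0 LE _].
have := LE (cst 1%E); rewrite integral_cst// [X in (_ * X)%E]probability_setT mul1e => -> //.
by apply: eq_integral => x _; rewrite mul1e.
Qed.

(** By privacy [F] stays within [(e - 1) m + delta] of its [P0]-mean [m], and the two laws differ
    only through [L - 1], whose absolute integral is at most [tau]. Centring [F] at [m] is what
    brings the factor [tau] into both error terms. *)
Lemma swap_privacy P0 P1 L tau (e M delta : R) (F : Z -> R) :
  likelihood P0 P1 L tau -> 1 <= e -> 0 <= delta -> bdd F M ->
  (forall x x', F x <= e * F x' + delta) ->
  Ex P1 F <= (1 + (e - 1) * tau) * Ex P0 F + delta * tau.
Proof.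
move=> lik e1 d0 bF dp.
have [mL L0 LE Ltau] := lik.
have [F0E /andP[m0 mM]] := ExE P0 bF.
set m := Ex P0 F in F0E m0 mM *.
have M0 : 0 <= M by apply: le_trans m0 mM.
have F0 x : 0 <= F x by case: bF => _ /(_ x)/andP[].
have e0 : 0 <= e by apply: le_trans e1.
have mF : measurable_fun setT F by case: bF.
have beF : bdd (fun x => e * F x + delta) (e * M + delta).
  apply: bddD; last exact: (bdd_cst _ d0).
  exact: (bddM (bdd_cst _ e0)).
have emE : Ex P0 (fun x => e * F x + delta) = e * m + delta.
  rewrite (ExD P0 (bddM (bdd_cst _ e0) bF) (bdd_cst _ d0)).
  by rewrite (ExZ P0 e0 bF) Ex_cst.
have up x : F x <= e * m + delta.
  rewrite -emE -(Ex_cst P0 (F0 x)).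
  by apply: (Ex_le P0 (bdd_cst _ (F0 x)) beF) => x'; exact: dp.
have lo x : m <= e * F x + delta.
  have h0 : 0 <= e * F x + delta by rewrite addr_ge0// mulr_ge0.
  rewrite -(Ex_cst P0 h0).
  by apply: (Ex_le P0 bF (bdd_cst _ h0)) => x'; exact: dp.
pose B := (e - 1) * m + delta.
have B0 : 0 <= B by rewrite /B addr_ge0// mulr_ge0// subr_ge0.
have Fm x : `|F x - m| <= B.
  rewrite ler_norml /B; apply/andP; split; last by have := up x; lra.
  have := lo x; have [h|h] := leP (F x) m.
    have : 0 <= (e - 1) * (m - F x) by rewrite mulr_ge0 ?subr_ge0.
    by lra.
  move=> _; have : 0 <= (e - 1) * m by rewrite mulr_ge0 ?subr_ge0.
  lra.
(* The product of [F - m] and [L - 1] is expanded and its negative terms moved across, so that both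
   sides are nonnegative before integration. *)
have pw x : F x * L x + m <= F x + m * L x + B * `|L x - 1|.
  have : (F x - m) * (L x - 1) <= B * `|L x - 1|.
    apply: le_trans (ler_norm _) _; rewrite normrM ler_wpM2r//.
  lra.
have mabs : measurable_fun setT (fun x => `|L x - 1|).
  by apply: measurableT_comp => //; exact: measurable_funB.
have : (\int[P0]_x (F x * L x + m)%:E <= \int[P0]_x (F x + m * L x + B * `|L x - 1|)%:E)%E.
  apply: ge0_le_integral => //.
  - by move=> x _; rewrite lee_fin addr_ge0// mulr_ge0.
  - by apply/measurable_EFinP; apply: measurable_funD => //; exact: measurable_funM.
  - apply/measurable_EFinP; apply: measurable_funD; last exact: measurable_funM.
    by apply: measurable_funD => //; exact: measurable_funM.
  - by move=> x _; rewrite lee_fin.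
have mFL : measurable_fun setT (fun x => F x * L x) by exact: measurable_funM.
have mmL : measurable_fun setT (fun x => m * L x) by exact: measurable_funM.
have mFmL : measurable_fun setT (fun x => F x + m * L x) by exact: measurable_funD.
have FL0 x : 0 <= F x * L x by rewrite mulr_ge0.
have mL0 x : 0 <= m * L x by rewrite mulr_ge0.
rewrite (int_realD P0 (f := fun x => F x * L x) (g := fun=> m))//.
rewrite (int_realD P0 (f := fun x => F x + m * L x) (g := fun x => B * `|L x - 1|))//; last 3 first.
- exact: measurable_funM.
- by move=> x; rewrite addr_ge0.
- by move=> x; rewrite mulr_ge0.
rewrite (int_realD P0 (f := F) (g := fun x => m * L x))//.
rewrite (int_realZ P0 m0 mL L0) (int_realZ P0 B0 mabs)//.
under eq_integral do rewrite EFinM.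
have mEF : measurable_fun setT (fun x => (F x)%:E) by exact/measurable_EFinP.
have EF0 x : (0 <= (F x)%:E)%E by rewrite lee_fin.
rewrite -(LE _ mEF EF0) (Ex_eq P1 bF) F0E int_prob_cst (likelihood_int1 lik) mule1 => h.
have {}h := le_trans h (leeD2l _ (lee_wpmul2l _ Ltau)).
have B0' : (0 <= B%:E)%E by rewrite lee_fin.
move: (h B0'); rewrite -!EFinM -!EFinD lee_fin /B; lra.
Qed.

Lemma neighbours_cons_l n (x x' : Z) (z : n.-tuple Z) :
  neighbours (Defs.cons_tuple (x, z)) (Defs.cons_tuple (x', z)).
Proof.
rewrite /neighbours -sum1_card big_mkcond big_ord_recl big1 => [|i _].
  by case: ifP.
by rewrite inE !tnth_consS eqxx.
Qed.

Lemma neighbours_cons_r n (x : Z) (z z' : n.-tuple Z) :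
  neighbours z z' -> neighbours (Defs.cons_tuple (x, z)) (Defs.cons_tuple (x, z')).
Proof.
rewrite /neighbours; apply: leq_trans.
rewrite -!sum1_card big_mkcond big_ord_recl /= inE !tnth_cons0 eqxx add0n [X in (_ <= X)%N]big_mkcond.
by apply: leq_sum => i _; rewrite !inE !tnth_consS.
Qed.

(** Observations are exchanged one at a time: the head by [swap_privacy], the tail by induction with
    the head already drawn from [P0]. Since the factor [G] of one exchange is at least one, the
    additive errors may all be put behind its highest power. *)
Lemma group_privacy n P0 P1 L tau (e M delta : R) (F : n.-tuple Z -> R) :
  likelihood P0 P1 L tau -> 1 <= e -> 0 <= delta -> 0 <= tau -> bdd F M ->
  (forall z z', neighbours z z' -> F z <= e * F z' + delta) ->
  (\int[prod_prob (fun _ : 'I_n => P1)]_z (F z)%:E <=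
   ((1 + (e - 1) * tau) ^+ n)%:E *
   (\int[prod_prob (fun _ : 'I_n => P0)]_z (F z)%:E + (n%:R * (delta * tau))%:E))%E.
Proof.
move=> lik e1 d0 t0.
have [mL L0 LE Ltau] := lik.
set G := 1 + (e - 1) * tau.
have G1 : 1 <= G by rewrite lerDl mulr_ge0 ?subr_ge0.
have G0 : 0 <= G by apply: le_trans G1.
elim: n F => [|n IH] F bF dp.
  have mF : measurable_fun setT F by case: bF.
  rewrite !integral_prod_prob0 ?expr0 ?mul1e ?mul0r ?adde0//; exact/measurable_EFinP.
have mF : measurable_fun setT F by case: bF.
have F0 z : 0 <= F z by case: bF => _ /(_ z)/andP[].
have mEF : measurable_fun setT (fun z => (F z)%:E) by exact/measurable_EFinP.
have EF0 z : (0 <= (F z)%:E)%E by rewrite lee_fin.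
have bl (z : n.-tuple Z) : bdd (fun x => F (Defs.cons_tuple (x, z))) M.
  split; first exact: measurableT_comp mF (measurable_cons_r z).
  by move=> x; case: bF.
have br (x : Z) : bdd (fun z : n.-tuple Z => F (Defs.cons_tuple (x, z))) M.
  split; first exact: measurableT_comp mF (measurable_cons_l x).
  by move=> z; case: bF.
rewrite ge0_integral_prod_probS2//.
apply: (@le_trans _ _ (\int[prod_prob (fun _ : 'I_n => P1)]_z
   (G%:E * (\int[P0]_x (F (Defs.cons_tuple (x, z)))%:E) + (delta * tau)%:E))%E).
  apply: ge0_le_integral => //.
  - by move=> z _; apply: integral_ge0.
  - exact: (measurable_int_cons_l P1 mEF EF0).
  - apply: emeasurable_funD => //; apply: emeasurable_funM => //.
    exact: (measurable_int_cons_l P0 mEF EF0).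
  - move=> z _; rewrite (Ex_eq P1 (bl z)) (Ex_eq P0 (bl z)) -EFinM -EFinD lee_fin.
    apply: (swap_privacy lik e1 d0 (bl z)) => x x'.
    by apply: dp; exact: neighbours_cons_l.
have dt0 : 0 <= delta * tau by rewrite mulr_ge0.
rewrite int_affine//; last 2 first.
- exact: (measurable_int_cons_l P0 mEF EF0).
- by move=> z; apply: integral_ge0.
(* The two sides are the iterated integrals, in both orders, under the mixed product with head [P0]
   and tail [P1]. *)
have swp : (\int[prod_prob (fun _ : 'I_n => P1)]_z \int[P0]_x (F (Defs.cons_tuple (x, z)))%:E =
  \int[P0]_x \int[prod_prob (fun _ : 'I_n => P1)]_z (F (Defs.cons_tuple (x, z)))%:E)%E.
  pose Q (i : 'I_n.+1) := if i == ord0 then P0 else P1.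
  have := ge0_integral_prod_probS2 Q mEF EF0; rewrite (ge0_integral_prod_probS Q mEF EF0).
  by rewrite /Q /= => <-.
rewrite swp.
have IH' x := IH _ (br x) (fun z z' nb => dp _ _ (neighbours_cons_r x nb)).
have H1 : (\int[P0]_x \int[prod_prob (fun _ : 'I_n => P1)]_z (F (Defs.cons_tuple (x, z)))%:E <=
  (G ^+ n)%:E * (\int[prod_prob (fun _ : 'I_n.+1 => P0)]_z (F z)%:E + (n%:R * (delta * tau))%:E))%E.
  rewrite ge0_integral_prod_probS//.
  have ndt0 : 0 <= n%:R * (delta * tau) by rewrite mulr_ge0.
  have Gn0 : 0 <= G ^+ n by rewrite exprn_ge0.
  apply: (@le_trans _ _ (\int[P0]_x ((G ^+ n)%:E *
     (\int[prod_prob (fun _ : 'I_n => P0)]_z (F (Defs.cons_tuple (x, z)))%:E) + (G ^+ n * (n%:R * (delta * tau)))%:E))%E).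
    apply: ge0_le_integral => //.
    - by move=> x _; apply: integral_ge0.
    - exact: (measurable_int_cons_r _ mEF EF0).
    - apply: emeasurable_funD => //; apply: emeasurable_funM => //.
      exact: (measurable_int_cons_r _ mEF EF0).
    - move=> x _; apply: le_trans (IH' x) _.
      rewrite ge0_muleDr ?lee_fin ?EFinM//; exact: integral_ge0.
  rewrite int_affine//; last 3 first.
  - exact: (measurable_int_cons_r _ mEF EF0).
  - by move=> x; apply: integral_ge0.
  - by rewrite mulr_ge0.
  have I0 : (0 <= \int[P0]_x \int[prod_prob (fun _ : 'I_n => P0)]_z (F (Defs.cons_tuple (x, z)))%:E)%E.
    by apply: integral_ge0 => x _; apply: integral_ge0.
  have ndt0' : (0 <= (n%:R * (delta * tau))%:E)%E by rewrite lee_fin.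
  by rewrite (ge0_muleDr _ I0 ndt0').
have [E1 _] := ExE (prod_prob (fun _ : 'I_n.+1 => P0)) bF.
apply: le_trans (leeD2r _ (lee_wpmul2l _ H1)) _; first by rewrite lee_fin.
rewrite E1; set a := Ex _ _.
have key : G * (G ^+ n * (a + n%:R * (delta * tau))) + delta * tau <=
    G ^+ n.+1 * (a + n.+1%:R * (delta * tau)).
  rewrite exprS mulrA -natr1.
  have h : 1 <= G * G ^+ n by rewrite mulr_ege1// exprn_ege1.
  have : 0 <= (G * G ^+ n - 1) * (delta * tau) by rewrite mulr_ge0// subr_ge0.
  by move: (G * G ^+ n) (delta * tau) => y1 y2; clear; lra.
by move: key; rewrite -lee_fin; apply.
Qed.

End likelihood_ratio.

(** * Even moments of likelihood ratios *)

Section even_powers.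
Context (R : realDomainType).

Lemma pow_mix_le (k : nat) (A B : R) : 0 <= A -> 0 <= B ->
  A ^+ k * B <= A ^+ k.+1 + B ^+ k.+1 /\ A * B ^+ k <= A ^+ k.+1 + B ^+ k.+1.
Proof.
move=> A0 B0.
have Ak : 0 <= A ^+ k.+1 by apply: exprn_ge0.
have Bk : 0 <= B ^+ k.+1 by apply: exprn_ge0.
have Akk : 0 <= A ^+ k by apply: exprn_ge0.
have Bkk : 0 <= B ^+ k by apply: exprn_ge0.
have [AB|BA] := leP A B.
  have h : A ^+ k <= B ^+ k by apply: lerXn2r.
  split.
    apply: (@le_trans _ _ (B ^+ k.+1)); last by rewrite lerDr.
    by rewrite exprSr ler_wpM2r.
  apply: (@le_trans _ _ (B ^+ k.+1)); last by rewrite lerDr.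
  by rewrite exprS ler_wpM2r.
have h : B ^+ k <= A ^+ k by apply: lerXn2r => //; exact: ltW.
split.
  apply: (@le_trans _ _ (A ^+ k.+1)); last by rewrite lerDl.
  by rewrite exprSr ler_wpM2l// ltW.
apply: (@le_trans _ _ (A ^+ k.+1)); last by rewrite lerDl.
by rewrite exprS ler_wpM2l.
Qed.

(** The induction step of [even_pow_expand], multiplication by [(a + b) ^ 2], where [X] and [Y]
    stand for [a ^ (2 k)] and [b ^ (2 k)]. *)
Lemma even_pow_step (a b X Y K C : R) : 0 <= K -> 0 <= C -> 0 <= X -> 0 <= Y ->
  X * b ^+ 2 <= a ^+ 2 * X + b ^+ 2 * Y -> a ^+ 2 * Y <= a ^+ 2 * X + b ^+ 2 * Y ->
  (a ^+ 2 * X + K * (a * X) * b + C * (X * b ^+ 2 + b ^+ 2 * Y)) * (a + b) ^+ 2 <=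
  a ^+ 2 * (a ^+ 2 * X) + (K + 2) * (a * (a ^+ 2 * X)) * b +
  (1 + K * 6 + C * 6) * (a ^+ 2 * X * b ^+ 2 + b ^+ 2 * (b ^+ 2 * Y)).
Proof.
move=> K0 C0 X0 Y0 p1 p2.
have a2 := sqr_ge0 a; have b2 := sqr_ge0 b; have ab2 := sqr_ge0 (a - b).
have f1 : 0 <= K * X * b ^+ 2 * (a - b) ^+ 2 by apply: mulr_ge0 => //; apply: mulr_ge0 => //; exact: mulr_ge0.
have f2 : 0 <= K * b ^+ 2 * (a ^+ 2 * X + b ^+ 2 * Y - X * b ^+ 2).
  by apply: mulr_ge0; [exact: mulr_ge0 | rewrite subr_ge0].
have f3 : 0 <= K * (b ^+ 2 * b ^+ 2 * Y) by apply: mulr_ge0 => //; apply: mulr_ge0 => //; exact: mulr_ge0.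
have f4 : 0 <= K * (a ^+ 2 * b ^+ 2 * X) by apply: mulr_ge0 => //; apply: mulr_ge0 => //; exact: mulr_ge0.
have f5 : 0 <= C * (X * b ^+ 2 + b ^+ 2 * Y) * (a - b) ^+ 2.
  by apply: mulr_ge0 => //; apply: mulr_ge0 => //; apply: addr_ge0; exact: mulr_ge0.
have f6 : 0 <= C * b ^+ 2 * (a ^+ 2 * X + b ^+ 2 * Y - X * b ^+ 2).
  by apply: mulr_ge0; [exact: mulr_ge0 | rewrite subr_ge0].
have f7 : 0 <= C * b ^+ 2 * (a ^+ 2 * X + b ^+ 2 * Y - a ^+ 2 * Y).
  by apply: mulr_ge0; [exact: mulr_ge0 | rewrite subr_ge0].
have f8 : 0 <= C * (a ^+ 2 * b ^+ 2 * X) by apply: mulr_ge0 => //; apply: mulr_ge0 => //; exact: mulr_ge0.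
have f9 : 0 <= C * (b ^+ 2 * b ^+ 2 * Y) by apply: mulr_ge0 => //; apply: mulr_ge0 => //; exact: mulr_ge0.
have f10 : 0 <= b ^+ 2 * b ^+ 2 * Y by apply: mulr_ge0 => //; exact: mulr_ge0.
lra.
Qed.

(** The linear term has to be exact, because it integrates to zero once [b] is a multiple of
    [L x - 1]; all the other terms are nonnegative, as the exponents are even. *)
Lemma even_pow_expand (k : nat) : exists2 C : R, 1 <= C & forall a b : R,
  (a + b) ^+ (2 * k.+1) <= a ^+ (2 * k.+1) + (2 * k.+1)%:R * a ^+ (2 * k).+1 * b +
     C * (a ^+ (2 * k) * b ^+ 2 + b ^+ (2 * k.+1)).
Proof.
elim: k => [|k [C C1 IH]].
  exists 1; rewrite ?lexx// => a b.
  by rewrite muln1 muln0 expr0 !mul1r expr1 -subr_ge0; apply: le_trans (sqr_ge0 b) _; lra.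
exists (1 + (2 * k.+1)%:R * 6 + C * 6).
  rewrite -addrA lerDl addr_ge0 ?mulr_ge0 ?ler0n//; exact: le_trans C1.
move=> a b.
have := IH a b => /(ler_wpM2r (sqr_ge0 (a + b))).
rewrite -exprD addnC -mulnS => h; apply: le_trans h _.
have -> : (2 * k.+2)%:R = (2 * k.+1)%:R + 2 :> R by rewrite mulnS natrD addrC.
have ea (x : R) m : x ^+ (2 * m) = (x ^+ 2) ^+ m by rewrite exprM.
rewrite [a ^+ (2 * k).+1]exprS [a ^+ (2 * k.+1).+1]exprS !ea.
have [] := pow_mix_le k (sqr_ge0 a) (sqr_ge0 b).
rewrite ![_ ^+ k.+2]exprS ![_ ^+ k.+1]exprS => p1 p2.
by apply: even_pow_step; [exact: ler0n|exact: le_trans ler01 C1|exact/exprn_ge0/sqr_ge0|exact/exprn_ge0/sqr_ge0| | ].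
Qed.

Lemma onePpow_le (k : nat) (a : R) : (1 + a) ^+ (2 * k) <= 4 ^+ k * (1 + a ^+ (2 * k)).
Proof.
rewrite !exprM; set A := a ^+ 2.
have A0 : 0 <= A by apply: sqr_ge0.
have h : (1 + a) ^+ 2 <= 2 * (1 + A).
  rewrite -subr_ge0; apply: le_trans (sqr_ge0 (1 - a)) _.
  by rewrite /A le_eqVlt; apply/orP; left; apply/eqP; ring.
apply: (@le_trans _ _ ((2 * (1 + A)) ^+ k)).
  by apply: lerXn2r => //; rewrite nnegrE ?sqr_ge0// mulr_ge0// addr_ge0.
have -> : 4 ^+ k = 2 ^+ k * 2 ^+ k :> R by rewrite -exprMn; congr (_ ^+ _); ring.
rewrite exprMn -mulrA ler_wpM2l ?exprn_ge0//.
have [A1|A1] := leP A 1.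
  apply: (@le_trans _ _ (2 ^+ k)).
    by apply: lerXn2r; rewrite ?nnegrE ?addr_ge0//; lra.
  by rewrite ler_peMr ?exprn_ge0// lerDl exprn_ge0.
clearbody A; apply: (@le_trans _ _ ((2 * A) ^+ k)).
  have A0' : 0 <= 1 + A by lra.
  by apply: lerXn2r; rewrite ?nnegrE ?mulr_ge0//; lra.
by rewrite exprMn ler_wpM2l ?exprn_ge0// lerDr.
Qed.

End even_powers.

Section likelihood_moment.
Context (R : realType).
Local Notation Z := (R * R)%type.

Definition lik_dev n (L : Z -> R) (z : n.-tuple Z) : R := \prod_i L (tnth z i) - 1.

Lemma measurable_lik_dev n (L : Z -> R) : measurable_fun setT L ->
  measurable_fun setT (@lik_dev n L).
Proof.
by move=> mL; apply: measurable_funB => //; apply: (measurable_prod_tnth (w := fun=> L)).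
Qed.

Lemma lik_dev_cons n (L : Z -> R) x (z : n.-tuple Z) :
  lik_dev L (Defs.cons_tuple (x, z)) = lik_dev L z + (1 + lik_dev L z) * (L x - 1).
Proof.
rewrite /lik_dev big_ord_recl tnth_cons0.
have -> : \prod_(i < n) L (tnth (Defs.cons_tuple (x, z)) (lift ord0 i)) =
   \prod_(i < n) L (tnth z i) by apply: eq_bigr => i _; rewrite tnth_consS.
by ring.
Qed.

(** One more observation turns the deviation [a] of the product likelihood into
    [a + (1 + a) (L x - 1)]. The linear term has mean zero and the rest is of size
    [beta (a ^ r + v ^ r)]. The scale [v] is free, and balances the second moment of [L - 1] against
    the moment of order [r]. *)
Lemma even_moment_step (P0 P1 : probability Z R) (L : Z -> R) (tau beta v C : R) (k : nat) (a : R) :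
  likelihood P0 P1 L tau -> 0 <= beta -> 0 <= v <= 1 -> 1 <= C ->
  (forall a b : R,
  (a + b) ^+ (2 * k.+1) <= a ^+ (2 * k.+1) + (2 * k.+1)%:R * a ^+ (2 * k).+1 * b +
     C * (a ^+ (2 * k) * b ^+ 2 + b ^+ (2 * k.+1))) ->
  (\int[P0]_x ((L x - 1) ^+ 2)%:E <= (beta * v ^+ 2)%:E)%E ->
  (\int[P0]_x ((L x - 1) ^+ (2 * k.+1))%:E <= (beta * v ^+ (2 * k.+1))%:E)%E ->
  (\int[P0]_x ((a + (1 + a) * (L x - 1)) ^+ (2 * k.+1))%:E <=
   (a ^+ (2 * k.+1) + C * (4 + 4 ^+ k.+1) * beta * (a ^+ (2 * k.+1) + v ^+ (2 * k.+1)))%:E)%E.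
Proof.
move=> lik b0 /andP[v0 v1] C1 expand E2 Er.
have [mL L0 LE Ltau] := lik.
have LI := likelihood_int1 lik.
set r := (2 * k.+1)%N.
have C0 : 0 <= C by apply: le_trans C1.
have er (x : R) : 0 <= x ^+ r by rewrite /r exprM exprn_ge0// sqr_ge0.
have er' (x : R) : 0 <= x ^+ (2 * k) by rewrite exprM exprn_ge0// sqr_ge0.
pose c := r%:R * a ^+ (2 * k).+1 * (1 + a).
(* The linear coefficient has an unknown sign. Its two parts are put on opposite sides, where they
   cancel because [L] integrates to one. *)
pose cp := Num.max c 0; pose cn := Num.max (- c) 0.
have cp0 : 0 <= cp by rewrite /cp le_max lexx orbT.
have cn0 : 0 <= cn by rewrite /cn le_max lexx orbT.
have cE : c = cp - cn.
  by rewrite /cp /cn; have [?|?] := leP c 0; have [?|?] := leP (- c) 0; lra.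
pose p2 := C * (a ^+ (2 * k) * (1 + a) ^+ 2).
pose pr := C * (1 + a) ^+ r.
have p20 : 0 <= p2 by rewrite /p2 mulr_ge0// mulr_ge0// sqr_ge0.
have pr0 : 0 <= pr by rewrite /pr mulr_ge0.
have pw x : (a + (1 + a) * (L x - 1)) ^+ r + cp + cn * L x <=
   a ^+ r + cn + cp * L x + (p2 * (L x - 1) ^+ 2 + pr * (L x - 1) ^+ r).
  have := expand a ((1 + a) * (L x - 1)); rewrite -/r.
  rewrite !exprMn -/r mulrA -/c => h.
  rewrite /p2 /pr; move: h; rewrite cE; lra.
have mb : measurable_fun setT (fun x => L x - 1) by exact: measurable_funB.
have mL2 n : measurable_fun setT (fun x => (L x - 1) ^+ n) by exact: measurable_funX.
have mS : measurable_fun setT (fun x => (a + (1 + a) * (L x - 1)) ^+ r).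
  by apply: measurable_funX; apply: measurable_funD => //; exact: measurable_funM.
have H : (\int[P0]_x ((a + (1 + a) * (L x - 1)) ^+ r + cp + cn * L x)%:E <=
   \int[P0]_x (a ^+ r + cn + cp * L x + (p2 * (L x - 1) ^+ 2 + pr * (L x - 1) ^+ r))%:E)%E.
  apply: ge0_le_integral => //.
  - by move=> x _; rewrite lee_fin !addr_ge0// mulr_ge0.
  - apply/measurable_EFinP; apply: measurable_funD; last exact: measurable_funM.
    exact: measurable_funD.
  - apply/measurable_EFinP; apply: measurable_funD.
      by apply: measurable_funD => //; exact: measurable_funM.
    by apply: measurable_funD; exact: measurable_funM.
  - by move=> x _; rewrite lee_fin.
have intZ := @int_realZ _ _ _ P0; have intD := @int_realD _ _ _ P0; have intC := @int_prob_cst _ _ _ P0.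
have mcL w : measurable_fun setT (fun x => w * L x) by exact: measurable_funM.
have mcE w n : measurable_fun setT (fun x => w * (L x - 1) ^+ n) by exact: measurable_funM.
have mS1 : measurable_fun setT (fun x => (a + (1 + a) * (L x - 1)) ^+ r + cp) by exact: measurable_funD.
have mS2 : measurable_fun setT (fun x => a ^+ r + cn + cp * L x) by exact: measurable_funD.
have mS3 : measurable_fun setT (fun x => p2 * (L x - 1) ^+ 2 + pr * (L x - 1) ^+ r) by exact: measurable_funD.
have nL w x : 0 <= w -> 0 <= w * L x by move=> ?; rewrite mulr_ge0.
have n2 x : 0 <= p2 * (L x - 1) ^+ 2 by rewrite mulr_ge0// sqr_ge0.
have nr x : 0 <= pr * (L x - 1) ^+ r by rewrite mulr_ge0.
rewrite (intD (fun x => (a + (1 + a) * (L x - 1)) ^+ r + cp) (fun x => cn * L x))// in H; last 2 first.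
- by move=> x; rewrite addr_ge0.
- by move=> x; exact: nL.
rewrite (intD (fun x => (a + (1 + a) * (L x - 1)) ^+ r) (fun x => cp))// in H.
rewrite (intD (fun x => a ^+ r + cn + cp * L x) (fun x => p2 * (L x - 1) ^+ 2 + pr * (L x - 1) ^+ r))// in H; last 2 first.
- by move=> x; rewrite !addr_ge0// nL.
- by move=> x; rewrite addr_ge0.
rewrite (intD (fun x => a ^+ r + cn) (fun x => cp * L x))// in H; last 2 first.
- by move=> x; rewrite addr_ge0.
- by move=> x; exact: nL.
rewrite (intD (fun x => p2 * (L x - 1) ^+ 2) (fun x => pr * (L x - 1) ^+ r))// in H.
rewrite !intC !intZ// ?LI ?mule1 in H; last by move=> x; exact: sqr_ge0.
set I := (\int[P0]_x _)%E in H *.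
have I0 : (0 <= I)%E by apply: integral_ge0 => x _; rewrite lee_fin.
have H' : (I + (cp + cn)%:E <= (a ^+ r + cn + cp + (p2 * (beta * v ^+ 2) + pr * (beta * v ^+ r)))%:E)%E.
  rewrite EFinD addeA; apply: le_trans H _.
  rewrite EFinD EFinD leeD2l// EFinD !(EFinM p2) !(EFinM pr).
  by apply: leeD; apply: lee_wpmul2l; rewrite ?lee_fin.
have Ifin : I \is a fin_num.
  rewrite ge0_fin_numE//; apply: le_lt_trans (ltry _); apply: le_trans H'.
  by rewrite leeDl// lee_fin addr_ge0.
move: H'; rewrite -(fineK Ifin) -EFinD !lee_fin => H'.
have {}H' : fine I <= a ^+ r + (p2 * (beta * v ^+ 2) + pr * (beta * v ^+ r)) by move: H'; clear; lra.
apply: le_trans H' _; rewrite -!addrA lerD2l.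
set A := a ^+ r; set V := v ^+ r.
have A0 : 0 <= A by exact: er.
have V0 : 0 <= V by exact: er.
have vr1 : V <= 1 by apply: exprn_ile1.
have [mx _] := pow_mix_le k (sqr_ge0 a) (sqr_ge0 v).
rewrite -!exprM -/r -/A -/V in mx.
have aA : a ^+ (2 * k) * a ^+ 2 = A by rewrite -exprD /A /r mulnS addnC.
have q2 : a ^+ (2 * k) * (1 + a) ^+ 2 * v ^+ 2 <= 4 * (A + V).
  have h : (1 + a) ^+ 2 <= 2 * (1 + a ^+ 2).
    rewrite -subr_ge0; apply: le_trans (sqr_ge0 (1 - a)) _.
    by rewrite le_eqVlt; apply/orP; left; apply/eqP; ring.
  have v2 : v ^+ 2 <= 1 by apply: exprn_ile1.
  have := ler_wpM2l (er' a) (ler_wpM2r (sqr_ge0 v) h).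
  have := ler_wpM2l A0 v2.
  rewrite -aA; move: mx (sqr_ge0 v) (er' a) (sqr_ge0 a); rewrite -aA; nra.
have qr : (1 + a) ^+ r * V <= 4 ^+ k.+1 * (A + V).
  apply: (@le_trans _ _ (4 ^+ k.+1 * (1 + A) * V)).
    by rewrite ler_wpM2r//; exact: onePpow_le.
  rewrite -mulrA ler_wpM2l ?exprn_ge0//.
  have : A * V <= A * 1 by exact: ler_wpM2l.
  lra.
rewrite /p2 /pr.
have Cb : 0 <= C * beta by rewrite mulr_ge0.
have := ler_wpM2l Cb q2; have := ler_wpM2l Cb qr; lra.
Qed.

(** A Rosenthal-type inequality for the likelihood ratio of a whole sample: the one-step bound is a
    linear recursion in the number of observations. It is useful when [v] is chosen so that [n beta]
    stays bounded. *)
Lemma even_moment (k : nat) : exists2 K : R, 0 <= K & forall (P0 P1 : probability Z R) (L : Z -> R)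
    (tau beta v : R) n,
  likelihood P0 P1 L tau -> 0 <= beta -> 0 <= v <= 1 ->
  (\int[P0]_x ((L x - 1) ^+ 2)%:E <= (beta * v ^+ 2)%:E)%E ->
  (\int[P0]_x ((L x - 1) ^+ (2 * k.+1))%:E <= (beta * v ^+ (2 * k.+1))%:E)%E ->
  (\int[prod_prob (fun _ : 'I_n => P0)]_z ((lik_dev L z) ^+ (2 * k.+1))%:E <=
    (((1 + K * beta) ^+ n - 1) * v ^+ (2 * k.+1))%:E)%E.
Proof.
have [C C1 expand] := even_pow_expand R k.
have C0 : 0 <= C by apply: le_trans C1.
set r := (2 * k.+1)%N in expand *.
exists (C * (4 + 4 ^+ k.+1)); first by rewrite mulr_ge0// addr_ge0// exprn_ge0.
move=> P0 P1 L tau beta v n lik b0 v01 E2 Er.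
have [mL _ _ _] := lik.
set K := C * (4 + 4 ^+ k.+1).
have K0 : 0 <= K by rewrite /K mulr_ge0// addr_ge0// exprn_ge0.
have er (x : R) : 0 <= x ^+ r by rewrite /r exprM exprn_ge0// sqr_ge0.
have mW m : measurable_fun setT (fun z : m.-tuple Z => (lik_dev L z ^+ r)%:E).
  by apply/measurable_EFinP; apply: measurable_funX; exact: measurable_lik_dev.
have W0 m (z : m.-tuple Z) : (0 <= (lik_dev L z ^+ r)%:E)%E by rewrite lee_fin.
elim: n => [|n IH].
  by rewrite integral_prod_prob0// /lik_dev big_ord0 !subrr mul0r expr0n.
rewrite ge0_integral_prod_probS2//.
apply: (@le_trans _ _ (\int[prod_prob (fun _ : 'I_n => P0)]_z
   ((1 + K * beta)%:E * (lik_dev L z ^+ r)%:E + (K * beta * v ^+ r)%:E))%E).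
  apply: ge0_le_integral => //.
  - by move=> z _; apply: integral_ge0.
  - exact: (measurable_int_cons_l P0 (mW n.+1) (@W0 n.+1)).
  - by apply: emeasurable_funD => //; apply: emeasurable_funM => //; exact: mW.
  - move=> z _; under eq_integral do rewrite lik_dev_cons.
    apply: le_trans (even_moment_step (lik_dev L z) lik b0 v01 C1 expand E2 Er) _.
    rewrite -EFinM -EFinD lee_fin -/r -/K; lra.
have Kb : 0 <= K * beta by rewrite mulr_ge0.
rewrite int_affine//; last 3 first.
- exact: mW.
- by rewrite addr_ge0.
- by rewrite mulr_ge0.
apply: (@le_trans _ _ ((1 + K * beta)%:E * (((1 + K * beta) ^+ n - 1) * v ^+ r)%:E + (K * beta * v ^+ r)%:E)%E).
  by rewrite leeD2r// lee_wpmul2l// lee_fin addr_ge0.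
rewrite -EFinM -EFinD lee_fin exprS; lra.
Qed.

End likelihood_moment.

(** * From likelihood ratios to transcript laws *)

Section server_bound.
Context (R : realType).
Local Notation Z := (R * R)%type.
Context d (T : measurableType d) (n : nat) (K : R.-pker (n.-tuple Z) ~> T).

(** A name under which the value of a kernel at one sample can carry the structure of a
    probability. *)
Definition ker_law (z : n.-tuple Z) : set T -> \bar R := K z.

HB.instance Definition _ z := Measure.on (ker_law z).

Let ker_law_setT z : ker_law z setT = 1%E.
Proof. exact: prob_kernel. Qed.

HB.instance Definition _ z :=
  Measure_isProbability.Build _ _ _ (ker_law z) (ker_law_setT z).

Definition transcript_of (P : probability Z R) : probability T R :=
  mixture (prod_prob (fun _ : 'I_n => P)) K.

Lemma measurable_int_kernel (phi : T -> R) M : bdd phi M ->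
  measurable_fun setT (fun z => (\int[K z]_t (phi t)%:E)%E).
Proof.
move=> [mp p0]; apply: measurable_fun_integral_kernel.
- by move=> U mU; exact: measurable_kernel.
- by move=> t; rewrite lee_fin; case/andP: (p0 t).
- exact/measurable_EFinP.
Qed.

Lemma bdd_kernel (phi : T -> R) M : bdd phi M -> bdd (fun z => Ex (ker_law z) phi) M.
Proof.
move=> bp; split; last by move=> z; have [_] := ExE (ker_law z) bp.
by apply: measurableT_comp => //; exact: measurable_int_kernel bp.
Qed.

Lemma Ex_transcript (P : probability Z R) (phi : T -> R) M : bdd phi M ->
  Ex (transcript_of P) phi = Ex (prod_prob (fun _ : 'I_n => P)) (fun z => Ex (ker_law z) phi).
Proof.
move=> bp; have [mp p0] := bp.
rewrite /Ex /transcript_of ge0_integral_mixture//; last 2 first.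
- exact/measurable_EFinP.
- by move=> t; rewrite lee_fin; case/andP: (p0 t).
congr fine; apply: eq_integral => z _.
exact: (Ex_eq (ker_law z) bp).
Qed.

Context (e delta : R).
Hypothesis e1 : 1 <= e.
Hypothesis d0 : 0 <= delta.
Hypothesis dpK : forall z z', neighbours z z' -> forall A, measurable A ->
  (K z A <= e%:E * K z' A + delta%:E)%E.

Lemma group_transcript (P0 P1 : probability Z R) L tau (phi : T -> R) M :
  likelihood P0 P1 L tau -> 0 <= tau -> 0 <= M -> bdd phi M ->
  Ex (transcript_of P1) phi <=
  (1 + (e - 1) * tau) ^+ n * (Ex (transcript_of P0) phi + n%:R * (delta * M * tau)).
Proof.
move=> lik t0 M0 bp.
rewrite !(Ex_transcript _ bp).
have bk := bdd_kernel bp.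
have h := group_privacy lik e1 (mulr_ge0 d0 M0) t0 bk.
rewrite -lee_fin EFinM EFinD -!(Ex_eq _ bk); apply: h => z z' nb.
have e0 : 0 <= e by apply: le_trans e1.
apply: (@dp_Ex _ _ _ (ker_law z) (ker_law z') e delta M phi e0 M0 bp) => A mA.
exact: dpK.
Qed.

(** It bounds the change in the mean of [phi] when the law of the data changes, as the transcript
    depends on the data alone. The absolute value makes it additive in [phi] among nonnegative test
    functions. *)
Definition lik_corr (P0 : probability Z R) (L : Z -> R) (phi : T -> R) : \bar R :=
  (\int[prod_prob (fun _ : 'I_n => P0)]_z (`|lik_dev L z| * Ex (ker_law z) phi)%:E)%E.

Lemma lik_corr_ge0 P0 L phi M : bdd phi M -> (0 <= lik_corr P0 L phi)%E.
Proof.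
move=> bp; apply: integral_ge0 => z _.
by rewrite lee_fin mulr_ge0// (Ex_ge0 _ bp).
Qed.

Lemma measurable_lik_corr (L : Z -> R) phi M : measurable_fun setT L -> bdd phi M ->
  measurable_fun setT (fun z : n.-tuple Z => `|lik_dev L z| * Ex (ker_law z) phi).
Proof.
move=> mL bp; apply: measurable_funM.
  by apply: measurableT_comp => //; exact: measurable_lik_dev.
by case: (bdd_kernel bp).
Qed.

Lemma transcript_density (P0 P1 : probability Z R) L tau (phi : T -> R) M :
  likelihood P0 P1 L tau -> bdd phi M ->
  ((Ex (transcript_of P1) phi)%:E =
   \int[prod_prob (fun _ : 'I_n => P0)]_z (Ex (ker_law z) phi * (1 + lik_dev L z))%:E)%E.
Proof.
move=> [mL L0 LE _] bp; have bk := bdd_kernel bp.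
rewrite (Ex_transcript _ bp) -(Ex_eq _ bk).
rewrite (prod_prob_density (P := fun=> P1) (mu := fun=> P0) (w := fun=> L))//; last 2 first.
- by apply/measurable_EFinP; case: bk.
- by move=> z; rewrite lee_fin (Ex_ge0 _ bp).
by apply: eq_integral => z _; rewrite /lik_dev addrC subrK EFinM.
Qed.

Lemma lik_transcript (P0 P1 : probability Z R) L tau (phi : T -> R) M :
  likelihood P0 P1 L tau -> bdd phi M ->
  ((Ex (transcript_of P1) phi)%:E <= (Ex (transcript_of P0) phi)%:E + lik_corr P0 L phi /\
   (Ex (transcript_of P0) phi)%:E <= (Ex (transcript_of P1) phi)%:E + lik_corr P0 L phi)%E.
Proof.
move=> lik bp; have bk := bdd_kernel bp.
have [mk k0M] := bk.
have k0 z : 0 <= Ex (ker_law z) phi by case/andP: (k0M z).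
have [mL L0 _ _] := lik.
have mW := @measurable_lik_dev _ n _ mL.
have W1 (z : n.-tuple Z) : 0 <= 1 + lik_dev L z.
  by rewrite /lik_dev addrC subrK prodr_ge0.
have mc := measurable_lik_corr mL bp.
have md : measurable_fun setT (fun z : n.-tuple Z => Ex (ker_law z) phi * (1 + lik_dev L z)).
  by apply: measurable_funM => //; exact: measurable_funD.
rewrite (transcript_density lik bp) (Ex_transcript _ bp) -(Ex_eq _ bk).
split; rewrite /lik_corr -int_realD//; try by move=> z; rewrite mulr_ge0.
- apply: ge0_le_integral => //; try by move=> z _; rewrite lee_fin ?mulr_ge0.
  + exact/measurable_EFinP.
  + by apply/measurable_EFinP; exact: measurable_funD.
  + move=> z _; rewrite lee_fin mulrDr mulr1 lerD2l mulrC ler_wpM2r//; exact: ler_norm.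
- apply: ge0_le_integral => //; try by move=> z _; rewrite lee_fin ?mulr_ge0.
  + exact/measurable_EFinP.
  + by apply/measurable_EFinP; exact: measurable_funD.
  + move=> z _; rewrite lee_fin mulrDr mulr1 -addrA lerDl [X in _ + X]mulrC -mulrDr.
    by rewrite mulr_ge0// -lerBlDr sub0r; have := ler_norm (- lik_dev L z); rewrite normrN; lra.
Qed.

Lemma lik_corrD (P0 : probability Z R) L (f g : T -> R) M M' : measurable_fun setT L ->
  bdd f M -> bdd g M' ->
  (lik_corr P0 L (fun t => f t + g t)%R = lik_corr P0 L f + lik_corr P0 L g)%E.
Proof.
move=> mL bf bg; rewrite /lik_corr -int_realD//.
- by apply: eq_integral => z _; rewrite (ExD _ bf bg) mulrDr.
- exact: measurable_lik_corr bf.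
- exact: measurable_lik_corr bg.
- by move=> z; rewrite mulr_ge0// (Ex_ge0 _ bf).
- by move=> z; rewrite mulr_ge0// (Ex_ge0 _ bg).
Qed.

Lemma lik_corr_le (P0 : probability Z R) L (f g : T -> R) M M' : measurable_fun setT L ->
  bdd f M -> bdd g M' -> (forall t, f t <= g t) ->
  (lik_corr P0 L f <= lik_corr P0 L g)%E.
Proof.
move=> mL bf bg fg; apply: ge0_le_integral => //.
- by move=> z _; rewrite lee_fin mulr_ge0// (Ex_ge0 _ bf).
- by apply/measurable_EFinP; exact: measurable_lik_corr bf.
- by apply/measurable_EFinP; exact: measurable_lik_corr bg.
- by move=> z _; rewrite lee_fin ler_wpM2l// (Ex_le _ bf bg fg).
Qed.

Lemma lik_corrZ (P0 : probability Z R) L (f : T -> R) M (c : R) : measurable_fun setT L -> 0 <= c ->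
  bdd f M -> (lik_corr P0 L (fun t => c * f t)%R = c%:E * lik_corr P0 L f)%E.
Proof.
move=> mL c0 bf; rewrite /lik_corr -int_realZ//.
- by apply: eq_integral => z _; rewrite (ExZ _ c0 bf) mulrCA.
- exact: measurable_lik_corr bf.
- by move=> z; rewrite mulr_ge0// (Ex_ge0 _ bf).
Qed.

(** The cases are [b <= 2 a] and its opposite. The coefficient 1/2 is what allows the last term to
    be absorbed later; [2 ^ k] pays for it. *)
Lemma young_pow (k : nat) (a b : R) : 0 <= a -> 0 <= b ->
  a * b ^+ k <= 2 ^+ k * a ^+ k.+1 + b ^+ k.+1 / 2.
Proof.
move=> a0 b0; have [h|h] := leP b (2 * a).
  apply: (@le_trans _ _ (2 ^+ k * a ^+ k.+1)); last by rewrite lerDl divr_ge0// exprn_ge0.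
  rewrite exprS mulrCA -exprMn ler_wpM2l//; apply: lerXn2r => //.
  by rewrite nnegrE mulr_ge0.
apply: (@le_trans _ _ (b ^+ k.+1 / 2)); last by rewrite lerDr mulr_ge0// exprn_ge0.
rewrite exprS mulrAC ler_wpM2r ?exprn_ge0//; lra.
Qed.

Lemma lik_corr_young (P0 P1 : probability Z R) L tau (f : T -> R) (k : nat) (u : R) :
  likelihood P0 P1 L tau -> bdd f 1 ->
  (\int[prod_prob (fun _ : 'I_n => P0)]_z ((lik_dev L z) ^+ (2 * k.+1))%:E <= u%:E)%E ->
  (lik_corr P0 L (fun t => f t ^+ (2 * k).+1)%R <=
   (2 ^+ (2 * k).+1 * u + Ex (transcript_of P0) (fun t => f t ^+ (2 * k.+1))%R / 2)%:E)%E.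
Proof.
move=> [mL _ _ _] [mf f01] hu.
have e2 : (2 * k.+1 = (2 * k).+2)%N by rewrite mulnS.
have bX m : bdd (fun t => f t ^+ m) 1.
  split; first exact: measurable_funX.
  by move=> t; have /andP[f0 f1] := f01 t; rewrite exprn_ge0// exprn_ile1.
have er (x : R) : 0 <= x ^+ (2 * k.+1) by rewrite exprM exprn_ge0// sqr_ge0.
set r := (2 * k.+1)%N in e2 er hu *.
have bk := bdd_kernel (bX r).
have mW := @measurable_lik_dev _ n _ mL.
rewrite (Ex_transcript _ (bX r)).
apply: (@le_trans _ _ (\int[prod_prob (fun _ : 'I_n => P0)]_z
   (2 ^+ (2 * k).+1 * (lik_dev L z) ^+ r + 2^-1 * Ex (ker_law z) (fun t => f t ^+ r))%:E)%E).
  apply: ge0_le_integral => //.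
  - by move=> z _; rewrite lee_fin mulr_ge0// (Ex_ge0 _ (bX _)).
  - by apply/measurable_EFinP; exact: measurable_lik_corr (bX _).
  - apply/measurable_EFinP; apply: measurable_funD; apply: measurable_funM => //.
      exact: measurable_funX.
    by case: bk.
  - move=> z _; rewrite lee_fin.
    rewrite -(ExZ _ _ (bX _))//.
    have c0 : 0 <= 2 ^+ (2 * k).+1 * lik_dev L z ^+ r by rewrite mulr_ge0// exprn_ge0.
    have h0 : (0:R) <= 2^-1 by rewrite invr_ge0.
    have bZ := bddM (bdd_cst _ h0) (bX r).
    rewrite -(ExZ _ h0 (bX _)) -[X in _ <= X + _](Ex_cst (ker_law z) c0).
    rewrite -(ExD _ (bdd_cst _ c0) bZ).
    apply: (Ex_le _ (bddM (bdd_cst _ (normr_ge0 (lik_dev L z))) (bX _)) (bddD (bdd_cst _ c0) bZ)) => t.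
    have /andP[f0 f1] := f01 t.
    have := young_pow (2 * k).+1 (normr_ge0 (lik_dev L z)) f0.
    rewrite -e2 -normrX (ger0_norm (er _)) /=; lra.
have p2 : 0 <= 2 ^+ (2 * k).+1 :> R by rewrite exprn_ge0.
have h2 : (0:R) <= 2^-1 by rewrite invr_ge0.
have mr : measurable_fun setT (fun z : n.-tuple Z => (lik_dev L z) ^+ r) by exact: measurable_funX.
have mk : measurable_fun setT (fun z => Ex (ker_law z) (fun t => f t ^+ r)) by case: bk.
have k0 z : 0 <= Ex (ker_law z) (fun t => f t ^+ r) by exact: Ex_ge0 (bX r).
rewrite int_realD//; last 4 first.
- exact: measurable_funM.
- exact: measurable_funM.
- by move=> z; rewrite mulr_ge0.
- by move=> z; rewrite mulr_ge0.
rewrite int_realZ// int_realZ// EFinD EFinM (Ex_eq _ bk) -EFinM.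
rewrite [_ / 2]mulrC; apply: leeD => //.
by rewrite EFinM lee_wpmul2l// lee_fin.
Qed.

End server_bound.

Section separation_arithmetic.
Context (R : realFieldType).

Lemma sq_amgm (g y : R) : g * y <= g ^+ 2 / 2 + 2^-1 * y ^+ 2.
Proof. by have := sqr_ge0 (g - y); rewrite sqrrB; lra. Qed.

(** The bookkeeping of [separation_moment]: [P] and [N] are moments of the positive and negative
    parts of [s] under the transcript laws, [X] and [Y] those under [kap], and [E] is the
    unknown. *)
Lemma moment_arith (X1 X2 Y1 Y2 P1 P0 N0 N1 cp cn c U E Eq : R) :
  P1 = X1 + X2 -> X1 = P0 + X2 -> N0 = Y1 + Y2 -> Y1 = N1 + Y2 ->
  P1 <= P0 + cp -> N0 <= N1 + cn -> c = cp + cn -> c <= U + Eq / 2 ->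
  E = X2 + Y2 -> Eq <= 2 * E -> E <= U /\ c <= 2 * U.
Proof. by move=> *; split; lra. Qed.

(** The bookkeeping of [separation_group]: in addition, [a] and [b] are the means of the truncated
    parts and [da], [db] those of the excesses. *)
Lemma group_arith (X1 X2 Y1 Y2 P1 P0 N0 N1 a1 a0 b1 b0 da1 da0 db1 db0 cp cn G B t Q A : R) :
  P1 = X1 + X2 -> X1 = P0 + X2 -> N0 = Y1 + Y2 -> Y1 = N1 + Y2 ->
  P1 = a1 + da1 -> P0 = a0 + da0 -> N1 = b1 + db1 -> N0 = b0 + db0 ->
  a1 <= G * (a0 + B) -> b0 <= G * (b1 + B) -> da1 <= da0 + cp -> db0 <= db1 + cn ->
  cp + cn <= t -> 0 <= da0 -> 0 <= db1 -> 0 <= X2 -> 0 <= Y2 -> 1 <= G ->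
  A = X2 + Y2 -> (G - 1) * (X1 + Y1) <= Q + A / 2 ->
  2 * A <= Q + A / 2 + 2 * G * B + t.
Proof.
move=> h1 h2 h3 h4 h5 h6 h7 h8 h9 h10 h11 h12 h13 h14 h15 h16 h17 h18 h19 h20.
have : (G - 1) * a0 <= (G - 1) * X1 by apply: ler_wpM2l; lra.
have : (G - 1) * b1 <= (G - 1) * Y1 by apply: ler_wpM2l; lra.
by lra.
Qed.

End separation_arithmetic.

Section server_separation.
Context (R : realType).
Local Notation Z := (R * R)%type.
Context d (T : measurableType d) (n : nat) (K : R.-pker (n.-tuple Z) ~> T).

Lemma bdd_X (g : T -> R) (k : nat) : bdd g 1 -> bdd (fun t => g t ^+ k) 1.
Proof.
move=> [mg g01]; split; first exact: measurable_funX.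
by move=> t; have /andP[f0 f1] := g01 t; rewrite exprn_ge0// exprn_ile1.
Qed.

Section split_integrals.
Context (Q0 Q1 kap : probability T R) (s : T -> R).
Hypothesis spl : splits Q0 Q1 kap s.

Definition pos_part t : R := Num.max (s t) 0.
Definition neg_part t : R := Num.max (- s t) 0.

Lemma bdd_pos_part : bdd pos_part 1.
Proof.
case: spl => ms s1 _ _; split; first exact: measurable_maxr.
by move=> t; have /andP[a b] := s1 t; rewrite /pos_part le_max lexx orbT ge_max b ler01.
Qed.

Lemma bdd_neg_part : bdd neg_part 1.
Proof.
case: spl => ms s1 _ _; split.
  by apply: measurable_maxr => //; exact: measurableT_comp.
by move=> t; have /andP[a b] := s1 t; rewrite /neg_part le_max lexx orbT ge_max ler01 andbT; lra.
Qed.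

Lemma bdd_1Bs : bdd (fun t => 1 - s t) 2.
Proof.
case: spl => ms s1 _ _; split; first exact: measurable_funB.
by move=> t; have /andP[? ?] := s1 t; apply/andP; split; lra.
Qed.

Lemma Ex_split1 g N : bdd g N -> Ex Q1 g = Ex kap (fun t => g t * (1 + s t)).
Proof.
move=> [mg g0]; case: spl => _ _ h _.
rewrite /Ex h//; first exact/measurable_EFinP.
by move=> t; rewrite lee_fin; case/andP: (g0 t).
Qed.

Lemma Ex_split0 g N : bdd g N -> Ex Q0 g = Ex kap (fun t => g t * (1 - s t)).
Proof.
move=> [mg g0]; case: spl => _ _ _ h.
rewrite /Ex h//; first exact/measurable_EFinP.
by move=> t; rewrite lee_fin; case/andP: (g0 t).
Qed.

(** Multiplying the positive part by [s] raises its power by one. Hence its means under the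
    densities [1 + s] and [1 - s] differ by exactly twice the next moment under [kap]. *)
Lemma pos_part_Ex (k : nat) :
  Ex Q1 (fun t => pos_part t ^+ k.+1) =
    Ex kap (fun t => pos_part t ^+ k.+1) + Ex kap (fun t => pos_part t ^+ k.+2) /\
  Ex kap (fun t => pos_part t ^+ k.+1) =
    Ex Q0 (fun t => pos_part t ^+ k.+1) + Ex kap (fun t => pos_part t ^+ k.+2).
Proof.
have b m := bdd_X m bdd_pos_part.
have e t : pos_part t * s t = pos_part t ^+ 2.
  by rewrite /pos_part; have [?|?] := leP (s t) 0; rewrite ?mul0r ?expr0n.
split.
  rewrite (Ex_split1 (b _)) -(ExD kap (b _) (b _)); congr Ex; apply/funext => t.
  have -> : pos_part t ^+ k.+2 = pos_part t ^+ k * pos_part t ^+ 2 by rewrite -exprD addn2.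
  by rewrite -e exprSr; ring.
rewrite (Ex_split0 (b _)) -(ExD kap (bddM (b _) bdd_1Bs) (b _)); congr Ex; apply/funext => t.
have -> : pos_part t ^+ k.+2 = pos_part t ^+ k * pos_part t ^+ 2 by rewrite -exprD addn2.
by rewrite -e exprSr; ring.
Qed.

End split_integrals.

Lemma splits_sym Q0 Q1 kap (s : T -> R) : splits Q0 Q1 kap s -> splits Q1 Q0 kap (fun t => - s t).
Proof.
move=> [ms s1 h1 h0]; split.
- exact: measurableT_comp.
- by move=> t; have /andP[a b] := s1 t; apply/andP; split; lra.
- exact: h0.
- by move=> g mg g0; rewrite h1//; under [RHS]eq_integral do rewrite opprK.
Qed.

Lemma pos_partN (s : T -> R) : pos_part (fun t => - s t) = neg_part s.
Proof. by []. Qed.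

Lemma neg_part_Ex Q0 Q1 kap (s : T -> R) (k : nat) : splits Q0 Q1 kap s ->
  Ex Q0 (fun t => neg_part s t ^+ k.+1) =
    Ex kap (fun t => neg_part s t ^+ k.+1) + Ex kap (fun t => neg_part s t ^+ k.+2) /\
  Ex kap (fun t => neg_part s t ^+ k.+1) =
    Ex Q1 (fun t => neg_part s t ^+ k.+1) + Ex kap (fun t => neg_part s t ^+ k.+2).
Proof. by move=> /splits_sym/pos_part_Ex/(_ k); rewrite pos_partN. Qed.

Lemma absX_parts (s : T -> R) (k : nat) t :
  `|s t| ^+ k.+1 = pos_part s t ^+ k.+1 + neg_part s t ^+ k.+1.
Proof.
rewrite /pos_part /neg_part; have [h|h] := leP 0 (s t).
  by rewrite (ger0_norm h) max_r ?oppr_le0// expr0n addr0.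
by rewrite ltr0_norm// max_l ?oppr_ge0 ?(ltW h)// expr0n add0r.
Qed.

Lemma bdd_abs Q0 Q1 kap (s : T -> R) : splits Q0 Q1 kap s -> bdd (fun t => `|s t|) 1.
Proof.
case=> ms s1 _ _; split; first exact: measurableT_comp.
by move=> t; rewrite normr_ge0 /= ler_norml.
Qed.

(** The power [2 k + 1] of the two parts of [s] distinguishes the laws by twice the moment of order
    [2 k + 2], and the difference is at most the correlation with the likelihood deviation. Young's
    inequality bounds this by a multiple of [u] plus half of the same moment under the first law,
    which is at most twice [kap]; so the unknown appears once on the right and twice on the left. *)
Lemma separation_moment (P0 P1 : probability Z R) (kap : probability T R) (s : T -> R) L tau (k : nat) (u : R) :
  likelihood P0 P1 L tau ->
  splits (transcript_of K P0) (transcript_of K P1) kap s ->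
  (\int[prod_prob (fun _ : 'I_n => P0)]_z ((lik_dev L z) ^+ (2 * k.+1))%:E <= u%:E)%E ->
  Ex kap (fun t => `|s t| ^+ (2 * k.+1)) <= 2 ^+ (2 * k).+1 * u /\
  (lik_corr K P0 L (fun t => `|s t| ^+ (2 * k).+1)%R <= (2 ^+ (2 * k.+1) * u)%:E)%E.
Proof.
move=> lik spl hu.
have [mL _ _ _] := lik.
have er : (2 * k.+1 = (2 * k).+2)%N by rewrite mulnS.
have bp := bdd_pos_part spl; have bn := bdd_neg_part spl; have ba := bdd_abs spl.
have bX f m := @bdd_X f m.
set Q0 := transcript_of K P0 in spl *; set Q1 := transcript_of K P1 in spl *.
have y := lik_corr_young K lik ba hu; rewrite -/Q0 in y.
have e1 m : (fun t => `|s t| ^+ m.+1) = (fun t => pos_part s t ^+ m.+1 + neg_part s t ^+ m.+1).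
  by apply/funext => t; exact: absX_parts.
have [p1 p0] := pos_part_Ex spl (2 * k)%N.
have [n0 n1] := neg_part_Ex (2 * k)%N spl.
have [l1 _] := lik_transcript K lik (bX _ (2 * k).+1 bp).
have [_ l0] := lik_transcript K lik (bX _ (2 * k).+1 bn).
have lD := lik_corrD K P0 mL (bX _ (2 * k).+1 bp) (bX _ (2 * k).+1 bn).
rewrite -/Q0 -/Q1 in l1 l0.
have c0 := lik_corr_ge0 K P0 L (bX _ (2 * k).+1 ba).
have cfin : lik_corr K P0 L (fun t => `|s t| ^+ (2 * k).+1)%R \is a fin_num.
  by rewrite ge0_fin_numE//; apply: le_lt_trans y (ltry _).
have cp0 := lik_corr_ge0 K P0 L (bX _ (2 * k).+1 bp).
have cn0 := lik_corr_ge0 K P0 L (bX _ (2 * k).+1 bn).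
set c := lik_corr K P0 L (fun t => `|s t| ^+ _)%R in y c0 cfin *.
have cE : (c = lik_corr K P0 L (fun t => pos_part s t ^+ (2 * k).+1)%R +
   lik_corr K P0 L (fun t => neg_part s t ^+ (2 * k).+1)%R)%E by rewrite -lD /c e1.
set cp := lik_corr K P0 L (fun t => pos_part s t ^+ _)%R in l1 cp0 cE.
set cn := lik_corr K P0 L (fun t => neg_part s t ^+ _)%R in l0 cn0 cE.
clearbody c cp cn.
have cpfin : cp \is a fin_num.
  by rewrite ge0_fin_numE//; apply: (@le_lt_trans _ _ c); [rewrite cE leeDl | rewrite -ge0_fin_numE].
have cnfin : cn \is a fin_num.
  by rewrite ge0_fin_numE//; apply: (@le_lt_trans _ _ c); [rewrite cE leeDr | rewrite -ge0_fin_numE].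
have cE' : fine c = fine cp + fine cn by rewrite cE fineD.
move: l1 l0 y; rewrite -(fineK cpfin) -(fineK cnfin) -(fineK cfin) -!EFinD !lee_fin => l1 l0 y.
have aD : Ex kap (fun t => `|s t| ^+ (2 * k.+1)) =
   Ex kap (fun t => pos_part s t ^+ (2 * k).+2) + Ex kap (fun t => neg_part s t ^+ (2 * k).+2).
  by rewrite er e1 (ExD kap (bX _ _ bp) (bX _ _ bn)).
have q0 : Ex Q0 (fun t => `|s t| ^+ (2 * k.+1)) <= 2 * Ex kap (fun t => `|s t| ^+ (2 * k.+1)).
  have h2 : (0 : R) <= 2 by [].
  rewrite (Ex_split0 spl (bX _ _ ba)) -(ExZ kap h2 (bX _ _ ba)).
  apply: (Ex_le kap (bddM (bX _ _ ba) (bdd_1Bs spl)) (bddM (bdd_cst _ h2) (bX _ _ ba))) => t.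
  rewrite mulrC ler_wpM2r ?exprn_ge0//; case: spl => _ /(_ t)/andP[u1 _] _ _; move: u1; move: (s t) => y1; clear; lra.
have [H1 H2] := moment_arith p1 p0 n0 n1 l1 l0 cE' y aD q0.
split => //.
by apply: le_trans H2 _; rewrite er [in leRHS]exprS -mulrA.
Qed.

(** Below the cut [M], group privacy applies and [delta] gains the factor [M]; the excess is
    controlled by [separation_moment]. With [M = 1] there is no excess, hence the first alternative,
    which asks for no moment. Both likelihood ratios occur, since the positive part is carried from
    [P0] to [P1] and the negative part backwards. *)
Lemma separation_group (P0 P1 : probability Z R) (kap : probability T R) (s : T -> R) L L' tau
    (k : nat) (u M e delta : R) :
  1 <= e -> 0 <= delta ->
  (forall z z', neighbours z z' -> forall A, measurable A ->
  (K z A <= e%:E * K z' A + delta%:E)%E) ->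
  likelihood P0 P1 L tau -> likelihood P1 P0 L' tau -> 0 <= tau ->
  splits (transcript_of K P0) (transcript_of K P1) kap s ->
  0 < M <= 1 ->
  (M = 1 /\ u = 0 \/
   (\int[prod_prob (fun _ : 'I_n => P0)]_z ((lik_dev L z) ^+ (2 * k.+1))%:E <= u%:E)%E) ->
  forall G : R, G = (1 + (e - 1) * tau) ^+ n ->
  2 * Ex kap (fun t => `|s t| ^+ 2) <=
  (G - 1) ^+ 2 / 2 + Ex kap (fun t => `|s t| ^+ 2) / 2 + 2 * G * (n%:R * (delta * M * tau)) +
  (M ^- (2 * k)) * (2 ^+ (2 * k.+1) * u).
Proof.
move=> e1 d0 dp lik lik' t0 spl /andP[M0 M1] hu G GE.
have [mL _ _ _] := lik.
have bp := bdd_pos_part spl; have bn := bdd_neg_part spl; have ba := bdd_abs spl.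
have bX f m := @bdd_X f m.
have G1 : 1 <= G by rewrite GE; apply: exprn_ege1; rewrite lerDl mulr_ge0 ?subr_ge0.
have M0' := ltW M0.
set Q0 := transcript_of K P0 in spl *; set Q1 := transcript_of K P1 in spl *.
have tr (f : T -> R) : bdd f 1 -> bdd (fun t => Num.min (f t) M) M /\ bdd (fun t => f t - Num.min (f t) M) 1.
  move=> [mf f01]; split.
    split; first exact: measurable_minr.
    by move=> t; have /andP[? ?] := f01 t; rewrite ge_min lexx orbT le_min M0' andbT; apply/andP.
  split; first by apply: measurable_funB => //; exact: measurable_minr.
  move=> t; have /andP[? ?] := f01 t; rewrite subr_ge0 ge_min lexx /=.
  by have : 0 <= Num.min (f t) M; [rewrite le_min M0' andbT | lra].
have [bpm bpd] := tr _ bp; have [bnm bnd] := tr _ bn.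
have g1 := group_transcript e1 d0 dp lik t0 M0' bpm.
have g0 := group_transcript e1 d0 dp lik' t0 M0' bnm.
rewrite -/Q0 -/Q1 -GE in g1 g0.
have split_min (Q : probability T R) (f : T -> R) : bdd f 1 -> Ex Q f = Ex Q (fun t => Num.min (f t) M) + Ex Q (fun t => f t - Num.min (f t) M).
  move=> bf; have [b1 b2] := tr _ bf; rewrite -(ExD Q b1 b2); congr Ex; apply/funext => t.
  by rewrite addrC subrK.
have [l1 _] := lik_transcript K lik bpd.
have [_ l0] := lik_transcript K lik bnd.
rewrite -/Q0 -/Q1 in l1 l0.
have tail : (lik_corr K P0 L (fun t => pos_part s t - Num.min (pos_part s t) M)%R +
   lik_corr K P0 L (fun t => neg_part s t - Num.min (neg_part s t) M)%R <=
   (M ^- (2 * k) * (2 ^+ (2 * k.+1) * u))%:E)%E.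
  rewrite -(lik_corrD K P0 mL bpd bnd).
  case: hu => [[M1' u0]|hu].
    rewrite u0 !mulr0 /lik_corr.
    rewrite integral0_eq// => z _.
    rewrite (_ : (fun t => _) = cst 0); first by rewrite Ex_cst ?mulr0.
    apply/funext => t; rewrite M1' !min_l ?subrr ?addr0//.
      by case: bn => _ /(_ t)/andP[].
    by case: bp => _ /(_ t)/andP[].
  have [_ mm] := separation_moment lik spl hu.
  have iM0 : 0 <= M ^- (2 * k) by rewrite invr_ge0 exprn_ge0.
  rewrite EFinM; apply: le_trans (lee_wpmul2l _ mm); last by rewrite lee_fin.
  rewrite -(lik_corrZ K P0 mL iM0 (bX _ _ ba)).
  apply: (lik_corr_le K P0 mL (bddD bpd bnd) (bddM (bdd_cst _ iM0) (bX _ _ ba))) => t.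
  (* A Markov-type bound: the excess vanishes below [M], and above [M] the factor [(f / M) ^ (2 k)]
     is at least one. *)
  have key (f : R) : 0 <= f -> f - Num.min f M <= M ^- (2 * k) * f ^+ (2 * k).+1.
    move=> f0; have [h|h] := leP f M; first by rewrite subrr mulr_ge0// exprn_ge0.
    apply: (@le_trans _ _ f); first by rewrite gerBl.
    rewrite exprSr mulrA ler_peMl// mulrC -expr_div_n exprn_ege1//.
    by rewrite ler_pdivlMr// mul1r ltW.
  rewrite absX_parts mulrDr lerD//; apply: key.
    by case: bp => _ /(_ t)/andP[].
  by case: bn => _ /(_ t)/andP[].
have cp0 := lik_corr_ge0 K P0 L bpd.
have cn0 := lik_corr_ge0 K P0 L bnd.
set cp := lik_corr K P0 L (fun t => pos_part s t - _)%R in l1 cp0 tail.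
set cn := lik_corr K P0 L (fun t => neg_part s t - _)%R in l0 cn0 tail.
clearbody cp cn.
have cpfin : cp \is a fin_num.
  rewrite ge0_fin_numE//; apply: le_lt_trans (ltry _); apply: le_trans tail; exact: leeDl.
have cnfin : cn \is a fin_num.
  rewrite ge0_fin_numE//; apply: le_lt_trans (ltry _); apply: le_trans tail; exact: leeDr.
move: l1 l0 tail; rewrite -(fineK cpfin) -(fineK cnfin) -!EFinD !lee_fin => l1 l0 tail.
have ex1 f : (fun t : T => f t ^+ 1) = f by apply/funext => t; rewrite expr1.
have [p1 p0] := pos_part_Ex spl 0%N.
have [n0 n1] := neg_part_Ex 0%N spl.
rewrite !ex1 in p1 p0 n0 n1.
have aD : Ex kap (fun t => `|s t| ^+ 2) =
   Ex kap (fun t => pos_part s t ^+ 2) + Ex kap (fun t => neg_part s t ^+ 2).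
  by rewrite -(ExD kap (bX _ _ bp) (bX _ _ bn)); congr Ex; apply/funext => t; exact: absX_parts.
have a1D : Ex kap (fun t => `|s t|) = Ex kap (pos_part s) + Ex kap (neg_part s).
  rewrite -(ExD kap bp bn); congr Ex; apply/funext => t.
  by have := absX_parts s 0 t; rewrite !expr1.
(* The factor [G - 1] multiplies a first moment of [s]; this trades it for the square of [G - 1] and
   half of the unknown. *)
have amgm : (G - 1) * Ex kap (fun t => `|s t|) <= (G - 1) ^+ 2 / 2 + Ex kap (fun t => `|s t| ^+ 2) / 2.
  have G0 : 0 <= G - 1 by rewrite subr_ge0.
  have h2 : (0 : R) <= 2^-1 by rewrite invr_ge0.
  have c0 : 0 <= (G - 1) ^+ 2 / 2 by rewrite divr_ge0// sqr_ge0.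
  rewrite [X in _ <= _ + X]mulrC -(ExZ kap G0 ba) -(ExZ kap h2 (bX _ _ ba)) -[X in _ <= X + _](Ex_cst kap c0).
  have bZ := bddM (bdd_cst _ h2) (bX _ 2 ba).
  rewrite -(ExD kap (bdd_cst _ c0) bZ).
  apply: (Ex_le kap (bddM (bdd_cst _ G0) ba) (bddD (bdd_cst _ c0) bZ)) => t /=.
  exact: sq_amgm.
have sp1 := split_min Q1 _ bp; have sp0 := split_min Q0 _ bp.
have sn1 := split_min Q1 _ bn; have sn0 := split_min Q0 _ bn.
have d0' : 0 <= Ex Q0 (fun t => pos_part s t - Num.min (pos_part s t) M) by exact: Ex_ge0 bpd.
have d1' : 0 <= Ex Q1 (fun t => neg_part s t - Num.min (neg_part s t) M) by exact: Ex_ge0 bnd.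
have x20 : 0 <= Ex kap (fun t => pos_part s t ^+ 2) by exact: Ex_ge0 (bX _ _ bp).
have y20 : 0 <= Ex kap (fun t => neg_part s t ^+ 2) by exact: Ex_ge0 (bX _ _ bn).
rewrite a1D in amgm.
exact: (group_arith p1 p0 n0 n1 sp1 sp0 sn1 sn0 g1 g0 l1 l0 tail d0' d1' x20 y20 G1 aD amgm).
Qed.

End server_separation.

(** * Le Cam and Assouad *)

Section two_point.
Context d (T : measurableType d) (R : realType).

(** The Weierstrass product inequality. *)
Lemma prod_one_minus (m : nat) (l : 'I_m -> R) : (forall j, 0 <= l j <= 1) ->
  1 - \sum_j l j <= \prod_j (1 - l j).
Proof.
elim: m l => [|m IH] l l01; first by rewrite !big_ord0 subr0.
rewrite !big_ord_recl.
have := IH (fun i => l (lift ord0 i)) (fun i => l01 _).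
have /andP[a b] := l01 ord0.
set p := \prod_(i < m) _; set s := \sum_(i < m) _ => h.
have p1 : p <= 1.
  by apply: prodr_ile1 => i _; have /andP[? ?] := l01 (lift ord0 i); apply/andP; split; lra.
have : l ord0 * p <= l ord0 * 1 by exact: ler_wpM2l.
by lra.
Qed.

(** [H] is at most the geometric mean of [A] and [B], hence at most their minimum plus a quarter of
    their sum. The minimum is paid by [F + G], and the quarter costs a constant after integration;
    no square root is ever integrated. *)
Lemma two_point_weights (F G : \bar R) (c A B H : R) : (0 <= F)%E -> (0 <= G)%E ->
  (c%:E <= F + G)%E -> 0 <= c -> 0 <= A -> 0 <= B -> 0 <= H -> H ^+ 2 <= A * B ->
  ((c * H)%:E <= F * B%:E + G * A%:E + (c / 4 * (A + B))%:E)%E.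
Proof.
move=> F0 G0 FG c0 A0 B0 H0 HAB.
pose mn := Num.min A B.
have mn0 : 0 <= mn by rewrite /mn le_min A0.
have mnA : mn <= A by rewrite ge_min lexx.
have mnB : mn <= B by rewrite ge_min lexx orbT.
have Hle : H <= mn + (A + B) / 4.
  have key x y : 0 <= x -> 0 <= y -> H ^+ 2 <= x * y -> H <= x + (x + y) / 4.
    move=> x0 y0 h; rewrite leNgt; apply/negP => lt.
    have z0 : 0 <= x + y / 4 by rewrite addr_ge0// divr_ge0.
    have zH : x + y / 4 < H by lra.
    have : (x + y / 4) ^+ 2 < H ^+ 2 by rewrite ltr_pXn2r// nnegrE.
    have := sqr_ge0 (x - y / 4); rewrite !sqrrD sqrrN mulrN; lra.
  rewrite /mn; have [AB|BA] := leP A B; first exact: key.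
  by rewrite [A + B]addrC; apply: key => //; rewrite mulrC.
apply: (@le_trans _ _ ((c * mn)%:E + (c / 4 * (A + B))%:E)%E).
  rewrite -EFinD lee_fin; have := ler_wpM2l c0 Hle; lra.
apply: leeD => //.
apply: (@le_trans _ _ ((F + G) * mn%:E)%E).
  by rewrite EFinM; apply: lee_wpmul2r; rewrite ?lee_fin.
rewrite ge0_muleDl//; apply: leeD; apply: lee_wpmul2l => //; rewrite lee_fin//.
Qed.

(** The product laws have densities [A] and [B], and [A B] is the product of the [1 - s ^ 2], of
    mean at least 3/4. The weights cost [c / 2], because [A] and [B] integrate to one, and [c / 4]
    remains. *)
Lemma two_point_risk (m : nat) (Q0 Q1 kap : 'I_m -> probability T R) (s : 'I_m -> T -> R)
    (F G : m.-tuple T -> \bar R) (c : R) :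
  (forall j, splits (Q0 j) (Q1 j) (kap j) (s j)) ->
  \sum_j Ex (kap j) (fun t => `|s j t| ^+ 2) <= 4^-1 ->
  measurable_fun setT F -> measurable_fun setT G ->
  (forall t, 0 <= F t)%E -> (forall t, 0 <= G t)%E -> 0 <= c ->
  (forall t, c%:E <= F t + G t)%E ->
  ((c / 4)%:E <= \int[prod_prob Q0]_t F t + \int[prod_prob Q1]_t G t)%E.
Proof.
move=> spl l4 mF mG F0 G0 c0 FG.
have ms j : measurable_fun setT (s j) by case: (spl j).
have s1 j t : -1 <= s j t <= 1 by case: (spl j).
have m1 j : measurable_fun setT (fun t => 1 + s j t) by exact: measurable_funD.
have m0 j : measurable_fun setT (fun t => 1 - s j t) by exact: measurable_funB.
have p1 j t : 0 <= 1 + s j t by have /andP[? ?] := s1 j t; lra.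
have p0 j t : 0 <= 1 - s j t by have /andP[? ?] := s1 j t; lra.
pose A (t : m.-tuple T) := \prod_j (1 + s j (tnth t j)).
pose B (t : m.-tuple T) := \prod_j (1 - s j (tnth t j)).
pose H (t : m.-tuple T) := \prod_j (1 - `|s j (tnth t j)| ^+ 2).
have mA : measurable_fun setT A by exact: (measurable_prod_tnth m1).
have mB : measurable_fun setT B by exact: (measurable_prod_tnth m0).
have mh j : measurable_fun setT (fun t => 1 - `|s j t| ^+ 2).
  by apply: measurable_funB => //; apply: measurable_funX; exact: measurableT_comp.
have h01 j t : 0 <= 1 - `|s j t| ^+ 2 <= 1.
  have a0 := normr_ge0 (s j t); have a1 : `|s j t| <= 1 by rewrite ler_norml.
  have e0 : 0 <= `|s j t| ^+ 2 by exact: exprn_ge0.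
  have e1 : `|s j t| ^+ 2 <= 1 by exact: exprn_ile1.
  by apply/andP; split; lra.
have mH : measurable_fun setT H by exact: (measurable_prod_tnth mh).
have A0 t : 0 <= A t by apply: prodr_ge0.
have B0 t : 0 <= B t by apply: prodr_ge0.
have H0 t : 0 <= H t by apply: prodr_ge0 => j _; case/andP: (h01 j (tnth t j)).
have H1 t : H t <= 1 by apply: prodr_ile1.
have HAB t : H t = A t * B t.
  rewrite /H /A /B -big_split /=; apply: eq_bigr => j _.
  by rewrite real_normK ?num_real//; ring.
have dens1 := prod_prob_density m1 p1 (fun j => let: And4 _ _ h _ := spl j in h).
have dens0 := prod_prob_density m0 p0 (fun j => let: And4 _ _ _ h := spl j in h).
rewrite dens0// dens1//.
have intA : (\int[prod_prob kap]_t (A t)%:E = 1)%E.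
  rewrite -[RHS](int_prob_cst (prod_prob Q1) 1) dens1//.
  by apply: eq_integral => t _; rewrite mul1e.
have intB : (\int[prod_prob kap]_t (B t)%:E = 1)%E.
  rewrite -[RHS](int_prob_cst (prod_prob Q0) 1) dens0//.
  by apply: eq_integral => t _; rewrite mul1e.
have c4 : 0 <= c / 4 by rewrite divr_ge0.
have mFB : measurable_fun setT (fun t => F t * (B t)%:E)%E.
  by apply: emeasurable_funM => //; exact/measurable_EFinP.
have mGA : measurable_fun setT (fun t => G t * (A t)%:E)%E.
  by apply: emeasurable_funM => //; exact/measurable_EFinP.
have FB0 t : (0 <= F t * (B t)%:E)%E by rewrite mule_ge0// lee_fin.
have GA0 t : (0 <= G t * (A t)%:E)%E by rewrite mule_ge0// lee_fin.
have key : ((c * (1 - 4^-1))%:E <= \int[prod_prob kap]_t (F t * (B t)%:E) +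
    \int[prod_prob kap]_t (G t * (A t)%:E) + (c / 2)%:E)%E.
  apply: (@le_trans _ _ (\int[prod_prob kap]_t (c * H t)%:E)%E).
    rewrite int_realZ// EFinM; apply: lee_wpmul2l; first by rewrite lee_fin.
    pose l j := Ex (kap j) (fun t => `|s j t| ^+ 2).
    have ba j := bdd_X 2 (bdd_abs (spl j)).
    have l01 j : 0 <= l j <= 1 by have [] := ExE (kap j) (ba j).
    apply: (@le_trans _ _ (\prod_j (1 - l j))%:E).
      rewrite lee_fin; apply: le_trans (prod_one_minus l01).
      by rewrite lerD2l lerN2.
    apply: (prod_prob_prod_ge (g := fun j t => 1 - `|s j t| ^+ 2) (a := fun j => 1 - l j)) => // j.
    - by move=> t; case/andP: (h01 j t).
    - by case/andP: (l01 j) => _; rewrite subr_ge0.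
    - have bh : bdd (fun t => 1 - `|s j t| ^+ 2) 1 by split.
      rewrite (Ex_eq _ bh) lee_fin lerBlDr -(ExD _ bh (ba j)).
      rewrite (_ : (fun t => _) = cst 1) ?Ex_cst//.
      by apply/funext => t; rewrite subrK.
  apply: (@le_trans _ _ (\int[prod_prob kap]_t (F t * (B t)%:E + G t * (A t)%:E + (c / 4 * (A t + B t))%:E))%E).
    apply: ge0_le_integral => //.
    - by move=> t _; rewrite lee_fin mulr_ge0.
    - by apply/measurable_EFinP; exact: measurable_funM.
    - apply: emeasurable_funD; first exact: emeasurable_funD.
      by apply/measurable_EFinP; apply: measurable_funM => //; exact: measurable_funD.
    (* Since [H] equals [A B] and is at most one, its square is at most [A B]. *)
    - move=> t _; apply: two_point_weights => //.
      rewrite -HAB expr2; exact: ler_piMr.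
  rewrite ge0_integralD//; last 4 first.
  - by move=> t _; rewrite adde_ge0.
  - exact: emeasurable_funD.
  - by move=> t _; rewrite lee_fin mulr_ge0// addr_ge0.
  - by apply/measurable_EFinP; apply: measurable_funM => //; exact: measurable_funD.
  rewrite ge0_integralD//; apply: leeD => //.
  rewrite (int_realZ _ c4 (measurable_funD mA mB)); last by move=> t; rewrite addr_ge0.
  rewrite int_realD// intA intB -EFinD -EFinM lee_fin; lra.
rewrite -leeBlDr// in key.
apply: le_trans key; rewrite -EFinB lee_fin; lra.
Qed.

End two_point.

Section assouad.
Context (R : realType).

Definition flip K (w : {ffun 'I_K -> bool}) (k : 'I_K) : {ffun 'I_K -> bool} :=
  [ffun i => if i == k then ~~ w i else w i].

Lemma flipK K (k : 'I_K) : involutive (fun w : {ffun 'I_K -> bool} => flip w k).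
Proof. by move=> w; apply/ffunP => i; rewrite !ffunE; case: eqP => // _; rewrite negbK. Qed.

(** Averaged over the cube, each vertex is paired with its flip in coordinate [k], so that every
    coordinate contributes [c / 2]. *)
Lemma assouad K (a : {ffun 'I_K -> bool} -> 'I_K -> \bar R) (B : \bar R) (c : R) :
  (forall w k, 0 <= a w k)%E -> (forall w, \sum_k a w k <= B)%E ->
  (forall w k, c%:E <= a w k + a (flip w k) k)%E -> ((K%:R * c / 2)%:E <= B)%E.
Proof.
move=> a0 aB ac.
have B0 : (0 <= B)%E by apply: le_trans (aB [ffun=> true]); apply: sume_ge0.
have [Bfin|] := boolP (B \is a fin_num); last first.
  by rewrite ge0_fin_numE// -leNgt leye_eq => /eqP ->; rewrite leey.
have afin w k : a w k \is a fin_num.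
  rewrite ge0_fin_numE//; apply: le_lt_trans (_ : (B < +oo)%E); last by rewrite -ge0_fin_numE.
  by apply: le_trans (aB w); rewrite (bigD1 k)//= leeDl// sume_ge0.
pose b w k := fine (a w k).
have ab w k : a w k = (b w k)%:E by rewrite fineK.
rewrite -(fineK Bfin) lee_fin; set b0 := fine B.
have bB w : \sum_k b w k <= b0.
  by rewrite -lee_fin fineK// -sumEFin; under eq_bigr do rewrite -ab; exact: aB.
have bc w k : c <= b w k + b (flip w k) k by rewrite -lee_fin EFinD -!ab; exact: ac.
have h1 : \sum_w \sum_k b w k <= (#|{ffun 'I_K -> bool}|)%:R * b0.
  rewrite mulr_natl -sumr_const; exact: ler_sum.
have h2 k : (#|{ffun 'I_K -> bool}|)%:R * c <= 2 * \sum_w b w k.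
  have -> : 2 * \sum_w b w k = \sum_w (b w k + b (flip w k) k).
    rewrite big_split /= mulr_natl mulr2n; congr (_ + _).
    by rewrite (reindex_inj (inv_inj (flipK k))).
  rewrite mulr_natl -sumr_const; exact: ler_sum.
have h3 : K%:R * ((#|{ffun 'I_K -> bool}|)%:R * c) <= 2 * \sum_w \sum_k b w k.
  rewrite exchange_big /= mulr_sumr -[K in K%:R]card_ord mulr_natl -sumr_const.
  exact: ler_sum.
have N0 : 0 < (#|{ffun 'I_K -> bool}|)%:R :> R by rewrite ltr0n card_ffun card_bool expn_gt0.
rewrite -(ler_pM2l N0); move: h1 h3; lra.
Qed.

End assouad.

(** * Gaussian regression *)

Section density.
Context d (T : measurableType d) (R : realType).
Local Open Scope ereal_scope.

(** The values on measurable sets identify [p] with the Radon-Nikodym derivative almost everywhere,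
    and the change of variables for the derivative then gives the formula. *)
Lemma ge0_integral_density (mu : {sigma_finite_measure set T -> \bar R})
    (nu : {finite_measure set T -> \bar R}) (p : T -> R) :
  measurable_fun setT p -> (forall x, 0 <= p x)%R ->
  (forall A, measurable A -> nu A = \int[mu]_(x in A) (p x)%:E) ->
  forall h : T -> \bar R, measurable_fun setT h -> (forall x, 0 <= h x) ->
  \int[nu]_x h x = \int[mu]_x (h x * (p x)%:E).
Proof.
move=> mp p0 nuE h mh h0.
have numu : nu `<< mu.
  apply/null_content_dominatesP => A mA A0; rewrite nuE//.
  apply: null_set_integral => //; apply/measurable_EFinP; exact: measurable_funTS.
rewrite -(Radon_Nikodym_SigmaFinite.change_of_variables numu)//.
have ip : mu.-integrable setT (EFin \o p).
  apply/integrableP; split; first exact/measurable_EFinP.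
  under eq_integral do rewrite /= ger0_norm//.
  by rewrite -nuE// ltey_eq fin_num_measure.
apply: ae_eq_integral => //.
- apply: emeasurable_funM => //.
  exact: measurable_int (Radon_Nikodym_SigmaFinite.f_integrable numu).
- by apply: emeasurable_funM => //; exact/measurable_EFinP.
have : ae_eq mu setT (Radon_Nikodym_SigmaFinite.f nu mu) (EFin \o p).
  apply: integral_ae_eq => //.
  - exact: Radon_Nikodym_SigmaFinite.f_integrable.
  - by apply/measurable_EFinP.
  - by move=> E _ mE; rewrite -Radon_Nikodym_SigmaFinite.f_integral//= nuE.
by apply: filterS => x /= hx xT; rewrite hx.
Qed.

End density.

Section translation.
Context (R : realType).
Local Notation mu := (@lebesgue_measure R).
Local Open Scope ereal_scope.

Lemma lebesgue_translate (c : R) (A : set (measurableTypeR R)) : measurable A ->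
  mu ((fun x : R => (x + c)%R) @^-1` A) = mu A.
Proof.
move=> mA.
have mf : measurable_fun setT (fun x : measurableTypeR R => (x + c)%R : measurableTypeR R).
  exact: measurable_funD.
apply/esym; apply: (@lebesgue_measure_unique R (pushforward mu (fun x : measurableTypeR R => (x + c)%R : measurableTypeR R)) _ A mA).
move=> X [[a b]] /= _ <-.
rewrite /pushforward.
have -> : (fun x : R => (x + c)%R) @^-1` `]a, b] = `](a - c)%R, (b - c)%R]%classic.
  by apply/seteqP; split => x /=; rewrite !in_itv/= ltrBlDr lerBrDr.
by rewrite !lebesgue_measure_itv/= !lte_fin ltrD2r; case: ifPn => // _; rewrite -!EFinB; congr (_%:E); ring.
Qed.

Lemma ge0_integral_translate (c : R) (h : R -> \bar R) : measurable_fun setT h ->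
  (forall x, 0 <= h x) -> \int[mu]_x h (x + c)%R = \int[mu]_x h x.
Proof.
move=> mh h0.
have mf : measurable_fun setT (fun x : measurableTypeR R => (x + c)%R : measurableTypeR R).
  exact: measurable_funD.
have := @ge0_integral_pushforward _ _ (measurableTypeR R) (measurableTypeR R) R _ mf mu setT h measurableT mh.
rewrite preimage_setT => /(_ (fun x _ => h0 x)) <-.
apply: eq_measure_integral => A mA _.
exact: lebesgue_translate.
Qed.

End translation.

Section gaussian.
Context (R : realType).
Local Notation mu := (@lebesgue_measure R).
Local Notation N01 := (normal_prob (0 : R) 1).
Local Open Scope ereal_scope.

Lemma normal_pdf1E (m x : R) : normal_pdf m 1 x = (normal_peak 1 * expR (- (x - m) ^+ 2 / 2))%R.
Proof. by rewrite /normal_pdf (negbTE (oner_neq0 _)) /normal_fun expr1n. Qed.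

Lemma ge0_integral_normal (h : R -> \bar R) : measurable_fun setT h -> (forall x, 0 <= h x) ->
  \int[N01]_x h x = \int[mu]_x (h x * (normal_pdf 0 1 x)%:E).
Proof.
move=> mh h0; apply: (@ge0_integral_density _ _ R mu N01 (normal_pdf 0 1)) => //.
- exact: measurable_normal_pdf.
- exact: normal_pdf_ge0.
Qed.

(** The Cameron-Martin formula in dimension one. *)
Lemma normal_shift (d : R) (h : R -> \bar R) : measurable_fun setT h -> (forall x, 0 <= h x) ->
  \int[N01]_x h (x + d)%R = \int[N01]_x (h x * (expR (d * x - d ^+ 2 / 2))%:E).
Proof.
move=> mh h0.
have mhd : measurable_fun setT (fun x : R => h (x + d)%R).
  by apply: measurableT_comp => //; exact: measurable_funD.
have me : measurable_fun setT (fun x : R => (expR (d * x - d ^+ 2 / 2))%:E).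
  by apply/measurable_EFinP; apply: measurableT_comp => //; apply: measurable_funB => //; exact: measurable_funM.
rewrite !ge0_integral_normal//; last 2 first.
- exact: emeasurable_funM.
- by move=> x; rewrite mule_ge0// lee_fin expR_ge0.
rewrite -(@ge0_integral_translate R d (fun x => h x * (expR (d * x - d ^+ 2 / 2))%:E * (normal_pdf 0 1 x)%:E)); last 2 first.
- apply: emeasurable_funM; first exact: emeasurable_funM.
  by apply/measurable_EFinP; exact: measurable_normal_pdf.
- by move=> x; rewrite !mule_ge0// lee_fin ?expR_ge0// normal_pdf_ge0.
apply: eq_integral => x _; rewrite -muleA -EFinM; congr (_ * _%:E).
rewrite !normal_pdf1E mulrCA -expRD; congr (_ * expR _)%R.
by field.
Qed.

Lemma normal_exp (c : R) : \int[N01]_x (expR (c * x))%:E = (expR (c ^+ 2 / 2))%:E.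
Proof.
have h := @normal_shift c (cst 1) (measurable_cst _) (fun=> lee01).
have me : measurable_fun setT (fun x : R => (expR (c * x - c ^+ 2 / 2))%:E).
  by apply/measurable_EFinP; apply: measurableT_comp => //; apply: measurable_funB => //; exact: measurable_funM.
transitivity (\int[N01]_x ((expR (c ^+ 2 / 2))%:E * (expR (c * x - c ^+ 2 / 2))%:E)).
  by apply: eq_integral => x _; rewrite -EFinM -expRD; congr (expR _)%:E; ring.
rewrite ge0_integralZl//.
have <- : \int[N01]_x cst 1 (x + c)%R = \int[N01]_x (expR (c * x - c ^+ 2 / 2))%:E.
  by rewrite h; apply: eq_integral => x _; rewrite mul1e.
by rewrite int_prob_cst mule1.
Qed.

Lemma normal_exp_abs (c : R) : (0 <= c)%R ->
  \int[N01]_x (expR (c * `|x|))%:E <= (2 * expR (c ^+ 2 / 2))%:E.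
Proof.
move=> c0.
have me (a : R) : measurable_fun setT (fun x : R => expR (a * x)).
  by apply: measurableT_comp => //; exact: measurable_funM.
have mabs : measurable_fun setT (fun x : R => expR (c * `|x|)).
  by apply: measurableT_comp => //; apply: measurable_funM => //; exact: measurableT_comp.
have pw (x : R) : (expR (c * `|x|) <= expR (c * x) + expR (- c * x))%R.
  have [h|h] := leP 0%R x; first by rewrite ger0_norm// lerDl expR_ge0.
  by rewrite ltr0_norm// mulrN mulNr lerDr expR_ge0.
apply: (@le_trans _ _ (\int[N01]_x (expR (c * x) + expR (- c * x))%:E)).
  apply: ge0_le_integral => //.
  - by apply/measurable_EFinP.
  - by apply/measurable_EFinP; apply: measurable_funD; exact: me.
  - by move=> x _; rewrite lee_fin; exact: pw.
have /= -> := int_realD N01 (me c) (me (- c)%R) (fun x => expR_ge0 _) (fun x => expR_ge0 _).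
by rewrite !normal_exp sqrrN -EFinD lee_fin -mulr2n mulr_natl.
Qed.

End gaussian.

Section regression_law.
Context (R : realType).
Local Notation N01 := (normal_prob (0 : R) 1).
Local Notation U01 := (uniform_prob (@ltr01 R)).
Local Open Scope ereal_scope.

Lemma measurable_obs_fun (f : {mfun R >-> R}) (g : R * R -> \bar R) : measurable_fun setT g ->
  measurable_fun setT (fun u : measurableTypeR R * measurableTypeR R => g (observe f u)).
Proof. move=> mg; apply: (measurableT_comp mg); exact: measurable_observe. Qed.

Lemma integral_P_ (f : {mfun R >-> R}) (g : R * R -> \bar R) : measurable_fun setT g ->
  (forall z, 0 <= g z) ->
  \int[P_ f]_z g z = \int[U01]_x \int[N01]_xi g (f x + xi, x)%R.
Proof.
move=> mg g0; rewrite /P_ ge0_integral_distribution//.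
have mo := measurable_obs_fun f mg.
by rewrite (fubini_tonelli1 _ mo)// => z; exact: g0.
Qed.

Lemma measurable_noise (f : {mfun R >-> R}) (g : R * R -> \bar R) : measurable_fun setT g ->
  (forall z, 0 <= g z) ->
  measurable_fun setT (fun x : R => \int[N01]_xi g (f x + xi, x)%R).
Proof.
move=> mg g0.
exact: (@measurable_fun_fubini_tonelli_F _ _ (measurableTypeR R) (measurableTypeR R) R N01 _ (measurable_obs_fun f mg) (fun z => g0 _)).
Qed.

(** The likelihood ratio of one observation; the law of the covariate is common to both hypotheses
    and cancels. *)
Definition gauss_lik (f0 f1 : R -> R) (z : R * R) : R :=
  expR ((f1 z.2 - f0 z.2) * (z.1 - f0 z.2) - (f1 z.2 - f0 z.2) ^+ 2 / 2).

Lemma measurable_gauss_lik (f0 f1 : {mfun R >-> R}) : measurable_fun setT (gauss_lik f0 f1).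
Proof.
have m0 : measurable_fun setT (fun z : R * R => f0 z.2) by exact: measurableT_comp.
have m1 : measurable_fun setT (fun z : R * R => f1 z.2) by exact: measurableT_comp.
have mB : measurable_fun setT (fun z : R * R => f1 z.2 - f0 z.2)%R by exact: measurable_funB.
apply: measurableT_comp => //; apply: measurable_funB.
  by apply: measurable_funM => //; exact: measurable_funB.
by apply: measurable_funM => //; exact: measurable_funX.
Qed.

Lemma gauss_lik_density (f0 f1 : {mfun R >-> R}) (g : R * R -> \bar R) : measurable_fun setT g ->
  (forall z, 0 <= g z) ->
  \int[P_ f1]_z g z = \int[P_ f0]_z (g z * (gauss_lik f0 f1 z)%:E).
Proof.
move=> mg g0.
have mL := measurable_gauss_lik f0 f1.
have mgL : measurable_fun setT (fun z => g z * (gauss_lik f0 f1 z)%:E).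
  by apply: emeasurable_funM => //; exact/measurable_EFinP.
have gL0 z : 0 <= g z * (gauss_lik f0 f1 z)%:E by rewrite mule_ge0// lee_fin expR_ge0.
apply: (etrans (integral_P_ f1 mg g0)); apply/esym; apply: (etrans (integral_P_ f0 mgL gL0)); apply/esym.
apply: eq_integral => x _.
have mgx : measurable_fun setT (fun xi : R => g (f0 x + xi, x)%R).
  apply: measurableT_comp mg _; apply/measurable_fun_pairP; split => /=; last exact: measurable_cst.
  exact: measurable_funD.
have := @normal_shift R (f1 x - f0 x)%R _ mgx (fun=> g0 _).
have -> : \int[N01]_x0 g (f0 x + (x0 + (f1 x - f0 x)), x)%R = \int[N01]_xi g (f1 x + xi, x)%R.
  by apply: eq_integral => y _; congr (g (_, _)); ring.
move=> ->; apply: eq_integral => y _; rewrite /gauss_lik /=; congr (_ * (expR _)%:E).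
by ring.
Qed.

End regression_law.

Section likelihood_deviation.
Context (R : realType).
Local Notation N01 := (normal_prob (0 : R) 1).
Local Open Scope ereal_scope.

Lemma abs_expR_sub1 (t : R) : (`|expR t - 1| <= `|t| * expR `|t|)%R.
Proof.
have [t0|t0] := leP 0%R t.
  rewrite (ger0_norm t0) ger0_norm; last by rewrite subr_ge0 -expR0 ler_expR.
  have := expR_ge1Dx (- t); rewrite -(ler_pM2r (expR_gt0 t)) expRN mulVf ?gt_eqF ?expR_gt0//.
  by lra.
rewrite (ltr0_norm t0) ler0_norm; last by rewrite subr_le0 -expR0 ler_expR ltW.
have := expR_ge1Dx t.
have : (- t * 1 <= - t * expR (- t))%R by rewrite ler_wpM2l ?oppr_ge0 ?(ltW t0)// -expR0 ler_expR oppr_ge0 ltW.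
by lra.
Qed.

Lemma pow_le_expR (j : nat) (x : R) : (0 <= x -> x ^+ j <= j`!%:R * expR x)%R.
Proof.
move=> x0; case: j => [|j].
  by rewrite expr0 fact0 mul1r -expR0 ler_expR.
have fj : (0 < j.+1`!%:R :> R)%R by rewrite ltr0n fact_gt0.
rewrite mulrC -ler_pdivrMr//; apply: le_trans (expR_ge1Dxn j x0).
by rewrite lerDr.
Qed.

(** With [t] the exponent, [|exp t - 1|] is at most [|t| exp |t|] and [|t|] at most [|d| (|x| + 1)].
    The power of [|d|] factors out, and what is left grows exponentially in [|x|], which the normal
    law integrates. *)
Lemma normal_lik_moment (j : nat) : exists2 C : R, (0 < C)%R & forall d : R, (`|d| <= 1)%R ->
  \int[N01]_x (`|expR (d * x - d ^+ 2 / 2) - 1| ^+ j)%:E <= (C * `|d| ^+ j)%:E.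
Proof.
(* One unit of the rate dominates the polynomial [(|x| + 1) ^ j]; the other [j] come from the power
   of [exp |t|]. *)
pose c : R := (j.+1)%:R.
exists (j`!%:R * expR c * (2 * expR (c ^+ 2 / 2)))%R.
  by rewrite !mulr_gt0// ?expR_gt0// ltr0n fact_gt0.
move=> d d1.
have c0 : (0 <= c)%R by rewrite ler0n.
have me : measurable_fun setT (fun x : R => expR (c * `|x|)).
  by apply: measurableT_comp => //; apply: measurable_funM => //; exact: measurableT_comp.
have ml : measurable_fun setT (fun x : R => `|expR (d * x - d ^+ 2 / 2) - 1| ^+ j)%R.
  apply: measurable_funX; apply: measurableT_comp => //; apply: measurable_funB => //.
  by apply: measurableT_comp => //; apply: measurable_funB => //; exact: measurable_funM.
have A0 : (0 <= `|d| ^+ j * (j`!%:R * expR c))%R by rewrite !mulr_ge0// ?exprn_ge0// expR_ge0.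
have pw (x : R) : (`|expR (d * x - d ^+ 2 / 2) - 1| ^+ j <= `|d| ^+ j * (j`!%:R * expR c) * expR (c * `|x|))%R.
  set t := (d * x - d ^+ 2 / 2)%R.
  have tle : (`|t| <= `|d| * (`|x| + 1))%R.
    apply: le_trans (ler_normB _ _) _; rewrite mulrDr mulr1 normrM lerD2l.
    rewrite normrM normrX (ger0_norm (_ : 0 <= 2^-1)%R) ?invr_ge0// expr2 -mulrA.
    have : (`|d| * `|d| <= `|d|)%R by rewrite ler_piMr.
    have : (0 <= `|d| * `|d|)%R by rewrite mulr_ge0.
    lra.
  have x1 : (0 <= `|x| + 1)%R by rewrite addr_ge0.
  have tle' : (`|t| <= `|x| + 1)%R by apply: le_trans tle _; rewrite ler_piMl.
  apply: (@le_trans _ _ ((`|d| * (`|x| + 1) * expR (`|x| + 1)) ^+ j)%R).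
    apply: lerXn2r; rewrite ?nnegrE ?mulr_ge0 ?expR_ge0//.
    apply: le_trans (abs_expR_sub1 t) _.
    by apply: ler_pM => //; rewrite ?expR_ge0// ler_expR.
  rewrite !exprMn -mulrA -[leRHS]mulrA ler_wpM2l ?exprn_ge0//.
  apply: (@le_trans _ _ (j`!%:R * expR (`|x| + 1) * expR (`|x| + 1) ^+ j)%R).
    by rewrite ler_wpM2r ?exprn_ge0 ?expR_ge0// pow_le_expR.
  rewrite -!mulrA ler_wpM2l// -exprS -expRM_natl -/c -expRD -/c ler_expR mulrDr mulr1 addrC lerD2l.
  by [].
apply: (@le_trans _ _ (\int[N01]_x (`|d| ^+ j * (j`!%:R * expR c) * expR (c * `|x|))%:E)).
  apply: ge0_le_integral => //.
  - exact/measurable_EFinP.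
  - by apply/measurable_EFinP; exact: measurable_funM.
  - by move=> x _; rewrite lee_fin; exact: pw.
rewrite int_realZ//.
apply: (@le_trans _ _ ((`|d| ^+ j * (j`!%:R * expR c))%:E * (2 * expR (c ^+ 2 / 2))%:E)).
  by apply: lee_wpmul2l; [rewrite lee_fin | exact: normal_exp_abs].
by rewrite -EFinM lee_fin le_eqVlt; apply/orP; left; apply/eqP; ring.
Qed.

(** The exponent is positive, so that covariates outside [B], where the likelihood ratio is one,
    contribute nothing; this yields the factor [w]. *)
Lemma gauss_lik_moment (j : nat) : exists2 C : R, (0 < C)%R &
  forall (f0 f1 : {mfun R >-> R}) (h w : R) (B : set R), (0 <= h <= 1)%R ->
  measurable B -> lebesgue_measure B <= w%:E ->
  (forall x, `|f1 x - f0 x| <= h)%R -> (forall x, ~ B x -> f1 x = f0 x) ->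
  \int[P_ f0]_z (`|gauss_lik f0 f1 z - 1| ^+ j.+1)%:E <= (C * h ^+ j.+1 * w)%:E.
Proof.
have [C C0 HC] := normal_lik_moment j.+1.
exists C => // f0 f1 h w B /andP[h0 h1] mB Bw fh fB.
have C0' := ltW C0.
have mL := measurable_gauss_lik f0 f1.
have mLj : measurable_fun setT (fun z => (`|gauss_lik f0 f1 z - 1| ^+ j.+1)%:E).
  apply/measurable_EFinP; apply: measurable_funX; apply: measurableT_comp => //.
  exact: measurable_funB.
have L0 z : 0 <= (`|gauss_lik f0 f1 z - 1| ^+ j.+1)%:E by rewrite lee_fin exprn_ge0.
rewrite (integral_P_ f0 mLj L0).
have Ch : (0 <= C * h ^+ j.+1)%R by rewrite mulr_ge0// exprn_ge0.
apply: (@le_trans _ _ (\int[uniform_prob (@ltr01 R)]_x ((C * h ^+ j.+1)%:E * (\1_B x)%:E))).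
  apply: ge0_le_integral => //.
  - by move=> x _; apply: integral_ge0 => y _; rewrite lee_fin exprn_ge0.
  - by apply: (measurable_noise f0 mLj) => z; rewrite lee_fin exprn_ge0.
  - apply: emeasurable_funM => //; exact/measurable_EFinP/measurable_indic.
  - move=> x _.
    have dh1 : (`|f1 x - f0 x| <= 1)%R by exact: le_trans h1.
    have e : \int[N01]_xi (`|gauss_lik f0 f1 (f0 x + xi, x) - 1| ^+ j.+1)%:E =
      \int[N01]_y (`|expR ((f1 x - f0 x) * y - (f1 x - f0 x) ^+ 2 / 2) - 1| ^+ j.+1)%:E.
      apply: eq_integral => y _; rewrite /gauss_lik /=; congr ((`|expR _ - 1| ^+ _)%:E).
      by ring.
    rewrite e; apply: le_trans (HC _ dh1) _; rewrite -EFinM lee_fin indicE.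
    have [xB|xB] := boolP (x \in B).
      by rewrite mulr1; apply: (ler_wpM2l C0'); apply: lerXn2r (fh x); rewrite nnegrE.
    have -> : f1 x = f0 x by apply: fB => /mem_set; exact/negP.
    by rewrite subrr normr0 expr0n !mulr0.
rewrite ge0_integralZl//; last first.
  exact/measurable_EFinP/measurable_indic.
rewrite [leRHS]EFinM; apply: (@lee_wpmul2l _ (C * h ^+ j.+1)%:E); first by rewrite lee_fin.
rewrite integral_uniform//; last first.
  exact/measurable_EFinP/measurable_indic.
rewrite subr0 invr1 mul1e integral_indic//.
by apply: le_trans Bw; apply: le_measure; rewrite ?inE//; exact: measurableI.
Qed.

End likelihood_deviation.

(** * Wavelets *)

Section unit_interval.
Context {R : realType}.
Local Notation mu := (@lebesgue_measure R).
Local Notation I01 := (`[0%R, 1%R]%classic : set R).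

Lemma mI01 : measurable (I01 : set (measurableTypeR R)).
Proof. exact: measurable_itv. Qed.

Lemma mu_I01 : mu I01 = 1%E.
Proof. by rewrite lebesgue_measure_itv/= lte_fin ltr01 oppr0 adde0. Qed.

(** Bounded and measurable on the unit interval: a class closed under the algebraic operations, in
    which integrability is automatic. *)
Definition bi (f : R -> R) := measurable_fun I01 f /\ exists M, forall x, 0 <= x <= 1 -> `|f x| <= M.

Lemma in_I01 x : I01 x <-> 0 <= x <= 1.
Proof. by rewrite /= in_itv/=. Qed.

Lemma bi_integrable f : bi f -> mu.-integrable I01 (EFin \o f).
Proof.
move=> [mf [M hM]]; apply: measurable_bounded_integrable => //.
- by have h := mu_I01; rewrite [X in (X < _)%E](_ : _ = 1%E) ?ltry//; exact: h.
- exists M; split; first exact: num_real.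
  move=> y My x /in_I01 x01; exact: le_trans (hM x x01) (ltW My).
Qed.

Lemma bi_cst c : bi (cst c).
Proof. by split => //; exists `|c|. Qed.

Lemma biD f g : bi f -> bi g -> bi (fun x => f x + g x).
Proof.
move=> [mf [M hM]] [mg [N hN]]; split; first exact: measurable_funD.
exists (M + N) => x x01; apply: le_trans (ler_normD _ _) _; exact: lerD (hM _ x01) (hN _ x01).
Qed.

Lemma biN f : bi f -> bi (fun x => - f x).
Proof.
move=> [mf [M hM]]; split; first exact: measurableT_comp.
by exists M => x x01; rewrite normrN; exact: hM.
Qed.

Lemma biM f g : bi f -> bi g -> bi (fun x => f x * g x).
Proof.
move=> [mf [M hM]] [mg [N hN]]; split; first exact: measurable_funM.
exists (M * N) => x x01; rewrite normrM; exact: ler_pM (hM _ x01) (hN _ x01).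
Qed.

Lemma bi_norm f : bi f -> bi (fun x => `|f x|).
Proof.
move=> [mf [M hM]]; split; first exact: measurableT_comp.
by exists M => x x01; rewrite normr_id; exact: hM.
Qed.

Lemma biX f n : bi f -> bi (fun x => f x ^+ n).
Proof.
move=> bf; elim: n => [|n IH].
  by under eq_fun do rewrite expr0; exact: bi_cst.
by under eq_fun do rewrite exprS; exact: biM.
Qed.

Lemma bi_sum (I : Type) (r : seq I) (F : I -> R -> R) : (forall i, bi (F i)) ->
  bi (fun x => \sum_(i <- r) F i x).
Proof.
move=> bF; elim: r => [|i r IH].
  by under eq_fun do rewrite big_nil; exact: bi_cst.
by under eq_fun do rewrite big_cons; exact: biD.
Qed.

Lemma bi_continuous f : continuous f -> bi f.
Proof.
move=> cf; split.
  by apply: measurable_funTS; exact: continuous_measurable_fun.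
have [|c c01 cM] := @EVT_max R (fun x => `|f x|) 0 1 ler01.
  apply: continuous_subspaceT => x.
  by apply: continuous_comp; [exact: cf | exact: norm_continuous].
by exists `|f c| => x x01; apply: cM; rewrite in_itv.
Qed.

Lemma bi_eq f g : (forall x, 0 <= x <= 1 -> f x = g x) -> bi f -> bi g.
Proof.
move=> fg [mf [M hM]]; split; last by exists M => x x01; rewrite -fg// hM.
by apply: eq_measurable_fun mf => x; rewrite inE => /in_I01 /fg.
Qed.

Definition Int01 (f : R -> R) : R := \int[mu]_(x in `[0, 1]) f x.

Lemma Int01D f g : bi f -> bi g -> Int01 (fun x => f x + g x) = Int01 f + Int01 g.
Proof. by move=> bf bg; apply: RintegralD => //; exact: bi_integrable. Qed.

Lemma Int01Z c f : bi f -> Int01 (fun x => c * f x) = c * Int01 f.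
Proof. by move=> bf; apply: RintegralZl => //; exact: bi_integrable. Qed.

Lemma Int01_sum (I : Type) (r : seq I) (F : I -> R -> R) : (forall i, bi (F i)) ->
  Int01 (fun x => \sum_(i <- r) F i x) = \sum_(i <- r) Int01 (F i).
Proof.
move=> bF; elim: r => [|i r IH].
  rewrite big_nil; under eq_fun do rewrite big_nil.
  by rewrite /Int01 Rintegral_cst//= mul0r.
rewrite big_cons -IH -Int01D//; last exact: bi_sum.
by congr Int01; apply/funext => x; rewrite big_cons.
Qed.

Lemma Int01_le f g : bi f -> bi g -> (forall x, 0 <= x <= 1 -> f x <= g x) -> Int01 f <= Int01 g.
Proof.
move=> bf bg fg; by apply: le_Rintegral => //; try exact: bi_integrable; move=> x /in_I01; exact: fg.
Qed.

Lemma Int01_cst c : Int01 (cst c) = c.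
Proof. by rewrite /Int01 Rintegral_cst//= mu_I01 mulr1. Qed.

Lemma Int01_eq f g : (forall x, 0 <= x <= 1 -> f x = g x) -> Int01 f = Int01 g.
Proof. by move=> fg; apply: eq_Rintegral => x; rewrite inE => /in_I01 /fg. Qed.

Lemma Int01_abs f : bi f -> `|Int01 f| <= Int01 (fun x => `|f x|).
Proof. by move=> bf; apply: le_normr_Rintegral => //; exact: bi_integrable. Qed.

Lemma Int01E f : bi f -> (\int[mu]_(x in `[0%R, 1%R]) (f x)%:E)%E = (Int01 f)%:E.
Proof.
move=> bf; rewrite /Int01 /Rintegral fineK//.
exact: (@integrable_fin_num _ _ _ mu _ mI01 _ (bi_integrable bf)).
Qed.

Lemma l2_integrable (f : {mfun R >-> R}) : square_integrable f ->
  mu.-integrable I01 (EFin \o f) /\ mu.-integrable I01 (EFin \o (fun x => f x ^+ 2)).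
Proof.
move=> f2; have mf : measurable_fun setT (f : R -> R) by exact: measurable_funPT.
have i2 : mu.-integrable I01 (EFin \o (fun x => f x ^+ 2)).
  apply/integrableP; split.
    by apply/measurable_EFinP; apply: measurable_funX; exact: measurable_funTS.
  under eq_integral do rewrite /= ger0_norm ?sqr_ge0//.
  exact: f2.
split => //.
apply: (@le_integrable _ _ _ mu _ mI01 _ (EFin \o (fun x => 1 + f x ^+ 2))).
- by apply/measurable_EFinP; exact: measurable_funTS.
- move=> x _ /=; rewrite lee_fin.
  rewrite [X in _ <= X]ger0_norm; last by rewrite addr_ge0// sqr_ge0.
  have := sqr_ge0 (`|f x| - 1); rewrite sqrrB expr1n mulr1 real_normK ?num_real//.
  by have := normr_ge0 (f x); lra.
- rewrite (_ : _ \o _ = (EFin \o cst 1%R) \+ (EFin \o (fun x => f x ^+ 2)%R))%E; last first.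
    by apply/funext.
  by apply: integrableD => //; exact: (bi_integrable (bi_cst 1)).
Qed.

Lemma integrable_biM f g : measurable_fun I01 f -> mu.-integrable I01 (EFin \o f) -> bi g ->
  mu.-integrable I01 (EFin \o (fun x => f x * g x)).
Proof.
move=> mf jf [mg [M hM]].
apply: (@le_integrable _ _ _ mu _ mI01 _ (fun x => `|M|%:E * (f x)%:E)%E).
- by apply/measurable_EFinP; exact: measurable_funM.
- move=> x /in_I01 x01 /=; rewrite lee_fin !normrM normr_id mulrC ler_wpM2r//.
  by apply: le_trans (hM x x01) _; exact: ler_norm.
- exact: integrableZl.
Qed.

End unit_interval.

Section compact_support.
Context {R : realType}.

Lemma bounded_of_support (g : R -> R) (a b : R) : a <= b -> continuous g ->
  (forall x, ~~ (a <= x <= b) -> g x = 0) -> exists2 M, 0 <= M & forall x, `|g x| <= M.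
Proof.
move=> ab cg g0.
have [|c cab cM] := @EVT_max R (fun x => `|g x|) a b ab.
  apply: continuous_subspaceT => x.
  by apply: continuous_comp; [exact: cg | exact: norm_continuous].
exists `|g c| => // x; have [xab|xab] := boolP (a <= x <= b); first by apply: cM; rewrite in_itv.
by rewrite g0// normr0.
Qed.

Lemma sum_window (n a c : nat) : (\sum_(k < n) ((a <= k) && (k < a + c)) <= c)%N.
Proof.
rewrite -(big_mkord xpredT (fun k => nat_of_bool ((a <= k) && (k < a + c)))%N).
rewrite -[X in (_ <= X)%N](size_iota a).
have -> : (\sum_(0 <= k < n) ((a <= k) && (k < a + c)) = size [seq k <- index_iota 0 n | (a <= k) && (k < a + c)])%N.
  by rewrite size_filter -sum1_count [RHS]big_mkcond; apply: eq_bigr => k _; case: ifP => // ->.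
apply: uniq_leq_size; first by rewrite filter_uniq// iota_uniq.
by move=> k; rewrite mem_filter mem_iota => /andP[].
Qed.

(** The support has length less than [2 S], so the translates that meet [y] have their indices in a
    window of length [2 S] starting at the least of them. *)
Lemma sum_translates (g : R -> R) (S n : nat) (M y : R) :
  0 <= M -> (forall x, `|g x| <= M) -> (forall x, ~~ (1 - S%:R <= x <= S%:R) -> g x = 0) ->
  \sum_(k < n) `|g (y - k%:R)| <= (2 * S)%:R * M.
Proof.
move=> M0 gM g0.
pose P (k : nat) := (1 - S%:R <= y - k%:R <= S%:R).
have [/existsP[i Pi]|/existsPn h] := boolP [exists k : 'I_n, P k]; last first.
  rewrite big1 ?mulr_ge0// => k _.
  by rewrite g0 ?normr0//; exact: h.
have ex : exists k, P k by exists i.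
pose a := ex_minn ex.
have Pa : P a by rewrite /a; case: ex_minnP.
have amin k : P k -> (a <= k)%N by rewrite /a; case: ex_minnP => m _ h /h.
apply: (@le_trans _ _ (\sum_(k < n) (((a <= k) && (k < a + 2 * S))%N)%:R * M)).
  apply: ler_sum => k _; have [Pk|Pk] := boolP (P k); last first.
    by rewrite g0 ?normr0 ?mulr_ge0.
  rewrite (amin _ Pk)/= (_ : (k < a + 2 * S)%N) ?mul1r//.
  rewrite -(ltr_nat R) natrD natrM; move: Pk Pa; rewrite /P => /andP[p _] /andP[_ q]; lra.
rewrite -mulr_suml -natr_sum ler_wpM2r// ler_nat; exact: sum_window.
Qed.

Lemma finite_bound (n : nat) (P : nat -> R -> Prop) :
  (forall k M N, M <= N -> P k M -> P k N) ->
  (forall k, (k < n)%N -> exists M, P k M) -> exists2 M, 0 <= M & forall k, (k < n)%N -> P k M.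
Proof.
move=> mon; elim: n => [|n IH] h; first by exists 0.
have [M M0 hM] := IH (fun k kn => h k (ltnW kn)).
have [N hN] := h n (ltnSn n).
exists (Num.max M N); first by rewrite le_max M0.
move=> k; rewrite ltnS leq_eqVlt => /orP[/eqP ->|kn].
  by apply: mon hN; rewrite le_max lexx orbT.
by apply: mon (hM k kn); rewrite le_max lexx.
Qed.

End compact_support.

Section cdv_bounds.
Context {R : realType} (W : cdv_system R) (A l0 : nat).
Hypothesis A0 : (0 < A)%N.
Hypothesis hW : cdv_basis W A l0.
Local Notation S := (cdv_S W).
Local Notation sq l := (2 `^ (l%:R / 2) : R).

Lemma S_gt0 : (0 < S)%N.
Proof. by case: hW => [[[[AS _] _ _ _ _] _] _ _ _ _]; exact: leq_trans AS. Qed.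

Lemma S_le : (2 * S <= 2 ^ l0.+1)%N.
Proof. by case: hW => [[_ h]]. Qed.

Lemma phi_support x : ~~ (1 - S%:R <= x <= S%:R) -> phi W x = 0.
Proof. by case: hW => [[[_ h _ _ _] _] _ _ _ _]; exact: h. Qed.

Lemma continuous_phi : continuous (phi W).
Proof.
case: hW => [[[[_ [h _]] _ _ _ _] _] _ _ _ _] x.
by apply: differentiable_continuous; apply/derivable1_diffP; exact: (h 0%N x A0).
Qed.

Lemma psiE x : psi W x = Num.sqrt 2 *
   \sum_(i < 2 * S) (-1) ^+ (i + S.+1) * taps W (2 * S - i.+1) * phi W (2 * x - i%:R + S%:R - 1).
Proof. by case: hW => [[[_ _ _ [_ h] _] _] _ _ _ _]; exact: h. Qed.

Lemma psi_support x : ~~ (1 - S%:R <= x <= S%:R) -> psi W x = 0.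
Proof.
move=> hx; rewrite psiE big1 ?mulr0// => i _.
rewrite phi_support ?mulr0//; apply: contra hx => /andP[a b].
have iS : (i%:R : R) <= 2 * S%:R - 1.
  by have := ltn_ord i; rewrite -(ler_nat R) natrM -natr1; lra.
have i0 : 0 <= (i%:R : R) by [].
apply/andP; split; lra.
Qed.

Lemma continuous_affine (g : R -> R) (a b : R) : continuous g -> continuous (fun x => g (a * x + b)).
Proof.
move=> cg x; apply: (@continuous_comp _ _ _ (fun x => a * x + b) g); last exact: cg.
apply: continuousD; last exact: cst_continuous.
by apply: continuousM; [exact: cst_continuous | exact: id].
Qed.

Lemma continuous_sumR (I : Type) (r : seq I) (F : I -> R -> R) : (forall i, continuous (F i)) ->
  continuous (fun x => \sum_(i <- r) F i x).
Proof.
move=> cF; elim: r => [|i r IH] x.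
  by under eq_fun do rewrite big_nil; exact: cst_continuous.
under eq_fun do rewrite big_cons.
by apply: continuousD; [exact: cF | exact: IH].
Qed.

Lemma continuousZR (c : R) (g : R -> R) : continuous g -> continuous (fun x => c * g x).
Proof. by move=> cg x; apply: continuousM; [exact: cst_continuous | exact: cg]. Qed.

Lemma continuous_psi : continuous (psi W).
Proof.
have -> : psi W = fun x => Num.sqrt 2 * \sum_(i < 2 * S) ((-1) ^+ (i + S.+1) * taps W (2 * S - i.+1)) * phi W (2 * x + (- i%:R + S%:R - 1)).
  by apply/funext => x; rewrite psiE; congr (_ * _); apply: eq_bigr => i _; rewrite !addrA.
apply: continuousZR; apply: continuous_sumR => i; apply: continuousZR.
apply: continuous_affine; exact: continuous_phi.
Qed.

Let S1 : 1 - S%:R <= S%:R :> R.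
Proof. by have := S_gt0; rewrite -(ler_nat R); lra. Qed.

Lemma phi_bounded : exists2 M, 0 <= M & forall x, `|phi W x| <= M.
Proof. exact: bounded_of_support S1 continuous_phi phi_support. Qed.

Lemma psi_bounded : exists2 M, 0 <= M & forall x, `|psi W x| <= M.
Proof. exact: bounded_of_support S1 continuous_psi psi_support. Qed.

Lemma continuous_edge (g : R -> R) a k : continuous g -> continuous (edge_scaling S a g k).
Proof.
move=> cg; apply: continuous_sumR => r; apply: continuousZR; apply: continuous_sumR => n.
apply: continuousZR.
rewrite (_ : (fun x => _) = (fun x => g (1 * x + (n%:R - S%:R + 1)))).
  exact: continuous_affine.
by apply/funext => x; rewrite mul1r !addrA.
Qed.

Lemma continuous_father j k : continuous (father W j k).
Proof.
rewrite /father /at_level; case: (k < S)%N; [|case: (k < 2 ^ j - S)%N]; apply: continuousZR.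
  rewrite (_ : (fun x => _) = (fun x => edge_scaling S (edgeL W) (phi W) k (2 ^+ j * x + 0))).
    by apply: continuous_affine; apply: continuous_edge; exact: continuous_phi.
  by apply/funext => x; rewrite addr0.
- by apply: continuous_affine; exact: continuous_phi.
- rewrite (_ : (fun x => _) = (fun x => edge_scaling S (edgeR W) (fun t => phi W (1 - t)) (2 ^ j - k.+1)%N (- 2 ^+ j * x + 2 ^+ j))).
  apply: continuous_affine; apply: continuous_edge.
  rewrite (_ : (fun t => _) = (fun t => phi W ((-1) * t + 1))); first by apply: continuous_affine; exact: continuous_phi.
  by apply/funext => t; congr (phi W _); ring.
by apply/funext => x; congr (edge_scaling _ _ _ _ _); ring.
Qed.

(* The mother wavelets are combinations of father wavelets, and [phi] is continuous. *)
Lemma wavelet_continuous l k : (l0 <= l)%N -> (k < nwav l0 l)%N ->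
  exists2 g : R -> R, continuous g & forall x, 0 <= x <= 1 -> wavelet W l0 l k x = g x.
Proof.
rewrite /wavelet /nwav; case: eqP => [->|/eqP ne] l0l kn.
  by exists (father W l0.+1 k) => //; exact: continuous_father.
have ll : (l0 < l)%N by rewrite ltn_neqAle eq_sym ne.
case: hW => [_ _ h _ _]; have [c hc] := h l k ll kn.
exists (fun x => \sum_(i < 2 ^ l.+1) c i * father W l.+1 i x) => //.
by apply: continuous_sumR => i; apply: continuousZR; exact: continuous_father.
Qed.

Lemma bi_wavelet l k : (l0 <= l)%N -> (k < nwav l0 l)%N -> bi (wavelet W l0 l k).
Proof.
move=> l0l kn; have [g cg gE] := wavelet_continuous l0l kn.
by apply: bi_eq (bi_continuous cg) => x x01; rewrite gE.
Qed.

(** The rescaling that reads a boundary function off the mother wavelets of level [j]; on the right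
    both the index and the variable run backwards. *)
Lemma mother_edges j k (y : R) : (l0 < j)%N -> (k < S)%N -> 0 <= y <= 2 ^+ j ->
  mother W j k (y / 2 ^+ j) = sq j * psiL W k y /\
  mother W j (2 ^ j - k.+1) (1 - y / 2 ^+ j) = sq j * psiR W k y.
Proof.
move=> lj kS /andP[y0 y1].
have SS : (2 * S <= 2 ^ j)%N.
  by apply: leq_trans S_le _; rewrite leq_exp2l.
have p0 : (2 ^+ j : R) != 0 by rewrite expf_neq0.
rewrite /mother /at_level kS; split; first by rewrite [2 ^+ j * _]mulrC divfK.
have -> : (2 ^ j - k.+1 < S)%N = false by apply/negbTE; rewrite -leqNgt; lia.
have -> : (2 ^ j - k.+1 < 2 ^ j - S)%N = false by apply/negbTE; rewrite -leqNgt; lia.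
have -> : (2 ^ j - (2 ^ j - k.+1).+1 = k)%N by lia.
by congr (_ * psiR _ _ _); rewrite opprB addrC subrK [2 ^+ j * _]mulrC divfK.
Qed.

Lemma sq_gt0 l : 0 < sq l.
Proof. exact: powR_gt0. Qed.

Lemma sq_ge1 l : 1 <= sq l.
Proof. by rewrite -[X in X <= _](powRr0 2) ler_powR ?ler1n// divr_ge0. Qed.

(** Beyond [B] the boundary functions vanish. Arguments up to [B] fit into [[0, 2 ^ J]] for a large
    level [J], where the values are those of a mother wavelet of level [J], bounded on the unit
    interval. *)
Lemma edge_bounded : exists2 M, 0 <= M & forall k y, (k < S)%N -> 0 <= y ->
  `|psiL W k y| <= M /\ `|psiR W k y| <= M.
Proof.
case: hW => [_ [B hB] _ _ _].
have [N BN] : exists N : nat, B < N%:R by exists (Num.bound `|B|); apply: le_lt_trans (ler_norm _) _; exact: archi_boundP.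
pose J := maxn l0.+1 N.
have lJ : (l0 < J)%N by rewrite leq_max leqnn.
have BJ : B < 2 ^+ J.
  apply: lt_le_trans BN _; rewrite -natrX ler_nat.
  by apply: leq_trans (leq_maxr l0.+1 N) _; apply: ltnW; exact: ltn_expl.
have [M M0 hM] : exists2 M, 0 <= M & forall k, (k < 2 ^ J)%N -> forall x, 0 <= x <= 1 -> `|mother W J k x| <= M.
  apply: finite_bound => [k M N' MN h x x01|k kJ]; first exact: le_trans (h x x01) MN.
  have := @bi_wavelet J k (ltnW lJ); rewrite /nwav /wavelet gtn_eqF// => /(_ kJ)[_ [M hM]].
  by exists M.
exists M => // k y kS y0.
have [yB|yB] := ltP B y; first by have [-> ->] := hB k y kS yB; rewrite normr0.
have yJ : 0 <= y <= 2 ^+ J by rewrite y0/=; exact: le_trans (ltW BJ).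
have [eL eR] := mother_edges lJ kS yJ.
have SJ : (2 * S <= 2 ^ J)%N.
  by apply: leq_trans S_le _; rewrite leq_exp2l.
have x01 : 0 <= y / 2 ^+ J <= 1.
  by rewrite divr_ge0 ?exprn_ge0//= ler_pdivrMr ?exprn_gt0// mul1r; case/andP: yJ.
have x01' : 0 <= 1 - y / 2 ^+ J <= 1 by move: x01 => /andP[? ?]; apply/andP; split; lra.
have key u v : `|u| <= M -> u = sq J * v -> `|v| <= M.
  move=> uM uE; apply: le_trans uM; rewrite uE normrM (gtr0_norm (sq_gt0 J)).
  by rewrite ler_peMl// sq_ge1.
have kJ : (k < 2 ^ J)%N by move: kS SJ; clear; lia.
split; first by apply: (key _ _ _ eL); exact: hM.
by apply: (key _ _ _ eR); apply: hM => //; move: kJ; clear; lia.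
Qed.

(** At a given point at most [2 S] translates of [psi] are nonzero, and there are [2 S] boundary
    functions, all of size [sq l]. The father wavelets of level [l0] form one finite family, bounded
    by compactness. *)
Lemma wavelet_sum_bound : exists2 C, 0 < C & forall l x, (l0 <= l)%N -> 0 <= x <= 1 ->
  \sum_(k < nwav l0 l) `|wavelet W l0 l k x| <= C * sq l.
Proof.
have [M M0 hM] := edge_bounded.
have [P P0 hP] := psi_bounded.
have [F F0 hF] : exists2 F, 0 <= F & forall k, (k < nwav l0 l0)%N -> forall x, 0 <= x <= 1 ->
    `|wavelet W l0 l0 k x| <= F.
  apply: finite_bound => [k M' N' MN h x x01|k kJ]; first exact: le_trans (h x x01) MN.
  by have [_ [M' hM']] := bi_wavelet (leqnn l0) kJ; exists M'.
pose C1 := (nwav l0 l0)%:R * F; pose C2 := (2 * S)%:R * P + 2 * S%:R * M.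
have C10 : 0 <= C1 by rewrite mulr_ge0.
have C20 : 0 <= C2 by rewrite addr_ge0// !mulr_ge0.
exists (1 + C1 + C2); first by rewrite ltr_wpDr// ltr_wpDr.
move=> l x l0l x01.
have [/eqP ll|/negP/negP ll] := boolP (l == l0).
  rewrite ll; apply: (@le_trans _ _ C1).
    rewrite /C1 -[X in X%:R]card_ord mulr_natl -sumr_const; apply: ler_sum => k _; exact: hF.
  apply: (@le_trans _ _ ((1 + C1 + C2) * 1)); first by rewrite mulr1; lra.
  by apply: ler_wpM2l; [lra | exact: sq_ge1].
have lt : (l0 < l)%N by rewrite ltn_neqAle eq_sym ll.
have [x0 x1] := andP x01.
have SS : (2 * S <= 2 ^ l)%N by apply: leq_trans S_le _; rewrite leq_exp2l.
rewrite /nwav /wavelet (negbTE ll).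
apply: (@le_trans _ _ (sq l * \sum_(k < 2 ^ l) ((((0 <= k) && (k < 0 + S))%N)%:R * M +
   `|psi W (2 ^+ l * x - k%:R)| + (((2 ^ l - S <= k) && (k < 2 ^ l - S + S))%N)%:R * M))).
  rewrite mulr_sumr; apply: ler_sum => k _.
  rewrite /mother /at_level normrM (gtr0_norm (sq_gt0 l)) ler_wpM2l ?(ltW (sq_gt0 l))//.
  have kl := ltn_ord k.
  have p0 : 0 <= 2 ^+ l * x by rewrite mulr_ge0// exprn_ge0.
  have p1 : 0 <= 2 ^+ l * (1 - x) by rewrite mulr_ge0 ?exprn_ge0// subr_ge0.
  have ps := normr_ge0 (psi W (2 ^+ l * x - k%:R)).
  case: ifPn => kS.
    rewrite leq0n /= mul1r -addrA; have [h _] := hM k _ kS p0.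
    by apply: le_trans h _; rewrite lerDl addr_ge0// mulr_ge0.
  case: ifPn => kS2; first by rewrite -addrA addrCA lerDl addr_ge0// mulr_ge0.
  have kR : (2 ^ l - k.+1 < S)%N by move: kS2 kl S_gt0; rewrite -leqNgt; clear; lia.
  have [_ h] := hM _ _ kR p1; apply: le_trans h _.
  have -> : (2 ^ l - S <= k < 2 ^ l - S + S)%N by move: kS2 kl SS; rewrite -leqNgt; clear; lia.
  by rewrite mul1r lerDr addr_ge0// mulr_ge0.
rewrite mulrC ler_wpM2r ?(ltW (sq_gt0 l))// !big_split /= -!mulr_suml -!natr_sum.
have w1 := sum_window (2 ^ l) 0 S; have w2 := sum_window (2 ^ l) (2 ^ l - S) S.
have t := sum_translates (2 ^ l) (2 ^+ l * x) P0 hP psi_support.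
rewrite -(ler_nat R) in w1; rewrite -(ler_nat R) in w2.
have u1 := ler_wpM2r M0 w1; have u2 := ler_wpM2r M0 w2.
rewrite /C2; lra.
Qed.

End cdv_bounds.

(** * Wavelet series on the unit interval *)

Section clamp.
Context {R : realType}.
Implicit Types x : R.

Definition clamp x : R := Num.max 0 (Num.min x 1).

Lemma clamp_in x : 0 <= clamp x <= 1.
Proof. by rewrite /clamp le_max lexx/= ge_max ler01 ge_min lexx orbT. Qed.

Lemma clamp_id x : 0 <= x <= 1 -> clamp x = x.
Proof. by move=> /andP[x0 x1]; rewrite /clamp min_l// max_r. Qed.

Lemma continuous_clamp : continuous clamp.
Proof.
move=> x; apply: (@continuous_max _ _ (cst 0) (fun x => Num.min x 1)); first exact: cst_continuous.
by apply: (@continuous_min _ _ id (cst 1)); [exact: id | exact: cst_continuous].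
Qed.

(** It supplies the pointwise sum of a wavelet series together with the rate that makes the
    convergence uniform. *)
Lemma geometric_tail (u : nat -> R) (B r : R) : 0 < r < 1 -> (forall l, `|u l| <= B * r ^+ l) ->
  exists s, forall n, `|s - \sum_(l < n) u l| <= B / (1 - r) * r ^+ n.
Proof.
move=> /andP[r0 r1] hu.
have B0 : 0 <= B by have := le_trans (normr_ge0 _) (hu 0%N); rewrite expr0 mulr1.
have r1' : 0 < 1 - r by rewrite subr_gt0.
have part n m : \sum_(l < m) `|u (n + l)%N| <= B / (1 - r) * r ^+ n.
  apply: (@le_trans _ _ (\sum_(l < m) B * r ^+ (n + l))); first by apply: ler_sum => l _; exact: hu.
  under eq_bigr do rewrite exprD mulrA; rewrite -mulr_sumr.
  rewrite [X in _ <= X]mulrAC ler_wpM2l ?mulr_ge0 ?exprn_ge0 ?(ltW r0)//.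
  have := subrX1 r m; rewrite -opprB -[r - 1]opprB mulNr => /oppr_inj e.
  rewrite -[X in _ <= X]mul1r ler_pdivlMr// mulrC -e lerBlDr lerDl exprn_ge0 ?(ltW r0)//.
have cu : cvgn (series u).
  apply: normed_cvg; apply: nondecreasing_is_cvgn.
    by apply: nondecreasing_series => l _ _; exact: normr_ge0.
  exists (B / (1 - r)) => _ [n _ <-]; rewrite /normed_series_of seriesEord.
  by have := part 0%N n; rewrite expr0 mulr1.
exists (limn (series u)) => n.
have c1 : `|series u m - \sum_(l < n) u l| @[m --> \oo] --> `|limn (series u) - \sum_(l < n) u l|.
  by apply: cvg_norm; apply: cvgB => //; exact: cvg_cst.
rewrite -(cvg_lim _ c1)//; apply: limr_le; first by apply/cvg_ex; eexists; exact: c1.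
exists n => // m /= nm; rewrite /series/= big_mkord -(subnKC nm) big_split_ord/= addrAC subrr add0r.
exact: le_trans (ler_norm_sum _ _ _) (part n _).
Qed.

End clamp.

Section expansion.
Context {R : realType} (W : cdv_system R) (A l0 : nat).
Hypothesis A0 : (0 < A)%N.
Hypothesis hW : cdv_basis W A l0.
Local Notation sq l := (2 `^ (l%:R / 2) : R).

(* Extending the wavelets by their boundary values makes them continuous on the line. *)
Definition wv l k (x : R) : R := wavelet W l0 l k (clamp x).

Lemma wv_id l k x : 0 <= x <= 1 -> wv l k x = wavelet W l0 l k x.
Proof. by move=> x01; rewrite /wv clamp_id. Qed.

Lemma continuous_wv l k : (l0 <= l)%N -> (k < nwav l0 l)%N -> continuous (wv l k).
Proof.
move=> l0l kn; have [g cg gE] := wavelet_continuous A0 hW l0l kn.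
rewrite (_ : wv l k = g \o @clamp R); last by apply/funext => x; rewrite /wv gE//= clamp_in.
by move=> x; apply: continuous_comp; [exact: continuous_clamp | exact: cg].
Qed.

Lemma bi_wv l k : (l0 <= l)%N -> (k < nwav l0 l)%N -> bi (wv l k).
Proof. by move=> l0l kn; apply: bi_continuous; exact: continuous_wv. Qed.

Lemma wv_sum_bound : exists2 C, 0 < C & forall l x, (l0 <= l)%N ->
  \sum_(k < nwav l0 l) `|wv l k x| <= C * sq l.
Proof.
have [C C0 hC] := wavelet_sum_bound A0 hW.
by exists C => // l x l0l; apply: hC => //; exact: clamp_in.
Qed.

Lemma wv_orth l k l' k' : (l0 <= l)%N -> (l0 <= l')%N -> (k < nwav l0 l)%N -> (k' < nwav l0 l')%N ->
  Int01 (fun x => wv l k x * wv l' k' x) = ((l == l') && (k == k'))%:R.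
Proof.
move=> *; case: hW => [_ _ _ h _]; rewrite -h//.
by apply: Int01_eq => x x01; rewrite !wv_id.
Qed.

Lemma coefE f l k : coef W l0 f l k = Int01 (fun x => f x * wv l k x).
Proof. by apply: Int01_eq => x x01; rewrite wv_id. Qed.

Definition level (c : nat -> nat -> R) l x := \sum_(k < nwav l0 l) c l k * wv l k x.
Definition wsum c n x := \sum_(i < n) level c (l0 + i) x.

Lemma continuous_wsum c n : continuous (wsum c n).
Proof.
apply: continuous_sumR => i; apply: continuous_sumR => k; apply: continuousZR.
by apply: continuous_wv => //; exact: leq_addr.
Qed.

Lemma bi_wsum c n : bi (wsum c n).
Proof. by apply: bi_continuous; exact: continuous_wsum. Qed.

Lemma Int01_wsum_wv c n l k : (l0 <= l)%N -> (k < nwav l0 l)%N ->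
  Int01 (fun x => wsum c n x * wv l k x) = if (l < l0 + n)%N then c l k else 0.
Proof.
move=> l0l kn.
have bw (i : 'I_n) (j : 'I_(nwav l0 (l0 + i))) : bi (fun x => wv (l0 + i) j x * wv l k x).
  by apply: biM; apply: bi_wv => //; exact: leq_addr.
transitivity (\sum_(i < n) \sum_(j < nwav l0 (l0 + i)) c (l0 + i)%N j *
    ((l0 + i == l)%N && (j == k :> nat))%:R).
  transitivity (Int01 (fun x => \sum_(i < n) \sum_(j < nwav l0 (l0 + i))
      c (l0 + i)%N j * (wv (l0 + i) j x * wv l k x))).
    congr Int01; apply/funext => x; rewrite /wsum mulr_suml; apply: eq_bigr => i _.
    by rewrite /level mulr_suml; apply: eq_bigr => j _; rewrite mulrA.
  have bZ (i : 'I_n) (j : 'I_(nwav l0 (l0 + i))) : bi (fun x => c (l0 + i)%N j * (wv (l0 + i) j x * wv l k x)).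
    by apply: (@biM _ (cst _)) => //; exact: bi_cst.
  rewrite Int01_sum; last by move=> i; apply: bi_sum => j; exact: bZ.
  apply: eq_bigr => i _; rewrite Int01_sum; last by move=> j; exact: bZ.
  by apply: eq_bigr => j _; rewrite Int01Z// wv_orth// leq_addr.
case: ifPn => [ln|ln]; last first.
  rewrite big1// => i _; rewrite big1// => j _.
  case: eqP => [e|_]; last by rewrite mulr0.
  by move: ln; rewrite -e ltn_add2l ltn_ord.
have ln' : (l - l0 < n)%N by rewrite ltn_subLR.
rewrite (bigD1 (Ordinal ln'))//= subnKC// eqxx (bigD1 (Ordinal kn))//= eqxx mulr1.
rewrite big1 ?addr0; last by move=> j; rewrite -val_eqE /= => /negbTE ->; rewrite mulr0.
rewrite big1 ?addr0// => i; rewrite -val_eqE/= => ne; rewrite big1// => j _.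
case: eqP => [e|_]; last by rewrite mulr0.
by move: ne; rewrite -e addKn eqxx.
Qed.

Lemma Int01_wsum_sqr c n : Int01 (fun x => wsum c n x ^+ 2) =
  \sum_(i < n) \sum_(k < nwav l0 (l0 + i)) c (l0 + i)%N k ^+ 2.
Proof.
have bw (i : 'I_n) (j : 'I_(nwav l0 (l0 + i))) : bi (fun x => c (l0 + i)%N j *
    (wsum c n x * wv (l0 + i) j x)).
  apply: (@biM _ (cst _)); first exact: bi_cst.
  by apply: biM; [exact: bi_wsum | apply: bi_wv => //; exact: leq_addr].
transitivity (Int01 (fun x => \sum_(i < n) \sum_(j < nwav l0 (l0 + i))
      c (l0 + i)%N j * (wsum c n x * wv (l0 + i) j x))).
  congr Int01; apply/funext => x; rewrite expr2 {2}/wsum mulr_sumr; apply: eq_bigr => i _.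
  by rewrite /level mulr_sumr; apply: eq_bigr => j _; rewrite mulrCA.
rewrite Int01_sum; last by move=> i; apply: bi_sum => j; exact: bw.
apply: eq_bigr => i _; rewrite Int01_sum; last by move=> j; exact: bw.
apply: eq_bigr => j _; rewrite Int01Z; last first.
  by apply: biM; [exact: bi_wsum | apply: bi_wv => //; exact: leq_addr].
by rewrite Int01_wsum_wv ?leq_addr// ltn_add2l ltn_ord expr2.
Qed.

End expansion.

(** * Besov balls *)

Section lp_norm.
Context {R : realType}.
Implicit Types (p : \bar R) (n : nat) (a : nat -> R).

Lemma powRK (r x : R) : 0 < r -> 0 <= x -> (x `^ r) `^ r^-1 = x.
Proof. by move=> r0 x0; rewrite -powRrM divff ?gt_eqF// powRr1. Qed.

Lemma powR_div (r x t : R) : 0 <= x -> 0 <= t -> (x / t) `^ r = x `^ r / t `^ r.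
Proof.
move=> x0 t0; rewrite powRM ?invr_ge0//; congr (_ * _).
have e1 := powR_inv1 t0; have e2 := powR_inv1 (powR_ge0 t r).
by rewrite -e1 -e2 -[LHS]powRrM -[RHS]powRrM mulrC.
Qed.

Lemma ler_powRV (r x y : R) : 0 < r -> 0 <= y -> x <= y `^ r -> 0 <= x -> x `^ r^-1 <= y.
Proof.
move=> r0 y0 xy x0; rewrite -[X in _ <= X](powRK r0 y0); apply: ge0_ler_powR => //.
- by rewrite invr_ge0 ltW.
- by rewrite nnegrE powR_ge0.
Qed.

Lemma lp_norm_ge0 p n a : 0 <= lp_norm p n a.
Proof.
case: p => [r| |] /=; first exact: powR_ge0.
- by elim/big_ind : _ => // x y x0 y0; rewrite le_max x0.
- by elim/big_ind : _ => // x y x0 y0; rewrite le_max x0.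
Qed.

Lemma lp_norm_ge p n a k : (1%:E <= p)%E -> (k < n)%N -> `|a k| <= lp_norm p n a.
Proof.
case: p => [r| |]//= r1 kn; last by rewrite (bigmax_sup (Ordinal kn)).
have r0 : 0 < r by rewrite (lt_le_trans ltr01).
rewrite -[X in X <= _](powRK r0)//; apply: ge0_ler_powR.
- by rewrite invr_ge0 ltW.
- by rewrite nnegrE powR_ge0.
- by rewrite nnegrE sumr_ge0// => i _; exact: powR_ge0.
by rewrite (bigD1 (Ordinal kn))//= lerDl sumr_ge0// => i _; exact: powR_ge0.
Qed.

(** Divided by the total [t], each term lies in the unit interval, where a power at least one
    decreases it. *)
Lemma sum_powR (I : Type) (s : seq I) (F : I -> R) (r : R) : 1 <= r -> (forall i, 0 <= F i) ->
  \sum_(i <- s) F i `^ r <= (\sum_(i <- s) F i) `^ r.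
Proof.
move=> r1 F0; have r0 : 0 < r by rewrite (lt_le_trans ltr01).
have [s0|s0] := leP (\sum_(i <- s) F i) 0.
  have e : \sum_(i <- s) F i = 0 by apply/eqP; rewrite eq_le s0 sumr_ge0.
  have : all (fun i => F i == 0) s.
    elim: s {s0} e => //= i s IH; rewrite big_cons => /eqP.
    by rewrite paddr_eq0// ?sumr_ge0// => /andP[-> /eqP /IH].
  elim: s {s0 e} => [_|i s IH /= /andP[/eqP Fi /IH h]]; first by rewrite big_nil powR_ge0.
  by rewrite !big_cons Fi powR0 ?gt_eqF// !add0r.
set t := \sum_(i <- s) F i in s0 *.
rewrite -[X in _ <= X]mul1r -ler_pdivrMr ?powR_gt0// mulr_suml.
have -> : 1 = \sum_(i <- s) F i / t by rewrite -mulr_suml divff ?gt_eqF.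
have key u : 0 <= u <= 1 -> u `^ r <= u.
  move=> /andP[u0 u1]; have [->|u0'] := eqVneq u 0; first by rewrite powR0// gt_eqF.
  by rewrite -[X in _ <= X]powRr1// ger_powR// u1 lt_neqAle eq_sym u0' u0.
have le_t : all (fun i => F i <= t) s.
  have : forall s', (\sum_(i <- s') F i <= t -> all (fun i => F i <= t) s').
    elim=> //= i s' IH; rewrite big_cons => h.
    rewrite (le_trans _ h) ?lerDl ?sumr_ge0//= IH//; apply: le_trans h.
    by rewrite lerDr.
  by apply; rewrite /t.
clearbody t; elim: s le_t => [_|i s IH /= /andP[Fi /IH h]]; first by rewrite !big_nil.
rewrite !big_cons; apply: lerD => //.
by rewrite -powR_div ?(ltW s0)//; apply: key; rewrite divr_ge0 ?(ltW s0)//= ler_pdivrMr// mul1r.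
Qed.

Lemma lp_norm_le_l1 p n a : (1%:E <= p)%E -> lp_norm p n a <= \sum_(k < n) `|a k|.
Proof.
have s0 : 0 <= \sum_(k < n) `|a k| by exact: sumr_ge0.
case: p => [r| |]//= r1.
  apply: ler_powRV => //; first by rewrite (lt_le_trans ltr01).
  - exact: sum_powR.
  - by apply: sumr_ge0 => i _; exact: powR_ge0.
apply: bigmax_le => // i _; by rewrite (bigD1 i)//= lerDl sumr_ge0.
Qed.

Lemma lp_norm_le_sup p n a (h : R) : (1%:E <= p)%E -> 0 <= h -> (forall k, (k < n)%N -> `|a k| <= h) ->
  lp_norm p n a <= n%:R `^ invp p * h.
Proof.
case: p => [r| |]//= r1 h0 ah; last first.
  rewrite /invp invey/= powRr0 mul1r; apply: bigmax_le => // i _; exact: ah.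
have r0 : 0 < r by rewrite (lt_le_trans ltr01).
rewrite /invp fine_invr; apply: ler_powRV => //; first by rewrite mulr_ge0// powR_ge0.
- rewrite powRM ?powR_ge0// -powRrM mulVf ?gt_eqF// powRr1//.
  rewrite -[X in X%:R]card_ord mulr_natl -sumr_const; apply: ler_sum => i _.
  by apply: ge0_ler_powR; rewrite ?nnegrE ?(ltW r0)//; exact: ah.
- by apply: sumr_ge0 => i _; exact: powR_ge0.
Qed.

Lemma invp_bounds p : (2%:E <= p)%E -> 0 <= invp p <= 1 / 2.
Proof.
case: p => [r| |]//=; rewrite /invp ?invey/=; last by move=> _; rewrite lexx divr_ge0.
rewrite lee_fin fine_invr => r2; have r0 : 0 < r by rewrite (lt_le_trans _ r2).
by rewrite invr_ge0 (ltW r0)/= div1r lef_pV2// posrE.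
Qed.

(** A substitute for Hölder's inequality, at the price of a factor 2: after division by the scale
    [t], every square is at most one plus the power of order [r], as [r >= 2], and [t] is chosen so
    that both parts sum to [n]. *)
Lemma lp_norm_sqr p n a : (2%:E <= p)%E -> (0 < n)%N ->
  \sum_(k < n) a k ^+ 2 <= 2 * n%:R `^ (1 - 2 * invp p) * lp_norm p n a ^+ 2.
Proof.
move=> p2 n0; have p1 : (1%:E <= p)%E by apply: le_trans p2; rewrite lee_fin ler1n.
have Z0 := lp_norm_ge0 p n a; have ge k := @lp_norm_ge p n a k p1.
set Z := lp_norm p n a in Z0 ge *.
have n0' : 0 < (n%:R : R) by rewrite ltr0n.
have [Z00|Zn0] := eqVneq Z 0.
  rewrite Z00 expr0n mulr0 big1// => k _.
  by have := ge k (ltn_ord k); rewrite Z00 normr_le0 => /eqP ->; rewrite expr0n.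
have Zp : 0 < Z by rewrite lt_neqAle eq_sym Zn0.
case: p p2 p1 @Z Z0 ge Zn0 Zp => [r| |]// p2 p1 Z Z0 ge Zn0 Zp; last first.
  rewrite /invp invey/= mulr0 subr0 powRr1 ?(ltW n0')//.
  apply: (@le_trans _ _ (n%:R * Z ^+ 2)).
    rewrite -[X in X%:R]card_ord mulr_natl -sumr_const; apply: ler_sum => k _.
    by rewrite -real_normK ?num_real// lerXn2r ?nnegrE//; exact: ge.
  by rewrite ler_wpM2r ?sqr_ge0// ler_peMl ?ler1n// ltW.
rewrite lee_fin in p2; have r0 : 0 < r by rewrite (lt_le_trans _ p2).
have ZE : Z `^ r = \sum_(k < n) `|a k| `^ r.
  rewrite /Z/= -powRrM mulVf ?gt_eqF// powRr1// sumr_ge0// => i _; exact: powR_ge0.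
rewrite /invp fine_invr; clearbody Z.
pose t := n%:R `^ (- r^-1) * Z.
have t0 : 0 < t by rewrite mulr_gt0// powR_gt0.
have tr : t `^ r = Z `^ r / n%:R.
  by rewrite powRM ?powR_ge0// -powRrM mulNr mulVf ?gt_eqF// powR_inv1 ?(ltW n0')// mulrC.
have t2 : t ^+ 2 = n%:R `^ (- 2 * r^-1) * Z ^+ 2.
  rewrite exprMn -[_ `^ _ ^+ 2]powR_mulrn ?powR_ge0// -powRrM; congr (_ `^ _ * _); ring.
have key k : a k ^+ 2 <= t ^+ 2 * (1 + `|a k| `^ r / t `^ r).
  have -> : a k ^+ 2 = t ^+ 2 * (`|a k| / t) ^+ 2.
    by rewrite expr_div_n mulrCA divff ?mulr1 ?real_normK ?num_real// expf_neq0// gt_eqF.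
  rewrite ler_pM2l ?exprn_gt0//.
  rewrite -powR_div ?(ltW t0)//.
  have : 0 <= `|a k| / t by rewrite divr_ge0// ltW.
  move: (`|a k| / t) => u u0; have [u1|u1] := leP u 1.
    by apply: ler_wpDr; rewrite ?powR_ge0// exprn_ile1.
  apply: (@le_trans _ _ (u `^ r)); last by rewrite lerDr.
  by rewrite -powR_mulrn// ler_powR// ltW.
apply: (@le_trans _ _ (\sum_(k < n) t ^+ 2 * (1 + `|a k| `^ r / t `^ r))).
  by apply: ler_sum => k _; exact: key.
rewrite -mulr_sumr big_split/= sumr_const card_ord -mulr_suml -ZE tr invf_div.
rewrite mulrCA divff ?gt_eqF ?powR_gt0// mulr1 t2.
have -> : n%:R `^ (1 - 2 / r) = n%:R * n%:R `^ (- 2 / r) :> R.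
  by rewrite mulNr powRB ?(gt_eqF n0') ?implybT// powRr1 ?(ltW n0')// powRN.
by move: (n%:R `^ _) => w; lra.
Qed.

End lp_norm.

Section besov.
Context {R : realType} (W : cdv_system R) (l0 : nat) (alpha : R) (p q : \bar R).
Hypothesis hp : (2%:E <= p)%E.
Hypothesis hq : (1%:E <= q)%E.

Let hp1 : (1%:E <= p)%E.
Proof. by apply: le_trans hp; rewrite lee_fin ler1n. Qed.

Definition besov_term f l := 2 `^ (l%:R * (alpha + 1 / 2 - invp p)) * lp_norm p (nwav l0 l) (coef W l0 f l).

Lemma besov_term_ge0 f l : 0 <= besov_term f l.
Proof. by rewrite mulr_ge0 ?powR_ge0 ?lp_norm_ge0. Qed.

Lemma besov_term_le f (rad : R) l : 0 <= rad -> (besov_norm W alpha p q l0 f <= rad%:E)%E -> (l0 <= l)%N ->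
  besov_term f l <= rad.
Proof.
move=> rad0; rewrite /besov_norm; case: q hq => [r| |]//= r1 h l0l; last first.
  by rewrite -lee_fin; apply: le_trans h; apply: ereal_sup_ubound; exists l.
rewrite lee_fin in r1; have r0 : 0 < r by rewrite (lt_le_trans ltr01).
have r0' : 0 <= r^-1 by rewrite invr_ge0 ltW.
rewrite -lee_fin; apply: le_trans h.
pose b k := (besov_term f k `^ r)%:E; have bE k : b k = (besov_term f k `^ r)%:E by [].
have b0 k : (0 <= b k)%E by rewrite bE lee_fin powR_ge0.
rewrite -[X in (_ <= X)%E]/((\sum_(l0 <= k <oo) b k) `^ r^-1)%E.
have s0 : (0 <= \sum_(l0 <= k <oo) b k)%E by apply: nneseries_ge0 => k _ _; exact: b0.
have le : (b l <= \sum_(l0 <= k <oo) b k)%E.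
  apply: le_trans (nneseries_lim_ge l.+1 (fun n _ _ => b0 n)).
  by rewrite big_nat_recr//= leeDr// sume_ge0.
have -> : ((besov_term f l)%:E = b l `^ r^-1)%E.
  by rewrite bE poweR_EFin powRK// besov_term_ge0.
by apply: gt0_ler_poweR; rewrite // ?in_itv/= ?leey ?andbT.
Qed.

(** With [besov_term_le] it traps the norm between the largest term and the sum of the terms, so
    that the sequel never has to distinguish the values of [q]. *)
Lemma besov_norm_le f (rad : R) : (forall n, \sum_(l0 <= l < n) besov_term f l <= rad) ->
  (besov_norm W alpha p q l0 f <= rad%:E)%E.
Proof.
move=> h; have rad0 : 0 <= rad by have := h 0%N; rewrite big_geq.
rewrite /besov_norm; case: q hq => [r| |]//= r1; last first.
  apply: ge_ereal_sup => _ [l /= l0l <-]; rewrite lee_fin -/(besov_term f l).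
  apply: le_trans (h l.+1); rewrite big_nat_recr//= lerDr sumr_ge0// => k _; exact: besov_term_ge0.
rewrite lee_fin in r1; have r0 : 0 < r by rewrite (lt_le_trans ltr01).
have r0' : 0 <= r^-1 by rewrite invr_ge0 ltW.
pose b k := (besov_term f k `^ r)%:E; have bE k : b k = (besov_term f k `^ r)%:E by [].
have b0 k : (0 <= b k)%E by rewrite bE lee_fin powR_ge0.
rewrite -[X in (X <= _)%E]/((\sum_(l0 <= k <oo) b k) `^ r^-1)%E.
have s0 : (0 <= \sum_(l0 <= k <oo) b k)%E by apply: nneseries_ge0 => k _ _; exact: b0.
have -> : (rad%:E = (rad `^ r)%:E `^ r^-1)%E by rewrite poweR_EFin powRK.
apply: gt0_ler_poweR; rewrite // ?in_itv/= ?leey ?andbT ?lee_fin ?powR_ge0//.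
apply: lime_le; first by apply: is_cvg_nneseries => k _ _; exact: b0.
apply: nearW => n; rewrite (eq_bigr (fun l => (besov_term f l `^ r)%:E))// sumEFin lee_fin.
apply: le_trans (sum_powR _ r1 (besov_term_ge0 f)) _.
apply: ge0_ler_powR; rewrite ?nnegrE ?(ltW r0)//.
by apply: sumr_ge0 => k _; exact: besov_term_ge0.
Qed.

Local Notation nu := (alpha - invp p).

Lemma nwav_le l : (nwav l0 l <= 2 ^ l.+1)%N.
Proof. by rewrite /nwav leq_exp2l//; case: ifP => // /eqP ->. Qed.

Lemma nwav_gt0 l : (0 < nwav l0 l)%N.
Proof. by rewrite expn_gt0. Qed.

Lemma besov_coef_le f (rad : R) l k : 0 <= rad -> (besov_norm W alpha p q l0 f <= rad%:E)%E ->
  (l0 <= l)%N -> (k < nwav l0 l)%N -> `|coef W l0 f l k| <= rad * 2 `^ (- (l%:R * (nu + 1 / 2))).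
Proof.
move=> rad0 hf l0l kn; have h := besov_term_le rad0 hf l0l.
rewrite powRN ler_pdivlMr ?powR_gt0// mulrC; apply: le_trans h.
rewrite /besov_term; have -> : alpha + 1 / 2 - invp p = nu + 1 / 2 by ring.
by rewrite ler_wpM2l ?powR_ge0//; exact: lp_norm_ge.
Qed.

(** Here [p >= 2] enters. Passing from the [p]-norm to the sum of squares costs
    [2 ^ (l (1 - 2 / p))], which the weight of the Besov norm restores, so that the exponent is
    [alpha] and not [nu]. *)
Lemma besov_coef_sqr f (rad : R) l : 0 <= rad -> (besov_norm W alpha p q l0 f <= rad%:E)%E ->
  (l0 <= l)%N -> \sum_(k < nwav l0 l) coef W l0 f l k ^+ 2 <= 4 * rad ^+ 2 * 2 `^ (- (2 * l%:R * alpha)).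
Proof.
move=> rad0 hf l0l; have := besov_term_le rad0 hf l0l.
rewrite /besov_term mulrC -ler_pdivlMr ?powR_gt0// -powRN => h.
apply: le_trans (lp_norm_sqr _ hp (nwav_gt0 l)) _.
have N0 := lp_norm_ge0 p (nwav l0 l) (coef W l0 f l).
have {}h := @lerXn2r _ 2 _ _ N0 (le_trans N0 h) h.
have [i0 i1] := andP (invp_bounds hp).
have w0 : 0 <= 2 * (nwav l0 l)%:R `^ (1 - 2 * invp p) :> R by rewrite mulr_ge0// powR_ge0.
apply: le_trans (ler_wpM2l w0 h) _.
have w1 : (nwav l0 l)%:R `^ (1 - 2 * invp p) <= 2 * 2 `^ (l%:R * (1 - 2 * invp p)) :> R.
  apply: (@le_trans _ _ ((2 ^ l.+1)%:R `^ (1 - 2 * invp p))).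
    by apply: ge0_ler_powR; rewrite ?nnegrE ?ler_nat ?nwav_le//; lra.
  have -> : (2 ^ l.+1)%:R = 2 `^ l.+1%:R :> R by rewrite natrX powR_mulrn.
  rewrite -powRrM -[l.+1%:R]natr1 mulrDl mul1r powRD ?pnatr_eq0 ?implybT//.
  rewrite mulrC ler_wpM2r ?powR_ge0// -[X in _ <= X]powRr1// ler_powR ?ler1n//; lra.
apply: (@le_trans _ _ (2 * (2 * 2 `^ (l%:R * (1 - 2 * invp p))) *
   (rad * 2 `^ (- (l%:R * (alpha + 1 / 2 - invp p)))) ^+ 2)).
  by rewrite ler_wpM2r ?sqr_ge0// ler_wpM2l.
rewrite exprMn -[_ `^ _ ^+ 2]powR_mulrn ?powR_ge0// -powRrM.
have -> : - (2 * l%:R * alpha) = l%:R * (1 - 2 * invp p) + - (l%:R * (alpha + 1 / 2 - invp p)) * 2.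
  by field.
rewrite powRD ?pnatr_eq0 ?implybT//.
by move: (_ `^ _) => u; move: (_ `^ _) => v; rewrite le_eqVlt; apply/orP; left; apply/eqP; ring.
Qed.

End besov.

(** * Continuous representatives of Besov functions *)

Section besov_expansion.
Context {R : realType} (W : cdv_system R) (A l0 : nat) (alpha : R) (p q : \bar R) (rad : R).
Hypothesis A0 : (0 < A)%N.
Hypothesis hW : cdv_basis W A l0.
Hypothesis hp : (2%:E <= p)%E.
Hypothesis hq : (1%:E <= q)%E.
Local Notation nu := (alpha - invp p).
Hypothesis hnu : 1 / 2 < nu.
Hypothesis rad0 : 0 < rad.
Local Notation mu := (@lebesgue_measure R).

Lemma pow2_split (e : R) (n m : nat) : 2 `^ (- ((n + m)%:R * e)) = 2 `^ (- (n%:R * e)) * 2 `^ (- e) ^+ m :> R.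
Proof.
rewrite -[_ ^+ m]powR_mulrn ?powR_ge0// -powRrM -powRD ?pnatr_eq0 ?implybT//.
by congr (_ `^ _); rewrite natrD; ring.
Qed.

Lemma pow2N_lt1 (e : R) : 0 < e -> 0 < (2 : R) `^ (- e) < 1.
Proof.
move=> e0; rewrite powR_gt0//= powRN invf_lt1 ?powR_gt0//.
by rewrite /powR pnatr_eq0/= expR_gt1 mulr_gt0// ln_gt0// ltr1n.
Qed.

(** The coefficients decay like [2 ^ (- l (nu + 1 / 2))] and the wavelets of a level sum to at most
    a multiple of [2 ^ (l / 2)], which leaves a geometric series in [l]. *)
Lemma level_bound : exists2 B, 0 < B & forall f l x, (besov_norm W alpha p q l0 f <= rad%:E)%E ->
  (l0 <= l)%N -> `|level W l0 (coef W l0 f) l x| <= B * 2 `^ (- (l%:R * nu)).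
Proof.
have [C C0 hC] := wv_sum_bound A0 hW.
exists (rad * C); first exact: mulr_gt0.
move=> f l x hf l0l; apply: le_trans (ler_norm_sum _ _ _) _.
apply: (@le_trans _ _ (\sum_(k < nwav l0 l) rad * 2 `^ (- (l%:R * (nu + 1 / 2))) * `|wv W l0 l k x|)).
  apply: ler_sum => k _; rewrite normrM ler_wpM2r//.
  exact: (besov_coef_le hp hq (ltW rad0) hf l0l (ltn_ord k)).
rewrite -mulr_sumr; apply: le_trans (ler_wpM2l _ (hC l x l0l)) _.
  by rewrite mulr_ge0 ?powR_ge0// ltW.
have -> : - (l%:R * nu) = - (l%:R * (nu + 1 / 2)) + l%:R / 2 by field.
rewrite powRD ?pnatr_eq0 ?implybT// le_eqVlt; apply/orP; left; apply/eqP.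
by move: (_ `^ _) => u; move: (_ `^ _) => v; ring.
Qed.

Lemma continuous_uniform_approx (g : R -> R) (s : nat -> R -> R) (B r : R) : 0 < r < 1 ->
  (forall n, continuous (s n)) -> (forall n x, `|g x - s n x| <= B * r ^+ n) -> continuous g.
Proof.
move=> /andP[r0 r1] cs gs x; apply/cvgrPdist_lt => e e0.
have e3 : 0 < e / 3 by rewrite divr_gt0.
have cB : (B * r ^+ n) @[n --> \oo] --> (0 : R).
  rewrite -(mulr0 B); apply: cvgM; first exact: cvg_cst.
  by apply: cvg_expr; rewrite gtr0_norm.
have /cvgr0Pnorm_lt/(_ _ e3)[n _ /(_ n (leqnn n)) hn] := cB.
have := cs n x; move/cvgrPdist_lt => /(_ _ e3); apply: filterS => t ht.
have bn : B * r ^+ n < e / 3 by exact: le_lt_trans (ler_norm _) hn.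
have a1 := gs n x; have a2 := gs n t.
have -> : g x - g t = (g x - s n x) + (s n x - s n t) - (g t - s n t) by ring.
apply: le_lt_trans (ler_normB _ _) _; have := ler_normD (g x - s n x) (s n x - s n t).
lra.
Qed.

Lemma pow2N_nat (e : R) n : 2 `^ (- (n%:R * e)) = 2 `^ (- e) ^+ n :> R.
Proof. by have := pow2_split e 0 n; rewrite add0n mul0r oppr0 powRr0 mul1r. Qed.

Lemma Int01_ge0_le_sqr (f g : R -> R) : bi f -> bi g ->
  Int01 (fun x => (f x + g x) ^+ 2) <= 2 * Int01 (fun x => f x ^+ 2) + 2 * Int01 (fun x => g x ^+ 2).
Proof.
move=> bf bg; rewrite -!Int01Z; try exact: biX.
have b2 h : bi h -> bi (fun x => 2 * h x ^+ 2).
  by move=> bh; apply: (@biM _ (cst 2)); [exact: bi_cst | exact: biX].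
rewrite -Int01D; try exact: b2.
apply: Int01_le; [exact/biX/biD | apply: biD; exact: b2 |] => x _.
by have := sqr_ge0 (f x - g x); rewrite sqrrB sqrrD; lra.
Qed.

(** The last two bounds are the biases of the pointwise and of the global estimator at resolution
    [n], of orders [nu] and [alpha]. *)
Definition expansion_bounds (B : R) (g : R -> R) :=
  [/\ continuous g, forall x, `|g x| <= B,
      forall n x, `|g x - wsum W l0 (coef W l0 g) n x| <= B * 2 `^ (- (n%:R * nu))
    & forall n, Int01 (fun x => (g x - wsum W l0 (coef W l0 g) n x) ^+ 2) <= B * 2 `^ (- (2 * n%:R * alpha))].

Lemma wsum_tail_sqr : exists2 B, 0 < B & forall f m n, (besov_norm W alpha p q l0 f <= rad%:E)%E ->
  Int01 (fun x => (wsum W l0 (coef W l0 f) (n + m) x - wsum W l0 (coef W l0 f) n x) ^+ 2) <=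
    B * 2 `^ (- (2 * n%:R * alpha)).
Proof.
have a0 : 0 < 2 * alpha.
  rewrite mulr_gt0//; apply: lt_trans (lt_le_trans hnu _); first by rewrite divr_gt0.
  by rewrite gerBl; case/andP: (invp_bounds hp).
have /andP[r0 r1] := pow2N_lt1 a0.
set r := 2 `^ (- (2 * alpha)) in r0 r1.
exists (4 * rad ^+ 2 / (1 - r)); first by rewrite divr_gt0 ?subr_gt0// mulr_gt0// exprn_gt0.
(* Zeroing the levels below [n] turns a difference of partial sums into a partial sum, to which
   Parseval's identity applies. *)
move=> f m n hf; pose c l k := if (l0 + n <= l)%N then coef W l0 f l k else 0.
have -> : (fun x => (wsum W l0 (coef W l0 f) (n + m) x - wsum W l0 (coef W l0 f) n x) ^+ 2) =
    (fun x => wsum W l0 c (n + m) x ^+ 2).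
  apply/funext => x; congr (_ ^+ 2); rewrite /wsum !big_split_ord/= addrAC subrr add0r.
  rewrite [X in _ = X + _]big1 ?add0r; last first.
    by move=> i _; rewrite /level big1// => k _; rewrite /c leqNgt ltn_add2l ltn_ord/= mul0r.
  apply: eq_bigr => i _; apply: eq_bigr => k _.
  by rewrite /c leq_add2l leq_addr.
rewrite (Int01_wsum_sqr A0 hW) big_split_ord/=.
rewrite big1 ?add0r; last first.
  by move=> i _; rewrite big1// => k _; rewrite /c leqNgt ltn_add2l ltn_ord/= expr0n.
apply: (@le_trans _ _ (\sum_(i < m) 4 * rad ^+ 2 * 2 `^ (- (2 * n%:R * alpha)) * r ^+ i)).
  apply: ler_sum => i _.
  apply: (@le_trans _ _ (4 * rad ^+ 2 * 2 `^ (- (2 * (l0 + (n + i))%:R * alpha)))).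
    apply: le_trans (besov_coef_sqr hp hq (ltW rad0) hf (leq_addr (n + i) l0)).
    by apply: ler_sum => k _; rewrite /c leq_add2l leq_addr.
  have P0 : 0 <= 4 * rad ^+ 2 by rewrite mulr_ge0// sqr_ge0.
  rewrite -[X in _ <= X]mulrA ler_wpM2l//.
  have -> : 2 * (l0 + (n + i))%:R * alpha = (n + i + l0)%:R * (2 * alpha).
    by rewrite addnC; ring.
  have -> : 2 * n%:R * alpha = n%:R * (2 * alpha) by ring.
  rewrite !pow2_split -[X in _ <= X]mulr1 ler_wpM2l ?exprn_ile1//; try exact: ltW.
rewrite -mulr_sumr; set P := 4 * rad ^+ 2; set Q := 2 `^ _.
have PQ : 0 <= P * Q by rewrite mulr_ge0 ?powR_ge0// mulr_ge0// sqr_ge0.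
rewrite [X in _ <= X]mulrAC; apply: ler_wpM2l => //.
have e : (\sum_(i < m) r ^+ i) * (1 - r) = 1 - r ^+ m.
  by have := subrX1 r m; rewrite -opprB -[r - 1]opprB mulNr mulrC => /oppr_inj ->.
by rewrite -[X in _ <= X]mul1r ler_pdivlMr ?subr_gt0// e lerBlDr lerDl exprn_ge0 ?(ltW r0).
Qed.


Lemma besov_alpha_gt0 : 0 < alpha.
Proof.
apply: lt_trans (lt_le_trans hnu _); first by rewrite divr_gt0.
by rewrite gerBl; case/andP: (invp_bounds hp).
Qed.

(** The wavelet series of [f] converges uniformly to a continuous [g] with the same coefficients;
    [f - g] has zero coefficients, hence zero norm by completeness of the basis. *)
Theorem besov_expansion : exists2 B, 0 < B & forall f : {mfun R >-> R}, besov_ball W alpha p q l0 rad f ->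
  exists g : {mfun R >-> R}, expansion_bounds B g /\
    (\int[mu]_(x in `[0%R, 1%R]) ((f x - g x) ^+ 2)%:E = 0)%E.
Proof.
have [B1 B10 hB1] := level_bound; have [B2 B20 hB2] := wsum_tail_sqr.
have nu0 : 0 < nu by apply: lt_trans hnu; rewrite divr_gt0.
have rr := pow2N_lt1 nu0; have /andP[r0 r1] := rr; set r := 2 `^ (- nu) in r0 r1 rr.
pose B3 := B1 / (1 - r); have B30 : 0 < B3 by rewrite divr_gt0 ?subr_gt0.
exists (B3 + 2 * B2); first by rewrite addr_gt0// mulr_gt0.
move=> f [f2 hf]; pose c := coef W l0 f.
have lev l x : `|level W l0 c (l0 + l) x| <= B1 * r ^+ l.
  apply: le_trans (hB1 _ _ x hf (leq_addr l l0)) _; rewrite ler_pM2l// pow2N_nat addnC exprD.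
  by rewrite ler_piMr ?exprn_ge0 ?exprn_ile1// ltW.
pose g x := sval (cid (geometric_tail rr (fun l => lev l x))).
have gw n x : `|g x - wsum W l0 c n x| <= B3 * r ^+ n.
  by rewrite /g; case: cid => y /= ->.
have gw2 n x : (g x - wsum W l0 c n x) ^+ 2 <= B3 ^+ 2 * r ^+ n.
  rewrite -real_normK ?num_real//; apply: (@le_trans _ _ ((B3 * r ^+ n) ^+ 2)).
    by apply: lerXn2r (gw n x); rewrite ?nnegrE// mulr_ge0 ?exprn_ge0// ltW.
  by rewrite exprMn ler_wpM2l ?sqr_ge0// ler_iXnr// ?exprn_ge0 ?exprn_ile1//; exact: ltW.
have cg : continuous g.
  by apply: (continuous_uniform_approx rr _ gw) => n; exact: (continuous_wsum A0 hW).
have mg : measurable_fun setT g by exact: continuous_measurable_fun.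
pose G : {mfun R >-> R} := HB.pack g (isMeasurableFun.Build _ _ _ _ g mg).
have bg : bi g := bi_continuous cg.
have bw n : bi (wsum W l0 c n) := bi_wsum A0 hW c n.
have bgw n : bi (fun x => g x - wsum W l0 c n x) by apply: biD => //; exact: biN.
have cB (K : R) : (K * r ^+ n) @[n --> \oo] --> (0 : R).
  rewrite -(mulr0 K); apply: cvgM; first exact: cvg_cst.
  by apply: cvg_expr; rewrite gtr0_norm.
(* A partial sum of high order has the coefficient [c l k] exactly, and its uniform distance to [g]
   is arbitrarily small. *)
have cgf l k : (l0 <= l)%N -> (k < nwav l0 l)%N -> coef W l0 g l k = c l k.
  move=> l0l kn; rewrite coefE; have bwv := bi_wv A0 hW l0l kn.
  have [_ [M hM]] := bwv.
  have M0 : 0 <= M by apply: le_trans (hM 0 _); rewrite ?lexx ?ler01.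
  apply/eqP; rewrite -subr_eq0 -normr_le0; apply/ler_addgt0Pr => e e0; rewrite add0r.
  have [n _ hn] : \forall n \near \oo, `|B3 * M * r ^+ n| < e.
    by move/cvgr0Pnorm_lt: (cB (B3 * M)); exact.
  pose m := maxn n (l - l0).+1; have {}hn := hn m (leq_maxl _ _).
  have lm : (l < l0 + m)%N.
    by rewrite -ltn_subLR// leq_max ltnSn orbT.
  have := Int01_wsum_wv A0 hW c m l0l kn; rewrite lm => <-.
  have -> : Int01 (fun x => g x * wv W l0 l k x) = Int01 (fun x => wsum W l0 c m x * wv W l0 l k x)
      + Int01 (fun x => (g x - wsum W l0 c m x) * wv W l0 l k x).
    rewrite -Int01D; try exact: biM; congr Int01; apply/funext => x; ring.
  rewrite addrAC subrr add0r; apply: le_trans (Int01_abs _) _; first exact: biM.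
  apply: le_trans (le_trans (ler_norm _) (ltW hn)); rewrite -(Int01_cst (B3 * M * r ^+ m)).
  apply: Int01_le; [exact/bi_norm/biM|exact: bi_cst|] => x x01.
  by rewrite normrM mulrAC ler_pM// hM.
(* The bound on finite tails passes to the limit through a later partial sum, uniformly close to
   [g]; the inequality for the square of a sum doubles the constant. *)
have sqr n : Int01 (fun x => (g x - wsum W l0 c n x) ^+ 2) <= 2 * B2 * 2 `^ (- (2 * n%:R * alpha)).
  apply/ler_addgt0Pr => e e0.
  have [m _ hm] : \forall m \near \oo, `|2 * B3 ^+ 2 * r ^+ m| < e.
    by move/cvgr0Pnorm_lt: (cB (2 * B3 ^+ 2)); exact.
  have {}hm := hm (n + m)%N (leq_addl _ _).
  have -> : (fun x => (g x - wsum W l0 c n x) ^+ 2) =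
     (fun x => ((g x - wsum W l0 c (n + m) x) + (wsum W l0 c (n + m) x - wsum W l0 c n x)) ^+ 2).
    by apply/funext => x; congr (_ ^+ 2); ring.
  apply: le_trans (Int01_ge0_le_sqr (bgw _) _) _; first by apply: biD => //; exact: biN.
  have h1 := hB2 f m n hf.
  have h2 : Int01 (fun x => (g x - wsum W l0 c (n + m) x) ^+ 2) <= B3 ^+ 2 * r ^+ (n + m).
    rewrite -(Int01_cst (B3 ^+ 2 * _)); apply: Int01_le; [exact: biX|exact: bi_cst|] => x _; exact: gw2.
  have := le_lt_trans (ler_norm _) hm; rewrite -mulrA; move: h1 h2; rewrite -/c.
  by move: (Int01 _) => u; move: (Int01 _) => v; move: (B3 ^+ 2 * _) => w; lra.
exists G; split; last first.
  pose H : {mfun R >-> R} := (f \- G)%R.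
  have [_ _ _ _ complete] := hW.
  have mI := @mI01 R; have [if1 if2] := l2_integrable f2.
  have f1 : measurable_fun (`[0%R, 1%R]%classic : set R) (f : R -> R) by apply: measurable_funTS; exact: measurable_funPT.
  apply: (complete H).
    have i3 : mu.-integrable (`[0%R, 1%R]%classic : set R) (EFin \o (fun x => f x * (- 2 * g x) + (f x ^+ 2 + g x ^+ 2))).
      rewrite (_ : _ \o _ = (EFin \o (fun x => f x * (- 2 * g x))%R) \+
          ((EFin \o (fun x => f x ^+ 2)%R) \+ (EFin \o (fun x => g x ^+ 2)%R)))%E; last exact/funext.
      apply: integrableD => //; first by apply: integrable_biM => //; apply: (@biM _ (cst _)) => //; exact: bi_cst.
      by apply: integrableD => //; exact/bi_integrable/biX.
    have /integrableP[_] := i3; rewrite /square_integrable; apply: le_lt_trans.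
    rewrite le_eqVlt; apply/orP; left; apply/eqP; apply: eq_integral => x _ /=; congr EFin.
    rewrite (_ : _ + _ = (f x - g x) ^+ 2) ?ger0_norm ?sqr_ge0//; ring.
  move=> l k l0l kn; rewrite coefE.
  have bwv := bi_wv A0 hW l0l kn.
  rewrite -[RHS](subrr (c l k)) -{2}(cgf l k)// /c !coefE /Int01.
  rewrite -RintegralB//; [|exact: integrable_biM|exact/bi_integrable/biM].
  by apply: eq_Rintegral => x _; rewrite /= mulrBl.
have wE n : wsum W l0 (coef W l0 g) n = wsum W l0 c n.
  apply/funext => x; apply: eq_bigr => i _; apply: eq_bigr => k _.
  by rewrite cgf// leq_addr.
split => //.
- move=> x; have := gw 0%N x; rewrite /wsum big_ord0 subr0 expr0 mulr1 => h; apply: le_trans h _.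
  by rewrite lerDl mulr_ge0// ltW.
- move=> n x; rewrite wE; apply: le_trans (gw n x) _; rewrite pow2N_nat ler_wpM2r ?exprn_ge0 ?(ltW r0)//.
  by rewrite lerDl mulr_ge0// ltW.
- move=> n; rewrite wE; apply: le_trans (sqr n) _; rewrite ler_wpM2r ?powR_ge0//.
  by rewrite lerDr ltW.
Qed.

End besov_expansion.

(** * Integrals on the line and the multiresolution analysis *)

Section compactly_supported.
Context {R : realType}.
Local Notation mu := (@lebesgue_measure R).
Implicit Types g h : R -> R.

Definition ccf g := continuous g /\ exists K : R, forall x, K < `|x| -> g x = 0.

Lemma ccf_integrable g : ccf g -> mu.-integrable setT (EFin \o g).
Proof.
move=> [cg [K hK]].
have -> : EFin \o g = (EFin \o g) \_ `[- K, K].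
  apply/funext => x; rewrite patchE; case: ifPn => //; rewrite notin_setE/= in_itv/= => /negP.
  by rewrite -ler_norml -ltNge => /hK ->.
apply/(integrable_mkcond _ _).1 => //.
apply: continuous_compact_integrable; first exact: segment_compact.
exact: continuous_subspaceT.
Qed.

Lemma ccfM g h : ccf g -> continuous h -> ccf (fun x => g x * h x).
Proof.
move=> [cg [K hK]] ch; split; last by exists K => x /hK ->; rewrite mul0r.
by move=> x; apply: continuousM; [exact: cg | exact: ch].
Qed.

Lemma ccfZ g c : ccf g -> ccf (fun x => c * g x).
Proof.
move=> [cg [K hK]]; split; last by exists K => x /hK ->; rewrite mulr0.
exact: continuousZR.
Qed.

Lemma ccfD g h : ccf g -> ccf h -> ccf (fun x => g x + h x).
Proof.
move=> [cg [K hK]] [ch [K' hK']]; split; last first.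
  by exists (Num.max K K') => x; rewrite gt_max => /andP[/hK -> /hK' ->]; rewrite addr0.
by move=> x; apply: continuousD; [exact: cg | exact: ch].
Qed.

Lemma ccf0 : ccf (fun _ => 0).
Proof. by split; [exact: cst_continuous | exists 0]. Qed.

Lemma ccf_sum (I : Type) (r : seq I) (F : I -> R -> R) : (forall i, ccf (F i)) ->
  ccf (fun x => \sum_(i <- r) F i x).
Proof.
move=> cF; elim: r => [|i r IH]; first by under eq_fun do rewrite big_nil; exact: ccf0.
by under eq_fun do rewrite big_cons; exact: ccfD.
Qed.

Lemma ccf_affine g (a b : R) : a != 0 -> ccf g -> ccf (fun x => g (a * x + b)).
Proof.
move=> a0 [cg [K hK]]; split; first exact: continuous_affine.
exists ((K + `|b|) / `|a|) => x; rewrite ltr_pdivrMr ?normr_gt0// => h; apply: hK.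
have := ler_normB (a * x + b) b; rewrite addrK normrM mulrC; lra.
Qed.

Definition IR g : R := \int[mu]_x g x.

Lemma IRD g h : ccf g -> ccf h -> IR (fun x => g x + h x) = IR g + IR h.
Proof. by move=> cg ch; apply: RintegralD => //; exact: ccf_integrable. Qed.

Lemma IRZ c g : ccf g -> IR (fun x => c * g x) = c * IR g.
Proof. by move=> cg; apply: RintegralZl => //; exact: ccf_integrable. Qed.

Lemma IR_sum (I : Type) (r : seq I) (F : I -> R -> R) : (forall i, ccf (F i)) ->
  IR (fun x => \sum_(i <- r) F i x) = \sum_(i <- r) IR (F i).
Proof.
move=> cF; elim: r => [|i r IH].
  rewrite big_nil -[RHS](mul0r (IR (fun=> 0))) -(IRZ 0 ccf0).
  by congr IR; apply/funext => x; rewrite big_nil mul0r.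
rewrite big_cons -IH -IRD//; last exact: ccf_sum.
by congr IR; apply/funext => x; rewrite big_cons.
Qed.

Lemma lebesgue_affine (a c : R) (A : set (measurableTypeR R)) : 0 < a -> measurable A ->
  (a%:E * mu ((fun x : R => (a * x + c)%R) @^-1` A) = mu A)%E.
Proof.
move=> a0 mA.
have mf : measurable_fun setT (fun x : measurableTypeR R => (a * x + c)%R : measurableTypeR R).
  by apply: measurable_funD => //; exact: measurable_funM.
apply/esym; apply: (@lebesgue_measure_unique R (mscale (NngNum (ltW a0)) (pushforward mu (fun x : measurableTypeR R => (a * x + c)%R : measurableTypeR R))) _ A mA).
move=> X [[u v]] /= _ <-.
rewrite /mscale/= /pushforward.
have -> : (fun x : R => (a * x + c)%R) @^-1` `]u, v] = `]((u - c) / a)%R, ((v - c) / a)%R]%classic.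
  apply/seteqP; split => x /=; rewrite !in_itv/= ltr_pdivrMr// ler_pdivlMr// mulrC;
  by rewrite ltrBlDr lerBrDr.
rewrite !lebesgue_measure_itv/= !lte_fin ltr_pM2r ?invr_gt0// ltrD2r; case: ifPn => // _; last by rewrite mule0.
by rewrite -!EFinB -EFinM; congr (_%:E); field; rewrite gt_eqF.
Qed.

Lemma ge0_integral_affine (a c : R) (h : R -> \bar R) : 0 < a -> measurable_fun setT h ->
  (forall x, 0 <= h x)%E -> (a%:E * \int[mu]_x h (a * x + c)%R = \int[mu]_x h x)%E.
Proof.
move=> a0 mh h0.
have mf : measurable_fun setT (fun x : measurableTypeR R => (a * x + c)%R : measurableTypeR R).
  by apply: measurable_funD => //; exact: measurable_funM.
have := @ge0_integral_pushforward _ _ (measurableTypeR R) (measurableTypeR R) R _ mf mu setT h measurableT mh.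
rewrite preimage_setT => /(_ (fun x _ => h0 x)) /(congr1 (fun z => a%:E * z)%E) /=.
have -> : (\int[mu]_x h (a * x + c)%R = \int[mu]_x (h \o (fun x => (a * x + c)%R)) x)%E by [].
move=> <-.
rewrite -(@ge0_integral_mscale _ _ _ (pushforward mu (fun x : measurableTypeR R => (a * x + c)%R : measurableTypeR R)) setT measurableT (NngNum (ltW a0)))//.
apply: eq_measure_integral => A mA _.
exact: lebesgue_affine.
Qed.

(** The change of variables is proved for nonnegative functions, hence applied to the positive and
    negative parts. *)
Lemma IR_affine (a b : R) g : 0 < a -> ccf g -> a * IR (fun x => g (a * x + b)) = IR g.
Proof.
move=> a0 cg; have ig := ccf_integrable cg.
have an0 : a != 0 by rewrite gt_eqF.
have ig' := ccf_integrable (ccf_affine b an0 cg).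
rewrite /IR /Rintegral.
rewrite -[X in X * _]/(fine a%:E) -fineM//; last exact: integrable_fin_num.
have mg := measurable_int _ ig; rewrite [in RHS]integralE [in LHS]integralE.
rewrite muleBr//; last by apply: fin_num_adde_defl; rewrite fin_numN; exact: (integrable_neg_fin_num _ ig').
rewrite -(@ge0_integral_affine a b (EFin \o g)^\+%E) ?funepos_ge0//; last exact: measurable_funepos.
rewrite -(@ge0_integral_affine a b (EFin \o g)^\-%E) ?funeneg_ge0//; last exact: measurable_funeneg.
by congr (fine (_ * _ - _ * _)); apply: eq_integral => x _; rewrite ?funeposE ?funenegE.
Qed.

Lemma Int01_IR g : (forall x, ~~ (0 <= x <= 1) -> g x = 0) -> Int01 g = IR g.
Proof.
move=> g0; rewrite /Int01 Rintegral_mkcond; apply: eq_Rintegral => x _.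
by rewrite patchE; case: ifPn => //; rewrite notin_setE => /in_I01/negP /g0.
Qed.

End compactly_supported.

Section multiresolution.
Context {R : realType} (W : cdv_system R) (A l0 : nat).
Hypothesis A0 : (0 < A)%N.
Hypothesis hW : cdv_basis W A l0.
Local Notation S := (cdv_S W).
Local Notation phi := (phi W).
Local Notation psi := (psi W).

Lemma ccf_of_support (g : R -> R) : continuous g -> (forall x, ~~ (1 - S%:R <= x <= S%:R) -> g x = 0) -> ccf g.
Proof.
move=> cg g0; split => //; exists S%:R => x hx; apply: g0; apply/negP => /andP[a b].
by move: hx; rewrite ltNge ler_norml b andbT; lra.
Qed.

Lemma phi_ccf : ccf phi.
Proof. exact: ccf_of_support (continuous_phi A0 hW) (phi_support hW). Qed.

Lemma psi_ccf : ccf psi.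
Proof. exact: ccf_of_support (continuous_psi A0 hW) (psi_support hW). Qed.

Let sh (i : nat) : int := i%:Z + 1 - S%:Z.
(** The low-pass filter [h] and the high-pass filter [g] of the two-scale relations, with the factor
    [sqrt 2] included. *)
Let h (i : nat) : R := Num.sqrt 2 * taps W i.
Let g (i : nat) : R := Num.sqrt 2 * ((-1) ^+ (i + S.+1) * taps W (2 * S - i.+1)).

Let shE i : (sh i)%:~R = i%:R - S%:R + 1 :> R.
Proof. by rewrite /sh rmorphB rmorphD/=; ring. Qed.

Let intrMD (a b c : int) : (a * b + c)%:~R = a%:~R * b%:~R + c%:~R :> R.
Proof. by rewrite intrD intrM. Qed.

Let int2X n : ((2 : int) ^+ n)%:~R = 2 ^+ n :> R.
Proof. by rewrite rmorphXn. Qed.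

Lemma phi_refine x : phi x = \sum_(i < 2 * S) h i * phi (2 * x - (sh i)%:~R).
Proof.
case: hW => [[[_ _ _ [e _] _] _] _ _ _ _]; rewrite {1}e mulr_sumr; apply: eq_bigr => i _.
by rewrite /h mulrA shE; congr (_ * phi _); ring.
Qed.

Lemma psi_refine x : psi x = \sum_(i < 2 * S) g i * phi (2 * x - (sh i)%:~R).
Proof.
rewrite (psiE hW) mulr_sumr; apply: eq_bigr => i _.
by rewrite /g !mulrA shE; congr (_ * phi _); ring.
Qed.

Lemma affine_ccf (u : R -> R) (a b : R) : 0 < a -> ccf u -> ccf (fun x => u (a * x - b)).
Proof. by move=> a0 cu; apply: (@ccf_affine _ u a (- b)) => //; rewrite gt_eqF. Qed.

Lemma IR_pair (u v : R -> R) (a b c : R) : 0 < a -> ccf u -> ccf v ->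
  a * IR (fun x => u (a * x - b) * v (a * x - c)) = IR (fun x => u x * v (x - (c - b))).
Proof.
move=> a0 cu cv; rewrite -(@IR_affine _ a (- b) (fun x => u x * v (x - (c - b))))//.
  by congr (_ * IR _); apply/funext => x; congr (_ * v _); ring.
apply: ccfM => //; have := @ccf_affine _ v 1 (- (c - b)) (oner_neq0 R) cv.
by under eq_fun do rewrite mul1r; case.
Qed.

Lemma phi_orth (i j : int) : 2 * IR (fun x => phi (2 * x - i%:~R) * phi (2 * x - j%:~R)) = (i == j)%:R.
Proof.
have [[[_ _ [_ e] _ _] _] _ _ _ _] := hW.
rewrite IR_pair//; try exact: phi_ccf.
by rewrite /IR -intrB e subr_eq0 eq_sym.
Qed.

Lemma sum_antisym (n : nat) (t : 'I_n -> 'I_n -> R) :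
  (forall i j, t (rev_ord j) (rev_ord i) = - t i j) -> \sum_i \sum_j t i j = 0.
Proof.
move=> ht; have e : \sum_i \sum_j t i j = - \sum_i \sum_j t i j.
  rewrite -sumrN exchange_big/= (reindex_inj rev_ord_inj)/=; apply: eq_bigr => i _.
  rewrite -sumrN (reindex_inj rev_ord_inj)/=; apply: eq_bigr => j _.
  exact: ht.
lra.
Qed.

(** Expanding both functions leaves the pairs of indices with [sh i = 2 k + sh j]. The map sending
    [(i, j)] to the reversed pair of reversals preserves this relation, under which [i] and [j] have
    equal parity, and it changes the alternating sign of the high-pass filter; the terms cancel in
    pairs. *)
Lemma phi_psi_orth0 (k : int) : IR (fun x => phi x * psi (x - k%:~R)) = 0.
Proof.
have cc i j : ccf (fun x => h i * g j * (phi (2 * x - (sh i)%:~R) * phi (2 * x - (2 * k + sh j)%:~R))).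
  apply: ccfZ; apply: ccfM; first exact: affine_ccf _ phi_ccf.
  exact: (affine_ccf _ _ phi_ccf).1.
have -> : (fun x => phi x * psi (x - k%:~R)) = (fun x => \sum_(i < 2 * S) \sum_(j < 2 * S)
    h i * g j * (phi (2 * x - (sh i)%:~R) * phi (2 * x - (2 * k + sh j)%:~R))).
  apply/funext => x; rewrite phi_refine psi_refine mulr_suml; apply: eq_bigr => i _.
  rewrite mulr_sumr; apply: eq_bigr => j _; rewrite mulrACA; congr (_ * (_ * phi _)).
  by rewrite intrMD; ring.
rewrite IR_sum; last by move=> i; apply: ccf_sum => j; exact: cc.
under eq_bigr => i _.
  rewrite IR_sum; last by move=> j; exact: cc.
  under eq_bigr => j _.
    rewrite IRZ; last first.
      by apply: ccfM; [exact: affine_ccf _ phi_ccf | exact: (affine_ccf _ _ phi_ccf).1].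
    over.
  over.
apply: (mulfI (x := 2)); first by rewrite pnatr_eq0.
rewrite mulr0 mulr_sumr; under eq_bigr => i _ do rewrite mulr_sumr.
apply: sum_antisym => i j.
rewrite mulrCA phi_orth [in RHS]mulrCA phi_orth.
have -> : (sh (rev_ord j) == 2 * k + sh (rev_ord i)) = (sh i == 2 * k + sh j).
  by rewrite /sh /=; have := ltn_ord i; have := ltn_ord j; move: (nat_of_ord i) (nat_of_ord j) => a b hb ha; apply/eqP/eqP; lia.
have [e|_] := eqVneq (sh i) (2 * k + sh j); last by rewrite !mulr0 oppr0.
rewrite !mulr1 /h /g /=.
have oij : odd i = odd j.
  case: k {cc} e => n; rewrite /sh => e.
    have -> : nat_of_ord i = (j + n.*2)%N by lia.
    by rewrite oddD odd_double addbF.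
  have -> : nat_of_ord j = (i + (n.+1).*2)%N by lia.
  by rewrite oddD odd_double addbF.
have -> : (2 * S - (2 * S - i.+1).+1 = i)%N by have := ltn_ord i; lia.
have -> : (-1) ^+ (2 * S - i.+1 + S.+1) = - (-1) ^+ (j + S.+1) :> R.
  rewrite -signr_odd -[in RHS]signr_odd !oddD oddB ?ltn_ord//= oij [odd (2 * S)](_ : _ = false) ?addFb; last by rewrite mul2n odd_double.
  by case: (odd j) => /=; case: (odd S) => /=; rewrite ?expr0 ?expr1 ?opprK.
by ring.
Qed.

Lemma phi_refine_iter n : exists s : seq (R * int), forall x, phi x = \sum_(c <- s) c.1 * phi (2 ^+ n * x - (c.2)%:~R).
Proof.
elim: n => [|n [s hs]].
  by exists [:: (1, 0)] => x; rewrite big_seq1/= !mul1r subr0.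
exists [seq (c.1 * h (nat_of_ord i), 2 * c.2 + sh i) | c <- s, i <- enum 'I_(2 * S)] => x.
rewrite hs big_allpairs_dep/=; apply: eq_bigr => c _.
rewrite phi_refine mulr_sumr big_enum/=; apply: eq_bigr => i _.
by rewrite mulrA; congr (_ * phi _); rewrite exprS intrMD; ring.
Qed.

(** The coarse scaling function is a combination of scaling functions of level [l], and rescaling by
    [2 ^ l] reduces each term to [phi_psi_orth0]. *)
Lemma phi_psi_orth (L l : nat) (k k' : int) : (L <= l)%N ->
  IR (fun x => phi (2 ^+ L * x - k%:~R) * psi (2 ^+ l * x - k'%:~R)) = 0.
Proof.
move=> Ll; have [s hs] := phi_refine_iter (l - L).
have p0 : 0 < 2 ^+ l :> R by rewrite exprn_gt0.
have cc (z : int) : ccf (fun x => phi (2 ^+ l * x - z%:~R) * psi (2 ^+ l * x - k'%:~R)).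
  by apply: ccfM; [exact: affine_ccf _ phi_ccf | exact: (affine_ccf _ _ psi_ccf).1].
have -> : (fun x => phi (2 ^+ L * x - k%:~R) * psi (2 ^+ l * x - k'%:~R)) =
    fun x => \sum_(c <- s) c.1 * (phi (2 ^+ l * x - (2 ^+ (l - L) * k + c.2)%:~R) * psi (2 ^+ l * x - k'%:~R)).
  apply/funext => x; rewrite hs mulr_suml; apply: eq_bigr => c _; rewrite mulrA; congr (_ * phi _ * _).
  by rewrite intrMD int2X mulrBr mulrA -exprD subnK//; ring.
rewrite IR_sum; last by move=> c; exact: ccfZ.
rewrite big1// => c _; rewrite IRZ//.
apply: (mulfI (x := 2 ^+ l)); first by rewrite gt_eqF.
rewrite mulr0 mulrCA IR_pair//; [|exact: phi_ccf|exact: psi_ccf].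
by rewrite -rmorphB phi_psi_orth0 mulr0.
Qed.

(** Otherwise the refinement equation propagates the zeros to all points [(u + k) / 2 ^ n]. These
    are dense, so the continuous function [phi] would be zero, against its integral being one. *)
Lemma phi_not_vanishing (u : R) : exists k : int, phi (u - k%:~R) != 0.
Proof.
apply: contrapT => /forallNP h0.
have {}h0 (k : int) : phi (u - k%:~R) = 0 by apply/eqP/negbNE/negP; exact: h0.
have z n (k : int) : phi ((u + k%:~R) / 2 ^+ n) = 0.
  elim: n k => [|n IH] k; first by rewrite divr1 -[k]opprK rmorphN/= h0.
  rewrite phi_refine big1// => i _.
  have -> : 2 * ((u + k%:~R) / 2 ^+ n.+1) - (sh i)%:~R = (u + (k - 2 ^+ n * sh i)%:~R) / 2 ^+ n :> R.
    rewrite [(k - _)%:~R]intrB intrM int2X exprS; field.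
    by rewrite expf_neq0.
  by rewrite IH mulr0.
have p0 x : phi x = 0.
  pose y n : R := (u + (Num.floor (2 ^+ n * x - u))%:~R) / 2 ^+ n.
  have yx : y n @[n --> \oo] --> x.
    apply/cvgrPdistC_le => e e0.
    have c0 : (2^-1 : R) ^+ n @[n --> \oo] --> (0 : R).
      by apply: cvg_expr; rewrite gtr0_norm ?invr_gt0// invf_lt1// ltr1n.
    have /cvgr0Pnorm_le/(_ _ e0) := c0; apply: filterS => n hn.
    apply: le_trans hn; rewrite exprVn [X in _ <= X]ger0_norm ?invr_ge0 ?exprn_ge0//.
    have p2 : 0 < 2 ^+ n :> R by rewrite exprn_gt0.
    have -> : y n - x = - (2 ^+ n * x - u - (Num.floor (2 ^+ n * x - u))%:~R) / 2 ^+ n.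
      by rewrite /y; field; rewrite gt_eqF.
    rewrite normrM normrN [X in _ * X]gtr0_norm ?invr_gt0// ler_piMl ?invr_ge0 ?(ltW p2)//.
    have /andP[a b] := mem_rg1_floor (2 ^+ n * x - u).
    by rewrite ger0_norm ?subr_ge0//; lra.
  have : phi (y n) @[n --> \oo] --> phi x.
    by apply: continuous_cvg => //; exact: (continuous_phi A0 hW).
  rewrite (_ : (fun n => phi (y n)) = cst 0); last by apply/funext => n; exact: z.
  by move/(cvg_lim (@Rhausdorff R)); rewrite lim_cst.
have [[[_ _ [e _] _ _] _] _ _ _ _] := hW.
have := ccf0 (R := R); have := IRZ 0 phi_ccf; rewrite mul0r [X in IR X](_ : _ = phi); last first.
  by apply/funext => x; rewrite mul0r p0.
by rewrite /IR e => /eqP; rewrite oner_eq0.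
Qed.

(** The sum of the absolute values of the translates is continuous, and positive by
    [phi_not_vanishing]; it has a positive minimum over a period, and some translate is at least the
    average of its [2 S + 1] terms. *)
Lemma phi_lower : exists2 c : R, 0 < c & forall t, exists k : int, c <= `|phi (t - k%:~R)|.
Proof.
pose F (t : R) := \sum_(i < (2 * S).+1) `|phi (t + (S%:R - i%:R))|.
have cF : continuous F.
  have cn (a : R) : continuous (fun t => `|phi (t + a)|).
    move=> t; apply: (@continuous_comp _ _ _ (fun t => phi (t + a)) (fun y => `|y|)).
      have := @continuous_affine _ phi 1 a (continuous_phi A0 hW) t.
      by under eq_fun do rewrite mul1r.
    exact: norm_continuous.
  by apply: continuous_sumR => i; exact: cn.
have [|c c01 cm] := @EVT_min R F 0 1 ler01; first exact: continuous_subspaceT.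
have Fpos : 0 < F c.
  rewrite lt_neqAle eq_sym sumr_ge0 ?andbT//; apply/eqP => /eqP.
  rewrite psumr_eq0// => /allP Fc.
  have [k] := phi_not_vanishing c; apply/negP; rewrite negbK; apply/eqP.
  have [kS|kS] := boolP (- S%:Z <= k <= S%:Z); last first.
    apply: (phi_support hW); apply: contra kS => /andP[a b]; move: c01; rewrite in_itv/= => /andP[c0 c1].
    by rewrite -!(ler_int R) rmorphN/= -!pmulrn; apply/andP; split; lra.
  have ki : (absz (k + S%:Z)%R < (2 * S).+1)%N by lia.
  have := Fc (Ordinal ki) (mem_index_enum _); rewrite normr_eq0 /= => /eqP <-.
  congr phi; congr (_ + _).
  have e : Posz (absz (k + S%:Z)) = k + S%:Z by lia.
  by rewrite [(absz _)%:R]pmulrn e intrD -pmulrn; ring.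
exists (F c / (2 * S).+1%:R); first by rewrite divr_gt0.
move=> t; pose n := Num.floor t.
have /andP[a b] := mem_rg1_floor t.
have t01 : t - n%:~R \in `[0, 1]%R by rewrite in_itv/= subr_ge0 a/=; move: b; rewrite -/n => b; apply: ltW; rewrite ltrBlDl.
apply: contrapT => /forallNP hk.
have := cm _ t01; apply/negP; rewrite -ltNge.
have avg (z : R) m : z = \sum_(i < m.+1) z / m.+1%:R.
  by rewrite sumr_const card_ord -[RHS]mulr_natr divfK// pnatr_eq0.
rewrite [X in _ < X](avg _ (2 * S)%N).
apply: ltr_sum; first by apply/hasP; exists ord0; rewrite ?mem_index_enum.
move=> i _; rewrite ltNge; apply/negP => hi; apply: (hk (n + i%:Z - S%:Z)); apply: le_trans hi _.
by rewrite le_eqVlt; apply/orP; left; apply/eqP; congr (`|phi _|); rewrite rmorphB/= rmorphD/= -!pmulrn; ring.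
Qed.

End multiresolution.

(** * Test functions for the lower bounds *)

Section support_arithmetic.
Context {R : realDomainType}.

Lemma dist_support (S x y : R) : 1 - S <= x -> x <= S -> 1 - S <= y -> y <= S -> `|x - y| <= 2 * S.
Proof. by move=> *; rewrite ler_norml; apply/andP; split; lra. Qed.

Lemma near_center (x0 d x : R) : 2 * d <= x0 -> 2 * d <= 1 - x0 -> `|x - x0| < d -> d <= x <= 1 - d.
Proof. by move=> a b; rewrite ltr_norml => /andP[u v]; apply/andP; split; lra. Qed.

End support_arithmetic.

Section test_functions.
Context {R : realType} (W : cdv_system R) (A l0 : nat) (alpha : R) (p q : \bar R).
Hypothesis A0 : (0 < A)%N.
Hypothesis hW : cdv_basis W A l0.
Hypothesis hp : (2%:E <= p)%E.
Hypothesis hq : (1%:E <= q)%E.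
Local Notation nu := (alpha - invp p).
Hypothesis hnu : 1 / 2 < nu.
Local Notation mu := (@lebesgue_measure R).
Local Notation S := (cdv_S W).
Local Notation sq l := (2 `^ (l%:R / 2) : R).

Let hp1 : (1%:E <= p)%E.
Proof. by apply: le_trans hp; rewrite lee_fin ler1n. Qed.

Lemma pow2_gt (x : R) : exists n, x < 2 ^+ n.
Proof.
exists (Num.bound `|x|); apply: le_lt_trans (ler_norm _) _; apply: lt_le_trans (archi_boundP _) _ => //.
by rewrite -natrX ler_nat ltnW// ltn_expl.
Qed.

Lemma sum_geo_le (n L m : nat) : \sum_(m <= l < n) (if (l < L)%N then 2 ^+ l else 0) <= 2 ^+ L :> R.
Proof.
apply: (@le_trans _ _ (\sum_(0 <= l < n) (if (l < L)%N then 2 ^+ l else 0 : R))).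
  have [mn|nm] := leqP m n; last first.
    by rewrite big_geq ?(ltnW nm)// sumr_ge0// => l _; case: ifP => // _; rewrite exprn_ge0.
  rewrite [X in _ <= X](big_cat_nat (n := m))//= lerDr sumr_ge0// => l _.
  by case: ifP => // _; rewrite exprn_ge0.
suff h : forall n, \sum_(0 <= l < n) (if (l < L)%N then 2 ^+ l else 0) <= 2 ^+ (minn n L) :> R.
  by apply: le_trans (h n) _; rewrite ler_weXn2l ?ler1n// geq_minr.
elim=> [|k IH]; first by rewrite big_geq// exprn_ge0.
rewrite big_nat_recr//=; case: ltnP => kL; move: IH.
  rewrite (minn_idPl (ltnW kL)) (minn_idPl kL) exprS; lra.
by rewrite addr0 (minn_idPr kL) (minn_idPr (leqW kL)).
Qed.

Lemma besov_term_l1 (f : R -> R) l : besov_term W l0 alpha p f l <=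
  2 `^ (l%:R * (alpha + 1 / 2 - invp p)) * \sum_(k < nwav l0 l) `|coef W l0 f l k|.
Proof. by rewrite ler_wpM2l ?powR_ge0//; exact: lp_norm_le_l1. Qed.

Lemma sum_abs_coef (f : R -> R) C l : (forall l x, (l0 <= l)%N -> \sum_(k < nwav l0 l) `|wv W l0 l k x| <= C * sq l) ->
  bi f -> (l0 <= l)%N ->
  \sum_(k < nwav l0 l) `|coef W l0 f l k| <= C * sq l * Int01 (fun x => `|f x|).
Proof.
move=> hC bf l0l; have bfw (k : 'I_(nwav l0 l)) : bi (fun x => f x * wv W l0 l k x).
  by apply: biM => //; exact: (bi_wv A0 hW).
apply: (@le_trans _ _ (\sum_(k < nwav l0 l) Int01 (fun x => `|f x * wv W l0 l k x|))).
  by apply: ler_sum => k _; rewrite coefE; exact: Int01_abs.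
rewrite -Int01_sum; last by move=> k; exact: bi_norm.
rewrite -Int01Z; last exact: bi_norm.
apply: Int01_le => [||x x01]; first by apply: bi_sum => k; exact: bi_norm.
  by apply: (@biM _ (cst _)); [exact: bi_cst | exact: bi_norm].
under eq_bigr do rewrite normrM; rewrite -mulr_sumr mulrC ler_wpM2r//; exact: hC.
Qed.

(** Away from the endpoints a wavelet of high level is either zero or an ordinary translate of
    [psi], so that orthogonality on the whole line can be used. *)
Lemma edge_vanish (l k : nat) (x B : R) : (forall k y, (k < S)%N -> B < y -> psiL W k y = 0 /\ psiR W k y = 0) ->
  (l0 < l)%N -> (k < 2 ^ l)%N -> B < 2 ^+ l * x -> B < 2 ^+ l * (1 - x) ->
  wavelet W l0 l k x = 0 \/ (k < 2 ^ l - S)%N /\ wavelet W l0 l k x = sq l * psi W (2 ^+ l * x - k%:R).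
Proof.
move=> hB l0l kl Bx Bx'; rewrite /wavelet gtn_eqF// /mother /at_level.
case: ifPn => kS; first by left; have [-> _] := hB k _ kS Bx; rewrite mulr0.
case: ifPn => kS2; first by right.
left; have kR : (2 ^ l - k.+1 < S)%N by move: kS2 kl (S_gt0 A0 hW); rewrite -leqNgt; clear; lia.
by have [_ ->] := hB _ _ kR Bx'; rewrite mulr0.
Qed.

(** The bump is a scaling function: by [phi_lower] one of its translates is bounded below at [x0],
    and it is orthogonal to the wavelets of level at least [L]. On the coarser levels the 1-norm of
    the coefficients suffices: once [2 ^ (l nu)] is bounded by [2 ^ (L nu)], the terms grow like
    [2 ^ l] and their sum is at most [2 ^ L], which the mass of the bump compensates. *)
Theorem bump (x0 : R) : 0 < x0 < 1 -> exists c C : R, [/\ 0 < c, 0 < C & exists L0 : nat, forall L, (L0 <= L)%N ->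
  exists g : {mfun R >-> R}, [/\ continuous g, c <= `|g x0|, (forall x, `|g x| <= C),
    (forall x, C / 2 ^+ L < `|x - x0| -> g x = 0) &
    forall b : R, (besov_norm W alpha p q l0 (fun x => b * g x)%R <= (`|b| * C * 2 `^ (L%:R * nu))%:E)%E]].
Proof.
move=> /andP[x0_gt0 x0_lt1].
have [c c0 hc] := phi_lower A0 hW; have [M M0 hM] := phi_bounded A0 hW.
have [C C0 hC] := wv_sum_bound A0 hW.
have [_ [B hB] _ _ _] := hW.
pose I1 := IR (fun x => `|phi W x|).
have cabs : ccf (fun x => `|phi W x|).
  have [cphi [K hK]] := phi_ccf A0 hW; split; last by exists K => x /hK ->; rewrite normr0.
  by move=> x; apply: continuous_comp; [exact: cphi | exact: norm_continuous].
have I10 : 0 <= I1 by apply: Rintegral_ge0 => x _.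
pose C1 := 1 + M + 2 * S%:R + C * I1.
have S0 : 0 <= S%:R :> R by [].
have CI : 0 <= C * I1 by rewrite mulr_ge0// ltW.
have C10 : 0 < C1 by rewrite /C1; lra.
exists c, C1; split => //.
(* At distance [d] from the endpoints the boundary wavelets of level at least [L] vanish, and for
   large [L] the support of the bump stays there. *)
pose d := Num.min x0 (1 - x0) / 2.
have d0 : 0 < d by rewrite divr_gt0// lt_min x0_gt0 subr_gt0.
have dx : 2 * d <= x0 by rewrite mulrC divfK// ge_min lexx.
have dx' : 2 * d <= 1 - x0 by rewrite mulrC divfK// ge_min lexx orbT.
have [n1 hn1] := pow2_gt (2 * S%:R / d); have [n2 hn2] := pow2_gt (B / d).
exists (maxn l0.+1 (maxn n1 n2)) => L; rewrite !geq_max => /andP[l0L /andP[n1L n2L]].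
have p0 : 0 < 2 ^+ L :> R by rewrite exprn_gt0.
have hS : 2 * S%:R / 2 ^+ L < d.
  rewrite ltr_pdivrMr// [d * _]mulrC -ltr_pdivrMr//; apply: lt_le_trans hn1 _.
  by rewrite ler_weXn2l ?ler1n.
have hBL l : (L <= l)%N -> B < 2 ^+ l * d.
  move=> Ll; rewrite -ltr_pdivrMr//; apply: lt_le_trans hn2 _.
  by rewrite ler_weXn2l ?ler1n// (leq_trans n2L).
have [k hk] := hc (2 ^+ L * x0).
pose g x := phi W (2 ^+ L * x - k%:~R).
have cg : ccf g by exact: affine_ccf (phi_ccf A0 hW).
have mg : measurable_fun setT g by apply: continuous_measurable_fun; case: cg.
have bg : bi g by apply: bi_continuous; case: cg.
have gS x : g x != 0 -> `|x - x0| <= 2 * S%:R / 2 ^+ L.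
  move=> gx; have /andP[a1 a2] : 1 - S%:R <= 2 ^+ L * x - k%:~R <= S%:R.
    by apply: contraNT gx => /(phi_support hW) h; rewrite /g h.
  have /andP[b1 b2] : 1 - S%:R <= 2 ^+ L * x0 - k%:~R <= S%:R.
    by apply: contraLR hk => /(phi_support hW) ->; rewrite normr0 -ltNge.
  rewrite ler_pdivlMr// -(gtr0_norm p0) -normrM.
  rewrite (_ : (x - x0) * _ = (2 ^+ L * x - k%:~R) - (2 ^+ L * x0 - k%:~R)); last by ring.
  by move: a1 a2 b1 b2; exact: dist_support.
have gd x : g x != 0 -> d <= x <= 1 - d.
  by move=> /gS h; have := le_lt_trans h hS; exact: near_center.
have gI x : g x != 0 -> 0 <= x <= 1.
  move=> /gd /andP[u v]; rewrite (le_trans (ltW d0) u) (le_trans v)// lerBlDr lerDl ltW//.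
have I1g : Int01 (fun x => `|g x|) = I1 / 2 ^+ L.
  rewrite Int01_IR; last first.
    by move=> x x01; apply/eqP; rewrite normr_eq0; apply: contraNT x01 => /gI.
  rewrite /I1 -(@IR_affine _ (2 ^+ L) (- k%:~R) (fun x => `|phi W x|))// mulrC mulKf ?gt_eqF//.
have hi l k' : (L <= l)%N -> (k' < nwav l0 l)%N -> Int01 (fun x => g x * wavelet W l0 l k' x) = 0.
  move=> Ll; have l0l : (l0 < l)%N by exact: leq_trans Ll.
  rewrite /nwav gtn_eqF// => k'l.
  have ev x : g x != 0 -> wavelet W l0 l k' x = 0 \/ (k' < 2 ^ l - S)%N /\ wavelet W l0 l k' x = sq l * psi W (2 ^+ l * x - k'%:R).
    move=> /gd /andP[u v]; apply: (edge_vanish hB l0l k'l).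
      by apply: lt_le_trans (hBL l Ll) _; rewrite ler_wpM2l ?exprn_ge0.
    by apply: lt_le_trans (hBL l Ll) _; rewrite ler_wpM2l ?exprn_ge0// lerBrDr addrC -lerBrDr.
  have [kS|kS] := boolP ((S <= k')%N && (k' < 2 ^ l - S)%N); last first.
    rewrite -[RHS]Int01_cst; apply: Int01_eq => x _ /=.
    have [->|gx] := eqVneq (g x) 0; first by rewrite mul0r.
    have [->|[k'2 e]] := ev x gx; first by rewrite mulr0.
    move: kS; rewrite k'2 andbT -ltnNge => kS.
    have [u v] := andP (gd x gx).
    rewrite /wavelet gtn_eqF// /mother /at_level kS.
    have hx : B < 2 ^+ l * x by apply: lt_le_trans (hBL l Ll) _; rewrite ler_wpM2l ?exprn_ge0.
    by have [-> _] := hB k' _ kS hx; rewrite !mulr0.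
  have e x : wavelet W l0 l k' x = sq l * psi W (2 ^+ l * x - k'%:R).
    by case/andP: kS => kS1 kS2; rewrite /wavelet gtn_eqF// /mother /at_level ltnNge kS1/= kS2.
  rewrite Int01_IR; last first.
    by move=> x x01; apply/eqP; rewrite mulf_eq0; apply/orP; left; apply: contraNT x01 => /gI.
  rewrite (_ : (fun x => _) = (fun x => sq l * (phi W (2 ^+ L * x - k%:~R) * psi W (2 ^+ l * x - (k'%:Z)%:~R)))).
    rewrite IRZ ?(phi_psi_orth A0 hW)// ?mulr0//; apply: ccfM => //.
    have pl : 0 < (2 : R) ^+ l by rewrite exprn_gt0.
    by case: (affine_ccf (k'%:~R) pl (psi_ccf A0 hW)).
  by apply/funext => x; rewrite e /g mulrCA -pmulrn.
pose G : {mfun R >-> R} := HB.pack g (isMeasurableFun.Build _ _ _ _ g mg).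
exists G; split.
- by case: cg.
- exact: hk.
- by move=> x; apply: le_trans (hM _) _; rewrite /C1; lra.
- move=> x hx; apply/eqP; apply/negPn/negP => /gS; apply/negP; rewrite -ltNge.
  by apply: le_lt_trans hx; rewrite ler_wpM2r ?invr_ge0 ?(ltW p0)// /C1; lra.
- move=> b; apply: besov_norm_le => // n.
  have bbg : bi (fun x => b * g x) by apply: (@biM _ (cst b)) => //; exact: bi_cst.
  have term l : (l0 <= l)%N -> besov_term W l0 alpha p (fun x => b * g x) l <=
      `|b| * (C * I1) * 2 `^ (L%:R * nu) / 2 ^+ L * (if (l < L)%N then 2 ^+ l else 0).
    move=> l0l; case: ltnP => lL; last first.
      rewrite mulr0; apply: le_trans (besov_term_l1 _ _) _; rewrite big1 ?mulr0// => k' _.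
      apply/eqP; rewrite normr_eq0; apply/eqP.
      rewrite /coef -/(Int01 _) (_ : (fun x => _) = (fun x => b * (g x * wavelet W l0 l k' x))).
        by rewrite Int01Z ?hi ?mulr0//; apply: biM => //; exact: (bi_wavelet A0 hW).
      by apply/funext => x; rewrite mulrA.
    apply: le_trans (besov_term_l1 _ _) _.
    apply: le_trans (ler_wpM2l (powR_ge0 _ _) (sum_abs_coef hC bbg l0l)) _.
    have -> : Int01 (fun x => `|b * g x|) = `|b| * (I1 / 2 ^+ L).
      by rewrite -I1g -Int01Z; [congr Int01; apply/funext => x; rewrite normrM | exact: bi_norm].
    have e1 : 2 `^ (l%:R * (alpha + 1 / 2 - invp p)) * sq l <= 2 `^ (L%:R * nu) * 2 ^+ l.
      rewrite -powR_mulrn// -!powRD ?pnatr_eq0 ?implybT// ler_powR ?ler1n//.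
      have : l%:R * nu <= L%:R * nu by rewrite ler_wpM2r ?ler_nat ?(ltnW lL)// (le_trans _ (ltW hnu))// divr_ge0.
      lra.
    have P0 : 0 <= `|b| * (C * I1) / 2 ^+ L by rewrite divr_ge0 ?mulr_ge0// ltW.
    have := ler_wpM2l P0 e1.
    by move: (_ `^ _) (_ `^ _) (_ `^ _) => u v w; lra.
  apply: (@le_trans _ _ (\sum_(l0 <= l < n) `|b| * (C * I1) * 2 `^ (L%:R * nu) / 2 ^+ L * (if (l < L)%N then 2 ^+ l else 0))).
    by rewrite big_nat_cond [X in _ <= X]big_nat_cond; apply: ler_sum => l /andP[/andP[l0l _] _]; exact: term.
  rewrite -mulr_sumr.
  have P0 : 0 <= `|b| * (C * I1) * 2 `^ (L%:R * nu) / 2 ^+ L.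
    by rewrite divr_ge0 ?mulr_ge0 ?powR_ge0// ltW.
  apply: le_trans (ler_wpM2l P0 (sum_geo_le n L l0)) _.
  by rewrite divfK ?gt_eqF// ler_wpM2r ?powR_ge0// ler_wpM2l// /C1; lra.
Qed.

(** All the bumps belong to level [L] and all their nonzero coefficients have the same size. The
    number of wavelets then cancels the factor [2 ^ (- L / p)] of the weight, so that the norm grows
    with exponent [alpha], not [nu]. *)
Theorem haystack : exists c C : R, [/\ 0 < c, 0 < C & exists L0 : nat, forall L, (L0 <= L)%N ->
  exists (K : nat) (e : 'I_K -> {mfun R >-> R}) (B : 'I_K -> set R),
    [/\ c * 2 ^+ L <= K%:R,
        forall i, [/\ continuous (e i), forall x, `|e i x| <= C & Int01 (fun x => e i x ^+ 2) = (2 ^+ L)^-1],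
        forall i, [/\ measurable (B i : set (measurableTypeR R)), (mu (B i) <= (C / 2 ^+ L)%:E)%E,
                   B i `<=` [set x | 0 <= x <= 1] & forall x, ~ B i x -> e i x = 0],
        trivIset setT B &
        forall (b : R) (w : 'I_K -> bool), (besov_norm W alpha p q l0
           (fun x => b * \sum_i (w i)%:R * e i x)%R <= (`|b| * 2 `^ (L%:R * alpha))%:E)%E]].
Proof.
have [M M0 hM] := psi_bounded A0 hW.
have S0 := S_gt0 A0 hW; have S0' : 0 < S%:R :> R by rewrite ltr0n.
exists (4 * S%:R)^-1, (1 + M + 2 * S%:R); split; [by rewrite invr_gt0 mulr_gt0 | by rewrite ltr_wpDr ?ltr_wpDr// mulr_ge0 |].
(* This gives [2 ^ L > 8 S], so that the rounding in [K] loses at most half of [2 ^ L / (2 S)]. *)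
exists (maxn l0.+1 (8 * S)) => L; rewrite geq_max => /andP[l0L SL].
have p0 : 0 < 2 ^+ L :> R by rewrite exprn_gt0.
have L8 : (8 * S < 2 ^ L)%N by apply: leq_ltn_trans SL _; exact: ltn_expl.
(* Indices at distance [2 S] place the supports in disjoint cells; taking one cell fewer than would
   fit keeps every index among the interior wavelets. *)
pose K := (2 ^ L %/ (2 * S)).-1; pose k i := (S + 2 * S * i)%N.
have kK i : (i < K)%N -> (2 * S * i.+1 < 2 ^ L - S)%N.
  move=> iK; have h : (i.+2 <= 2 ^ L %/ (2 * S))%N by move: iK; rewrite /K; lia.
  have := leq_trunc_div (2 ^ L) (2 * S); have := leq_mul2r (2 * S) i.+2 (2 ^ L %/ (2 * S)).
  by rewrite h orbT => h2 h3; have := leq_trans h2 h3; lia.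
have Kc : (4 * S%:R)^-1 * 2 ^+ L <= (K%:R : R).
  rewrite mulrC ler_pdivrMr ?mulr_gt0// -natrX -!natrM ler_nat.
  have := divn_eq (2 ^ L) (2 * S); have := ltn_pmod (2 ^ L) (_ : 0 < 2 * S)%N.
  move=> /(_ ltac:(lia)); rewrite /K; move: (2 ^ L %/ (2 * S))%N => u; move: (_ %% _)%N => v; nia.
clearbody K.
pose e0 (i : nat) x := psi W (2 ^+ L * x - (k i)%:R).
have ce i : continuous (e0 i) by case: (affine_ccf (k i)%:R p0 (psi_ccf A0 hW)).
have me i : measurable_fun setT (e0 i) by exact: continuous_measurable_fun.
pose e (i : 'I_K) : {mfun R >-> R} := HB.pack (e0 i) (isMeasurableFun.Build _ _ _ _ (e0 i) (me i)).
pose B (i : 'I_K) : set R := [set x | (2 * S * i)%:R < 2 ^+ L * x <= (2 * S * i.+1)%:R].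
have BE i : B i = `](2 * S * i)%:R / 2 ^+ L, (2 * S * i.+1)%:R / 2 ^+ L]%classic.
  by apply/seteqP; split => x /=; rewrite in_itv/= ltr_pdivrMr// ler_pdivlMr// mulrC.
have sL0 : 0 < sq L by exact: powR_gt0.
have kS i : (i < K)%N -> (S <= k i)%N && (k i < 2 ^ L - S)%N by move=> /kK; rewrite /k; clear; lia.
have knw i : (i < K)%N -> (k i < nwav l0 L)%N.
  by move=> /kS /andP[_ h]; rewrite /nwav gtn_eqF//; exact: leq_trans h (leq_subr _ _).
have ewE i x : (i < K)%N -> 0 <= x <= 1 -> wv W l0 L (k i) x = sq L * e0 i x.
  move=> iK x01; rewrite wv_id//; case/andP: (kS _ iK) => h1 h2.
  by rewrite /wavelet gtn_eqF// /mother /at_level ltnNge h1/= h2.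
have sqL : (sq L) ^+ 2 = 2 ^+ L.
  by rewrite -powR_mulrn ?powR_ge0// -powRrM divfK ?pnatr_eq0// powR_mulrn.
have be i : bi (e0 i) by exact: bi_continuous.
have ein i l k' : (i < K)%N -> (l0 <= l)%N -> (k' < nwav l0 l)%N -> Int01 (fun x => e0 i x * wv W l0 l k' x) =
    (sq L)^-1 * ((L == l) && (k i == k'))%:R.
  move=> iK l0l k'l; rewrite -(wv_orth hW (ltnW l0L) l0l (knw _ iK) k'l).
  have bb : bi (fun x => wv W l0 L (k i) x * wv W l0 l k' x).
    by apply: biM; apply: (bi_wv A0 hW) => //; [exact: ltnW | exact: knw].
  rewrite -Int01Z//; apply: Int01_eq => x x01.
  by rewrite ewE// -mulrA mulKf// gt_eqF.
exists K, e, B; split.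
- exact: Kc.
- move=> i; split; first exact: (ce i).
    by move=> x; apply: le_trans (hM _) _; have := ltW S0'; lra.
  have := ein i L (k i) (ltn_ord i) (ltnW l0L) (knw _ (ltn_ord i)); rewrite !eqxx mulr1 => h.
  have h2 : Int01 (fun x => e0 i x * wv W l0 L (k i) x) = sq L * Int01 (fun x => e0 i x ^+ 2).
    by rewrite -Int01Z; [apply: Int01_eq => x x01; rewrite ewE// expr2 mulrCA | exact: biX].
  apply: (mulfI (x := sq L)); first by rewrite gt_eqF.
  by rewrite -[LHS]h2 h -sqL expr2 invfM mulrA divff ?mul1r ?gt_eqF.
- move=> i; split.
  + by rewrite BE; exact: measurable_itv.
  + rewrite BE lebesgue_measure_itv/= lte_fin ltr_pM2r ?invr_gt0// ltr_nat ltn_pmul2l ?muln_gt0// ltnS leqnn.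
    rewrite -EFinB lee_fin -mulrBl ler_wpM2r ?invr_ge0 ?(ltW p0)//.
    by rewrite -natrB ?leq_mul2l ?leqnSn ?orbT// -mulnBr subSnn muln1 natrM; lra.
  + move=> x /= /andP[h1 h2]; apply/andP; split.
      by rewrite -(pmulr_rge0 _ p0); apply: le_trans (ltW h1).
    rewrite -(ler_pM2l p0) mulr1; apply: le_trans h2 _; rewrite -natrX ler_nat.
    exact: leq_trans (ltnW (kK i (ltn_ord i))) (leq_subr _ _).
  + move=> x Bx; apply: (psi_support hW); apply/negP => /andP[h1 h2]; apply: Bx => /=.
    have e1 : (2 * S * i.+1)%:R = 2 * S%:R * i%:R + 2 * S%:R :> R by rewrite !natrM -[i.+1%:R]natr1; ring.
    have e2 : (2 * S * i)%:R = 2 * S%:R * i%:R :> R by rewrite !natrM.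
    have e3 : (k i)%:R = S%:R + 2 * S%:R * i%:R :> R by rewrite /k natrD e2.
    move: h1 h2; rewrite /B/= e1 e2 e3 => h1 h2; apply/andP; split; lra.
- apply/trivIsetP => i j _ _ ij; apply/seteqP; split => // x /= [/andP[a1 a2] /andP[b1 b2]].
  have h1 := lt_le_trans a1 b2; have h2 := lt_le_trans b1 a2.
  move: h1 h2; rewrite !ltr_nat !ltn_pmul2l ?muln_gt0// !ltnS => h1 h2.
  by move: ij; rewrite -val_eqE/= eqn_leq h1 h2.
- move=> b w; set f := fun x => _.
  have cf l k' : (l0 <= l)%N -> (k' < nwav l0 l)%N -> coef W l0 f l k' =
      b * (sq L)^-1 * \sum_(i < K) (w i)%:R * ((L == l) && (k i == k'))%:R.
    move=> l0l k'l; rewrite coefE.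
    have bb (i : 'I_K) : bi (fun x => (w i)%:R * (e0 i x * wv W l0 l k' x)).
      apply: (@biM _ (cst _)); first exact: bi_cst.
      by apply: biM => //; exact: (bi_wv A0 hW).
    rewrite (_ : (fun x => _) = (fun x => b * \sum_(i < K) (w i)%:R * (e0 i x * wv W l0 l k' x))); last first.
      by apply/funext => x; rewrite /f -mulrA mulr_suml; congr (_ * _); apply: eq_bigr => i _; rewrite mulrA.
    rewrite Int01Z; last exact: bi_sum.
    rewrite Int01_sum// -mulrA; congr (_ * _); rewrite mulr_sumr; apply: eq_bigr => i _.
    by rewrite (Int01Z _ (biM (be i) (bi_wv A0 hW l0l k'l))) (ein i l k' (ltn_ord i) l0l k'l) mulrCA.
  have t0 l : (l0 <= l)%N -> l != L -> besov_term W l0 alpha p f l = 0.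
    move=> l0l lL; apply/eqP; rewrite eq_le besov_term_ge0 andbT.
    apply: le_trans (besov_term_l1 _ _) _; rewrite big1 ?mulr0// => k' _.
    rewrite cf// big1 ?mulr0 ?normr0// => i _.
    by rewrite eq_sym (negbTE lL) mulr0.
  have tL : besov_term W l0 alpha p f L <= `|b| * 2 `^ (L%:R * alpha).
    have h0 : 0 <= `|b| / sq L by rewrite divr_ge0 ?powR_ge0.
    rewrite /besov_term; apply: le_trans (ler_wpM2l (powR_ge0 _ _) (@lp_norm_le_sup _ p (nwav l0 L) _ (`|b| / sq L) hp1 h0 _)) _.
      move=> k' k'l; rewrite cf ?(ltnW l0L)// normrM normrM (gtr0_norm (_ : 0 < (sq L)^-1)) ?invr_gt0//.
      rewrite ler_piMr// eqxx/=.
      have [/existsP[i /eqP ki]|/existsPn h] := boolP [exists i : 'I_K, k i == k'].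
        rewrite (bigD1 i)//= ki eqxx big1 ?addr0 ?mulr1; first by case: (w i); rewrite ?normr1 ?normr0.
        move=> j ji; rewrite (_ : (k j == k') = false) ?mulr0//; apply/negbTE; apply: contra ji.
        rewrite -ki /k eqn_add2l eqn_pmul2l ?muln_gt0// => /eqP h; exact/eqP/val_inj.
      by rewrite big1 ?normr0// => i _; rewrite (negbTE (h i)) mulr0.
    rewrite (_ : (nwav l0 L)%:R = 2 `^ L%:R :> R); last by rewrite /nwav gtn_eqF// natrX powR_mulrn.
    have -> : L%:R * alpha = L%:R * (alpha + 1 / 2 - invp p) + (L%:R * invp p + - (L%:R / 2)) by field.
    rewrite -powRrM -powRN !powRD ?pnatr_eq0 ?implybT//.
    by move: (_ `^ _) (_ `^ _) (_ `^ _) => u1 u2 u3; rewrite le_eqVlt; apply/orP; left; apply/eqP; ring.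
  apply: besov_norm_le => // n.
  have [Ln|Ln] := boolP ((l0 <= L)%N && (L < n)%N); last first.
    rewrite big_nat_cond big1 ?mulr_ge0 ?powR_ge0// => l /andP[/andP[h1 h2] _].
    by rewrite t0//; apply: contraNneq Ln => <-; rewrite h1 h2.
  rewrite (bigD1_seq L) ?mem_index_iota ?iota_uniq//= big_nat_cond big1 ?addr0//.
  by move=> l /andP[/andP[h1 h2] lL]; rewrite t0.
Qed.

End test_functions.

(** * Lower bounds *)

Section clamped_data.
Context (R : realType).
Local Notation Z := (R * R)%type.
Local Open Scope ereal_scope.

Lemma measurable_clamp : measurable_fun setT (@clamp R).
Proof. by apply: continuous_measurable_fun; exact: continuous_clamp. Qed.

(** Privacy is assumed on samples with covariates in the unit interval only. Clamping does not
    change the law of the transcripts, as the covariates are uniform, and it makes the mechanism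
    private on all samples. *)
Definition clampZ (z : Z) : Z := (z.1, clamp z.2).

Lemma measurable_clampZ : measurable_fun setT clampZ.
Proof.
apply/measurable_fun_pairP; split => /=; first exact: measurable_fst.
exact: (measurableT_comp measurable_clamp measurable_snd).
Qed.

Lemma uniform_eq (g h : R -> \bar R) : measurable_fun setT g -> measurable_fun setT h ->
  (forall x, 0 <= g x) -> (forall x, 0 <= h x) -> (forall x, (0 <= x <= 1)%R -> g x = h x) ->
  \int[uniform_prob (@ltr01 R)]_x g x = \int[uniform_prob (@ltr01 R)]_x h x.
Proof.
move=> mg mh g0 h0 gh; rewrite !integral_uniform//; congr (_ * _); apply: eq_integral => x.
by rewrite inE/= in_itv/=; exact: gh.
Qed.

Lemma integral_P_clamp (f : {mfun R >-> R}) (g : Z -> \bar R) : measurable_fun setT g ->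
  (forall z, 0 <= g z) -> \int[P_ f]_z g z = \int[P_ f]_z g (clampZ z).
Proof.
move=> mg g0; have mg' : measurable_fun setT (fun z => g (clampZ z)) by exact: (measurableT_comp mg measurable_clampZ).
rewrite [LHS](integral_P_ f mg g0) [RHS](integral_P_ f mg' (fun z => g0 _)); apply: uniform_eq.
- exact: measurable_noise.
- exact: (measurable_noise f mg' (fun z => g0 _)).
- by move=> x; exact: integral_ge0.
- by move=> x; exact: integral_ge0.
- by move=> x x01; apply: eq_integral => y _; rewrite /clampZ/= clamp_id.
Qed.

Definition clamps n (z : n.-tuple Z) : n.-tuple Z := [tuple of map clampZ z].

Lemma measurable_clamps n : measurable_fun setT (@clamps n).
Proof.
apply/measurable_fun_tnthP => i.
rewrite (_ : _ \o _ = clampZ \o (@tnth n Z ^~ i)); last first.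
  by apply/funext => z /=; rewrite tnth_map.
by apply: (measurableT_comp measurable_clampZ); exact: measurable_tnth.
Qed.

Lemma clamps_cons n x (z : n.-tuple Z) : clamps (Defs.cons_tuple (x, z)) = Defs.cons_tuple (clampZ x, clamps z).
Proof. by apply: val_inj. Qed.

Lemma integral_prod_clamps n (f : {mfun R >-> R}) (F : n.-tuple Z -> \bar R) : measurable_fun setT F ->
  (forall z, 0 <= F z) ->
  \int[prod_prob (fun _ : 'I_n => P_ f)]_z F z = \int[prod_prob (fun _ : 'I_n => P_ f)]_z F (clamps z).
Proof.
elim: n F => [|n IH] F mF F0.
  by apply: eq_integral => z _; congr F; rewrite (tuple0 z) [RHS]tuple0.
have mF' : measurable_fun setT (F \o @clamps n.+1) by exact: (measurableT_comp mF (@measurable_clamps _)).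
rewrite (ge0_integral_prod_probS _ mF F0) (ge0_integral_prod_probS _ mF' (fun z => F0 _)) /=.
rewrite integral_P_clamp; last 2 first.
- exact: measurable_int_cons_r.
- by move=> x; exact: integral_ge0.
apply: eq_integral => x _; rewrite IH//; last exact: (measurableT_comp mF (@measurable_cons_l _ _ _ _)).
by apply: eq_integral => z _; rewrite clamps_cons.
Qed.

Lemma sample_clamps n (z : n.-tuple Z) : sample_space (clamps z).
Proof. by move=> i; rewrite tnth_map/=; exact: clamp_in. Qed.

Lemma neighbours_clamps n (z z' : n.-tuple Z) : neighbours z z' -> neighbours (clamps z) (clamps z').
Proof.
move=> h; apply: leq_trans h; apply: subset_leq_card; apply/fintype.subsetP => i; rewrite !inE !tnth_map.
by apply: contra => /eqP ->.
Qed.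

Context d (T : measurableType d).

Lemma mixture_clamps n (K : R.-pker (n.-tuple Z) ~> T) (f : {mfun R >-> R}) A : measurable A ->
  mixture (prod_prob (fun _ : 'I_n => P_ f)) K A = transcript_of (precomp K (@measurable_clamps n)) (P_ f) A.
Proof.
move=> mA; rewrite /transcript_of /mixture integral_prod_clamps//.
exact: measurable_kernel.
Qed.

Lemma splits_clamps n (K : R.-pker (n.-tuple Z) ~> T) (f0 f1 : {mfun R >-> R}) kap s :
  splits (mixture (prod_prob (fun _ : 'I_n => P_ f0)) K : probability T R)
         (mixture (prod_prob (fun _ : 'I_n => P_ f1)) K : probability T R) kap s ->
  splits (transcript_of (precomp K (@measurable_clamps n)) (P_ f0))
         (transcript_of (precomp K (@measurable_clamps n)) (P_ f1)) kap s.
Proof.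
move=> [ms s1 h1 h0]; split; [exact: ms | exact: s1 | |] => g mg g0.
  by rewrite -(h1 g mg g0); apply: eq_measure_integral => A mA _; exact/esym/mixture_clamps.
by rewrite -(h0 g mg g0); apply: eq_measure_integral => A mA _; exact/esym/mixture_clamps.
Qed.

Lemma private_clamps n (K : R.-pker (n.-tuple Z) ~> T) (e delta : R) : diff_private K e delta ->
  forall z z', neighbours z z' -> forall A, measurable A ->
  precomp K (@measurable_clamps n) z A <=
    (expR e)%:E * precomp K (@measurable_clamps n) z' A + delta%:E.
Proof. by move=> dp z z' zz A mA; apply: dp => //; [exact: sample_clamps..|exact: neighbours_clamps]. Qed.

End clamped_data.

(** * The separation contributed by one server *)

Section server_arithmetic.
Context (R : realType).

Lemma pow1D_le (n : nat) (x : R) : 0 <= x -> (1 + x) ^+ n <= expR (n%:R * x).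
Proof.
move=> x0; rewrite mulrC expRM_natr; apply: lerXn2r; rewrite ?nnegrE ?expR_ge0// ?addr_ge0//.
exact: expR_ge1Dx.
Qed.

Lemma expR_sub1_le (y : R) : expR y - 1 <= y * expR y.
Proof.
have := expR_ge1Dx (- y); rewrite expRN => h.
have e0 := expR_gt0 y; have := ler_wpM2r (ltW e0) h; rewrite mulVf ?gt_eqF//; lra.
Qed.

Lemma pow1D_sub1_le (n : nat) (x Y : R) : 0 <= x -> n%:R * x <= Y ->
  (1 + x) ^+ n - 1 <= n%:R * x * expR Y.
Proof.
move=> x0 nx; apply: le_trans (lerB (pow1D_le n x0) (lexx 1)) _.
apply: le_trans (expR_sub1_le _) _; rewrite ler_wpM2l ?mulr_ge0//.
by rewrite ler_expR.
Qed.

End server_arithmetic.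

Section gaussian_server.
Context (R : realType).
Local Notation Z := (R * R)%type.

Lemma Ex_sq_le1 d (T : measurableType d) (Q0 Q1 kap : probability T R) s : splits Q0 Q1 kap s ->
  0 <= Ex kap (fun t => `|s t| ^+ 2) <= 1.
Proof. by move=> spl; have [_] := ExE kap (bdd_X 2 (bdd_abs spl)). Qed.

Lemma gauss_likelihood (f0 f1 : {mfun R >-> R}) (tau : R) :
  (\int[P_ f0]_z (`|gauss_lik f0 f1 z - 1| ^+ 1)%:E <= tau%:E)%E ->
  likelihood (P_ f0) (P_ f1) (gauss_lik f0 f1) tau.
Proof.
move=> h; split.
- exact: measurable_gauss_lik.
- by move=> z; exact: expR_ge0.
- by move=> g mg g0; exact: gauss_lik_density.
- by move: h; under eq_integral do rewrite expr1.
Qed.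

Lemma group_final (l a Z0 Ct q t u : R) : 2 * l <= Z0 ^+ 2 * a ^+ 2 / 2 + l / 2 + 2 * ((1 + Z0) * (Ct * q)) + t * u ->
  0 <= a ^+ 2 -> 0 <= q -> 0 <= t * u -> 0 <= Z0 -> 0 <= Ct ->
  l <= (Z0 ^+ 2 + 2 * ((1 + Z0) * Ct)) * (a ^+ 2 + q) + t * u.
Proof.
move=> h a0 q0 t0 z0 c0.
have h1 : 0 <= Z0 ^+ 2 * a ^+ 2 by rewrite mulr_ge0 ?sqr_ge0.
have h2 : 0 <= Z0 ^+ 2 * q by rewrite mulr_ge0 ?sqr_ge0.
have h3 : 0 <= (1 + Z0) * Ct * a ^+ 2 by rewrite mulr_ge0// mulr_ge0 ?addr_ge0.
have h4 : 0 <= (1 + Z0) * Ct * q by rewrite mulr_ge0// mulr_ge0 ?addr_ge0.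
lra.
Qed.

(** As long as [n e h w] is at most one, the compounded factor of group privacy exceeds one by at
    most a multiple of [n e h w]. *)
Lemma group_factor (n : nat) (e h w Ct Ceps : R) : 0 < e <= Ceps -> 0 <= h -> 0 <= w -> 0 <= Ct ->
  n%:R * e * h * w <= 1 -> forall Y Z0, Y = expR Ceps * Ct -> Z0 = Y * expR Y ->
  1 <= (1 + (expR e - 1) * (Ct * h * w)) ^+ n <= 1 + Z0 * (n%:R * e * h * w).
Proof.
move=> /andP[e0 eC] h0 w0 c0 a1 Y Z0 YE Z0E.
have e1 : 0 <= expR e - 1 by rewrite subr_ge0 ltW// expR_gt1.
have t0 : 0 <= Ct * h * w by rewrite !mulr_ge0.
have x0 : 0 <= (expR e - 1) * (Ct * h * w) by exact: mulr_ge0.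
have eE : expR e - 1 <= expR Ceps * e.
  by apply: le_trans (expR_sub1_le _) _; rewrite mulrC ler_wpM2r ?(ltW e0)// ler_expR.
have a0 : 0 <= n%:R * e * h * w by rewrite !mulr_ge0// ltW.
have Y0 : 0 <= Y by rewrite YE mulr_ge0 ?expR_ge0.
have yY : n%:R * ((expR e - 1) * (Ct * h * w)) <= Y * (n%:R * e * h * w).
  have nt : 0 <= n%:R * (Ct * h * w) by rewrite mulr_ge0.
  have := ler_wpM2r nt eE; rewrite YE; lra.
apply/andP; split; first by rewrite exprn_ege1// lerDl.
have yY1 : n%:R * ((expR e - 1) * (Ct * h * w)) <= Y.
  by apply: le_trans yY _; rewrite ler_piMr.
have := pow1D_sub1_le x0 yY1; have := ler_wpM2r (expR_ge0 Y) yY; rewrite Z0E; lra.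
Qed.

(** The first bound is data processing, from the second moment of the likelihood ratio. The second
    is group privacy without a cut. The third cuts at [M] and uses the moment of order [2 (k + 1)];
    [V] is the square of the scale of the likelihood deviation in it. *)
Lemma gaussian_server (k : nat) (Cb Ceps : R) : 0 < Cb -> 0 < Ceps -> exists2 C : R, 0 < C &
  forall d (T : measurableType d) n (K : R.-pker (n.-tuple Z) ~> T) (f0 f1 : {mfun R >-> R}) (h w : R)
    (B : set R) (e delta : R) (kap : probability T R) (s : T -> R),
  0 < h <= 1 -> 0 < w -> measurable (B : set (measurableTypeR R)) -> (lebesgue_measure B <= (Cb * w)%:E)%E ->
  (forall x, `|f1 x - f0 x| <= h) -> (forall x, ~ B x -> f1 x = f0 x) ->
  0 < e <= Ceps -> 0 <= delta -> diff_private K e delta ->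
  splits (mixture (prod_prob (fun _ : 'I_n => P_ f0)) K : probability T R)
         (mixture (prod_prob (fun _ : 'I_n => P_ f1)) K : probability T R) kap s ->
  [/\ Ex kap (fun t => `|s t| ^+ 2) <= C * (n%:R * h ^+ 2 * w),
      Ex kap (fun t => `|s t| ^+ 2) <= C * ((n%:R * e * h * w) ^+ 2 + n%:R * delta * h * w) &
      forall M V, 0 < M <= 1 -> n%:R * h ^+ 2 * w <= 1 -> V = h ^+ 2 * Num.max 1 (n%:R * w) ->
      Ex kap (fun t => `|s t| ^+ 2) <=
        C * ((n%:R * e * h * w) ^+ 2 + n%:R * delta * M * h * w + V * (V / M ^+ 2) ^+ k)].
Proof.
move=> Cb0 Ce0.
have [C1 C10 H1] := @gauss_lik_moment R 0; have [C2 C20 H2] := @gauss_lik_moment R 1.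
have [Cr Cr0 Hr] := @gauss_lik_moment R (2 * k).+1.
have [K0 K00 HK0] := even_moment R 0; have [Kr Kr0 HKr] := even_moment R k.
pose Ct := C1 * Cb; pose Y := expR Ceps * Ct; pose Z0 := Y * expR Y.
pose B2 := C2 * Cb; pose C' := (C2 + Cr) * Cb.
have Ct0 : 0 < Ct by rewrite mulr_gt0.
have Y0 : 0 < Y by rewrite mulr_gt0 ?expR_gt0.
have Z00 : 0 < Z0 by rewrite mulr_gt0 ?expR_gt0.
have B20 : 0 < B2 by rewrite mulr_gt0.
have C'0 : 0 < C' by rewrite mulr_gt0// addr_gt0.
pose Ca := 1 + 2 * (K0 * B2 * expR (K0 * B2)).
pose Cg := Z0 ^+ 2 + 2 * ((1 + Z0) * Ct).
pose Cm := 2 ^+ (2 * k.+1) * expR (Kr * C').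
have Ca0 : 0 <= 2 * (K0 * B2 * expR (K0 * B2)) by rewrite !mulr_ge0 ?expR_ge0// ltW.
have Cg0 : 0 <= Cg by rewrite addr_ge0 ?sqr_ge0// mulr_ge0// mulr_ge0 ?addr_ge0// ltW.
have Cm0 : 0 <= Cm by rewrite mulr_ge0 ?expR_ge0 ?exprn_ge0.
have Ca1 : 1 <= Ca by rewrite /Ca lerDl.
have Ca0' : 0 <= Ca by exact: le_trans ler01 Ca1.
have CS1 : 1 <= Ca + Cg + Cm by rewrite -addrA; apply: le_trans Ca1 _; rewrite lerDl addr_ge0.
exists (Ca + Cg + Cm); first by rewrite ltr_wpDr// ltr_wpDr// ltr_wpDr.
move=> d T n K f0 f1 h w B e delta kap s /andP[h0 h1] w0 mB wB fh fB ee d0 dp spl0.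
have hh : 0 <= h <= 1 by rewrite (ltW h0).
have fh' x : `|f0 x - f1 x| <= h by rewrite distrC.
have fB' x : ~ B x -> f0 x = f1 x by move=> /fB ->.
have mL := measurable_gauss_lik f0 f1; have mL' := measurable_gauss_lik f1 f0.
have tE : C1 * h * (Cb * w) = Ct * h * w by rewrite /Ct; ring.
have m1 := H1 f0 f1 h _ B hh mB wB fh fB; have m1' := H1 f1 f0 h _ B hh mB wB fh' fB'.
rewrite expr1 tE in m1; rewrite expr1 tE in m1'; clear tE.
have lik := gauss_likelihood m1; have lik' := gauss_likelihood m1'.
have m2 := H2 f0 f1 h _ B hh mB wB fh fB; have mr := Hr f0 f1 h _ B hh mB wB fh fB.
have spl := splits_clamps spl0; have dpc := private_clamps dp.
have /andP[l0 l1] := Ex_sq_le1 spl0.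
set l := Ex kap _ in l0 l1 *.
have t0 : 0 <= Ct * h * w by rewrite !mulr_ge0// ltW.
have n0 : 0 <= n%:R :> R by [].
have a0 : 0 <= n%:R * e * h * w by case/andP: ee => e0 _; rewrite !mulr_ge0// ltW.
have nd0 M : 0 <= M -> 0 <= n%:R * delta * M * h * w by move=> M0; rewrite !mulr_ge0// ltW.
have sep (k' : nat) (u M : R) : 0 < M <= 1 -> (M = 1 /\ u = 0 \/
   (\int[prod_prob (fun _ : 'I_n => P_ f0)]_z ((lik_dev (gauss_lik f0 f1) z) ^+ (2 * k'.+1))%:E <= u%:E)%E) ->
   0 <= M ^- (2 * k') * (2 ^+ (2 * k'.+1) * u) -> n%:R * e * h * w <= 1 ->
   l <= Cg * ((n%:R * e * h * w) ^+ 2 + n%:R * delta * M * h * w) + M ^- (2 * k') * (2 ^+ (2 * k'.+1) * u).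
  move=> M01 hu u0 a1; have M0 : 0 <= M by case/andP: M01 => /ltW.
  have e1 : 1 <= expR e by case/andP: ee => e0 _; rewrite ltW// expR_gt1.
  have /andP[G1 G2] := group_factor ee (ltW h0) (ltW w0) (ltW Ct0) a1 (erefl Y) (erefl Z0).
  have := separation_group e1 d0 dpc lik lik' t0 spl M01 hu erefl.
  rewrite -/l; move: G1 G2; move: ((1 + (expR e - 1) * (Ct * h * w)) ^+ n) => G G1 G2 H.
  apply: group_final => //; try exact: ltW; try exact: sqr_ge0; try exact: nd0.
  have g1 : (G - 1) ^+ 2 <= Z0 ^+ 2 * (n%:R * e * h * w) ^+ 2.
    rewrite -exprMn; apply: lerXn2r; rewrite ?nnegrE ?subr_ge0//.
      by apply: mulr_ge0 => //; exact: ltW.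
    by rewrite lerBlDl.
  have g2 : G <= 1 + Z0 by apply: le_trans G2 _; rewrite lerD2l ler_piMr// ltW.
  have q0 : 0 <= n%:R * (delta * M * (Ct * h * w)) by rewrite mulr_ge0// mulr_ge0// mulr_ge0.
  have g3 := ler_wpM2r q0 g2.
  move: H g1 g3; move: (M ^- _ * _) (n%:R * e * h * w) => y1 y2; clear; lra.
(* If [n e h w] exceeds one, the bound is trivial, since the separation never does. *)
have CZ M : 0 <= M -> l <= 1 -> 1 < n%:R * e * h * w -> l <= (Ca + Cg + Cm) * ((n%:R * e * h * w) ^+ 2 + n%:R * delta * M * h * w).
  move=> M0 _ a1; have := nd0 M M0; move: (_ * M * h * w) => y y0.
  apply: le_trans l1 _; have b1 : 1 <= (n%:R * e * h * w) ^+ 2 by rewrite exprn_ege1// ltW.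
  by rewrite -[X in X <= _]mul1r ler_pM// (le_trans b1)// lerDl.
split.
- have [nh|nh] := leP (n%:R * h ^+ 2 * w) 1; last first.
    apply: le_trans l1 _; rewrite -[X in X <= _]mul1r ler_pM// ?(ltW nh)//.
  pose beta := B2 * (h ^+ 2 * w).
  have b0 : 0 <= beta by rewrite !mulr_ge0 ?sqr_ge0// ltW.
  have m2' : (\int[P_ f0]_x ((gauss_lik f0 f1 x - 1) ^+ 2)%:E <= (beta * 1 ^+ 2)%:E)%E.
    move: m2; under eq_integral do rewrite real_normK ?num_real//.
    by rewrite expr1n mulr1 (_ : C2 * h ^+ 2 * (Cb * w) = beta)// /beta /B2; ring.
  have := HK0 _ _ _ _ beta 1 n lik b0 (_ : 0 <= 1 <= 1) m2'; rewrite muln1 lexx ler01 => /(_ isT m2') mu.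
  have := separation_moment (k := 0) lik spl mu; rewrite muln0 expr1 => -[le2 _].
  apply: le_trans le2 _; rewrite expr1n mulr1.
  have nb : n%:R * (K0 * beta) = K0 * B2 * (n%:R * h ^+ 2 * w) by rewrite /beta; ring.
  have nb1 : n%:R * (K0 * beta) <= K0 * B2.
    by rewrite nb ler_piMr// mulr_ge0// ltW.
  have := pow1D_sub1_le (mulr_ge0 K00 b0) nb1; rewrite nb.
  have nn : 0 <= n%:R * h ^+ 2 * w by rewrite !mulr_ge0 ?sqr_ge0// ltW.
  have e0 : 0 <= (Cg + Cm + 1) * (n%:R * h ^+ 2 * w) by apply: mulr_ge0 => //; apply: addr_ge0 => //; exact: addr_ge0.
  by move: e0; rewrite /Ca; move: (n%:R * h ^+ 2 * w) (K0 * B2) (expR _) (_ ^+ n) => y1 y2 y3 y4; clear; lra.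
- have [a1|a1] := leP (n%:R * e * h * w) 1; last first.
    by have := CZ 1 ler01 l1 a1; rewrite mulr1.
  have := sep 0%N 0 1 (_ : 0 < 1 <= 1) (or_introl (conj erefl erefl)).
  rewrite ltr01 lexx !mulr0 lexx !mulr1 addr0 => /(_ isT isT a1) H; apply: le_trans H _.
  have := nd0 1 ler01; rewrite mulr1 => y0.
  rewrite ler_wpM2r ?addr_ge0 ?sqr_ge0//; move: Ca0' Cg0 Cm0; move: (Ca) (Cg) (Cm) => y1 y2 y3; clear; lra.
- move=> M V M01 nh VE; have /andP[M0 M1] := M01.
  have mx1 : 1 <= Num.max 1 (n%:R * w) by rewrite le_max lexx.
  have mx0 : 0 < Num.max 1 (n%:R * w) by exact: lt_le_trans mx1.
  have V0 : 0 <= V by rewrite VE mulr_ge0 ?sqr_ge0// ltW.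
  have V1 : V <= 1.
    rewrite VE /Num.max; case: ifP => _; last by rewrite mulr1 exprn_ile1// ltW.
    by move: nh; move: (n%:R) => y; clear; lra.
  have M2 : 0 < M ^+ 2 by rewrite exprn_gt0.
  have tt0 : 0 <= V * (V / M ^+ 2) ^+ k by rewrite mulr_ge0// exprn_ge0// divr_ge0// ltW.
  have [a1|a1] := leP (n%:R * e * h * w) 1; last first.
    apply: le_trans (CZ M (ltW M0) l1 a1) _.
    by rewrite ler_wpM2l ?lerDl// (le_trans ler01).
  (* This makes [beta V] equal to [C' h ^ 2 w], the order of the second moment, while [n beta] stays
     below [C'] and keeps the compounded constant bounded. *)
  pose beta := C' * (w / Num.max 1 (n%:R * w)).
  have b0 : 0 <= beta by rewrite mulr_ge0 ?divr_ge0// ltW.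
  pose v := Num.sqrt V; have v2 : v ^+ 2 = V by rewrite sqr_sqrtr.
  have vr : v ^+ (2 * k.+1) = V ^+ k.+1 by rewrite exprM v2.
  have v01 : 0 <= v <= 1 by rewrite sqrtr_ge0/= -[X in _ <= X](sqrtr1 R) ler_sqrt.
  have bV : beta * V = C' * h ^+ 2 * w.
    by rewrite /beta VE; move: mx0; move: (Num.max _ _) => y y0; field; rewrite gt_eqF.
  have m2' : (\int[P_ f0]_x ((gauss_lik f0 f1 x - 1) ^+ 2)%:E <= (beta * v ^+ 2)%:E)%E.
    move: m2; under eq_integral do rewrite real_normK ?num_real//.
    move/le_trans; apply; rewrite lee_fin v2 bV /C'.
    have : 0 <= Cr * h ^+ 2 * (Cb * w) by rewrite !mulr_ge0 ?sqr_ge0// ltW.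
    by move: (h ^+ 2) => y; clear; lra.
  have mr' : (\int[P_ f0]_x ((gauss_lik f0 f1 x - 1) ^+ (2 * k.+1))%:E <= (beta * v ^+ (2 * k.+1))%:E)%E.
    have r2 : (2 * k.+1 = (2 * k).+2)%N by rewrite mulnS.
    apply: le_trans (_ : (Cr * h ^+ (2 * k.+1) * (Cb * w))%:E <= _)%E; last first.
      rewrite lee_fin vr [V ^+ _]exprS [X in _ <= X]mulrA bV.
      have -> : h ^+ (2 * k.+1) = h ^+ 2 * h ^+ (2 * k) by rewrite -exprD r2.
      have hV : h ^+ (2 * k) <= V ^+ k.
        rewrite exprM; apply: lerXn2r; rewrite ?nnegrE ?sqr_ge0// VE ler_peMr ?sqr_ge0//.
      have P0 : 0 <= C' * h ^+ 2 * w by rewrite mulr_ge0 ?(ltW w0)// mulr_ge0 ?sqr_ge0// (ltW C'0).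
      have := ler_wpM2l P0 hV.
      have : 0 <= C2 * h ^+ 2 * (Cb * w) * h ^+ (2 * k) by rewrite !mulr_ge0 ?exprn_ge0// ltW.
      by rewrite /C'; move: (h ^+ 2) (h ^+ _) (V ^+ k) => y1 y2 y3; clear; lra.
    move: mr; rewrite -r2; under eq_integral => z _.
      rewrite (_ : `|_| ^+ _ = (gauss_lik f0 f1 z - 1) ^+ (2 * k.+1)); last by rewrite !exprM real_normK ?num_real.
      over.
    by [].
  have mu := HKr _ _ _ _ beta v n lik b0 v01 m2' mr'.
  pose u := expR (Kr * C') * V ^+ k.+1.
  have u0 : 0 <= u by rewrite mulr_ge0 ?expR_ge0 ?exprn_ge0.
  have mu' : (\int[prod_prob (fun _ : 'I_n => P_ f0)]_z ((lik_dev (gauss_lik f0 f1) z) ^+ (2 * k.+1))%:E <= u%:E)%E.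
    apply: le_trans mu _; rewrite lee_fin vr ler_wpM2r ?exprn_ge0//.
    apply: (@le_trans _ _ ((1 + Kr * beta) ^+ n)); first by rewrite gerBl.
    apply: le_trans (pow1D_le n (mulr_ge0 Kr0 b0)) _; rewrite ler_expR mulrCA ler_wpM2l//.
    rewrite /beta mulrCA ler_piMr ?(ltW C'0)// mulrA ler_pdivrMr// mul1r le_max lexx orbT//.
  have u0' : 0 <= M ^- (2 * k) * (2 ^+ (2 * k.+1) * u).
    by rewrite mulr_ge0 ?invr_ge0 ?exprn_ge0 ?mulr_ge0 ?exprn_ge0// ltW.
  apply: le_trans (sep k u M M01 (or_intror mu') u0' a1) _.
  have -> : M ^- (2 * k) * (2 ^+ (2 * k.+1) * u) = Cm * (V * (V / M ^+ 2) ^+ k).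
    rewrite /u /Cm expr_div_n -exprM [V ^+ k.+1]exprS; move: (2 ^+ _) (V ^+ k) (M ^- (2 * k)) (expR _) => y1 y2 y3 y4; clear; ring.
  have := nd0 M (ltW M0); move: tt0 (sqr_ge0 (n%:R * e * h * w)).
  move: (V * (V / M ^+ 2) ^+ k) (n%:R * delta * M * h * w) ((n%:R * e * h * w) ^+ 2) => y1 y2 y3 z1 z3 z2.
  have := mulr_ge0 Ca0' z1; have := mulr_ge0 Ca0' z2; have := mulr_ge0 Ca0' z3.
  have := mulr_ge0 Cg0 z1; have := mulr_ge0 Cm0 z2; have := mulr_ge0 Cm0 z3.
  by clear; lra.
Qed.

End gaussian_server.

Section budget_arithmetic.
Context (R : realType).

(* With [r = sqrt n], [X = sqrt n * e ^ 2 * w] and [s ^ 2 = max 1 (n w)]. *)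
Lemma budget_cross (r e w h s : R) : 0 <= e -> 0 <= w -> 0 <= h -> 0 <= s <= r ->
  r ^+ 2 * h * w * (r * e ^+ 2 * w) * (h * s) <= (r ^+ 2 * e * h * w) ^+ 2.
Proof.
move=> e0 w0 h0 /andP[s0 sr].
have P : 0 <= r ^+ 3 * e ^+ 2 * w ^+ 2 * h ^+ 2.
  by rewrite !mulr_ge0 ?sqr_ge0 ?exprn_ge0// (le_trans s0).
have := ler_wpM2l P sr; nra.
Qed.

Lemma budget_cross1 (r e w h : R) : 0 <= e -> 0 <= w -> 0 <= h -> 0 <= r -> 1 <= r * h ->
  r ^+ 2 * h * w * (r * e ^+ 2 * w) <= (r ^+ 2 * e * h * w) ^+ 2.
Proof.
move=> e0 w0 h0 r0 rh.
have P : 0 <= r ^+ 3 * e ^+ 2 * w ^+ 2 * h by rewrite !mulr_ge0 ?sqr_ge0 ?exprn_ge0.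
have := ler_wpM2l P rh; nra.
Qed.

Lemma budget_sq (r e w h s E : R) : 0 <= e <= E -> 0 <= s <= r ->
  h ^+ 2 * s ^+ 2 * (r * e ^+ 2 * w) ^+ 2 <= E ^+ 2 * (r ^+ 2 * e * h * w) ^+ 2.
Proof.
move=> /andP[e0 eE] /andP[s0 sr].
have r0 : 0 <= r by exact: le_trans sr.
have s2 : s ^+ 2 <= r ^+ 2 by rewrite lerXn2r ?nnegrE.
have e2 : e ^+ 2 <= E ^+ 2 by rewrite lerXn2r ?nnegrE// (le_trans e0).
have P : 0 <= (h * r * e ^+ 2 * w) ^+ 2 by exact: sqr_ge0.
have Q : 0 <= (r ^+ 2 * e * h * w) ^+ 2 by exact: sqr_ge0.
have := ler_wpM2l P s2; have := ler_wpM2r Q e2; nra.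
Qed.

(** The three bounds are compared with the minimum in the equation for [D], [w] standing for the
    inverse of the resolution. If the minimum is its nonprivate member, data processing suffices.
    Otherwise the target is [Q], and the term with [delta] has to be absorbed into it: directly when
    [n h ^ 2 w > 1] or [X ^ kappa <= h s], and by a cut in the remaining case. *)
Lemma private_budget (kappa Cd Ce : R) : 0 < kappa -> 0 < Cd -> 0 < Ce ->
  exists (k : nat) (C : R), 0 < C /\ forall (n : nat) (h w e delta l C0 : R), (0 < n)%N ->
  0 < h <= 1 -> 0 < w <= 1 -> 0 < e <= Ce -> 0 <= delta -> 0 < C0 ->
  delta <= Cd * (Num.sqrt n%:R * e ^+ 2 * w) `^ (1 + kappa) ->
  [/\ l <= C0 * (n%:R * h ^+ 2 * w),
      l <= C0 * ((n%:R * e * h * w) ^+ 2 + n%:R * delta * h * w) &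
      forall M V, 0 < M <= 1 -> n%:R * h ^+ 2 * w <= 1 -> V = h ^+ 2 * Num.max 1 (n%:R * w) ->
      l <= C0 * ((n%:R * e * h * w) ^+ 2 + n%:R * delta * M * h * w + V * (V / M ^+ 2) ^+ k)] ->
  l <= C0 * C * (h ^+ 2 * w ^+ 2 * Num.min (n%:R ^+ 2 * e ^+ 2) (n%:R / w)).
Proof.
move=> ka0 Cd0 Ce0.
(* As [X] turns out to be bounded by [Y], the choice [k kappa >= 1] bounds [X ^ (2 k kappa)] by a
   multiple of [X ^ 2]. *)
pose k := Num.bound kappa^-1; pose Y := Num.max 1 Ce.
have k1 : 1 <= k%:R * kappa.
  by rewrite -ler_pdivrMr// mul1r ltW// archi_boundP// invr_ge0 ltW.
have Y1 : 1 <= Y by rewrite le_max lexx.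
have Y0 : 0 < Y by exact: lt_le_trans Y1.
pose C := 1 + Cd * Y `^ kappa + Cd + Ce ^+ 2 * Y `^ (2 * (k%:R * kappa) - 2).
have P1 : 0 <= Cd * Y `^ kappa by rewrite mulr_ge0 ?powR_ge0// ltW.
have P2 : 0 <= Ce ^+ 2 * Y `^ (2 * (k%:R * kappa) - 2) by rewrite mulr_ge0 ?powR_ge0 ?sqr_ge0.
have C1 : 1 <= C by rewrite /C; lra.
exists k, C; split; first exact: lt_le_trans C1.
move=> n h w e delta l C0 n0 /andP[h0 h1] /andP[w0 w1] ee d0 C00 dX [b1 b2 b3].
have /andP[e0 eC] := ee.
pose r : R := Num.sqrt n%:R; have r2 : r ^+ 2 = n%:R by rewrite sqr_sqrtr.
have r1 : 1 <= r by rewrite -(sqrtr1 R) ler_sqrt// ler1n.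
have r0 : 0 < r by exact: lt_le_trans r1.
pose X := r * e ^+ 2 * w; have X0 : 0 < X by rewrite !mulr_gt0// exprn_gt0.
rewrite -/r -/X in dX.
have dX' : delta <= Cd * (X * X `^ kappa).
  by apply: le_trans dX _; rewrite powRD ?(gt_eqF X0) ?implybT// powRr1 ?(ltW X0).
set Q := (n%:R * e * h * w) ^+ 2 in b2 b3.
have QE : Q = h ^+ 2 * w ^+ 2 * (n%:R ^+ 2 * e ^+ 2) by rewrite /Q; ring.
have Q0 : 0 <= Q by exact: sqr_ge0.
have [c|c] := leP (n%:R / w) (n%:R ^+ 2 * e ^+ 2).
  apply: le_trans b1 _; rewrite -[X in _ <= X]mulrA ler_wpM2l ?(ltW C00)//.
  have -> : h ^+ 2 * w ^+ 2 * (n%:R / w) = n%:R * h ^+ 2 * w by field; rewrite gt_eqF.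
  by rewrite ler_peMl// !mulr_ge0 ?sqr_ge0// ltW.
suff : l <= C0 * (C * Q) by rewrite -QE mulrA.
have neW : r ^+ 2 * e ^+ 2 * w < 1.
  move: c; rewrite ltr_pdivlMr// -r2 (_ : (r ^+ 2) ^+ 2 * e ^+ 2 * w = r ^+ 2 * (r ^+ 2 * e ^+ 2 * w)); last by ring.
  by rewrite gtr_pMr ?exprn_gt0.
have XY : X <= Y.
  have : X ^+ 2 <= Y ^+ 2.
    apply: (@le_trans _ _ (Ce ^+ 2)); last first.
      by rewrite lerXn2r ?nnegrE ?(ltW Y0) ?(ltW Ce0)// le_max lexx orbT.
    have -> : X ^+ 2 = (r ^+ 2 * e ^+ 2 * w) * (e ^+ 2 * w) by rewrite /X; ring.
    apply: (@le_trans _ _ (e ^+ 2 * w)); first by rewrite ler_piMl ?(ltW neW)// mulr_ge0 ?sqr_ge0 ?(ltW w0).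
    apply: (@le_trans _ _ (e ^+ 2)); first by rewrite ler_piMr ?sqr_ge0.
    by rewrite lerXn2r ?nnegrE// ltW.
  by rewrite ler_pXn2r// ?nnegrE ltW.
have Xk : X `^ kappa <= Y `^ kappa by apply: (ge0_ler_powR (ltW ka0)) => //; rewrite nnegrE ltW.
have nhw : 0 <= n%:R * h * w by rewrite !mulr_ge0// ltW.
have [nh|nh] := leP (n%:R * h ^+ 2 * w) 1; last first.
  apply: le_trans b2 _; rewrite ler_pM2l//.
  have rh : 1 <= r * h.
    have : 1 <= (r * h) ^+ 2.
      rewrite exprMn r2; apply: le_trans (ltW nh) _.
      by rewrite ler_piMr// mulr_ge0 ?sqr_ge0.
    by rewrite -[X in X <= _](expr1n R 2) ler_pXn2r ?nnegrE// mulr_ge0// ltW.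
  have := budget_cross1 (ltW e0) (ltW w0) (ltW h0) (ltW r0) rh; rewrite r2 -/X -/Q => hx.
  have h2 : n%:R * delta * h * w <= Cd * Y `^ kappa * (n%:R * h * w * X).
    have := ler_wpM2l nhw dX'; have := ler_wpM2l (mulr_ge0 (mulr_ge0 nhw (ltW Cd0)) (ltW X0)) Xk.
    by move: (X `^ _) (Y `^ _) => y1 y2; clear; lra.
  have := ler_wpM2l P1 hx; rewrite /C; move: h2 (Q0); have := mulr_ge0 P2 Q0.
  have := mulr_ge0 (ltW Cd0) Q0.
  move: (n%:R * delta * h * w) (n%:R * h * w * X) (Cd * Y `^ kappa) (Ce ^+ 2 * _) => y1 y2 y3 y4; clear; lra.
pose s := Num.sqrt (Num.max 1 (n%:R * w)).
have mx0 : 0 <= Num.max 1 (n%:R * w) by rewrite le_max ler01.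
have s2 : s ^+ 2 = Num.max 1 (n%:R * w) by rewrite sqr_sqrtr.
have s0 : 0 < s by rewrite sqrtr_gt0 lt_max ltr01.
have sr : 0 <= s <= r.
  rewrite (ltW s0)/= ler_sqrt ?ltr0n// ge_max ler1n n0/=.
  by rewrite ler_piMr.
have cr := budget_cross (ltW e0) (ltW w0) (ltW h0) sr; rewrite r2 -/X -/Q in cr.
have hs0 : 0 < h * s by rewrite mulr_gt0.
have [v|v] := leP (X `^ kappa) (h * s).
  apply: le_trans b2 _; rewrite ler_pM2l//.
  have h2 : n%:R * delta * h * w <= Cd * (n%:R * h * w * X * (h * s)).
    have := ler_wpM2l nhw dX'; have := ler_wpM2l (mulr_ge0 (mulr_ge0 nhw (ltW Cd0)) (ltW X0)) v.
    by move: (X `^ _) (h * s) => y1 y2; clear; lra.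
  have := ler_wpM2l (ltW Cd0) cr; rewrite /C; move: h2 (Q0); have := mulr_ge0 P2 Q0; have := mulr_ge0 P1 Q0.
  move: (n%:R * delta * h * w) (n%:R * h * w * X * (h * s)) (Cd * Y `^ kappa) (Ce ^+ 2 * _) => y1 y2 y3 y4; clear; lra.
have Xp : 0 < X `^ kappa by exact: powR_gt0.
(* This cut trades the factor [X ^ kappa] of the [delta] term for [h s], after which the term is a
   multiple of [Q]; the excess becomes [(h s) ^ 2 X ^ (2 k kappa)]. *)
pose M := h * s / X `^ kappa.
have M01 : 0 < M <= 1 by rewrite divr_gt0//= ler_pdivrMr// mul1r ltW.
have VE : (h * s) ^+ 2 = h ^+ 2 * Num.max 1 (n%:R * w) by rewrite exprMn s2.
apply: le_trans (b3 M _ M01 nh VE) _; rewrite ler_pM2l//.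
have -> : (h * s) ^+ 2 / M ^+ 2 = (X `^ kappa) ^+ 2.
  by rewrite /M expr_div_n invf_div mulrA mulrAC divff ?mul1r// expf_neq0// gt_eqF.
have Xpow : (X `^ kappa) ^+ 2 ^+ k <= X ^+ 2 * Y `^ (2 * (k%:R * kappa) - 2).
  rewrite -exprM -powR_mulrn ?powR_ge0// -powRrM.
  have -> : kappa * (2 * k)%:R = 2 + (2 * (k%:R * kappa) - 2) by rewrite natrM; ring.
  rewrite powRD ?(gt_eqF X0) ?implybT// (powR_mulrn 2) ?(ltW X0)// ler_wpM2l ?sqr_ge0//.
  by apply: ge0_ler_powR; rewrite ?nnegrE ?(ltW X0) ?(ltW Y0)//; lra.
have h3 : (h * s) ^+ 2 * (X `^ kappa) ^+ 2 ^+ k <= Ce ^+ 2 * Y `^ (2 * (k%:R * kappa) - 2) * Q.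
  apply: le_trans (ler_wpM2l (sqr_ge0 _) Xpow) _.
  have eC' : 0 <= e <= Ce by rewrite (ltW e0).
  have := budget_sq w h eC' sr; rewrite r2 -/X -/Q => hb.
  by rewrite [X in X <= _]mulrA [X in _ <= X]mulrAC exprMn ler_wpM2r ?powR_ge0.
have h2 : n%:R * delta * M * h * w <= Cd * (n%:R * h * w * X * (h * s)).
  have M0 : 0 <= M by case/andP: M01 => /ltW.
  have := ler_wpM2l (mulr_ge0 nhw M0) dX'.
  have -> : n%:R * h * w * M * (Cd * (X * X `^ kappa)) = Cd * (n%:R * h * w * X * (h * s)).
    by rewrite /M; field; rewrite gt_eqF.
  by rewrite (_ : n%:R * h * w * M * delta = n%:R * delta * M * h * w)//; ring.
have := ler_wpM2l (ltW Cd0) cr; rewrite /C; move: h2 h3 (Q0); have := mulr_ge0 P1 Q0.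
move: (n%:R * delta * M * h * w) (n%:R * h * w * X * (h * s)) (Cd * Y `^ kappa) (Ce ^+ 2 * _) (_ * _ ^+ k) => y1 y2 y3 y4 y5; clear; lra.
Qed.

(** [2 ^ L] is the first power, from [L0] on, that reaches [D]. Replacing [D] by it multiplies the
    sum by at most [2 ^ L / D], and the right-hand side grows at least as much. For small [D] the
    level is [L0], whence the maximum with one. *)
Lemma resolution (gamma D : R) (s : setting R) (L0 : nat) : 0 < gamma -> solves_rate gamma s D ->
  exists L : nat, [/\ (L0 <= L)%N, (2 : R) ^+ L <= 2 ^+ L0.+1 * Num.max D 1 &
   \sum_(j < servers s) Num.min ((nobs j)%:R ^+ 2 * eps j ^+ 2) ((nobs j)%:R * 2 ^+ L) <= (2 ^+ L) `^ (2 * gamma + 2)].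
Proof.
move=> g0 [D0 DE].
have ex : exists m, D <= 2 ^+ (L0 + m).
  exists (Num.bound `|D|); apply: le_trans (ler_norm _) _; apply: le_trans (ltW (archi_boundP _)) _ => //.
  by rewrite -natrX ler_nat ltnW// (leq_trans (ltn_expl _ (ltnSn 1)))// leq_exp2l// leq_addl.
pose m := ex_minn ex.
have [Dm mmin] : D <= 2 ^+ (L0 + m) /\ forall i, D <= 2 ^+ (L0 + i) -> (m <= i)%N.
  by rewrite /m; case: ex_minnP.
clearbody m; exists (L0 + m)%N.
have p0 : 0 < (2 : R) ^+ (L0 + m) by rewrite exprn_gt0.
have mx1 : 1 <= Num.max D 1 by rewrite le_max lexx orbT.
split; first exact: leq_addr.
- case: m Dm mmin p0 => [|m] Dm mmin p0.
    rewrite addn0 exprS; have : 0 <= (2 : R) ^+ L0 by rewrite exprn_ge0.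
    move=> q0; have := ler_wpM2l q0 mx1; lra.
  have : 2 ^+ (L0 + m) < D by rewrite ltNge; apply/negP => /mmin; rewrite ltnn.
  have q1 : 1 <= (2 : R) ^+ L0 by rewrite exprn_ege1// ler1n.
  have DD : D <= Num.max D 1 by rewrite le_max lexx.
  rewrite addnS !exprS => h.
  have mx0 : 0 <= Num.max D 1 by apply: le_trans DD; exact: ltW.
  by have := ler_wpM2r mx0 q1; lra.
set D' := 2 ^+ (L0 + m) in Dm p0 *.
have D1 : 1 <= D' / D by rewrite ler_pdivlMr// mul1r.
have D'0 := ltW p0.
apply: (@le_trans _ _ (D' / D * D `^ (2 * gamma + 2))).
  rewrite DE mulr_sumr; apply: ler_sum => j _.
  set a := _ ^+ 2 * _; have a0 : 0 <= a by rewrite mulr_ge0 ?sqr_ge0.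
  rewrite /Num.min; case: ifP => c1; case: ifP => c2.
  - by rewrite ler_peMl.
  - move: c1 => /ltW; have -> : D' / D * ((nobs j)%:R * D) = (nobs j)%:R * D' by field; rewrite gt_eqF.
    by [].
  - move: c1 => /negbT; rewrite -leNgt => c1; apply: le_trans c1 _; rewrite ler_peMl//.
  - by have -> : D' / D * ((nobs j)%:R * D) = (nobs j)%:R * D' by field; rewrite gt_eqF.
have -> : 2 * gamma + 2 = 1 + (2 * gamma + 1) by ring.
have e0 : 0 <= 2 * gamma + 1 by lra.
move: (2 * gamma + 1) e0 => e e0.
rewrite !powRD ?(gt_eqF D0) ?(gt_eqF p0) ?implybT// !powRr1 ?(ltW D0)// [X in X <= _]mulrA divfK ?gt_eqF//.
by rewrite ler_wpM2l//; apply: (ge0_ler_powR e0) => //; rewrite nnegrE ltW.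
Qed.

Lemma powR_shrink (x K D' m r : R) : 0 <= r -> 0 <= x -> 0 < K -> 0 < D' -> 0 < m -> D' <= K * m ->
  (x / m) `^ r <= K `^ r * (x / D') `^ r.
Proof.
move=> r0 x0 K0 D0 m0 h; have K0' := ltW K0.
have xD : 0 <= x / D' by rewrite divr_ge0// ltW.
rewrite -(powRM r K0' xD); apply: (ge0_ler_powR r0).
- by rewrite nnegrE divr_ge0// ltW.
- by rewrite nnegrE mulr_ge0.
- by rewrite mulrCA ler_wpM2l// ler_pdivlMr// mulrC ler_pdivrMr.
Qed.

Lemma rate_le (g D D' K : R) : 0 < g -> 0 < D -> 0 < D' -> 0 < K -> D' <= K * Num.max D 1 ->
  K `^ (- g) * Num.min (D `^ (- g)) 1 <= D' `^ (- g).
Proof.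
move=> g0 D0 D'0 K0 h.
have mx0 : 0 < Num.max D 1 by rewrite lt_max ltr01 orbT.
apply: (@le_trans _ _ ((K * Num.max D 1) `^ (- g))).
  rewrite powRM ?(ltW K0) ?(ltW mx0)// ler_wpM2l ?powR_ge0//.
  rewrite /Num.max; case: ifP => _; first by rewrite powR1 ge_min lexx orbT.
  by rewrite ge_min lexx.
rewrite !powRN lef_pV2 ?posrE ?powR_gt0 ?mulr_gt0//.
by apply: ge0_ler_powR => //; rewrite ?nnegrE ltW// mulr_gt0.
Qed.

End budget_arithmetic.

(** * From separations to minimax lower bounds *)

Section two_hypotheses.
Context (R : realType).
Local Notation mu := (@lebesgue_measure R).

Lemma transcript_two_point (s : setting R) (Q : protocol s) (f0 f1 : {mfun R >-> R})
  (l : 'I_(servers s) -> R) (F G : (servers s).-tuple (transcript Q) -> \bar R) (c : R) :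
  (forall j (kap : probability (transcript Q) R) sg,
    splits (mixture (prod_prob (fun _ : 'I_(nobs j) => P_ f0)) (mechanism Q j) : probability _ R)
           (mixture (prod_prob (fun _ : 'I_(nobs j) => P_ f1)) (mechanism Q j) : probability _ R) kap sg ->
    Ex kap (fun t => `|sg t| ^+ 2) <= l j) ->
  \sum_j l j <= 4^-1 -> measurable_fun setT F -> measurable_fun setT G ->
  (forall t, 0 <= F t)%E -> (forall t, 0 <= G t)%E -> 0 <= c -> (forall t, c%:E <= F t + G t)%E ->
  ((c / 4)%:E <= \int[transcript_law Q f0]_t F t + \int[transcript_law Q f1]_t G t)%E.
Proof.
move=> hl sl mF mG F0 G0 c0 cFG.
pose q0 j : probability (transcript Q) R := mixture (prod_prob (fun _ : 'I_(nobs j) => P_ f0)) (mechanism Q j).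
pose q1 j : probability (transcript Q) R := mixture (prod_prob (fun _ : 'I_(nobs j) => P_ f1)) (mechanism Q j).
pose kap j := sval (cid (splits_exists (q0 j) (q1 j))).
have hk j : exists sg, splits (q0 j) (q1 j) (kap j) sg by rewrite /kap; case: cid.
pose sg j := sval (cid (hk j)).
have spl j : splits (q0 j) (q1 j) (kap j) (sg j) by rewrite /sg; case: cid.
apply: (two_point_risk spl) => //.
by apply: le_trans sl; apply: ler_sum => j _; exact: (hl j _ _ (spl j)).
Qed.

Lemma sq_two (a u v : R) : (u - v) ^+ 2 / 2 <= (a - u) ^+ 2 + (a - v) ^+ 2.
Proof. by have := sqr_ge0 (2 * a - u - v); nra. Qed.

Lemma ehalf_le (x : R) (B : \bar R) : (x%:E <= 2%:E * B)%E -> ((x / 2)%:E <= B)%E.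
Proof.
case: B => [r| |]; last by rewrite gt0_muleNy ?lte_fin.
- by rewrite -EFinM !lee_fin => h; lra.
- by rewrite leey.
Qed.

Lemma bounded_square_integrable (f : {mfun R >-> R}) : bi f -> square_integrable f.
Proof. by move=> bf; rewrite /square_integrable Int01E ?ltry//; exact: biX. Qed.

Lemma measurable_estimator_at (s : setting R) (Q : protocol s) (x : R) :
  measurable_fun setT (fun t : (servers s).-tuple (transcript Q) => estimator Q t x).
Proof.
apply: (measurableT_comp (@measurable_estimator _ _ Q) (f := fun u => estimator Q u.1 u.2) (g := fun t => (t, x))).
by apply/measurable_fun_pairP; split => /=; [exact: measurable_id | exact: measurable_cst].
Qed.

Lemma measurable_loss_at (s : setting R) (Q : protocol s) u (f : {mfun R >-> R}) :
  measurable_fun (setT : set (measurableTypeR R)) (fun x : R => ((estimator Q u x - f x) ^+ 2)%:E).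
Proof.
have mf : measurable_fun (setT : set (measurableTypeR R)) (f : R -> R) by exact: (@measurable_funPT _ _ R R f).
apply/measurable_EFinP; apply: measurable_funX; apply: measurable_funB => //.
apply: (measurableT_comp (@measurable_estimator _ _ Q) (f := fun u => estimator Q u.1 u.2) (g := fun x => (u, x))).
by apply/measurable_fun_pairP; split => /=; [exact: measurable_cst | exact: measurable_id].
Qed.

Lemma measurable_loss (s : setting R) (Q : protocol s) (f : {mfun R >-> R}) (B : set R) :
  measurable (B : set (measurableTypeR R)) ->
  measurable_fun setT (fun t : (servers s).-tuple (transcript Q) =>
    \int[mu]_(x in B) ((estimator Q t x - f x) ^+ 2)%:E)%E.
Proof.
move=> mB.
pose g (u : (servers s).-tuple (transcript Q) * measurableTypeR R) : \bar R :=
  ((estimator Q u.1 u.2 - f u.2) ^+ 2 * \1_B u.2)%:E.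
have mg : measurable_fun setT g.
  apply/measurable_EFinP; apply: measurable_funM.
    apply: measurable_funX; apply: measurable_funB; first exact: (@measurable_estimator _ _ Q).
    exact: (measurableT_comp (measurable_funPT f) measurable_snd).
  apply: (measurableT_comp (f := \1_B : measurableTypeR R -> R) _ measurable_snd).
  exact: measurable_indic.
have g0 u : (0 <= g u)%E by rewrite lee_fin mulr_ge0 ?sqr_ge0// indicE.
have := @measurable_fun_fubini_tonelli_F _ _ _ _ R mu g mg g0.
apply: eq_measurable_fun => t _; rewrite /fubini_F [RHS]integral_mkcond; apply: eq_integral => x _.
by rewrite patchE /g indicE; case: ifP => _; rewrite ?mulr1 ?mulr0.
Qed.

Lemma scaled_threshold (C rad : R) : 0 < C -> 0 < rad ->
  exists t : R, [/\ 0 < t, t <= 1, t <= rad & C * t ^+ 2 <= 8^-1].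
Proof.
move=> C0 r0; pose u := (8 * C + 1)^-1; pose t := Num.min (Num.min 1 rad) u.
have p : 0 < 8 * C + 1 by rewrite addr_gt0// mulr_gt0.
have u0 : 0 < u by rewrite invr_gt0.
have t0 : 0 < t by rewrite !lt_min ltr01 r0.
have t1 : t <= 1 by rewrite !ge_min lexx.
have tr : t <= rad by rewrite !ge_min lexx orbT.
have tu : t <= u by rewrite ge_min lexx orbT.
exists t; split => //.
have h : t * (8 * C + 1) <= 1 by rewrite -ler_pdivlMr// div1r.
have := ler_wpM2r (ltW t0) t1; have := ler_wpM2l (ltW C0) (ler_wpM2r (ltW t0) t1).
rewrite mul1r -expr2; lra.
Qed.

(** Squared height times squared width times the value of the sum in the equation for [D]: the power
    of the resolution disappears, which is what the exponent [2 gamma + 2] achieves, and [t] remains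
    to be chosen small. *)
Lemma between_rate (D' nu t : R) : 0 < D' -> (t * D' `^ (- nu)) ^+ 2 * (D'^-1) ^+ 2 * D' `^ (2 * nu + 2) = t ^+ 2.
Proof.
move=> D0; rewrite exprMn -[_ `^ _ ^+ 2]powR_mulrn ?powR_ge0// -powRrM.
rewrite -[D'^-1]powR_inv1 ?(ltW D0)// -[_ `^ (-1) ^+ 2]powR_mulrn ?powR_ge0// -powRrM -!mulrA -!powRD ?(gt_eqF D0) ?implybT//.
by rewrite (_ : _ + _ = 0) ?powRr0 ?mulr1//; ring.
Qed.

End two_hypotheses.

Section lower_bounds.
Context {R : realType} (W : cdv_system R) (A l0 : nat) (alpha : R) (p q : \bar R) (rad Ceps : R).
Hypothesis A0 : (0 < A)%N.
Hypothesis hW : cdv_basis W A l0.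
Hypothesis hp : (2%:E <= p)%E.
Hypothesis hq : (1%:E <= q)%E.
Local Notation nu := (alpha - invp p).
Hypothesis hnu : 1 / 2 < nu.
Hypothesis rad0 : 0 < rad.
Hypothesis Ce0 : 0 < Ceps.
Local Notation mu := (@lebesgue_measure R).

(** The bump is scaled so that its Besov norm is at most [t <= rad]. Of the total separation 1/4
    that is allowed, 1/8 goes to [C1 t ^ 2] and 1/8 to the sum of the [n delta], which determines
    [eta]. *)
Theorem pointwise_lower (x0 : R) : 0 < x0 < 1 -> exists c eta : R, [/\ 0 < c, 0 < eta &
  forall (s : setting R) (D : R), valid_setting Ceps s -> solves_rate nu s D ->
  \sum_(j < servers s) (nobs j)%:R * del j <= eta ->
  ((c * Num.min (D `^ (- (2 * nu))) 1)%:E <=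
    minimax (besov_ball_cont W alpha p q l0 rad) (@pointwise_risk R x0 s))%E].
Proof.
move=> x01; have nu0 : 0 < nu by apply: lt_trans hnu; rewrite divr_gt0.
have [cg [Cg [cg0 Cg0 [L0 hbump]]]] := bump A0 hW hp hq hnu x01.
have Cb0 : 0 < 2 * Cg by rewrite mulr_gt0.
have [C1 C10 hserv] := @gaussian_server R 0 _ _ Cb0 Ce0.
have [t [t0 t1 tr tC]] := scaled_threshold C10 rad0.
pose K : R := 2 ^+ L0.+1; have K0 : 0 < K by rewrite exprn_gt0.
(* The factor 1/16 collects 1/2 from the two squared losses, 1/4 from the two-point bound and 1/2
   from averaging two risks. *)
pose c := (t / Cg) ^+ 2 * cg ^+ 2 / 16 * K `^ (- (2 * nu)).
have c0 : 0 < c by rewrite mulr_gt0 ?powR_gt0// divr_gt0// mulr_gt0 ?exprn_gt0 ?divr_gt0.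
exists c, (8 * C1)^-1; split => //; first by rewrite invr_gt0 mulr_gt0.
move=> s D val rate hd; have [D0 _] := rate.
have [L [L0L LK hsum]] := resolution L0 nu0 rate.
pose D' : R := 2 ^+ L; have D'0 : 0 < D' by rewrite exprn_gt0.
rewrite -/D' -/K in LK; rewrite -/D' in hsum.
have D'1 : 1 <= D' by rewrite exprn_ege1// ler1n.
have [g [contg gx0 gC gsupp gbes]] := hbump L L0L.
pose h := t * D' `^ (- nu).
have pw0 : 0 < D' `^ (- nu) by rewrite powR_gt0.
have pw1 : D' `^ (- nu) <= 1 by rewrite -[X in _ <= X](powRr0 D') ler_powR// oppr_le0 ltW.
have h0 : 0 < h by rewrite mulr_gt0.
have h1 : h <= 1 by rewrite -[X in _ <= X](mulr1 1) ler_pM// ltW.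
pose b := h / Cg; have b0 : 0 < b by rewrite divr_gt0.
have cb (b' : R) : continuous (fun x => b' * g x) by exact: continuousZR.
have mb (b' : R) : measurable_fun setT (fun x => b' * g x) by exact: continuous_measurable_fun.
pose F b' : {mfun R >-> R} := HB.pack (fun x : R => b' * g x) (isMeasurableFun.Build _ _ _ _ (fun x : R => b' * g x) (mb b')).
have ball b' : `|b'| <= b -> besov_ball_cont W alpha p q l0 rad (F b').
  move=> bb; split; last by apply: continuous_subspaceT; exact: cb.
  split; first by apply: bounded_square_integrable; exact: (bi_continuous (cb b')).
  apply: le_trans (gbes b') _; rewrite lee_fin.
  apply: (@le_trans _ _ (b * Cg * 2 `^ (L%:R * nu))).
    by rewrite ler_wpM2r ?powR_ge0// ler_wpM2r// ltW.
  rewrite /b divfK ?gt_eqF// /h -mulrA.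
  have -> : 2 `^ (L%:R * nu) = D' `^ nu by rewrite powRrM powR_mulrn.
  by rewrite -powRD ?(gt_eqF D'0) ?implybT// addNr powRr0 mulr1.
have ball0 := ball 0; rewrite normr0 in ball0; have {}ball0 := ball0 (ltW b0).
have ball1 := ball b; rewrite gtr0_norm// lexx in ball1; have {}ball1 := ball1 isT.
apply: le_ereal_inf_tmp => _ [Q [bor priv] ->].
set B := ereal_sup _.
have r0 : (pointwise_risk x0 Q (F 0%R) <= B)%E by apply: ereal_sup_ubound; exists (F 0).
have r1 : (pointwise_risk x0 Q (F b) <= B)%E by apply: ereal_sup_ubound; exists (F b).
pose l (j : 'I_(servers s)) := C1 * (h ^+ 2 * (D'^-1) ^+ 2 * Num.min ((nobs j)%:R ^+ 2 * eps j ^+ 2) ((nobs j)%:R * D') + (nobs j)%:R * del j).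
have sl : \sum_j l j <= 4^-1.
  rewrite -mulr_sumr big_split/= -mulr_sumr.
  have hw0 : 0 <= h ^+ 2 * D'^-1 ^+ 2 by rewrite mulr_ge0// sqr_ge0.
  have e1 := ler_wpM2l hw0 hsum; rewrite between_rate// in e1.
  have e2 := ler_wpM2l (ltW C10) (lerD e1 hd); apply: le_trans e2 _.
  have e3 : C1 * (8 * C1)^-1 = 8^-1 by field; rewrite gt_eqF.
  rewrite mulrDr e3; apply: le_trans (lerD tC (lexx _)) _.
  by rewrite (_ : 8^-1 + 8^-1 = 4^-1 :> R)//; field.
pose cc := (b * g x0) ^+ 2 / 2.
have key : ((cc / 4)%:E <= pointwise_risk x0 Q (F 0%R) + pointwise_risk x0 Q (F b))%E.
  apply: (@transcript_two_point R s Q (F 0) (F b) l) => //.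
  - move=> j kap sg spl; have [n0 ej dj] := val j.
    have w0 : 0 < D'^-1 by rewrite invr_gt0.
    pose Bs : set R := `[x0 - Cg / D', x0 + Cg / D']%classic.
    have mBs : measurable (Bs : set (measurableTypeR R)) by exact: measurable_itv.
    have lBs : (mu Bs <= (2 * Cg * D'^-1)%:E)%E.
      rewrite lebesgue_measure_itv/= lte_fin; case: ifP => _; last by rewrite lee_fin !mulr_ge0// ltW.
      by rewrite -EFinB lee_fin le_eqVlt; apply/orP; left; apply/eqP; ring.
    have fh x : `|F b x - F 0 x| <= h.
      rewrite /= mul0r subr0 normrM gtr0_norm// -[X in _ <= X](divfK (lt0r_neq0 Cg0)) -/b.
      by rewrite ler_wpM2l// ltW.
    have fB x : ~ Bs x -> F b x = F 0 x.
      move=> nB /=; rewrite gsupp ?mulr0// ltNge; apply/negP => hx; apply: nB.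
      by rewrite /Bs/= in_itv/= -ler_distl.
    have h01 : 0 < h <= 1 by rewrite h0.
    have [b1 b2 _] := hserv _ _ _ (mechanism Q j) (F 0) (F b) h D'^-1 Bs (eps j) (del j) kap sg h01 w0 mBs lBs fh fB ej dj (priv j) spl.
    have hw : h * D'^-1 <= 1 by rewrite -[X in _ <= X](mulr1 1) ler_pM ?(ltW h0) ?(ltW w0)// invf_le1.
    have nd : 0 <= (nobs j)%:R * del j by rewrite mulr_ge0.
    rewrite /l /Num.min; case: ifP => _.
      apply: le_trans b2 _; rewrite ler_wpM2l ?(ltW C10)//; apply: lerD; last first.
        by rewrite -mulrA ler_piMr.
      by rewrite le_eqVlt; apply/orP; left; apply/eqP; ring.
    apply: le_trans b1 _; rewrite ler_wpM2l ?(ltW C10)//; apply: (@le_trans _ _ (h ^+ 2 * D'^-1 ^+ 2 * ((nobs j)%:R * D'))); last by rewrite lerDl.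
    by rewrite le_eqVlt; apply/orP; left; apply/eqP; field; rewrite gt_eqF.
  - apply/measurable_EFinP; apply: measurable_funX; apply: measurable_funB => //; exact: measurable_estimator_at.
  - apply/measurable_EFinP; apply: measurable_funX; apply: measurable_funB => //; exact: measurable_estimator_at.
  - by move=> u; rewrite lee_fin sqr_ge0.
  - by move=> u; rewrite lee_fin sqr_ge0.
  - by rewrite divr_ge0// sqr_ge0.
  - move=> u; rewrite -EFinD lee_fin; apply: le_trans (sq_two _ _ _).
    by rewrite /cc /= mul0r sub0r sqrrN.
have BB : ((cc / 4)%:E <= 2%:E * B)%E.
  by apply: le_trans key _; rewrite mule_natl mule2n; exact: (leeD r0 r1).
have B8 : ((cc / 8)%:E <= B)%E.
  have -> : cc / 8 = cc / 4 / 2 by field.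
  exact: ehalf_le.
apply: le_trans B8; rewrite lee_fin /cc /c.
have dr : 0 < 2 * nu by rewrite mulr_gt0.
have := rate_le dr D0 D'0 K0 LK.
have -> : (b * g x0) ^+ 2 / 2 / 8 = (t / Cg) ^+ 2 * (g x0) ^+ 2 / 16 * D' `^ (- (2 * nu)).
  have -> : D' `^ (- (2 * nu)) = (D' `^ (- nu)) ^+ 2.
    by rewrite -[RHS]powR_mulrn ?powR_ge0// -powRrM; congr (_ `^ _); ring.
  by rewrite /b /h; field; rewrite gt_eqF.
have gg : cg ^+ 2 <= (g x0) ^+ 2.
  by rewrite -[(g x0) ^+ 2]real_normK ?num_real// lerXn2r ?nnegrE// ltW.
move=> rl; rewrite -mulrA; apply: ler_pM => //.
- by rewrite divr_ge0// mulr_ge0// sqr_ge0.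
- by rewrite mulr_ge0 ?powR_ge0// le_min powR_ge0 ler01.
- by rewrite ler_wpM2r// ler_wpM2l// sqr_ge0.
Qed.

End lower_bounds.

Section global_lower_bound.
Context {R : realType} (W : cdv_system R) (A l0 : nat) (alpha : R) (p q : \bar R) (rad Ceps : R).
Hypothesis A0 : (0 < A)%N.
Hypothesis hW : cdv_basis W A l0.
Hypothesis hp : (2%:E <= p)%E.
Hypothesis hq : (1%:E <= q)%E.
Local Notation nu := (alpha - invp p).
Hypothesis hnu : 1 / 2 < nu.
Hypothesis rad0 : 0 < rad.
Hypothesis Ce0 : 0 < Ceps.
Local Notation mu := (@lebesgue_measure R).

(** Each coordinate is tested with the others fixed, on the cell of its own bump. Any two vertices
    that differ in one coordinate have the same budget, so one bound on the separations serves the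
    whole cube. *)
Theorem global_lower (kappa Cdel : R) : 0 < kappa -> 0 < Cdel -> exists2 c : R, 0 < c &
  forall (s : setting R) (D : R), valid_setting Ceps s -> solves_rate alpha s D ->
  (forall j : 'I_(servers s), del j <= Cdel * (Num.sqrt (nobs j)%:R * eps j ^+ 2
                         * (Num.max D 1)^-1) `^ (1 + kappa)) ->
  ((c * Num.min (D `^ (- (2 * alpha))) 1)%:E <=
    minimax (besov_ball W alpha p q l0 rad) (@global_risk R s))%E.
Proof.
move=> ka0 Cdel0; have al0 : 0 < alpha := besov_alpha_gt0 hp hnu.
have [cK [Cg [cK0 Cg0 [L0 hhay]]]] := haystack A0 hW hp hq hnu.
pose K0 : R := 2 ^+ L0.+1; have K00 : 0 < K0 by rewrite exprn_gt0.
(* The hypothesis on [delta] involves the maximum of [D] and 1, while the test uses the resolution,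
   at most [K0] times larger; this constant pays for the replacement. *)
pose Cd := Cdel * K0 `^ (1 + kappa); have Cd0 : 0 < Cd by rewrite mulr_gt0 ?powR_gt0.
have [k [Cb [Cb0 hbud]]] := private_budget ka0 Cd0 Ce0.
have [C1 C10 hserv] := @gaussian_server R k _ _ Cg0 Ce0.
have CC0 : 0 < C1 * Cb by rewrite mulr_gt0.
have [t [t0 t1 trad tC]] := scaled_threshold CC0 (mulr_gt0 rad0 Cg0).
(* Here 1/16 is 1/2 from the squared losses, 1/4 from the two-point bound and 1/2 from Assouad's
   averaging. *)
pose c := cK * (t / Cg) ^+ 2 / 16 * K0 `^ (- (2 * alpha)).
have c0 : 0 < c by rewrite mulr_gt0 ?powR_gt0// divr_gt0// mulr_gt0 ?exprn_gt0 ?divr_gt0.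
exists c => // s D val rate hd; have [D0 _] := rate.
have [L [L0L LK hsum]] := resolution L0 al0 rate.
pose D' : R := 2 ^+ L; have D'0 : 0 < D' by rewrite exprn_gt0.
rewrite -/D' -/K0 in LK; rewrite -/D' in hsum.
have D'1 : 1 <= D' by rewrite exprn_ege1// ler1n.
have [K [e [Bs [cKL he hB tB hbes]]]] := hhay L L0L.
pose h := t * D' `^ (- alpha).
have pw0 : 0 < D' `^ (- alpha) by rewrite powR_gt0.
have pw1 : D' `^ (- alpha) <= 1 by rewrite -[X in _ <= X](powRr0 D') ler_powR// oppr_le0 ltW.
have h0 : 0 < h by rewrite mulr_gt0.
have h1 : h <= 1 by rewrite -[X in _ <= X](mulr1 1) ler_pM// ltW.
pose b := h / Cg; have b0 : 0 < b by rewrite divr_gt0.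
pose f (w : 'I_K -> bool) x := b * \sum_i (w i)%:R * e i x.
have cf w : continuous (f w).
  apply: continuousZR; apply: continuous_sumR => i; apply: continuousZR; by have [] := he i.
have mf w : measurable_fun setT (f w) by exact: continuous_measurable_fun.
pose F w : {mfun R >-> R} := HB.pack (f w) (isMeasurableFun.Build _ _ _ _ (f w) (mf w)).
have FE w x : F w x = b * \sum_i (w i)%:R * e i x by [].
have ball w : besov_ball W alpha p q l0 rad (F w).
  split; first by apply: bounded_square_integrable; exact: (bi_continuous (cf w)).
  apply: le_trans (hbes b w) _; rewrite lee_fin gtr0_norm//.
  have -> : 2 `^ (L%:R * alpha) = D' `^ alpha by rewrite powRrM powR_mulrn.
  have -> : b * D' `^ alpha = t / Cg.
    rewrite /b /h; have : D' `^ (- alpha) * D' `^ alpha = 1.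
      by rewrite -powRD ?(gt_eqF D'0) ?implybT// addNr powRr0.
    by move: (D' `^ (- alpha)) (D' `^ alpha) => y1 y2 y; rewrite -[RHS]mulr1 -y; ring.
  by rewrite ler_pdivrMr.
have flipE (w : {ffun 'I_K -> bool}) i x : F (flip w i) x - F w x = b * ((~~ w i)%:R - (w i)%:R) * e i x.
  rewrite !FE -mulrBr -sumrB (bigD1 i)//= big1 ?addr0; last first.
    by move=> j ji; rewrite ffunE (negbTE ji) subrr.
  by rewrite ffunE eqxx -mulrBl mulrA.
have sgn (y : bool) : (~~ y)%:R - y%:R = (-1) ^+ y :> R.
  by case: y; rewrite ?expr0 ?expr1 /= ?subr0 ?sub0r.
move: F FE ball flipE => F FE ball flipE {cf mf f}.
apply: le_ereal_inf_tmp => _ [Q [bor priv] ->].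
set B := ereal_sup _.
have rF w : (global_risk Q (F w) <= B)%E by apply: ereal_sup_ubound; exists (F w).
(* Restricting the loss to the cell of one bump makes the coordinate losses add up to at most the
   global loss. *)
pose loss (w : {ffun 'I_K -> bool}) i (u : (servers s).-tuple (transcript Q)) :=
  (\int[mu]_(x in Bs i) ((estimator Q u x - F w x) ^+ 2)%:E)%E.
pose loss' (w : {ffun 'I_K -> bool}) i (u : (servers s).-tuple (transcript Q)) :=
  (\int[mu]_(x in Bs i) ((estimator Q u x - F (flip w i) x) ^+ 2)%:E)%E.
have mBs i : measurable (Bs i : set (measurableTypeR R)) by have [] := hB i.
have mest u w : measurable_fun (setT : set (measurableTypeR R)) (fun x : R => ((estimator Q u x - F w x) ^+ 2)%:E).
  exact: measurable_loss_at.
have mloss w i : measurable_fun setT (loss w i) by apply: measurable_loss; exact: mBs.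
have loss0 w i u : (0 <= loss w i u)%E by apply: integral_ge0 => x _; rewrite lee_fin sqr_ge0.
pose a (w : {ffun 'I_K -> bool}) i := (\int[transcript_law Q (F w)]_u loss w i u)%E.
have a0 w i : (0 <= a w i)%E by exact: integral_ge0.
have aB w : (\sum_i a w i <= B)%E.
  apply: le_trans (rF w); rewrite /a -ge0_integral_sum//.
  apply: ge0_le_integral => //.
  - by move=> u _; exact: sume_ge0.
  - by apply: emeasurable_sum => i; exact: mloss.
  - by apply: measurable_loss; exact: mI01.
  move=> u _.
  rewrite -(@ge0_integral_bigsetU _ _ _ mu _ Bs (fun x => ((estimator Q u x - F w x) ^+ 2)%:E) (index_enum 'I_K))//; last 4 first.
  - by rewrite index_enum_uniq.
  - by apply: sub_trivIset tB.
  - by apply: measurable_funTS; exact: mest.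
  - by move=> x _; rewrite lee_fin sqr_ge0.
  apply: ge0_subset_integral => //.
  - exact: bigsetU_measurable.
  - by apply: measurable_funTS; exact: mest.
  - by move=> x _; rewrite lee_fin sqr_ge0.
  apply: (@big_ind _ (fun X : set R => X `<=` (`[0%R, 1%R]%classic : set R))).
  - by [].
  - by move=> X Y hX hY x [/hX|/hY].
  - by move=> i _ x Bx; have [_ _ hBI _] := hB i; apply/in_I01; exact: hBI.
pose cc := b ^+ 2 / D' / 2.
have cc0 : 0 <= cc by rewrite !divr_ge0 ?sqr_ge0// ltW.
have akey w i : ((cc / 4)%:E <= a w i + a (flip w i) i)%E.
  pose l (j : 'I_(servers s)) := C1 * Cb * (h ^+ 2 * (D'^-1) ^+ 2 * Num.min ((nobs j)%:R ^+ 2 * eps j ^+ 2) ((nobs j)%:R * D')).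
  have [ce eC ee2] := he i; have [_ lBi BiI eBi] := hB i.
  apply: (@transcript_two_point R s Q (F w) (F (flip w i)) l (loss w i) (loss' w i)) => //.
  - move=> j kap sg spl; have [n0 ej dj] := val j.
    have w0 : 0 < D'^-1 by rewrite invr_gt0.
    have w1 : D'^-1 <= 1 by rewrite invf_le1.
    have fh x : `|F (flip w i) x - F w x| <= h.
      rewrite flipE sgn normrM [`|b * _|]normrM (gtr0_norm b0) normrX normrN1 expr1n mulr1 -[X in _ <= X](divfK (lt0r_neq0 Cg0)) -/b.
      by rewrite ler_wpM2l// ltW.
    have fB x : ~ Bs i x -> F (flip w i) x = F w x.
      by move=> /eBi ex; apply/eqP; rewrite -subr_eq0 flipE ex mulr0.
    have h01 : 0 < h <= 1 by rewrite h0.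
    have w01 : 0 < D'^-1 <= 1 by rewrite w0.
    have hs := hserv _ _ _ (mechanism Q j) (F w) (F (flip w i)) h D'^-1 (Bs i) (eps j) (del j) kap sg h01 w0 (mBs i) lBi fh fB ej dj (priv j) spl.
    have dd : del j <= Cd * (Num.sqrt (nobs j)%:R * eps j ^+ 2 * D'^-1) `^ (1 + kappa).
      apply: le_trans (hd j) _; rewrite /Cd -[X in _ <= X]mulrA ler_wpM2l ?(ltW Cdel0)//.
      have x0 : 0 <= Num.sqrt (nobs j)%:R * eps j ^+ 2 :> R by rewrite mulr_ge0 ?sqr_ge0 ?sqrtr_ge0.
      have mx0 : 0 < Num.max D 1 by rewrite lt_max ltr01 orbT.
      by apply: (@powR_shrink _ _ K0 D' (Num.max D 1)) => //; rewrite addr_ge0// ltW.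
    by have := hbud _ _ _ _ _ _ _ n0 h01 w01 ej dj C10 dd hs; rewrite invrK.
  - rewrite -mulr_sumr -mulr_sumr.
    have hw0 : 0 <= h ^+ 2 * D'^-1 ^+ 2 by rewrite mulr_ge0// sqr_ge0.
    have e1 := ler_wpM2l hw0 hsum; rewrite between_rate// in e1.
    by have := ler_wpM2l (ltW CC0) e1; lra.
  - exact: mloss.
  - by move=> u; exact: loss0.
  - move=> u; rewrite /loss /loss' -ge0_integralD//; last 4 first.
    + by move=> x _; rewrite lee_fin sqr_ge0.
    + by apply: measurable_funTS; exact: mest.
    + by move=> x _; rewrite lee_fin sqr_ge0.
    + by apply: measurable_funTS; exact: mest.
    have pw (x : R) : b ^+ 2 / 2 * e i x ^+ 2 = (F w x - F (flip w i) x) ^+ 2 / 2.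
      rewrite -[(F w x - _) ^+ 2]sqrrN opprB flipE sgn !exprMn.
      by have -> : ((-1) ^+ w i) ^+ 2 = 1 :> R; [case: (w i); rewrite ?expr0 ?expr1 ?sqrrN expr1n | ring].
    have be : bi (e i) by exact: bi_continuous.
    have cE : cc%:E = (\int[mu]_(x in Bs i) (b ^+ 2 / 2 * e i x ^+ 2)%:E)%E.
      have -> : cc = Int01 (fun x => b ^+ 2 / 2 * e i x ^+ 2).
        rewrite Int01Z; last exact: biX.
        by rewrite ee2 /cc /D'; ring.
      rewrite -Int01E; last by apply: (@biM _ (cst _)); [exact: bi_cst | exact: biX].
      rewrite integral_mkcond [RHS]integral_mkcond; apply: eq_integral => x _.
      rewrite !patchE; case: ifPn => xI; case: ifPn => xB //.
        by rewrite eBi ?expr0n ?mulr0//; move: xB; rewrite notin_setE.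
      by move: xB; rewrite inE => /BiI /in_I01 xI'; move: xI; rewrite notin_setE.
    rewrite cE; apply: ge0_le_integral => //.
    + by move=> x _; rewrite lee_fin mulr_ge0 ?divr_ge0 ?sqr_ge0.
    + by apply/measurable_EFinP; apply: measurable_funM => //; apply: measurable_funX; apply: measurable_funTS; exact: (continuous_measurable_fun ce).
    + by apply: emeasurable_funD; apply: measurable_funTS; exact: mest.
    + by move=> x _; rewrite -EFinD lee_fin pw; exact: sq_two.
have := assouad a0 aB akey; apply: le_trans; rewrite lee_fin /c.
have dr : 0 < 2 * alpha by rewrite mulr_gt0.
have := rate_le dr D0 D'0 K00 LK.
have -> : K%:R * (cc / 4) / 2 = K%:R / D' * (t / Cg) ^+ 2 / 16 * D' `^ (- (2 * alpha)).
  have -> : D' `^ (- (2 * alpha)) = (D' `^ (- alpha)) ^+ 2.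
    by rewrite -[RHS]powR_mulrn ?powR_ge0// -powRrM; congr (_ `^ _); ring.
  by rewrite /cc /b /h; field; rewrite !gt_eqF.
move=> rl; rewrite -mulrA; apply: ler_pM => //.
- by rewrite divr_ge0// mulr_ge0 ?sqr_ge0// ltW.
- by rewrite mulr_ge0 ?powR_ge0// le_min powR_ge0 ler01.
- by rewrite ler_wpM2r// ler_wpM2r ?sqr_ge0// ler_pdivlMr.
Qed.

End global_lower_bound.

(** * The Laplace mechanism *)

Section row_space.
Context (R : realType) (K : nat).
Local Notation rows := ('rV[R]_K).

(** Generating by the open sets lets the identity witness that the transcript space is standard
    Borel; maps into it are then handled through a countable base. *)
Definition row_borel : Type := g_sigma_algebraType [set U : set rows | open U].

HB.instance Definition _ := Measurable.on row_borel.

Let box (c : 'rV[rat]_K) (n : nat) : set rows := [set y | forall i, `|y ord0 i - ratr (c ord0 i)| < n.+1%:R^-1].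

Lemma rational_box (U : set rows) (x : rows) : open U -> U x -> exists c n, box c n x /\ box c n `<=` U.
Proof.
move=> oU Ux; have /nbhs_ballP[e /= e0 xeU] := open_nbhs_nbhs (conj oU Ux).
pose n := Num.bound (2 / e); have n0 : 0 < (n.+1%:R^-1 : R) by rewrite invr_gt0.
have ne : 2 * n.+1%:R^-1 <= e.
  rewrite ler_pdivrMr// mulrC -ler_pdivrMr//; apply: ltW; apply: lt_le_trans (archi_boundP _) _.
    by rewrite divr_ge0// ltW.
  by rewrite ler_nat.
have ex i : exists q : rat, `|x ord0 i - ratr q| < n.+1%:R^-1.
  have [q] := @rat_in_itvoo R (x ord0 i - n.+1%:R^-1) (x ord0 i + n.+1%:R^-1) ltac:(by rewrite ltrBlDr -addrA ltrDl addr_gt0).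
  by rewrite in_itv/= => /andP[a b]; exists q; rewrite distrC ltr_norml; apply/andP; split; [rewrite ltrBrDl; exact: a | rewrite ltrBlDl; exact: b].
exists (\row_i sval (cid (ex i))), n; split.
  by move=> i; rewrite mxE; case: cid.
move=> y hy; apply: xeU; split => // i j; rewrite (ord1 i) /ball/=.
have := hy j; rewrite mxE; case: cid => r /= hr hy'.
have := ler_distD (ratr r) (x ord0 j) (y ord0 j); rewrite [`|ratr r - _|]distrC => h.
have := ltrD hr hy'; rewrite -[X in _ < X]mulr2n -[X in _ < X]mulr_natl => h2.
exact: lt_le_trans (le_lt_trans h h2) ne.
Qed.

Lemma standard_borel_row : standard_borel row_borel R.
Proof.
exists ('rV[R]_K : completePseudoMetricType R), id; split.
- exact: norm_hausdorff.
- exists (range (fun c : 'rV[rat]_K => \row_i ratr (c ord0 i) : rows)).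
    apply: sub_countable (card_image_le _ _) _; exact: countableP.
  move=> U [x Ux] oU; have [c [n [_ cU]]] := rational_box oU Ux.
  exists (\row_i ratr (c ord0 i)); split; last by exists c.
  by apply: cU => i; rewrite mxE subrr normr0 invr_gt0.
- by exists id.
- by move=> B; rewrite image_id.
Qed.

Lemma measurable_coord (i : 'I_K) : measurable_fun setT (fun y : row_borel => (y : rows) ord0 i).
Proof.
apply: (measurability _ (RGenOpens.measurableE R)).
move=> _ [_ [a [b ->]] <-]; rewrite setTI; apply: sub_sigma_algebra.
have : open ((fun y : rows => y ord0 i) @^-1` `]a, b[%classic).
  by apply: open_comp; [move=> y _; exact: coord_continuous | exact: interval_open].
by [].
Qed.

(** An open set is a countable union of rational boxes, and the preimage of a box is a finite
    intersection of conditions on coordinates. *)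
Lemma measurable_to_row d (Y : measurableType d) (f : Y -> row_borel) :
  (forall i, measurable_fun setT (fun y => (f y : rows) ord0 i)) -> measurable_fun setT f.
Proof.
move=> mf; apply: (@measurability _ _ _ _ setT f [set U : set rows | open U]) => //.
move=> _ [U oU <-]; rewrite setTI.
(* Boxes are enumerated by [unpickle]; a code of no box, or of a box not contained in [U], gives the
   empty set. *)
pose V (k : nat) : set Y := if @unpickle ('rV[rat]_K * nat)%type k is Some cn then
   (if `[<box cn.1 cn.2 `<=` U>] then f @^-1` (box cn.1 cn.2) else set0) else set0.
have -> : f @^-1` U = \bigcup_k V k.
  apply/seteqP; split => y /=.
    move=> /(rational_box oU)[c [n [cy cU]]]; exists (pickle (c, n)) => //.
    by rewrite /V pickleK/= asboolT.
  by move=> [k _]; rewrite /V; case: unpickle => // -[c n] /=; case: asboolP => // h /h.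
apply: bigcupT_measurable => k; rewrite /V; case: unpickle => [[c n]|//].
case: asboolP => // _ /=.
have -> : f @^-1` (box c n) = \bigcap_(i in [set: 'I_K]) [set y | `|(f y : rows) ord0 i - ratr (c ord0 i)| < n.+1%:R^-1].
  by apply/seteqP; split => [y h i _|y h i]; [exact: h | exact: (h i I)].
apply: fin_bigcap_measurable => // i _.
have mg : measurable_fun setT (fun y => `|(f y : rows) ord0 i - ratr (c ord0 i)|).
  by apply: measurableT_comp => //; apply: measurable_funB.
rewrite -[X in measurable X]setTI.
have := mg measurableT `]-oo, n.+1%:R^-1[%classic (measurable_itv _).
by congr measurable; apply/seteqP; split => y /=; rewrite in_itv.
Qed.

End row_space.

Section laplace.
Context (R : realType).
Local Notation mu := (@lebesgue_measure R).
Local Notation mR := (measurableTypeR R).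

Lemma measurable_opp : measurable_fun (setT : set mR) (fun x : mR => - x : mR).
Proof. by apply: continuous_measurable_fun; exact: opp_continuous. Qed.

Lemma lebesgue_opp (A : set mR) : measurable A -> mu ((fun x : R => - x) @^-1` A) = mu A.
Proof.
move=> mA.
have mf : measurable_fun setT (fun x : mR => (- x)%R : mR) by exact: measurable_opp.
apply/esym; apply: (@lebesgue_measure_unique R (pushforward mu (fun x : mR => (- x)%R : mR)) _ A mA).
move=> X [[a b]] /= _ <-; rewrite /pushforward.
have -> : (fun x : R => - x) @^-1` `]a, b] = `[- b, - a[%classic.
  by apply/seteqP; split => x /=; rewrite !in_itv/= lerNl ltrNr andbC.
rewrite !lebesgue_measure_itv/= !lte_fin ltrN2; case: ifPn => // _.
by rewrite -!EFinB; congr (_%:E); ring.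
Qed.

Lemma ge0_integral_opp (h : R -> \bar R) : measurable_fun setT h ->
  (forall x, 0 <= h x)%E -> (\int[mu]_x h (- x)%R = \int[mu]_x h x)%E.
Proof.
move=> mh h0.
have mf : measurable_fun setT (fun x : mR => (- x)%R : mR) by exact: measurable_opp.
have := @ge0_integral_pushforward _ _ mR mR R _ mf mu setT h measurableT mh.
rewrite preimage_setT => /(_ (fun x _ => h0 x)) <-.
by apply: eq_measure_integral => A mA _; exact: lebesgue_opp.
Qed.

Definition lap_fun (x : R) : R := expR (- `|x|).

Lemma measurable_lap_fun : measurable_fun (setT : set mR) lap_fun.
Proof.
by apply: measurableT_comp => //; apply: measurableT_comp => //; exact: measurableT_comp.
Qed.

Lemma measurable_lap_funE : measurable_fun (setT : set mR) (fun x : mR => (lap_fun x)%:E).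
Proof. by apply/measurable_EFinP; exact: measurable_lap_fun. Qed.

(** Each half-line is covered by an exponential density, whose integral is known. *)
Lemma exp_abs_le (r x : R) : 0 < r -> expR (- (r * `|x|)) <= r^-1 * (exponential_pdf r x + exponential_pdf r (- x)).
Proof.
move=> r0; have p0 y := exponential_pdf_ge0 (ltW r0) y.
have [x0|x0] := leP 0 x.
  rewrite ger0_norm// mulrDr ler_wpDr ?mulr_ge0 ?invr_ge0 ?(ltW r0)//.
  by rewrite exponential_pdfE// mulKf ?gt_eqF// mulNr.
rewrite ltr0_norm// mulrDr ler_wpDl ?mulr_ge0 ?invr_ge0 ?(ltW r0)//.
rewrite exponential_pdfE ?oppr_ge0 ?(ltW x0)// mulKf ?gt_eqF// mulNr//.
Qed.

Lemma integral_exp_abs_le (r : R) : 0 < r -> (\int[mu]_x (expR (- (r * `|x|)))%:E <= (2 / r)%:E)%E.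
Proof.
move=> r0; have p0 y := exponential_pdf_ge0 (ltW r0) y.
have mp := measurable_exponential_pdf r.
have mpo : measurable_fun (setT : set mR) (fun x : mR => exponential_pdf r (- x)).
  exact: (measurableT_comp mp measurable_opp).
apply: (@le_trans _ _ (\int[mu]_x ((r^-1)%:E * ((exponential_pdf r x)%:E + (exponential_pdf r (- x))%:E)))%E).
  apply: ge0_le_integral => //.
  - apply/measurable_EFinP; apply: measurableT_comp => //; apply: measurableT_comp => //.
    by apply: measurable_funM => //; exact: measurableT_comp.
  - by apply: emeasurable_funM => //; apply: emeasurable_funD; exact/measurable_EFinP.
  - by move=> x _; rewrite -EFinD -EFinM lee_fin; exact: exp_abs_le.
rewrite ge0_integralZl//; last 3 first.
- by apply: emeasurable_funD; exact/measurable_EFinP.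
- by move=> x _; rewrite adde_ge0// lee_fin.
- by rewrite lee_fin invr_ge0 ltW.
rewrite ge0_integralD//; last 4 first.
- by move=> x _; rewrite lee_fin.
- exact/measurable_EFinP.
- by move=> x _; rewrite lee_fin.
- exact/measurable_EFinP.
rewrite (ge0_integral_opp (h := fun x => (exponential_pdf r x)%:E)); last 2 first.
- exact/measurable_EFinP.
- by move=> x; rewrite lee_fin.
by rewrite integral_exponential_pdf// -EFinD -EFinM lee_fin mulrC.
Qed.

(** The normalising constant is kept abstract: it is shown to be finite and positive. *)
Definition lap_const : R := fine (\int[mu]_x (lap_fun x)%:E)%E.

Lemma lap_constP : (\int[mu]_x (lap_fun x)%:E = lap_const%:E)%E /\ 0 < lap_const.
Proof.
have i0 : (0 <= \int[mu]_x (lap_fun x)%:E)%E by apply: integral_ge0 => x _; rewrite lee_fin expR_ge0.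
have fin : (\int[mu]_x (lap_fun x)%:E)%E \is a fin_num.
  rewrite ge0_fin_numE//; apply: le_lt_trans (ltry (2 / 1)).
  have := integral_exp_abs_le (@ltr01 R); apply: le_trans; rewrite le_eqVlt; apply/orP; left; apply/eqP.
  by apply: eq_integral => x _; rewrite /lap_fun mul1r.
split; first by rewrite /lap_const fineK.
rewrite -lte_fin /lap_const fineK//.
apply: (@lt_le_trans _ _ (\int[mu]_(x in `[0%R, 1%R]) (expR (- 1))%:E)%E).
  by rewrite integral_cst//= lebesgue_measure_itv/= lte_fin ltr01 -EFinB -EFinM lte_fin mulr_gt0 ?expR_gt0// subr0.
apply: (@le_trans _ _ (\int[mu]_(x in `[0%R, 1%R]) (lap_fun x)%:E)%E).
  apply: ge0_le_integral => //.
  - by apply/measurable_EFinP; apply: measurable_funTS; exact: measurable_lap_fun.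
  - move=> x /=; rewrite in_itv/= => /andP[x0 x1]; rewrite lee_fin ler_expR lerN2 ger0_norm//.
apply: ge0_subset_integral => //.
- exact: measurable_lap_funE.
- by move=> x _; rewrite lee_fin expR_ge0.
Qed.

Definition lap_pdf (x : R) : R := lap_const^-1 * lap_fun x.

Lemma lap_pdf_ge0 x : 0 <= lap_pdf x.
Proof. by rewrite mulr_ge0 ?expR_ge0// invr_ge0 ltW//; case: lap_constP. Qed.

Lemma measurable_lap_pdf : measurable_fun (setT : set mR) lap_pdf.
Proof. by apply: measurable_funM => //; exact: measurable_lap_fun. Qed.

Lemma measurable_lap_pdfE : measurable_fun (setT : set mR) (fun x : mR => (lap_pdf x)%:E).
Proof. by apply/measurable_EFinP; exact: measurable_lap_pdf. Qed.

Definition laplace (A : set mR) : \bar R := (\int[mu]_(x in A) (lap_pdf x)%:E)%E.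

Let laplace0 : laplace set0 = 0%E.
Proof. by rewrite /laplace integral_set0. Qed.

Let laplace_ge0 A : (0 <= laplace A)%E.
Proof. by apply: integral_ge0 => x _; rewrite lee_fin lap_pdf_ge0. Qed.

Let laplace_sigma_additive : semi_sigma_additive laplace.
Proof.
move=> /= F mF tF mUF; apply: cvg_toP.
  apply: ereal_nondecreasing_is_cvgn => m n mn.
  apply: lee_sum_nneg_natr => // k _ _; exact: laplace_ge0.
rewrite /laplace ge0_integral_bigcup//=.
- by apply/measurable_EFinP/measurable_funTS; exact: measurable_lap_pdf.
- by move=> x _; rewrite lee_fin lap_pdf_ge0.
Qed.

HB.instance Definition _ := isMeasure.Build _ _ _ laplace laplace0 laplace_ge0 laplace_sigma_additive.

Let laplace_setT : laplace setT = 1%E.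
Proof.
have [e c0] := lap_constP; rewrite /laplace; under eq_integral do rewrite EFinM.
rewrite ge0_integralZl//.
- by rewrite e -EFinM mulVf// gt_eqF.
- exact: measurable_lap_funE.
- by move=> x _; rewrite lee_fin expR_ge0.
- by rewrite lee_fin invr_ge0 ltW.
Qed.

HB.instance Definition _ := @Measure_isProbability.Build _ _ R laplace laplace_setT.

Local Open Scope ereal_scope.

Lemma ge0_integral_laplace (h : R -> \bar R) : measurable_fun (setT : set mR) h -> (forall x, 0 <= h x) ->
  \int[laplace]_x h x = \int[mu]_x (h x * (lap_pdf x)%:E).
Proof.
move=> mh h0; apply: ge0_integral_density => //; first exact: measurable_lap_pdf.
exact: lap_pdf_ge0.
Qed.

Lemma laplace_opp (h : R -> \bar R) : measurable_fun (setT : set mR) h -> (forall x, 0 <= h x) ->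
  \int[laplace]_x h (- x)%R = \int[laplace]_x h x.
Proof.
move=> mh h0.
have mo : measurable_fun (setT : set mR) (fun x : mR => h (- x)%R) by exact: (measurableT_comp mh measurable_opp).
rewrite !ge0_integral_laplace//.
rewrite -[RHS](ge0_integral_opp (h := fun x => h x * (lap_pdf x)%:E)).
- by apply: eq_integral => x _; rewrite /lap_pdf /lap_fun normrN.
- by apply: emeasurable_funM => //; exact: measurable_lap_pdfE.
- by move=> x; rewrite mule_ge0// lee_fin lap_pdf_ge0.
Qed.

(** A translation changes the density by a factor at most [exp |a|], by the triangle inequality;
    this is the whole privacy of the mechanism in one dimension. *)
Lemma laplace_translate (a : R) (h : R -> \bar R) : measurable_fun (setT : set mR) h -> (forall x, 0 <= h x) ->
  \int[laplace]_x h (x + a)%R <= (expR `|a|)%:E * \int[laplace]_x h x.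
Proof.
move=> mh h0.
have mt (b : R) : measurable_fun (setT : set mR) (fun x : mR => (x + b)%R : mR) by exact: measurable_funD.
have mha : measurable_fun (setT : set mR) (fun x : mR => h (x + a)%R) by exact: (measurableT_comp mh (mt a)).
have mpa : measurable_fun (setT : set mR) (fun x : mR => lap_pdf (x - a)).
  exact: (measurableT_comp measurable_lap_pdf (mt (- a)%R)).
rewrite !ge0_integral_laplace//.
have -> : \int[mu]_x (h (x + a)%R * (lap_pdf x)%:E) = \int[mu]_x (h x * (lap_pdf (x - a))%:E).
  rewrite -(ge0_integral_translate a (h := fun x => h x * (lap_pdf (x - a))%:E)).
  - by apply: eq_integral => x _; rewrite addrK.
  - by apply: emeasurable_funM => //; exact/measurable_EFinP.
  - by move=> x; rewrite mule_ge0// lee_fin lap_pdf_ge0.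
rewrite -ge0_integralZl//; last 2 first.
- by apply: emeasurable_funM => //; exact: measurable_lap_pdfE.
- by move=> x _; rewrite mule_ge0// lee_fin lap_pdf_ge0.
have pw (x : R) : (lap_pdf (x - a) <= expR `|a| * lap_pdf x)%R.
  rewrite /lap_pdf mulrCA ler_wpM2l ?invr_ge0 ?(ltW lap_constP.2)//.
  rewrite /lap_fun -expRD ler_expR -subr_ge0.
  by have := ler_normD (x - a)%R a; rewrite subrK; lra.
apply: ge0_le_integral => //.
- by move=> x _; rewrite mule_ge0// lee_fin lap_pdf_ge0.
- by apply: emeasurable_funM => //; exact/measurable_EFinP.
- by apply: emeasurable_funM => //; apply: emeasurable_funM => //; exact: measurable_lap_pdfE.
- by move=> x _; rewrite muleCA lee_wpmul2l// -EFinM lee_fin.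
Qed.

Lemma laplace_spread : exists2 v : R, (0 < v)%R & spread (laplace : probability mR R) id v.
Proof.
have c0 := lap_constP.2.
have mx2 (c : R) : measurable_fun (setT : set mR) (fun x : mR => ((x + c) ^+ 2)%:E).
  exact: (measurable_sqr_add (U := mR) c (@measurable_id _ mR setT)).
(* [exp (- |x|)] is split into two equal factors: one absorbs [x ^ 2] up to the constant 8, the
   other integrates to at most [2 / 2^-1]. *)
pose v : R := (lap_const^-1 * (8 * (2 / 2^-1)))%R.
have v0 : (0 < v)%R by rewrite !mulr_gt0 ?invr_gt0.
have m2 : \int[laplace]_x (x ^+ 2)%:E <= v%:E.
  have mx : measurable_fun (setT : set mR) (fun x : mR => (x ^+ 2)%:E).
    by have := mx2 0%R; under eq_fun do rewrite addr0.
  rewrite ge0_integral_laplace//; last by move=> x; rewrite lee_fin sqr_ge0.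
  have pw (x : R) : (x ^+ 2 * lap_pdf x <= lap_const^-1 * 8 * expR (- (2^-1 * `|x|)))%R.
    have e : lap_fun x = (expR (- (2^-1 * `|x|)) * expR (- (2^-1 * `|x|)))%R.
      by rewrite -expRD /lap_fun; congr expR; field.
    have h1 : (x ^+ 2 * expR (- (2^-1 * `|x|)) <= 8)%R.
      rewrite expRN ler_pdivrMr ?expR_gt0//.
      have := @pow_le_expR R 2 (2^-1 * `|x|)%R; rewrite mulr_ge0// => /(_ isT).
      by rewrite exprMn real_normK ?num_real//; move: (expR _) => y; rewrite (_ : (2`!%:R = 2 :> R)%R)//; lra.
    rewrite /lap_pdf e.
    have ci : (0 <= lap_const^-1 * expR (- (2^-1 * `|x|)))%R by rewrite mulr_ge0 ?expR_ge0// invr_ge0 ltW.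
    by have := ler_wpM2r ci h1; lra.
  apply: (@le_trans _ _ (\int[mu]_x ((lap_const^-1 * 8)%:E * (expR (- (2^-1 * `|x|)))%:E))).
    apply: ge0_le_integral => //.
    - by move=> x _; rewrite mule_ge0 ?lee_fin ?sqr_ge0 ?lap_pdf_ge0.
    - by apply: emeasurable_funM => //; exact: measurable_lap_pdfE.
    - apply: emeasurable_funM => //; apply/measurable_EFinP; apply: measurableT_comp => //; apply: measurableT_comp => //.
      by apply: measurable_funM => //; exact: measurableT_comp.
    - by move=> x _; rewrite -!EFinM lee_fin.
  rewrite ge0_integralZl//; last 2 first.
  - apply/measurable_EFinP; apply: measurableT_comp => //; apply: measurableT_comp => //.
    by apply: measurable_funM => //; exact: measurableT_comp.
  - by rewrite lee_fin mulr_ge0// invr_ge0 ltW.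
  have h2 : (0 < 2^-1 :> R)%R by rewrite invr_gt0.
  have := lee_wpmul2l (_ : 0 <= (lap_const^-1 * 8)%:E) (integral_exp_abs_le h2).
  by rewrite lee_fin mulr_ge0 ?invr_ge0 ?(ltW c0)// => /(_ isT)/le_trans; apply; rewrite -EFinM lee_fin /v mulrA.
exists v => // c; set I := \int[laplace]_x _.
have I0 : 0 <= I by apply: integral_ge0 => x _; rewrite lee_fin sqr_ge0.
(* Adding the reflected integral removes the linear term, so that the zero mean never appears as a
   signed integral. *)
have e : I + I = 2%:E * (\int[laplace]_x (x ^+ 2)%:E + (c ^+ 2)%:E).
  rewrite {1}/I -(laplace_opp (mx2 c)); last by move=> x; rewrite lee_fin sqr_ge0.
  have mo : measurable_fun (setT : set mR) (fun x : mR => ((- x + c) ^+ 2)%:E).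
    exact: (measurableT_comp (mx2 c) measurable_opp).
  rewrite -ge0_integralD//; last 2 first.
  - by move=> x _; rewrite lee_fin sqr_ge0.
  - by move=> x _; rewrite lee_fin sqr_ge0.
  transitivity (\int[laplace]_x (2%:E * (x ^+ 2)%:E + (2 * c ^+ 2)%:E)).
    by apply: eq_integral => x _; rewrite -EFinM -!EFinD; congr EFin; ring.
  have mx : measurable_fun (setT : set mR) (fun x : mR => (x ^+ 2)%:E).
    by have := mx2 0%R; under eq_fun do rewrite addr0.
  rewrite (int_affine (laplace : probability mR R) mx)//; last 2 first.
  - by move=> x; rewrite lee_fin sqr_ge0.
  - by rewrite mulr_ge0// sqr_ge0.
  have x20 : 0 <= \int[laplace]_x (x ^+ 2)%:E by apply: integral_ge0 => x _; rewrite lee_fin sqr_ge0.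
  have c20 : 0 <= (c ^+ 2)%:E by rewrite lee_fin sqr_ge0.
  by rewrite (ge0_muleDr _ x20 c20).
have h : I + I <= (2 * (v + c ^+ 2))%:E.
  have -> : (2 * (v + c ^+ 2))%:E = 2%:E * (v%:E + (c ^+ 2)%:E) by rewrite -EFinD -EFinM.
  by rewrite e; apply: lee_wpmul2l => //; exact: leeD2r.
case: I I0 h {e} => [r| |]//= _; rewrite -EFinD !lee_fin; lra.
Qed.

Definition shift n (z : n.-tuple mR) (a : 'I_n -> R) : n.-tuple mR := [tuple tnth z i + a i | i < n]%R.

Lemma measurable_shift n (a : 'I_n -> R) : measurable_fun setT (fun z : n.-tuple mR => shift z a).
Proof.
apply/measurable_fun_tnthP => i.
rewrite (_ : _ \o _ = (fun z : n.-tuple mR => (tnth z i + a i)%R : mR)); last first.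
  by apply/funext => z /=; rewrite tnth_mktuple.
by apply: measurable_funD => //; exact: measurable_tnth.
Qed.

(** The shift enters through its 1-norm, hence the sensitivity of the statistics is measured in that
    norm. *)
Lemma laplace_shift n (a : 'I_n -> R) (F : n.-tuple mR -> \bar R) : measurable_fun setT F ->
  (forall z, 0 <= F z) ->
  \int[prod_prob (fun _ : 'I_n => laplace : probability mR R)]_z F (shift z a) <=
  (expR (\sum_i `|a i|))%:E * \int[prod_prob (fun _ : 'I_n => laplace : probability mR R)]_z F z.
Proof.
elim: n a F => [|n IH] a F mF F0.
  rewrite big_ord0 expR0 mul1e le_eqVlt; apply/orP; left; apply/eqP.
  by apply: eq_integral => z _; congr F; rewrite [LHS]tuple0 [RHS]tuple0.
have mF' := measurableT_comp mF (measurable_shift a).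
rewrite (ge0_integral_prod_probS _ mF' (fun z => F0 _)) (ge0_integral_prod_probS _ mF F0) /=.
set P := prod_prob _.
have consE (x : mR) (z : n.-tuple mR) : shift (Defs.cons_tuple (x, z)) a =
    Defs.cons_tuple ((x + a ord0)%R : mR, shift z (fun i => a (lift ord0 i))).
  apply: eq_from_tnth => i; rewrite tnth_mktuple; case: (unliftP ord0 i) => [j ->|->].
    by rewrite !tnth_consS tnth_mktuple.
  by rewrite !tnth_cons0.
pose G (x : mR) := \int[P]_z F (Defs.cons_tuple (x, z)).
have mG : measurable_fun setT G by exact: measurable_int_cons_r.
have G0 x : 0 <= G x by exact: integral_ge0.
have mt : measurable_fun (setT : set mR) (fun x : mR => (x + a ord0)%R : mR) by exact: measurable_funD.
rewrite big_ord_recl expRD EFinM -muleA muleCA.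
apply: (@le_trans _ _ (\int[laplace]_x ((expR (\sum_(i < n) `|a (lift ord0 i)|))%:E * G (x + a ord0)%R))).
  apply: ge0_le_integral => //.
  - by move=> x _; exact: integral_ge0.
  - exact: (measurable_int_cons_r _ mF' (fun z => F0 _)).
  - by apply: emeasurable_funM => //; exact: (measurableT_comp mG mt).
  - move=> x _; under eq_integral do rewrite consE.
    have mx : measurable_fun setT (fun z : n.-tuple mR => F (Defs.cons_tuple ((x + a ord0)%R : mR, z))).
      by apply: (measurableT_comp mF); apply: measurableT_comp => //; exact: measurable_cons_tuple.
    exact: (IH (fun i => a (lift ord0 i)) (fun z => F (Defs.cons_tuple ((x + a ord0)%R : mR, z))) mx (fun z => F0 _)).
rewrite ge0_integralZl//; last first.
  exact: (measurableT_comp mG mt).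
by rewrite lee_wpmul2l ?lee_fin ?expR_ge0//; exact: laplace_translate.
Qed.

End laplace.

(** * Finite wavelet families and the private server *)

Section frames.
Context {R : realType} (W : cdv_system R) (A l0 : nat).
Hypothesis A0 : (0 < A)%N.
Hypothesis hW : cdv_basis W A l0.

(* [e] lists the wavelets of the levels below [l0 + n], padded with zero functions. *)
Definition frame (C : R) (n K : nat) (e : 'I_K -> R -> R) :=
  [/\ forall k, continuous (e k),
      forall x, \sum_k `|e k x| <= C * 2 `^ (n%:R / 2),
      forall c : 'I_K -> R, Int01 (fun x => (\sum_k c k * e k x) ^+ 2) <= \sum_k c k ^+ 2
    & forall g x, \sum_k Int01 (fun u => g u * e k u) * e k x = wsum W l0 (coef W l0 g) n x].

Lemma sum_widen (n m : nat) (F : nat -> R) : (n <= m)%N ->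
  \sum_(k < m) (if (k < n)%N then F k else 0) = \sum_(k < n) F k.
Proof.
move=> nm; rewrite -(big_mkord xpredT (fun k => if (k < n)%N then F k else 0)) -(big_mkord xpredT F).
rewrite (@big_cat_nat _ _ _ n)//= [X in _ + X]big1_seq ?addr0.
  by apply: eq_big_nat => k /andP[_ ->].
by move=> k /andP[_]; rewrite mem_index_iota => /andP[nk _]; rewrite ltnNge nk.
Qed.

Lemma sqrt_powers_sum (n : nat) : \sum_(i < n) (2 : R) `^ ((l0 + i)%:R / 2) <= 4 * 2 `^ (l0%:R / 2) * 2 `^ (n%:R / 2).
Proof.
have s0 : 0 < (2 : R) `^ (l0%:R / 2) by rewrite powR_gt0.
have E i : (2 : R) `^ ((l0 + i)%:R / 2) = 2 `^ (l0%:R / 2) * 2 `^ (i%:R / 2).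
  by rewrite -powRD ?pnatr_eq0 ?implybT// natrD mulrDl.
under eq_bigr do rewrite E; rewrite -mulr_sumr -[X in _ <= X]mulrA mulrCA ler_wpM2l ?(ltW s0)//.
have r2 : ((2 : R) `^ (1 / 2)) ^+ 2 = 2 by rewrite -powR_mulrn ?powR_ge0// -powRrM mul1r mulVf// powRr1.
have r0 : 0 < (2 : R) `^ (1 / 2) by rewrite powR_gt0.
(* The inductive step of the geometric sum with ratio [sqrt 2]: four and one are at most four times
   the ratio. *)
have rr : 5 <= 4 * (2 : R) `^ (1 / 2).
  by rewrite leNgt; apply/negP => h; move: r2 r0 h; set r := _ `^ _ => r2 r0 h; nra.
elim: n => [|n IH]; first by rewrite big_ord0 mulr_ge0// powR_ge0.
rewrite big_ord_recr/=.
have -> : (2 : R) `^ (n.+1%:R / 2) = 2 `^ (n%:R / 2) * 2 `^ (1 / 2).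
  by rewrite -powRD ?pnatr_eq0 ?implybT// -[n.+1%:R]natr1 mulrDl.
have p0 : 0 < (2 : R) `^ (n%:R / 2) by rewrite powR_gt0.
have := ler_wpM2l (ltW p0) rr; move: IH; set S := \sum_(i < n) _; lra.
Qed.

Lemma frame_exists : exists2 C, 0 < C & forall n, exists K (e : 'I_K -> R -> R), frame C n e.
Proof.
have [C C0 hC] := wv_sum_bound A0 hW.
exists (C * (4 * 2 `^ (l0%:R / 2))); first by rewrite !mulr_gt0 ?powR_gt0.
move=> n; pose M := (2 ^ (l0 + n).+1)%N.
have nM i : (i < n)%N -> (nwav l0 (l0 + i) <= M)%N.
  by move=> ni; apply: leq_trans (nwav_le _ _) _; rewrite leq_exp2l// ltnS leq_add2l ltnW.
pose ee (ik : 'I_n * 'I_M) x := if (ik.2 < nwav l0 (l0 + ik.1))%N then wv W l0 (l0 + ik.1) ik.2 x else 0.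
exists #|{: 'I_n * 'I_M}|, (fun k => ee (enum_val k)).
have sumE (G : 'I_n * 'I_M -> R) : \sum_(k < #|{: 'I_n * 'I_M}|) G (enum_val k) = \sum_(i < n) \sum_(k < M) G (i, k).
  rewrite (reindex (@enum_rank _)); last by exists enum_val => x _; [exact: enum_rankK | exact: enum_valK].
  by under eq_bigr do rewrite enum_rankK; rewrite pair_big; apply: eq_bigr => -[].
have cee ik : continuous (ee ik).
  rewrite /ee; case: (boolP (ik.2 < nwav l0 (l0 + ik.1))%N) => h; last exact: cst_continuous.
  by apply: (continuous_wv A0 hW) => //; exact: leq_addr.
have sumW (G : 'I_n -> nat -> R) (H : 'I_n * 'I_M -> R) :
    (forall ik, H ik = if (ik.2 < nwav l0 (l0 + ik.1))%N then G ik.1 ik.2 else 0) ->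
    \sum_(i < n) \sum_(k < M) H (i, k) = \sum_(i < n) \sum_(k < nwav l0 (l0 + i)) G i k.
  move=> HG; apply: eq_bigr => i _; under eq_bigr do rewrite HG/=.
  exact: (sum_widen (G i) (nM i (ltn_ord i))).
split.
- by move=> k; exact: cee.
- move=> x; rewrite (sumE (fun ik => `|ee ik x|)).
  rewrite (sumW (fun i k => `|wv W l0 (l0 + i) k x|) (fun ik => `|ee ik x|)); last first.
    by move=> ik; rewrite /ee; case: ifP => // _; rewrite normr0.
  apply: (@le_trans _ _ (\sum_(i < n) C * 2 `^ ((l0 + i)%:R / 2))).
    by apply: ler_sum => i _; apply: hC; exact: leq_addr.
  by rewrite -mulr_sumr -mulrA ler_wpM2l ?(ltW C0)//; exact: sqrt_powers_sum.
- move=> c.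
  (* The coefficients are extended by zero to all levels and positions, so that the combination
     becomes a partial sum of wavelets. *)
  pose c' l k : R := if insub (l - l0)%N is Some i then (if insub k is Some k' then c (enum_rank (i, k')) else 0) else 0.
  have c'E (i : 'I_n) (k : 'I_M) : c' (l0 + i)%N k = c (enum_rank (i, k)).
    by rewrite /c' addKn !valK.
  have -> : (fun x => (\sum_k c k * ee (enum_val k) x) ^+ 2) = (fun x => wsum W l0 c' n x ^+ 2).
    apply/funext => x; congr (_ ^+ 2).
    under eq_bigr => k _ do rewrite -{1}(enum_valK k).
    rewrite (sumE (fun ik => c (enum_rank ik) * ee ik x)).
    rewrite (sumW (fun i k => c' (l0 + i)%N k * wv W l0 (l0 + i) k x) (fun ik => c (enum_rank ik) * ee ik x))//.
    by move=> -[i k]; rewrite -c'E /ee; case: ifP => //=; rewrite mulr0.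
  rewrite (Int01_wsum_sqr A0 hW).
  apply: (@le_trans _ _ (\sum_(i < n) \sum_(k < M) c (enum_rank (i, k)) ^+ 2)).
    apply: ler_sum => i _.
    rewrite -(sum_widen (fun k => c' (l0 + i)%N k ^+ 2) (nM i (ltn_ord i))).
    by apply: ler_sum => k _; rewrite c'E; case: ifP => // _; exact: sqr_ge0.
  rewrite -(sumE (fun ik => c (enum_rank ik) ^+ 2)).
  by apply: ler_sum => k _; rewrite enum_valK.
- move=> g x; rewrite (sumE (fun ik => Int01 (fun u => g u * ee ik u) * ee ik x)).
  rewrite (sumW (fun i k => coef W l0 g (l0 + i) k * wv W l0 (l0 + i) k x) (fun ik => Int01 (fun u => g u * ee ik u) * ee ik x))//.
  by move=> ik; rewrite /ee coefE; case: ifP => // _; rewrite mulr0.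
Qed.

End frames.

Section push_kernel.
Context d d' d'' (X : measurableType d) (U : measurableType d') (Y : measurableType d'') (R : realType).
Context (P : probability U R) (phi : X * U -> Y).

Definition slice of measurable_fun setT phi := fun (x : X) (u : U) => phi (x, u).

Hypothesis mphi : measurable_fun setT phi.

Let measurable_slice x : measurable_fun setT (slice mphi x).
Proof. exact: (measurableT_comp mphi (pair1_measurable x)). Qed.

HB.instance Definition _ x := @isMeasurableFun.Build _ _ _ _ (slice mphi x) (measurable_slice x).

Definition push_kernel : X -> {measure set Y -> \bar R} := fun x => distribution P (slice mphi x).

Let measurable_push_kernel A : measurable A -> measurable_fun setT (push_kernel ^~ A).
Proof.
move=> mA.
have mB : measurable (phi @^-1` A) by rewrite -[X in measurable X]setTI; exact: mphi.
have := measurable_fun_xsection P mB; congr measurable_fun; apply/funext => x /=.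
rewrite /push_kernel /distribution /pushforward; congr (P _).
by apply/seteqP; split => u /=; rewrite /xsection/= inE.
Qed.

HB.instance Definition _ := @isKernel.Build _ _ X Y R push_kernel measurable_push_kernel.

Let push_kernel_prob x : push_kernel x setT = 1%E.
Proof. exact: probability_setT. Qed.

HB.instance Definition _ := @Kernel_isProbability.Build _ _ X Y R push_kernel push_kernel_prob.

Lemma ge0_integral_push_kernel x (f : Y -> \bar R) : measurable_fun setT f -> (forall y, (0 <= f y)%E) ->
  (\int[push_kernel x]_y f y = \int[P]_u f (phi (x, u)))%E.
Proof. by move=> mf f0; rewrite ge0_integral_distribution. Qed.

End push_kernel.

Section clip.
Context {R : realType}.
Local Notation mR := (measurableTypeR R).

Definition clip (tau y : R) : R := Num.max (- tau) (Num.min y tau).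

Lemma clip_le tau y : 0 <= tau -> `|clip tau y| <= tau.
Proof.
by move=> t0; rewrite /clip ler_norml le_max lexx/= ge_max ge_min lexx orbT andbT; lra.
Qed.

Lemma continuous_clip tau : continuous (clip tau).
Proof.
move=> x; apply: (@continuous_max _ _ (cst (- tau)) (fun x => Num.min x tau)); first exact: cst_continuous.
by apply: (@continuous_min _ _ id (cst tau)); [exact: id | exact: cst_continuous].
Qed.

Lemma measurable_clip tau : measurable_fun (setT : set mR) (clip tau).
Proof. by apply: continuous_measurable_fun; exact: continuous_clip. Qed.

Lemma clip_le_abs tau y : 0 <= tau -> `|clip tau y| <= `|y|.
Proof.
move=> t0; rewrite /clip; have := ler_norm y; have := ler_norm (- y); rewrite normrN => h1 h2.
rewrite ler_norml le_max ge_max ge_min le_min h2 /=; apply/andP; split.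
  by case: (leP (- tau) y) => h; apply/orP; [right|left]; lra.
by have := normr_ge0 y; lra.
Qed.

Lemma clip_id tau y : `|y| <= tau -> clip tau y = y.
Proof. by rewrite ler_norml => /andP[a b]; rewrite /clip min_l// max_r. Qed.

End clip.

Section server.
Context {R : realType} (n K : nat) (e : 'I_K -> R -> R) (tau b : R).
Local Notation Z := (R * R)%type.
Local Notation mR := (measurableTypeR R).
Hypothesis ce : forall k, continuous (e k).
Hypothesis t0 : 0 <= tau.

Definition clipped_mean (z : n.-tuple Z) (k : 'I_K) : R :=
  n%:R^-1 * \sum_(i < n) clip tau (tnth z i).1 * e k (tnth z i).2.

Definition add_noise (u : n.-tuple Z * K.-tuple mR) : row_borel R K :=
  (\row_k (clipped_mean u.1 k + b * tnth u.2 k) : 'rV[R]_K).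

Lemma measurable_clipped k : measurable_fun setT (fun z : Z => clip tau z.1 * e k z.2).
Proof.
apply: measurable_funM; first exact: (measurableT_comp (measurable_clip tau) (@measurable_fst _ _ mR mR)).
have me : measurable_fun (setT : set mR) (e k) by apply: continuous_measurable_fun; exact: ce.
exact: (measurableT_comp me (@measurable_snd _ _ mR mR)).
Qed.

Lemma measurable_clipped_mean k : measurable_fun setT (clipped_mean ^~ k).
Proof.
apply: measurable_funM => //; apply: measurable_sum => i.
apply: (measurableT_comp (measurable_clipped k)); exact: measurable_tnth.
Qed.

Lemma measurable_add_noise : measurable_fun setT add_noise.
Proof.
apply: measurable_to_row => k; under eq_fun do rewrite mxE.
apply: measurable_funD; first exact: (measurableT_comp (measurable_clipped_mean k) measurable_fst).
by apply: measurable_funM => //; exact: (measurableT_comp (measurable_tnth k) measurable_snd).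
Qed.

Definition server_kernel : R.-pker n.-tuple Z ~> row_borel R K :=
  push_kernel (prod_prob (fun _ : 'I_K => @laplace R : probability mR R)) measurable_add_noise.

(** Only one summand changes, and there the sum of the [|e k|] at a single point governs the change,
    not the number of coefficients. *)
Lemma sensitivity (a : R) (z z' : n.-tuple Z) : (0 < n)%N -> (forall x, \sum_k `|e k x| <= a) -> neighbours z z' ->
  \sum_k `|clipped_mean z k - clipped_mean z' k| <= 2 * tau * a / n%:R.
Proof.
move=> n0 ha zz.
have a0 : 0 <= a by apply: le_trans (ha 0); apply: sumr_ge0.
have n0' : 0 <= (n%:R : R)^-1 by rewrite invr_ge0.
pose q k (x : Z) : R := clip tau x.1 * e k x.2.
have qs (x : Z) : \sum_k `|q k x| <= tau * a.
  apply: (@le_trans _ _ (\sum_k tau * `|e k x.2|)).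
    by apply: ler_sum => k _; rewrite normrM ler_wpM2r// clip_le.
  by rewrite -mulr_sumr ler_wpM2l.
apply: (@le_trans _ _ (n%:R^-1 * \sum_(i < n) \sum_k `|q k (tnth z i) - q k (tnth z' i)|)).
  rewrite exchange_big/= mulr_sumr; apply: ler_sum => k _.
  rewrite /clipped_mean -mulrBr normrM ger0_norm// ler_wpM2l// -sumrB.
  exact: ler_norm_sum.
rewrite mulrC ler_wpM2r//.
apply: (@le_trans _ _ (\sum_(i < n) (tnth z i != tnth z' i)%:R * (2 * tau * a))).
  apply: ler_sum => i _; case: eqP => [->|_] /=.
    by rewrite mul0r big1// => k _; rewrite subrr normr0.
  rewrite mul1r; apply: (@le_trans _ _ (\sum_k (`|q k (tnth z i)| + `|q k (tnth z' i)|))).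
    by apply: ler_sum => k _; exact: ler_normB.
  rewrite big_split/=; have := qs (tnth z i); have := qs (tnth z' i); lra.
rewrite -mulr_suml -natr_sum -[X in _ <= X]mul1r ler_wpM2r ?mulr_ge0//.
rewrite -[X in _ <= X](_ : 1%:R = 1)// ler_nat; apply: leq_trans zz.
by rewrite -sum1_card [X in (_ <= X)%N]big_mkcond/=; apply: leq_sum => i _; rewrite inE; case: eqP.
Qed.

(** Passing from one sample to its neighbour amounts to shifting the noise vector by the difference
    of the means over [b]. *)
Lemma server_kernel_private (a ee delta : R) : (0 < n)%N -> 0 <= delta -> 0 < b ->
  (forall x, \sum_k `|e k x| <= a) -> 2 * tau * a / n%:R <= b * ee ->
  diff_private server_kernel ee delta.
Proof.
move=> n0 d0 b0 ha hb z z' _ _ zz A mA.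
apply: (@le_trans _ _ ((expR ee)%:E * server_kernel z' A)%E); last by rewrite leeDl// lee_fin.
pose F (xi : K.-tuple mR) : \bar R := (\1_A (add_noise (z', xi)))%:E.
have I0 (t : row_borel R K) : (0 <= (\1_A t : R)%:E)%E by rewrite lee_fin indicE.
have mI : measurable_fun setT (fun t : row_borel R K => (\1_A t : R)%:E).
  by apply/measurable_EFinP; exact: measurable_indic.
have indE (y : n.-tuple Z) : server_kernel y A =
    (\int[prod_prob (fun _ : 'I_K => @laplace R : probability mR R)]_xi (\1_A (add_noise (y, xi)))%:E)%E.
  rewrite -[in LHS](setIT A) -integral_indic// (ge0_integral_push_kernel _ _ _ mI I0)//.
have mF : measurable_fun setT F.
  apply/measurable_EFinP; apply: (measurableT_comp (measurable_indic mA)).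
  exact: (measurableT_comp measurable_add_noise (pair1_measurable z')).
pose sh k := (clipped_mean z k - clipped_mean z' k) / b.
have -> : server_kernel z A = (\int[prod_prob (fun _ : 'I_K => @laplace R : probability mR R)]_xi F (shift xi sh))%E.
  rewrite indE; apply: eq_integral => xi _; rewrite /F; congr (\1_A _)%:E.
  apply/rowP => k; rewrite !mxE /= tnth_mktuple /sh mulrDr mulrCA divff ?gt_eqF// mulr1.
  by ring.
apply: le_trans (laplace_shift sh mF (fun xi => I0 _)) _.
rewrite -indE; apply: lee_wpmul2r; first exact: measure_ge0.
rewrite lee_fin ler_expR; apply: le_trans (_ : (\sum_k `|clipped_mean z k - clipped_mean z' k|) / b <= _).
  by rewrite mulr_suml; apply: ler_sum => k _; rewrite normrM normfV (gtr0_norm b0).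
by rewrite ler_pdivrMr// mulrC; apply: le_trans hb; exact: sensitivity.
Qed.

Context (f : {mfun R >-> R}) (x m v vl : R).
Hypothesis vlap : spread (@laplace R : probability mR R) id vl.
Hypothesis hv : spread (P_ f) (fun z => clip tau z.1 * (\sum_k e k z.2 * e k x) - m) v.

(** Given the sample, the noise is centred with independent coordinates; the means in turn average
    [n] independent terms, each with spread [v]. *)
Lemma server_spread : (0 < n)%N ->
  spread (mixture (prod_prob (fun _ : 'I_n => P_ f)) server_kernel : probability _ _)
    (fun t => \sum_k (t : 'rV[R]_K) ord0 k * e k x - m) (b ^+ 2 * vl * (\sum_k e k x ^+ 2) + v / n%:R).
Proof.
move=> n0; have n0' : (n%:R : R) != 0 by rewrite pnatr_eq0 -lt0n.
pose M (z : n.-tuple Z) := \sum_k clipped_mean z k * e k x - m.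
have mM : measurable_fun setT M.
  apply: measurable_funB => //; apply: measurable_sum => k; apply: measurable_funM => //.
  exact: measurable_clipped_mean.
have mG : measurable_fun setT (fun t : row_borel R K => \sum_k (t : 'rV[R]_K) ord0 k * e k x - m).
  apply: measurable_funB => //; apply: measurable_sum => k; apply: measurable_funM => //.
  exact: measurable_coord.
apply: (@spread_mixture _ _ _ _ _ _ _ _ M) => //.
  move=> z c; rewrite ge0_integral_push_kernel; last 2 first.
  - apply: measurable_sqr_add; exact: measurable_funB.
  - by move=> t; rewrite lee_fin sqr_ge0.
  have mid k : measurable_fun (setT : set mR) (fun y : mR => (b * e k x) * y) by exact: measurable_funM.
  have sp := @spread_prod_prob _ mR R K (fun=> @laplace R) (fun k y => (b * e k x) * y) (fun k => (b * e k x) ^+ 2 * vl) mid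
    (fun k => spread_scale (b * e k x) (@measurable_id _ mR setT) vlap).
  have -> : b ^+ 2 * vl * (\sum_k e k x ^+ 2) = \sum_k (b * e k x) ^+ 2 * vl.
    by rewrite mulr_sumr; apply: eq_bigr => k _; ring.
  apply: le_trans (sp c); rewrite le_eqVlt; apply/orP; left; apply/eqP; apply: eq_integral => xi _.
  have -> : \sum_k (add_noise (z, xi) : 'rV[R]_K) ord0 k * e k x =
      \sum_k clipped_mean z k * e k x + \sum_k b * e k x * tnth xi k.
    by rewrite -big_split/=; apply: eq_bigr => k _; rewrite mxE; ring.
  by rewrite /M; congr (_ ^+ 2)%:E; ring.
pose H (z : Z) := clip tau z.1 * (\sum_k e k z.2 * e k x) - m.
have mH : measurable_fun setT H.
  apply: measurable_funB => //; under eq_fun do rewrite mulr_sumr; apply: measurable_sum => k.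
  under eq_fun do rewrite mulrA; apply: measurable_funM => //; exact: measurable_clipped.
have -> : M = (fun z => \sum_(i < n) n%:R^-1 * H (tnth z i)).
  apply/funext => z; rewrite /M /H -mulr_sumr sumrB sumr_const card_ord mulrBr -[m *+ n]mulr_natl mulrA mulVf// mul1r.
  congr (_ - _); rewrite /clipped_mean; under eq_bigr do rewrite -mulrA mulr_suml.
  rewrite -mulr_sumr exchange_big; congr (_ * _); apply: eq_bigr => i _; rewrite mulr_sumr.
  by apply: eq_bigr => k _; rewrite mulrA.
have -> : v / n%:R = \sum_(i < n) n%:R^-1 ^+ 2 * v.
  by rewrite sumr_const card_ord -[RHS]mulr_natl; field.
apply: (@spread_prod_prob _ _ R n (fun=> P_ f) (fun _ z => n%:R^-1 * H z)) => i.
  exact: measurable_funM.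
exact: spread_scale.
Qed.

End server.

(** * Clipped responses *)

Section centered.
Context d (T : measurableType d) (R : realType) (P : probability T R).

Lemma bounded_integrable (f : T -> R) (M : R) : measurable_fun setT f -> (forall t, `|f t| <= M) ->
  P.-integrable setT (EFin \o f).
Proof.
move=> mf fM; apply: measurable_bounded_integrable => //.
  by rewrite [X in (X < _)%E]probability_setT ltry.
by exists M; split; [exact: num_real | move=> y My t _; exact: le_trans (fM t) (ltW My)].
Qed.

Lemma RintegralE (f : T -> R) : P.-integrable setT (EFin \o f) ->
  (\int[P]_t (f t)%:E = (\int[P]_t f t)%:E)%E.
Proof. by move=> jf; rewrite /Rintegral fineK//; exact: integrable_fin_num. Qed.

Lemma Rintegral_prob_cst (c : R) : \int[P]_t c = c.
Proof. by rewrite /Rintegral int_prob_cst. Qed.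

Lemma spread_centered (f : T -> R) (M v : R) : measurable_fun setT f -> (forall t, `|f t| <= M) ->
  (\int[P]_t ((f t) ^+ 2)%:E <= v%:E)%E -> spread P (fun t => f t - \int[P]_t f t) v.
Proof.
move=> mf fM fv c; set m := \int[P]_t f t.
have M0 : 0 <= M by exact: le_trans (normr_ge0 _) (fM point).
have jf := bounded_integrable mf fM.
have mf2 : measurable_fun setT (fun t => f t ^+ 2) by exact: measurable_funX.
have jf2 : P.-integrable setT (EFin \o (fun t => f t ^+ 2)).
  by apply: (@bounded_integrable _ (M ^+ 2)) => // t; rewrite normrX lerXn2r ?nnegrE.
have ma : measurable_fun setT (fun t => 2 * (c - m) * f t) by exact: measurable_funM.
have jl : P.-integrable setT (EFin \o (fun t => 2 * (c - m) * f t + (c - m) ^+ 2)).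
  apply: (@bounded_integrable _ (`|2 * (c - m)| * M + `|(c - m) ^+ 2|)); first exact: measurable_funD.
  by move=> t; apply: le_trans (ler_normD _ _) _; rewrite lerD2r normrM ler_wpM2l.
have js : P.-integrable setT (EFin \o (fun t => 2 * (c - m) * f t)).
  by apply: (@bounded_integrable _ (`|2 * (c - m)| * M)) => // t; rewrite normrM ler_wpM2l.
have E : (fun t => (f t - m + c) ^+ 2) = (fun t => f t ^+ 2 + (2 * (c - m) * f t + (c - m) ^+ 2)).
  by apply/funext => t; ring.
have jE : P.-integrable setT (EFin \o (fun t => (f t - m + c) ^+ 2)).
  by rewrite E; apply: (integrableD _ jf2 jl).
rewrite (RintegralE jE) E RintegralD// RintegralD//; last exact: finite_measure_integrable_cst.
rewrite RintegralZl// Rintegral_prob_cst -/m.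
rewrite (RintegralE jf2) lee_fin in fv; rewrite lee_fin.
have := sqr_ge0 m; nra.
Qed.

End centered.

Section clipped_normal.
Context {R : realType}.
Local Notation mR := (measurableTypeR R).
Local Notation N01 := (normal_prob (0 : R) 1).

Let mabs (c : R) : measurable_fun setT (fun x : R => (expR (c * `|x|))%:E).
Proof.
by apply/measurable_EFinP; apply: measurableT_comp => //; apply: measurable_funM.
Qed.

Lemma integrable_normal_id : N01.-integrable setT (EFin \o (@id R)).
Proof.
apply/integrableP; split; first exact/measurable_EFinP.
apply: le_lt_trans (ltry (2 * expR (1 ^+ 2 / 2))); apply: le_trans (normal_exp_abs (ler01 : 0 <= 1 :> R)).
apply: ge0_le_integral => //.
- by apply: measurableT_comp => //; exact/measurable_EFinP.
- exact: mabs.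
- by move=> x _; rewrite lee_fin mul1r; apply: le_trans (expR_ge1Dx _); rewrite lerDr.
Qed.

Lemma normal_opp (h : R -> \bar R) : measurable_fun (setT : set mR) h -> (forall x, (0 <= h x)%E) ->
  (\int[N01]_x h (- x)%R = \int[N01]_x h x)%E.
Proof.
move=> mh h0.
have mo : measurable_fun (setT : set mR) (fun x : mR => h (- x)%R) by exact: (measurableT_comp mh (@measurable_opp R)).
rewrite !ge0_integral_normal//.
rewrite -[RHS](ge0_integral_opp (h := fun x => (h x * (normal_pdf 0 1 x)%:E)%E)).
- by apply: eq_integral => x _; rewrite !normal_pdf1E !subr0 sqrrN.
- by apply: emeasurable_funM => //; apply/measurable_EFinP; exact: measurable_normal_pdf.
- by move=> x; rewrite mule_ge0// lee_fin normal_pdf_ge0.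
Qed.

Lemma normal_mean0 : \int[N01]_x x = 0.
Proof.
rewrite /Rintegral integralE [X in (_ - X)%E](_ : _ = \int[N01]_x (EFin \o @id R)^\+ x)%E.
  rewrite subee//; apply: (integrable_pos_fin_num _ integrable_normal_id) => //.
rewrite -[RHS]normal_opp.
- by apply: eq_integral => x _; rewrite funenegE funeposE/= EFinN.
- by apply: measurable_funepos; exact/measurable_EFinP.
- by move=> x; exact: funepos_ge0.
Qed.

(** An exponential majorant has an explicit normal integral; [tau >= 2] makes the rate [tau / 2] at
    least one. *)
Lemma clip_excess (tau y : R) : 2 <= tau -> `|clip tau y - y| <= expR (tau / 2 * (`|y| - tau)).
Proof.
move=> t2; have [h|h] := leP `|y| tau; first by rewrite clip_id// subrr normr0 expR_ge0.
have e : `|clip tau y - y| = `|y| - tau.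
  rewrite /clip; have [y0|y0] := leP 0 y.
    move: h; rewrite (ger0_norm y0) => h; rewrite [Num.min _ _]min_r ?(ltW h)// max_r; last lra.
    by rewrite ler0_norm; lra.
  move: h; rewrite (ltr0_norm y0) => h; rewrite [Num.min _ _]min_l; last lra.
  by rewrite max_l; [rewrite ger0_norm; lra | lra].
have tp : 0 <= `|y| - tau by rewrite subr_ge0 ltW.
rewrite e; apply: (@le_trans _ _ (tau / 2 * (`|y| - tau))).
  by rewrite -[X in X <= _]mul1r ler_wpM2r// ler_pdivlMr// mul1r.
by apply: le_trans (expR_ge1Dx _); rewrite lerDr.
Qed.

(** After integration the exponent is [tau (B - tau) / 2 + tau ^ 2 / 8], and the square of
    [tau / 2 - B] shows that it is at most [B ^ 2 / 2 - tau ^ 2 / 4]. *)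
Lemma clip_mean_bias (B tau a : R) : 2 <= tau -> `|a| <= B ->
  `|\int[N01]_xi clip tau (a + xi) - a| <= 2 * expR (B ^+ 2 / 2) * expR (- (tau ^+ 2 / 4)).
Proof.
move=> t2 aB; have t0 : 0 <= tau by lra.
have mad : measurable_fun (setT : set mR) (fun x : mR => (a + x)%R : mR) by exact: measurable_funD.
have mc : measurable_fun setT (fun x : R => clip tau (a + x)).
  exact: (measurableT_comp (measurable_clip tau) mad).
have jc : N01.-integrable setT (EFin \o (fun x : R => clip tau (a + x))).
  by apply: (@bounded_integrable _ mR R N01 _ tau mc) => x; exact: clip_le.
have jac : N01.-integrable setT (EFin \o (fun x : R => a + x)).
  have ja : N01.-integrable setT (EFin \o (fun _ : R => a)) by exact: finite_measure_integrable_cst.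
  by apply: (integrableD _ ja integrable_normal_id).
have mean_a : \int[N01]_xi (a + xi) = a.
  rewrite RintegralD//; [|exact: finite_measure_integrable_cst|exact: integrable_normal_id].
  by rewrite Rintegral_prob_cst normal_mean0 addr0.
rewrite -[X in `|_ - X|]mean_a -RintegralB//.
have jd : N01.-integrable setT (EFin \o (fun x : R => clip tau (a + x) - (a + x))).
  exact: (integrableB _ jc jac).
apply: le_trans (le_normr_Rintegral _ jd) _ => //.
have jn : N01.-integrable setT (EFin \o (fun x : R => `|clip tau (a + x) - (a + x)|)).
  exact: (integrable_norm jd).
rewrite -lee_fin -(RintegralE jn).
apply: (@le_trans _ _ (\int[N01]_x ((expR (tau / 2 * (B - tau)))%:E * (expR (tau / 2 * `|x|))%:E))%E).
  apply: ge0_le_integral => //.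
  - by case/integrableP: jn.
  - by apply: emeasurable_funM => //; exact: mabs.
  - move=> x _; rewrite -EFinM lee_fin -expRD; apply: le_trans (clip_excess _ t2) _.
    rewrite ler_expR -mulrDr ler_wpM2l ?divr_ge0//.
    have := ler_normD a (x : R); lra.
rewrite ge0_integralZl//; last first.
  exact: mabs.
have th0 : 0 <= tau / 2 by rewrite divr_ge0.
apply: le_trans (lee_wpmul2l _ (normal_exp_abs th0)) _; first by rewrite lee_fin expR_ge0.
rewrite -EFinM lee_fin mulrCA -!mulrA ler_wpM2l// -!expRD ler_expR.
have := sqr_ge0 (tau / 2 - B); nra.
Qed.

(** Clipping only shrinks, so the bound is free of [tau], and the logarithm hidden in [tau] does not
    reach the sampling variance. *)
Lemma clip_second_moment (tau a : R) : 0 <= tau ->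
  (\int[N01]_xi ((clip tau (a + xi)) ^+ 2)%:E <= (2 * a ^+ 2 + 8 * expR (1 / 2))%:E)%E.
Proof.
move=> t0.
have mad : measurable_fun (setT : set mR) (fun x : mR => (a + x)%R : mR) by exact: measurable_funD.
have mc : measurable_fun setT (fun x : R => clip tau (a + x)).
  exact: (measurableT_comp (measurable_clip tau) mad).
apply: (@le_trans _ _ (\int[N01]_x (4%:E * (expR (1 * `|x|))%:E + (2 * a ^+ 2)%:E))%E).
  apply: ge0_le_integral => //.
  - by move=> x _; rewrite lee_fin sqr_ge0.
  - by apply/measurable_EFinP; exact: measurable_funX.
  - by apply: emeasurable_funD => //; apply: emeasurable_funM => //; exact: mabs.
  - move=> x _; rewrite -EFinM -EFinD lee_fin mul1r.
    have h1 : clip tau (a + x) ^+ 2 <= (a + x) ^+ 2.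
      by rewrite -[X in X <= _]real_normK ?num_real// -[X in _ <= X]real_normK ?num_real// lerXn2r ?nnegrE ?clip_le_abs.
    have := @pow_le_expR R 2 `|x|; rewrite normr_ge0 => /(_ isT).
    rewrite real_normK ?num_real// (_ : (2`!)%:R = 2 :> R)// => h2.
    have h3 : (a + x) ^+ 2 <= 2 * a ^+ 2 + 2 * x ^+ 2 by have := sqr_ge0 (a - x); nra.
    lra.
rewrite int_affine//; last 2 first.
- exact: mabs.
- by rewrite mulr_ge0// sqr_ge0.
apply: le_trans (leeD (lee_wpmul2l _ (normal_exp_abs (ler01 : 0 <= 1 :> R))) (lexx _)) _; first by rewrite lee_fin.
by rewrite -EFinM -EFinD lee_fin expr1n; lra.
Qed.

End clipped_normal.

Section sample.
Context {R : realType}.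
Local Notation mR := (measurableTypeR R).
Local Notation mu := (@lebesgue_measure R).
Local Notation N01 := (normal_prob (0 : R) 1).
Local Notation I01 := (`[0%R, 1%R]%classic : set R).

Lemma integral_U01 (h : R -> \bar R) : measurable_fun setT h -> (forall x, (0 <= h x)%E) ->
  (\int[uniform_prob (@ltr01 R)]_x h x = \int[mu]_(x in I01) h x)%E.
Proof. by move=> mh h0; rewrite integral_uniform// subr0 invr1 mul1e. Qed.

Lemma ae_eq_l2 (f g : {mfun R >-> R}) : (\int[mu]_(x in I01) ((f x - g x) ^+ 2)%:E = 0)%E ->
  ae_eq mu I01 (f : R -> R) g.
Proof.
move=> fg0.
have mfg : measurable_fun (I01 : set mR) (fun x => ((f x - g x) ^+ 2)%:E).
  apply/measurable_EFinP; apply: measurable_funTS; apply: measurable_funX; apply: measurable_funB.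
    exact: (@measurable_funPT _ _ R R f).
  exact: (@measurable_funPT _ _ R R g).
have /(ae_eq_integral_abs mu (mI01 (R := R)) mfg) : (\int[mu]_(x in I01) `|((f x - g x) ^+ 2)%:E| = 0)%E.
  by rewrite -[RHS]fg0; apply: eq_integral => x _; rewrite gee0_abs// lee_fin sqr_ge0.
apply: filterS => x h /h /= [] /eqP; rewrite sqrf_eq0 subr_eq0 => /eqP //.
Qed.

Context (f g : {mfun R >-> R}).
Hypothesis fg0 : (\int[mu]_(x in I01) ((f x - g x) ^+ 2)%:E = 0)%E.

(** The covariate has a density, so altering the regression function on a null set does not change
    the law of the data. *)
Lemma integral_P_ae (h : R * R -> \bar R) : measurable_fun setT h -> (forall z, (0 <= h z)%E) ->
  (\int[P_ f]_z h z = \int[P_ g]_z h z)%E.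
Proof.
move=> mh h0; rewrite [RHS](integral_P_ g mh h0) [LHS](integral_P_ f mh h0).
have m1 := measurable_noise f mh h0; have m2 := measurable_noise g mh h0.
have p (k : {mfun R >-> R}) x : (0 <= \int[N01]_xi h (k x + xi, x)%R)%E by exact: integral_ge0.
rewrite (integral_U01 m1 (p f)) (integral_U01 m2 (p g)).
apply: ge0_ae_eq_integral => //.
- exact: measurable_funTS.
- exact: measurable_funTS.
- by apply: filterS (ae_eq_l2 fg0) => x fgx /fgx ->.
Qed.

Context (K : nat) (e : 'I_K -> R -> R) (tau a B x : R).
Hypothesis t2 : 2 <= tau.
Hypothesis ce : forall k, continuous (e k).
Hypothesis ea : forall y, \sum_k `|e k y| <= a.
Hypothesis be : forall c : 'I_K -> R, Int01 (fun x => (\sum_k c k * e k x) ^+ 2) <= \sum_k c k ^+ 2.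
Hypothesis gB : forall y, `|g y| <= B.
Hypothesis cg : continuous g.

Let Ker u := \sum_k e k u * e k x.
Let H (z : R * R) := clip tau z.1 * Ker z.2.
Let M := tau * a ^+ 2.

Let t0 : 0 <= tau. Proof. exact: le_trans t2. Qed.
Let a0 : 0 <= a. Proof. by apply: le_trans (ea 0); apply: sumr_ge0. Qed.

Let KerM u : `|Ker u| <= a ^+ 2.
Proof.
apply: le_trans (ler_norm_sum _ _ _) _; apply: (@le_trans _ _ (\sum_k a * `|e k x|)).
  apply: ler_sum => k _; rewrite normrM ler_wpM2r//; apply: le_trans (ea u).
  by rewrite (bigD1 k)//= lerDl sumr_ge0.
by rewrite -mulr_sumr ler_wpM2l.
Qed.

Let cKer : continuous Ker.
Proof. by apply: continuous_sumR => k; under eq_fun do rewrite mulrC; exact: continuousZR. Qed.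

Let bKer : bi Ker. Proof. exact: bi_continuous. Qed.

Let mH : measurable_fun setT H.
Proof.
apply: measurable_funM; first exact: (measurableT_comp (measurable_clip tau) (@measurable_fst _ _ mR mR)).
have mK : measurable_fun (setT : set mR) Ker by exact: continuous_measurable_fun.
exact: (measurableT_comp mK (@measurable_snd _ _ mR mR)).
Qed.

Let HM z : `|H z| <= M.
Proof. by rewrite normrM ler_pM// clip_le. Qed.

Let rho (b : R) := \int[N01]_xi clip tau (b + xi).

Let clip_int (b : R) : N01.-integrable setT (EFin \o (fun xi : R => clip tau (b + xi))).
Proof.
have mad : measurable_fun (setT : set mR) (fun x : mR => (b + x)%R : mR) by exact: measurable_funD.
apply: (@bounded_integrable _ mR R N01 _ tau) => [|xi]; last exact: clip_le.
exact: (measurableT_comp (measurable_clip tau) mad).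
Qed.

(** Adding the bound [M] makes the integrand nonnegative, so that the integral may be iterated;
    [mean_eq] subtracts it again. *)
Let mean_shifted : bi (fun u => rho (g u) * Ker u) /\ (\int[P_ g]_z (H z + M)%:E = (Int01 (fun u => rho (g u) * Ker u + M))%:E)%E.
Proof.
have p z : (0 <= (H z + M)%:E)%E by rewrite lee_fin; have := HM z; rewrite ler_norml; lra.
have mHM : measurable_fun setT (fun z => (H z + M)%:E) by apply/measurable_EFinP; exact: measurable_funD.
have mn := measurable_noise g mHM p.
have inner u : (\int[N01]_xi (H (g u + xi, u)%R + M)%:E = (rho (g u) * Ker u + M)%:E)%E.
  have jk : N01.-integrable setT (EFin \o (fun xi : R => Ker u * clip tau (g u + xi))).
    exact: (integrableZl _ (Ker u) (clip_int (g u))).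
  have jm : N01.-integrable setT (EFin \o (fun _ : R => M)) by exact: finite_measure_integrable_cst.
  have E : EFin \o (fun xi : R => Ker u * clip tau (g u + xi) + M) = (fun xi : R => (H (g u + xi, u)%R + M)%:E).
    by apply/funext => xi /=; rewrite /H/= mulrC.
  have jE : N01.-integrable setT (EFin \o (fun xi : R => Ker u * clip tau (g u + xi) + M)) by exact: (integrableD _ jk jm).
  have := RintegralE jE; rewrite RintegralD// Rintegral_prob_cst RintegralZl// => h.
  by rewrite -[LHS](congr1 (fun F => \int[N01]_xi F xi)%E E) h mulrC.
have b1 : bi (fun u => rho (g u) * Ker u); last first.
  split => //; rewrite (integral_P_ g mHM p) integral_U01//; last by move=> u; exact: integral_ge0.
  rewrite -Int01E; first by apply: eq_integral => u _; rewrite inner.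
  by apply: biD => //; exact: bi_cst.
split; last first.
  exists (tau * a ^+ 2) => u _; rewrite normrM ler_pM//.
  apply: le_trans (le_normr_Rintegral _ (clip_int _)) _ => //.
  rewrite -lee_fin -(RintegralE (integrable_norm (clip_int (g u)))).
  rewrite -(int_prob_cst N01 tau); apply: ge0_le_integral => //.
  - by move=> xi _; rewrite lee_fin normr_ge0.
  - by case/integrableP: (integrable_norm (clip_int (g u))).
  - by move=> xi _; rewrite lee_fin clip_le.
apply: measurable_funTS; have -> : (fun u => rho (g u) * Ker u) = (fun u => rho (g u) * Ker u + M - M).
  by apply/funext => u; rewrite addrK.
apply: measurable_funB => //; apply/measurable_EFinP; apply: eq_measurable_fun mn => u _; exact: inner.
Qed.

Let m := \int[P_ f]_z H z.

Let jH : (P_ f).-integrable setT (EFin \o H).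
Proof. exact: bounded_integrable mH HM. Qed.

Let mean_eq : m = Int01 (fun u => rho (g u) * Ker u).
Proof.
have [b1 e1] := mean_shifted.
have jM : (P_ f).-integrable setT (EFin \o (fun _ : R * R => M)) by exact: finite_measure_integrable_cst.
have p z : (0 <= (H z + M)%:E)%E by rewrite lee_fin; have := HM z; rewrite ler_norml; lra.
have mHM : measurable_fun setT (fun z => (H z + M)%:E) by apply/measurable_EFinP; exact: measurable_funD.
have := RintegralE (integrableD measurableT jH jM); rewrite /= (integral_P_ae mHM p) e1 => -[].
rewrite RintegralD// Rintegral_prob_cst Int01D//; last exact: bi_cst.
by rewrite (Int01_cst M) => /addIr.
Qed.

(** Without clipping the mean would be the projection of [g] at [x]. The clipping bias is integrated
    against the crude bound [a ^ 2] of the kernel, affordable as the bias is exponentially small. *)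
Lemma sample_mean : `|m - \sum_k Int01 (fun u => g u * e k u) * e k x| <=
  a ^+ 2 * (2 * expR (B ^+ 2 / 2) * expR (- (tau ^+ 2 / 4))).
Proof.
have be' k : bi (e k) by exact: bi_continuous.
have bg : bi g by exact: bi_continuous.
have -> : \sum_k Int01 (fun u => g u * e k u) * e k x = Int01 (fun u => g u * Ker u).
  rewrite /Ker; under [in RHS]eq_fun do rewrite mulr_sumr.
  rewrite Int01_sum; last by move=> k; apply: biM => //; apply: biM => //; exact: bi_cst.
  apply: eq_bigr => k _; rewrite mulrC -Int01Z; last exact: biM.
  by congr Int01; apply/funext => u; ring.
have [b1 _] := mean_shifted.
have bgK : bi (fun u => g u * Ker u) by exact: biM.
rewrite mean_eq.
have -> : Int01 (fun u => rho (g u) * Ker u) - Int01 (fun u => g u * Ker u) =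
   Int01 (fun u => rho (g u) * Ker u + -1 * (g u * Ker u)).
  rewrite Int01D//; last by apply: (@biM _ (cst (-1))) => //; exact: bi_cst.
  by rewrite Int01Z// mulN1r.
have bd : bi (fun u => rho (g u) * Ker u + -1 * (g u * Ker u)).
  by apply: biD => //; apply: (@biM _ (cst (-1))) => //; exact: bi_cst.
apply: le_trans (Int01_abs bd) _; rewrite -[X in _ <= X]Int01_cst.
apply: Int01_le => [||u _]; [exact: bi_norm | exact: bi_cst|].
rewrite mulN1r -mulrBl normrM mulrC ler_pM//; exact: clip_mean_bias.
Qed.

(** Given the covariate, the clipped response has a bounded second moment, and the kernel is
    integrated in mean square: Bessel's inequality gives [a ^ 2] where the sup bound would give
    [a ^ 4]. *)
Lemma sample_spread : spread (P_ f) (fun z => H z - m) ((2 * B ^+ 2 + 8 * expR (1 / 2)) * a ^+ 2).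
Proof.
apply: (spread_centered mH HM).
have B0 : 0 <= B by exact: le_trans (gB 0).
have c0 : 0 <= 2 * B ^+ 2 + 8 * expR (1 / 2) by rewrite addr_ge0// mulr_ge0 ?sqr_ge0 ?expR_ge0.
have mH2 : measurable_fun setT (fun z => ((H z) ^+ 2)%:E) by apply/measurable_EFinP; exact: measurable_funX.
have p z : (0 <= ((H z) ^+ 2)%:E)%E by rewrite lee_fin sqr_ge0.
rewrite (integral_P_ae mH2 p) (integral_P_ g mH2 p).
have mn := measurable_noise g mH2 p.
rewrite integral_U01//; last by move=> u; exact: integral_ge0.
have b2 : bi (fun u => (2 * B ^+ 2 + 8 * expR (1 / 2)) * Ker u ^+ 2).
  by apply: (@biM _ (cst _)); [exact: bi_cst | exact: biX].
apply: (@le_trans _ _ (\int[mu]_(u in I01) ((2 * B ^+ 2 + 8 * expR (1 / 2)) * Ker u ^+ 2)%:E)%E).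
  apply: ge0_le_integral => //.
  - by move=> u _; exact: integral_ge0.
  - exact: measurable_funTS.
  - by apply/measurable_EFinP; case: b2.
  - move=> u _; rewrite mulrC EFinM.
    have mc : measurable_fun (setT : set mR) (fun xi : R => ((clip tau (g u + xi)) ^+ 2)%:E).
      apply/measurable_EFinP; apply: measurable_funX.
      have mad : measurable_fun (setT : set mR) (fun x : mR => (g u + x)%R : mR) by exact: measurable_funD.
      exact: (measurableT_comp (measurable_clip tau) mad).
    under eq_integral do rewrite /H/= exprMn mulrC EFinM.
    rewrite ge0_integralZl//; last 2 first.
    + by move=> xi _; rewrite lee_fin sqr_ge0.
    + by rewrite lee_fin sqr_ge0.
    apply: lee_wpmul2l; first by rewrite lee_fin sqr_ge0.
    apply: le_trans (clip_second_moment _ t0) _; rewrite lee_fin lerD2r ler_wpM2l//.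
    by rewrite -[X in X <= _]real_normK ?num_real// lerXn2r ?nnegrE.
rewrite Int01E// lee_fin Int01Z; last exact: biX.
rewrite ler_wpM2l//.
have -> : (fun u => Ker u ^+ 2) = (fun u => (\sum_k e k x * e k u) ^+ 2).
  by apply/funext => u; congr (_ ^+ 2); apply: eq_bigr => k _; rewrite mulrC.
apply: le_trans (be _) _; apply: (@le_trans _ _ (\sum_k a * `|e k x|)).
  apply: ler_sum => k _; rewrite -[X in X <= _]real_normK ?num_real// expr2 ler_wpM2r//.
  by apply: le_trans (ea x); rewrite (bigD1 k)//= lerDl sumr_ge0.
by rewrite -mulr_sumr expr2 ler_wpM2l.
Qed.

End sample.

(** * Upper bounds *)

Section averaging_protocol.
Context {R : realType} (s : setting R) (K : nat) (e : 'I_K -> R -> R) (tau : R) (b w : 'I_(servers s) -> R).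
Hypothesis ce : forall k, continuous (e k).

Definition series_at (t : row_borel R K) (x : R) : R := \sum_k (t : 'rV[R]_K) ord0 k * e k x.

Definition weighted_series (t : (servers s).-tuple (row_borel R K)) (x : R) : R :=
  \sum_j w j * series_at (tnth t j) x.

Lemma measurable_weighted_series :
  measurable_fun setT (fun u : (servers s).-tuple (row_borel R K) * R => weighted_series u.1 u.2).
Proof.
apply: measurable_sum => j; apply: measurable_funM => //; apply: measurable_sum => k; apply: measurable_funM.
  apply: (measurableT_comp (measurable_coord k)).
  exact: (measurableT_comp (measurable_tnth j) measurable_fst).
have me : measurable_fun (setT : set (measurableTypeR R)) (e k) by apply: continuous_measurable_fun; exact: ce.
exact: (measurableT_comp me measurable_snd).
Qed.

Definition averaging_protocol : protocol s :=
  @Protocol R s _ (row_borel R K) (fun j => server_kernel (nobs j) tau (b j) ce)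
    weighted_series measurable_weighted_series.

Lemma averaging_private (a : R) : 0 <= tau -> (forall x, \sum_k `|e k x| <= a) ->
  (forall j, [/\ (0 < nobs j)%N, 0 <= del j, 0 < b j & 2 * tau * a / (nobs j)%:R <= b j * eps j]) ->
  private_protocol averaging_protocol.
Proof.
move=> t0 ea h; split; first exact: standard_borel_row.
by move=> j; have [n0 d0 b0 hb] := h j; exact: (server_kernel_private ce t0 n0 d0 b0 ea hb).
Qed.

(** Weights that sum to one keep the mean [m] common to all servers, so the bias is not averaged and
    the variances add with squared weights. *)
Lemma averaging_risk (f : {mfun R >-> R}) (x m v vl y : R) : (forall j : 'I_(servers s), (0 < nobs j)%N) ->
  spread (@laplace R : probability (measurableTypeR R) R) id vl ->
  spread (P_ f) (fun z => clip tau z.1 * (\sum_k e k z.2 * e k x) - m) v ->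
  \sum_j w j = 1 ->
  (\int[transcript_law averaging_protocol f]_t ((estimator averaging_protocol t x - y) ^+ 2)%:E <=
   (\sum_j w j ^+ 2 * (b j ^+ 2 * vl * (\sum_k e k x ^+ 2) + v / (nobs j)%:R) + (m - y) ^+ 2)%:E)%E.
Proof.
move=> n0 hvl hv w1.
pose G (j : 'I_(servers s)) (t : row_borel R K) : R := w j * (series_at t x - m).
have mS : measurable_fun setT (fun t : row_borel R K => series_at t x - m).
  apply: measurable_funB => //; apply: measurable_sum => k; apply: measurable_funM => //.
  exact: measurable_coord.
have mG j : measurable_fun setT (G j) by exact: measurable_funM.
have sp := spread_prod_prob mG (fun j => spread_scale (w j) mS (server_spread (b j) ce hvl hv (n0 j))).
apply: le_trans (sp (m - y)); rewrite le_eqVlt; apply/orP; left; apply/eqP.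
apply: eq_integral => t _; congr (_ ^+ 2)%:E; rewrite /G.
under eq_bigr do rewrite mulrBr.
by rewrite sumrB -mulr_suml w1 mul1r /= /weighted_series; ring.
Qed.

End averaging_protocol.

Section risk_bound.
Context {R : realType} (W : cdv_system R) (A l0 : nat) (B : R).
Hypothesis A0 : (0 < A)%N.
Hypothesis hW : cdv_basis W A l0.
Hypothesis B0 : 0 < B.
Local Notation mu := (@lebesgue_measure R).

Lemma half_pow_sqr (n : nat) : (2 `^ (n%:R / 2)) ^+ 2 = 2 ^+ n :> R.
Proof. by rewrite -powR_mulrn ?powR_ge0// -powRrM divfK// powR_mulrn. Qed.

(** The two variance terms come from sampling and from the noise; the squared term is the bias, due
    to clipping and to the truncation of the series. One constant serves all settings, resolutions
    and weights. *)
Lemma protocol_risk : exists2 C, 0 < C & forall (s : setting R) (n : nat) (tau : R) (w : 'I_(servers s) -> R),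
  (forall j : 'I_(servers s), [/\ (0 < nobs j)%N, 0 < eps j & 0 <= del j]) -> 2 <= tau -> \sum_j w j = 1 ->
  exists2 Q : protocol s, private_protocol Q & forall f g : {mfun R >-> R},
    continuous g -> (forall x, `|g x| <= B) ->
    (\int[mu]_(x in `[0%R, 1%R]) ((f x - g x) ^+ 2)%:E = 0)%E -> forall x,
    (\int[transcript_law Q f]_t ((estimator Q t x - g x) ^+ 2)%:E <=
      (C * (\sum_j w j ^+ 2 * (2 ^+ n / (nobs j)%:R + tau ^+ 2 * (2 ^+ n) ^+ 2 / ((nobs j)%:R ^+ 2 * eps j ^+ 2)))
       + (C * 2 ^+ n * expR (- (tau ^+ 2 / 4)) + `|wsum W l0 (coef W l0 g) n x - g x|) ^+ 2)%:E)%E.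
Proof.
have [C C0 fr] := frame_exists A0 hW.
have [vl vl0 hvl] := laplace_spread R.
pose cB : R := 2 * B ^+ 2 + 8 * expR (1 / 2).
have cB0 : 0 < cB by rewrite ltr_wpDl ?mulr_gt0 ?expR_gt0// mulr_ge0// sqr_ge0.
pose c1 := 4 * C ^+ 4 * vl; pose c2 := cB * C ^+ 2; pose c3 := C ^+ 2 * (2 * expR (B ^+ 2 / 2)).
have c10 : 0 < c1 by rewrite !mulr_gt0// exprn_gt0.
have c20 : 0 < c2 by rewrite !mulr_gt0// exprn_gt0.
have c30 : 0 < c3 by rewrite !mulr_gt0 ?expR_gt0// exprn_gt0.
exists (c1 + c2 + c3); first by rewrite !addr_gt0.
move=> s n tau w val t2 w1.
have [K [e [ce ea be ew]]] := fr n.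
set a := C * _ in ea.
have a0 : 0 < a by rewrite mulr_gt0// powR_gt0.
have a2 : a ^+ 2 = C ^+ 2 * 2 ^+ n by rewrite exprMn half_pow_sqr.
have t0 : 0 < tau by exact: lt_le_trans t2.
(* The sensitivity divided by [eps j], which is the scale for which the mechanism is private. *)
pose b (j : 'I_(servers s)) := 2 * tau * a / ((nobs j)%:R * eps j).
have n0 (j : 'I_(servers s)) : 0 < (nobs j)%:R :> R by have [h _ _] := val j; rewrite ltr0n.
have e0 (j : 'I_(servers s)) : 0 < eps j by have [_ h _] := val j.
have b0 j : 0 < b j by rewrite divr_gt0 ?mulr_gt0.
exists (averaging_protocol tau b w ce).
  apply: (@averaging_private _ _ _ _ _ _ _ _ a); [exact: ltW | exact: ea |].
  move=> j; have [h1 _ h3] := val j; split => //; rewrite /b le_eqVlt; apply/orP; left; apply/eqP.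
  by field; rewrite !gt_eqF.
move=> f g cg gB fg0 x.
pose m := \int[P_ f]_z (clip tau z.1 * (\sum_k e k z.2 * e k x)).
have hm := sample_mean fg0 x t2 ce ea gB cg; rewrite -/m ew in hm.
have hv := sample_spread fg0 x t2 ce ea be gB; rewrite -/m -/cB in hv.
have n0' (j : 'I_(servers s)) : (0 < nobs j)%N by have [] := val j.
apply: le_trans (averaging_risk b (w := w) ce (g x) n0' hvl hv w1) _.
have e2 : \sum_k e k x ^+ 2 <= a ^+ 2.
  apply: (@le_trans _ _ (\sum_k a * `|e k x|)).
    apply: ler_sum => k _; rewrite -[X in X <= _]real_normK ?num_real// expr2 ler_wpM2r//.
    by apply: le_trans (ea x); rewrite (bigD1 k)//= lerDl sumr_ge0.
  by rewrite -mulr_sumr expr2 ler_wpM2l// ltW.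
rewrite lee_fin; apply: lerD.
  rewrite mulr_sumr; apply: ler_sum => j _; rewrite [X in _ <= X]mulrCA ler_wpM2l ?sqr_ge0//.
  set p := 2 ^+ n; have p0 : 0 < p by rewrite exprn_gt0.
  set Nj := (nobs j)%:R; have N0 : 0 < Nj by exact: n0.
  have ej := e0 j.
  apply: (@le_trans _ _ (c1 * (tau ^+ 2 * p ^+ 2 / (Nj ^+ 2 * eps j ^+ 2)) + c2 * (p / Nj))).
    apply: lerD; last by rewrite a2 /c2 -/p le_eqVlt; apply/orP; left; apply/eqP; ring.
    apply: le_trans (ler_wpM2l _ e2) _; first by rewrite mulr_ge0 ?sqr_ge0// ltW.
    rewrite /b -/Nj exprMn exprVn exprMn a2 -/p exprMn exprMn le_eqVlt; apply/orP; left; apply/eqP; rewrite /c1.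
    by field; rewrite !gt_eqF.
  have q1 : 0 <= p / Nj by rewrite divr_ge0// ltW.
  have q2 : 0 <= tau ^+ 2 * p ^+ 2 / (Nj ^+ 2 * eps j ^+ 2) by apply: divr_ge0; apply: mulr_ge0; exact: sqr_ge0.
  have := ltW c10; have := ltW c20; have := ltW c30; move: q1 q2; set u := p / Nj; set u' := _ / _.
  by move=> q1 q2 r3 r2 r1; nra.
rewrite -[X in X <= _]real_normK ?num_real// lerXn2r ?nnegrE//.
  by rewrite addr_ge0// !mulr_ge0 ?expR_ge0 ?exprn_ge0// !addr_ge0// ltW.
rewrite (_ : m - g x = (m - wsum W l0 (coef W l0 g) n x) + (wsum W l0 (coef W l0 g) n x - g x)); last by ring.
apply: le_trans (ler_normD _ _) _; rewrite lerD2r; apply: le_trans hm _.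
rewrite a2; set E := expR (- _); have E0 : 0 <= E by exact: expR_ge0.
have pE : 0 <= 2 ^+ n * E by rewrite mulr_ge0// exprn_ge0.
have -> : C ^+ 2 * 2 ^+ n * (2 * expR (B ^+ 2 / 2) * E) = c3 * (2 ^+ n * E) by rewrite /c3; ring.
by rewrite -mulrA ler_wpM2r// lerDr addr_ge0// ltW.
Qed.

End risk_bound.

Section rate_arithmetic.
Context {R : realType}.

Lemma dyadic_floor (D : R) : 1 <= D -> exists n, 2 ^+ n <= D < 2 ^+ n.+1.
Proof.
move=> D1; have ex : exists m, D < 2 ^+ m.
  exists (Num.bound `|D|); apply: le_lt_trans (ler_norm _) _; apply: lt_le_trans (archi_boundP _) _ => //.
  by rewrite -natrX ler_nat ltnW// ltn_expl.
case: (ex_minnP ex) => -[|m] Dm min; first by rewrite expr0 ltNge D1 in Dm.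
exists m; rewrite Dm andbT leNgt; apply/negP => /min; by rewrite ltnn.
Qed.

Context (gamma : R) (s : setting R) (D : R).
Hypothesis g0 : 0 < gamma.
Hypothesis val : forall j : 'I_(servers s), [/\ (0 < nobs j)%N, 0 < eps j & 0 <= del j].
Hypothesis rate : solves_rate gamma s D.
Hypothesis D1 : 1 <= D.
Local Notation N := ((total_obs s)%:R : R).
Local Notation u j := (Num.min ((nobs j)%:R ^+ 2 * eps j ^+ 2) ((nobs j)%:R * D)).

Let D0 : 0 < D. Proof. exact: lt_le_trans D1. Qed.

Lemma sum_nobs : N = \sum_(j < servers s) (nobs j)%:R.
Proof. by rewrite /total_obs natr_sum. Qed.

Let powE : D `^ (2 * gamma + 2) = (D `^ (gamma + 1)) ^+ 2.
Proof. by rewrite -powR_mulrn ?powR_ge0// -powRrM; congr (_ `^ _); ring. Qed.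

Let pow_ge : D <= D `^ (gamma + 1).
Proof. by rewrite -[X in X <= _](powRr1 (ltW D0)) ler_powR// lerDr ltW. Qed.

(** The nonprivate member of each minimum gives [D ^ (2 gamma + 2) <= N D], and
    [D <= D ^ (gamma + 1)] because [D >= 1]. *)
Lemma rate_le_obs : D `^ (gamma + 1) <= N.
Proof.
have h : D `^ (gamma + 1) * D `^ (gamma + 1) <= N * D `^ (gamma + 1).
  rewrite -expr2 -powE (proj2 rate); apply: (@le_trans _ _ (N * D)); last by rewrite ler_wpM2l.
  by rewrite sum_nobs mulr_suml; apply: ler_sum => j _; rewrite ge_min lexx orbT.
by rewrite -(ler_pM2r (_ : 0 < D `^ (gamma + 1)))// powR_gt0.
Qed.

(** In each variance term one factor [u j] cancels the denominator, as [u j] is at most [n D] and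
    [u j tau ^ 2] at most [M n ^ 2 eps ^ 2]; the other factor sums to [D ^ (2 gamma + 2)]. *)
Lemma resolution_choice (M tau : R) : 0 <= M -> tau ^+ 2 = 8 * ln N ->
  (forall j : 'I_(servers s), u j * tau ^+ 2 <= M * ((nobs j)%:R ^+ 2 * eps j ^+ 2)) ->
  exists (n : nat) (w : 'I_(servers s) -> R), [/\ \sum_j w j = 1,
    \sum_j w j ^+ 2 * (2 ^+ n / (nobs j)%:R + tau ^+ 2 * (2 ^+ n) ^+ 2 / ((nobs j)%:R ^+ 2 * eps j ^+ 2)) <=
      (1 + M) * D `^ (- (2 * gamma)),
    2 ^+ n * expR (- (tau ^+ 2 / 4)) <= D `^ (- gamma)
  & forall e, 0 <= e -> 2 `^ (- (n%:R * e)) <= 2 `^ e * D `^ (- e)].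
Proof.
move=> M0 tauE hM; have [n /andP[nD Dn]] := dyadic_floor D1.
have U0 : 0 < D `^ (2 * gamma + 2) by rewrite powR_gt0.
(* The equation for [D] says precisely that these weights sum to one. *)
exists n, (fun j => u j / D `^ (2 * gamma + 2)); split.
- by rewrite -mulr_suml -(proj2 rate) divff// gt_eqF.
- apply: (@le_trans _ _ (\sum_(j < servers s) u j * ((1 + M) * D ^+ 2 / (D `^ (2 * gamma + 2)) ^+ 2))); last first.
    rewrite -mulr_suml -(proj2 rate) le_eqVlt; apply/orP; left; apply/eqP.
    have -> : D `^ (- (2 * gamma)) = D ^+ 2 / D `^ (2 * gamma + 2).
      by rewrite -powRN -powR_mulrn ?(ltW D0)// -powRD ?(gt_eqF D0) ?implybT//; congr (_ `^ _); ring.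
    by move: U0; set P := D `^ _ => U0; field; rewrite gt_eqF.
  apply: ler_sum => j _; have [n0 e0 _] := val j.
  have Nj0 : 0 < (nobs j)%:R :> R by rewrite ltr0n.
  have a0 : 0 < (nobs j)%:R ^+ 2 * eps j ^+ 2 by rewrite mulr_gt0 ?exprn_gt0.
  have u0 : 0 < u j by rewrite lt_min a0 mulr_gt0.
  have u2 : u j <= (nobs j)%:R * D by rewrite ge_min lexx orbT.
  have p0 : (0 : R) <= 2 ^+ n by rewrite exprn_ge0.
  move: (hM j) u0 u2 a0 U0 nD p0 Nj0; set uj := Num.min _ _; set a := _ * eps j ^+ 2.
  set U := D `^ _; set p := 2 ^+ n; set nj := (nobs j)%:R => hj u0 u2 a0 U0 nD p0 nj0.
  have b1 : uj * (p / nj) <= D ^+ 2.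
    rewrite mulrA ler_pdivrMr//; apply: (@le_trans _ _ (nj * D * D)).
      by apply: ler_pM => //; exact: ltW.
    by rewrite le_eqVlt; apply/orP; left; apply/eqP; ring.
  have b2 : uj * (tau ^+ 2 * p ^+ 2 / a) <= M * D ^+ 2.
    have h1 : p ^+ 2 <= D ^+ 2 by rewrite lerXn2r ?nnegrE// ltW.
    have h2 : 0 <= uj * tau ^+ 2 by rewrite mulr_ge0 ?sqr_ge0// ltW.
    rewrite mulrA ler_pdivrMr//; apply: le_trans (le_trans _ (ler_pM h2 (sqr_ge0 p) hj h1)) _.
    - by rewrite mulrA.
    - by rewrite le_eqVlt; apply/orP; left; apply/eqP; ring.
  have -> : (uj / U) ^+ 2 * (p / nj + tau ^+ 2 * p ^+ 2 / a) =
     uj / U ^+ 2 * (uj * (p / nj) + uj * (tau ^+ 2 * p ^+ 2 / a)).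
    by field; rewrite !gt_eqF.
  have -> : uj * ((1 + M) * D ^+ 2 / U ^+ 2) = uj / U ^+ 2 * (D ^+ 2 + M * D ^+ 2) by field; rewrite gt_eqF.
  by rewrite ler_wpM2l ?lerD// divr_ge0 ?sqr_ge0// ltW.
- have N1 : 1 <= N by apply: le_trans rate_le_obs; exact: le_trans pow_ge.
  have N0 : 0 < N by exact: lt_le_trans N1.
  (* The choice [tau ^ 2 = 8 ln N] makes the clipping bias [N ^- 2], which compensates the factor
     [2 ^ n]. *)
  have -> : expR (- (tau ^+ 2 / 4)) = N ^- 2.
    rewrite tauE (_ : 8 * ln N / 4 = ln N * 2%:R); last by field.
    by rewrite expRN expRM_natr lnK.
  rewrite powRN ler_pdivrMr ?exprn_gt0// mulrC ler_pdivlMr ?powR_gt0//.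
  apply: (@le_trans _ _ (D `^ (gamma + 1))).
    rewrite powRD ?(gt_eqF D0) ?implybT// powRr1 ?(ltW D0)// mulrC ler_wpM2l ?powR_ge0//.
  by apply: le_trans rate_le_obs _; rewrite expr2 ler_peMl// ltW.
- move=> e e0; rewrite !powRN -[X in _ <= X]invrK invfM invrK.
  rewrite lef_pV2 ?posrE ?mulr_gt0 ?invr_gt0 ?powR_gt0//.
  rewrite mulrC ler_pdivrMr ?powR_gt0// -powRD ?pnatr_eq0 ?implybT//.
  have -> : n%:R * e + e = n.+1%:R * e by rewrite -[n.+1%:R]natr1; ring.
  rewrite powRrM powR_mulrn//; apply: (ge0_ler_powR e0); rewrite ?nnegrE ?exprn_ge0// ltW//.
Qed.

(* With loose privacy constraints the rate is the nonprivate one, so that the logarithm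
   of [N] is dominated by [D], hence by the number of observations of each server. *)
Lemma loose_privacy (c Ceps : R) : 0 < c -> 0 < Ceps -> (forall j : 'I_(servers s), eps j <= Ceps) ->
  (forall j : 'I_(servers s), c * D <= Num.sqrt (nobs j)%:R * eps j ^+ 2) ->
  forall j : 'I_(servers s), u j * (8 * ln N) <=
    8 * (2 * gamma + 1 + `|ln (Num.min c 1)|) * Ceps ^+ 2 / c ^+ 2 * ((nobs j)%:R ^+ 2 * eps j ^+ 2).
Proof.
move=> c0 C0 eC hc.
pose r (j : 'I_(servers s)) : R := Num.sqrt (nobs j)%:R.
have rE j : (nobs j)%:R = r j ^+ 2 by rewrite sqr_sqrtr.
have r1 j : 1 <= r j.
  by have [n0 _ _] := val j; rewrite -[X in X <= _]sqrtr1 ler_wsqrtr// ler1n.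
(* Loose privacy makes every minimum comparable to its nonprivate member [n D], up to this
   constant. *)
pose c' := Num.min c 1; have c'0 : 0 < c' by rewrite lt_min c0 ltr01.
have ulow (j : 'I_(servers s)) : c' * ((nobs j)%:R * D) <= u j.
  rewrite le_min; apply/andP; split; last by rewrite ler_piMl ?ge_min ?lexx ?orbT// mulr_ge0// ltW.
  have cc : c' <= c by rewrite ge_min lexx.
  rewrite rE; have hj := hc j; rewrite -/(r j) in hj.
  apply: (@le_trans _ _ (r j ^+ 2 * (r j * (r j * eps j ^+ 2)))); last first.
    by rewrite le_eqVlt; apply/orP; left; apply/eqP; ring.
  rewrite mulrCA ler_wpM2l ?sqr_ge0//; apply: (@le_trans _ _ (c * D)); first by rewrite ler_wpM2r// ltW.
  by apply: (le_trans hj); rewrite ler_peMl// (le_trans _ hj)// mulr_ge0// ltW.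
have N1 : 1 <= N by apply: le_trans rate_le_obs; exact: le_trans pow_ge.
have N0 : 0 < N by exact: lt_le_trans N1.
(* So [N] is at most a multiple of a power of [D], and [ln N] at most a multiple of [D]. *)
have low : c' * N <= D `^ (2 * gamma + 1).
  rewrite -(ler_pM2r D0) -[X in _ * X <= _ * X](powRr1 (ltW D0)) -[X in _ <= X]powRD ?(gt_eqF D0) ?implybT//.
  rewrite (_ : 2 * gamma + 1 + 1 = 2 * gamma + 2) ?powRr1 ?(ltW D0)//; last by ring.
  rewrite (proj2 rate) sum_nobs -mulrA mulr_suml mulr_sumr; exact: ler_sum.
pose L := 2 * gamma + 1 + `|ln c'|.
have lnN : ln N <= L * D.
  have : ln (c' * N) <= ln (D `^ (2 * gamma + 1)) by rewrite ler_ln ?posrE ?mulr_gt0 ?powR_gt0.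
  rewrite lnM ?posrE// ln_powR => h.
  have h1 : ln D <= D by rewrite -ler_expR lnK//; apply: le_trans (expR_ge1Dx D); rewrite lerDr.
  have h2 : (2 * gamma + 1) * ln D <= (2 * gamma + 1) * D by rewrite ler_wpM2l// addr_ge0// mulr_ge0// ltW.
  have h3 : `|ln c'| <= `|ln c'| * D by rewrite ler_peMr.
  have := ler_norm (- ln c'); rewrite normrN /L; lra.
move=> j; have [n0 e0 _] := val j.
have hj := hc j; rewrite -/(r j) in hj.
have rj0 : 0 < r j by exact: lt_le_trans (r1 j).
have Dr : c * D <= Ceps ^+ 2 * r j.
  apply: le_trans hj _; rewrite mulrC ler_wpM2r ?(ltW rj0)// lerXn2r ?nnegrE ?(ltW e0) ?(ltW C0)//.
have L0 : 0 <= L by rewrite /L !addr_ge0// mulr_ge0// ltW.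
have lnN0 : 0 <= ln N by exact: ln_ge0.
apply: (@le_trans _ _ ((nobs j)%:R * D * (8 * (L * D)))).
  apply: ler_pM => //.
  - by rewrite le_min; apply/andP; split; [rewrite mulr_ge0 ?sqr_ge0 | rewrite mulr_ge0// ltW].
  - by rewrite mulr_ge0.
  - by rewrite ge_min lexx orbT.
  - by rewrite ler_wpM2l.
rewrite -/c' -/L rE.
have k1 : c * D * (c * D) <= (Ceps ^+ 2 * r j) * (r j * eps j ^+ 2) by apply: ler_pM => //; rewrite mulr_ge0// ltW.
have P : 0 <= r j ^+ 2 * (8 * L) / c ^+ 2 by rewrite divr_ge0 ?sqr_ge0// mulr_ge0 ?sqr_ge0// mulr_ge0.
have := ler_wpM2l P k1.
rewrite [X in X <= _](_ : _ = r j ^+ 2 * D * (8 * (L * D))); last by field; rewrite gt_eqF.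
rewrite [X in _ <= X -> _](_ : _ = 8 * L * Ceps ^+ 2 / c ^+ 2 * ((r j ^+ 2) ^+ 2 * eps j ^+ 2))//.
by field; rewrite gt_eqF.
Qed.

End rate_arithmetic.

Lemma rate_constant (R : realDomainType) (C b x M : R) : 0 <= C -> 0 <= b -> 0 <= x -> 1 <= M ->
  C * (1 + M) + b <= 2 * C * M + b * M + x * M.
Proof. by move=> C0 b0 x0 M1; have := ler_wpM2l C0 M1; have := ler_wpM2l b0 M1; nra. Qed.

Section upper_bounds.
Context {R : realType} (W : cdv_system R) (A l0 : nat) (alpha : R) (p q : \bar R) (rad : R).
Hypothesis A0 : (0 < A)%N.
Hypothesis hW : cdv_basis W A l0.
Hypothesis hp : (2%:E <= p)%E.
Hypothesis hq : (1%:E <= q)%E.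
Local Notation nu := (alpha - invp p).
Hypothesis hnu : 1 / 2 < nu.
Hypothesis rad0 : 0 < rad.
Local Notation mu := (@lebesgue_measure R).
Local Notation I01 := (`[0%R, 1%R]%classic : set R).
Local Notation N s := ((total_obs s)%:R : R).
Local Notation u s D j := (Num.min ((nobs j)%:R ^+ 2 * eps j ^+ 2) ((nobs j)%:R * D)).
Local Notation valid s := (forall j : 'I_(servers s), [/\ (0 < nobs j)%N, 0 < eps j & 0 <= del j]).

(** If the functions differed at the interior point [x0], they would differ on an interval around
    it, of positive measure but contained in a null set. *)
Lemma continuous_repr_eq (f g : {mfun R >-> R}) (x0 : R) : 0 < x0 < 1 ->
  {within I01, continuous f} -> continuous g ->
  (\int[mu]_(x in I01) ((f x - g x) ^+ 2)%:E = 0)%E -> f x0 = g x0.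
Proof.
move=> x01 cf cg fg0; apply: contrapT => /eqP ne.
have [cf' _ _] := (continuous_within_itvP (f : R -> R) (@ltr01 R)).1 cf.
have ch : {for x0, continuous (fun x => f x - g x)}.
  by apply: continuousB; [apply: cf'; rewrite in_itv/= | exact: cg].
have d0 : f x0 - g x0 != 0 by rewrite subr_eq0.
have : \forall x \near x0, f x - g x != 0.
  exact: (cvgr_neq0 _ ch d0).
move=> /nbhs_ballP[r /= r0 hr].
pose r' := Num.min (r / 2) (Num.min x0 (1 - x0)).
have /andP[x00 x10] := x01.
have r'0 : 0 < r' by rewrite !lt_min subr_gt0 x10 x00 divr_gt0.
have r'r : r' < r by apply: (@le_lt_trans _ _ (r / 2)); [rewrite ge_min lexx | rewrite ltr_pdivrMr// ltr_pMr// ltr1n].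
have [Nn [mN N0 hN]] := ae_eq_l2 fg0.
pose J : set (measurableTypeR R) := `]x0 - r', x0 + r'[%classic.
have sub : J `<=` Nn.
  move=> x; rewrite /J/= in_itv/= => /andP[xa xb]; apply: hN => /= h.
  have xr : `|x0 - x| < r' by rewrite ltr_norml; apply/andP; split; lra.
  have /eqP : f x - g x != 0 by apply: hr; apply: lt_trans xr r'r.
  apply; rewrite h ?subrr//; apply/in_I01.
  have : r' <= x0 by rewrite !ge_min lexx !orbT.
  have : r' <= 1 - x0 by rewrite !ge_min lexx !orbT.
  by move=> *; apply/andP; split; lra.
have : (mu J <= mu Nn)%E by apply: le_measure => //; rewrite inE//; exact: measurable_itv.
have lt2 : x0 - r' < x0 + r' by rewrite ltrBlDr -addrA ltrDl addr_gt0.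
rewrite N0 /J lebesgue_measure_itv/= lte_fin lt2 -EFinB lee_fin.
by rewrite (_ : x0 + r' - (x0 - r') = r' + r'); [rewrite leNgt addr_gt0 | ring].
Qed.

Lemma ln_obs_ge (x : R) : 2 <= x -> 4 <= 8 * ln x.
Proof.
move=> x2; have x0 : 0 < x by exact: lt_le_trans x2.
have h : 2^-1 <= ln x.
  rewrite -ler_expR lnK//; apply: le_trans x2.
  have := expR_ge1Dx (- 2^-1 : R); rewrite expRN; have := expR_gt0 (2^-1 : R).
  move: (expR _) => e e0 h; have := ler_wpM2r (ltW e0) h; rewrite mulVf ?gt_eqF//; lra.
lra.
Qed.

Lemma clip_level (x : R) : 4 <= x -> exists2 tau : R, 2 <= tau & tau ^+ 2 = x.
Proof.
move=> x4; exists (Num.sqrt x); last by rewrite sqr_sqrtr// (le_trans _ x4).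
rewrite -[X in X <= _](_ : Num.sqrt (2 ^+ 2) = 2); last by rewrite sqrtr_sqr ger0_norm.
by rewrite ler_wsqrtr// -natrX.
Qed.

(** It has no coefficients and zero weights. The balls are uniformly bounded, so its risk gives the
    minimum with 1 in the rate. *)
Definition zero_protocol (s : setting R) : protocol s :=
  @averaging_protocol R s 0 (fun _ => cst 0) 0 (fun _ => 1) (fun _ => 0) (fun _ => @cst_continuous _ _ 0).

Lemma zero_protocol_private (s : setting R) : valid s -> private_protocol (zero_protocol s).
Proof.
move=> val; apply: (@averaging_private _ _ _ _ _ _ _ _ 0) => // [x|j]; first by rewrite big_ord0.
by have [n0 e0 d0] := val j; split => //; rewrite !mulr0 mul0r mul1r ltW.
Qed.

Lemma zero_protocolE (s : setting R) t x : estimator (zero_protocol s) t x = 0.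
Proof. by rewrite /= /weighted_series big1// => j _; rewrite mul0r. Qed.

Lemma minimax_le (F : set {mfun R >-> R}) (s : setting R) (risk : protocol s -> {mfun R >-> R} -> \bar R)
  (Q : protocol s) (b : \bar R) : private_protocol Q -> (forall f, F f -> (risk Q f <= b)%E) ->
  (minimax F risk <= b)%E.
Proof.
move=> pQ h; apply: (@le_trans _ _ (ereal_sup [set risk Q f | f in F])).
  by apply: ereal_inf_lbound; exists Q.
by apply: ge_ereal_sup => _ [f Ff <-]; exact: h.
Qed.

(** By Tonelli the global risk is an integral of pointwise risks, in which [f] may be replaced by
    its continuous representative [g]. *)
Lemma global_risk_le (s : setting R) (Q : protocol s) (f g : {mfun R >-> R}) (b : R -> R) :
  (\int[mu]_(x in I01) ((f x - g x) ^+ 2)%:E = 0)%E -> bi b -> continuous b -> (forall x, 0 <= b x) ->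
  (forall x, \int[transcript_law Q f]_t ((estimator Q t x - g x) ^+ 2)%:E <= (b x)%:E)%E ->
  (global_risk Q f <= (Int01 b)%:E)%E.
Proof.
move=> fg0 bb cb b0 hb.
have -> : global_risk Q f = (\int[transcript_law Q f]_t \int[mu]_(x in I01) ((estimator Q t x - g x) ^+ 2)%:E)%E.
  apply: eq_integral => t _; apply: ge0_ae_eq_integral => //.
  - apply: measurable_funTS; exact: measurable_loss_at.
  - apply: measurable_funTS; exact: measurable_loss_at.
  - by move=> x _; rewrite lee_fin sqr_ge0.
  - by move=> x _; rewrite lee_fin sqr_ge0.
  - by apply: filterS (ae_eq_l2 fg0) => x fgx /fgx ->.
pose F (tx : (servers s).-tuple (transcript Q) * measurableTypeR R) : \bar R := ((estimator Q tx.1 tx.2 - g tx.2) ^+ 2)%:E.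
have mF : measurable_fun setT F.
  apply/measurable_EFinP; apply: measurable_funX; apply: measurable_funB; first exact: (@measurable_estimator _ _ Q).
  exact: (measurableT_comp (@measurable_funPT _ _ R R g) measurable_snd).
have F0 tx : (0 <= F tx)%E by rewrite lee_fin sqr_ge0.
have -> : (\int[transcript_law Q f]_t \int[mu]_(x in I01) ((estimator Q t x - g x) ^+ 2)%:E =
    \int[transcript_law Q f]_t \int[uniform_prob (@ltr01 R)]_x F (t, x))%E.
  apply: eq_integral => t _; rewrite integral_U01//; exact: measurable_loss_at.
rewrite (fubini_tonelli _ mF F0).
rewrite -Int01E// -integral_U01; last 2 first.
- by apply/measurable_EFinP; exact: continuous_measurable_fun.
- by move=> x; rewrite lee_fin.
apply: ge0_le_integral => //.
- by move=> x _; exact: integral_ge0.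
- exact: (measurable_fun_fubini_tonelli_G _ mF F0).
- by apply/measurable_EFinP; exact: continuous_measurable_fun.
- by move=> x _; exact: hb.
Qed.

(** [M] is the price of the noise, left open because it is the logarithm in one use and, for the
    global risk under loose privacy, a constant. *)
Theorem pointwise_upper (x0 : R) : 0 < x0 < 1 -> exists2 C, 0 < C & forall (s : setting R), valid s ->
  (minimax (besov_ball_cont W alpha p q l0 rad) (@pointwise_risk R x0 s) <= C%:E)%E /\
  forall D M, solves_rate nu s D -> 1 <= D -> 2 <= N s -> 1 <= M ->
   (forall j : 'I_(servers s), u s D j * (8 * ln (N s)) <= M * ((nobs j)%:R ^+ 2 * eps j ^+ 2)) ->
   (minimax (besov_ball_cont W alpha p q l0 rad) (@pointwise_risk R x0 s) <= (C * M * D `^ (- (2 * nu)))%:E)%E.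
Proof.
move=> x01; have nu0 : 0 < nu by apply: lt_trans hnu; rewrite divr_gt0.
have [B B0 hB] := besov_expansion A0 hW hp hq hnu rad0.
have [C C0 hC] := protocol_risk B A0 hW.
have c20 : 0 < C + B * 2 `^ nu by rewrite addr_gt0// mulr_gt0// powR_gt0.
exists (2 * C + (C + B * 2 `^ nu) ^+ 2 + B ^+ 2); first by rewrite !addr_gt0 ?mulr_gt0 ?exprn_gt0.
move=> s val; split.
  apply: (minimax_le (zero_protocol_private val)) => f [fb fc].
  have [g [[cg gB _ _] fg0]] := hB f fb.
  rewrite /pointwise_risk (continuous_repr_eq x01 fc cg fg0).
  under eq_integral do rewrite zero_protocolE sub0r sqrrN.
  rewrite int_prob_cst lee_fin -[X in X <= _]real_normK ?num_real//.
  apply: (@le_trans _ _ (B ^+ 2)); first by rewrite lerXn2r ?nnegrE// ltW.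
  by rewrite lerDr addr_ge0 ?sqr_ge0// mulr_ge0// ltW.
move=> D M rate D1 N2 M1 hM.
have lnN := ln_obs_ge N2.
have [tau t2 tauE] := clip_level lnN.
rewrite -tauE in hM.
have [n [w [w1 hvar hsmall hpow]]] := resolution_choice nu0 val rate D1 (le_trans ler01 M1) tauE hM.
have [Q pQ hQ] := hC s n tau w val t2 w1.
apply: (minimax_le pQ) => f [fb fc].
have [g [[cg gB gsup _] fg0]] := hB f fb.
rewrite /pointwise_risk (continuous_repr_eq x01 fc cg fg0).
apply: le_trans (hQ f g cg gB fg0 x0) _; rewrite lee_fin.
have p0 : 0 < D `^ (- nu) by rewrite powR_gt0// (lt_le_trans ltr01).
have pE : D `^ (- (2 * nu)) = (D `^ (- nu)) ^+ 2.
  by rewrite -[RHS]powR_mulrn ?powR_ge0// -powRrM; congr (_ `^ _); ring.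
rewrite pE in hvar *.
have h1 := ler_wpM2l (ltW C0) hvar.
have h2 : C * 2 ^+ n * expR (- (tau ^+ 2 / 4)) + `|wsum W l0 (coef W l0 g) n x0 - g x0| <= (C + B * 2 `^ nu) * D `^ (- nu).
  rewrite mulrDl -mulrA; apply: lerD; first by rewrite ler_wpM2l// ltW.
  by rewrite distrC; apply: le_trans (gsup n x0) _; rewrite -mulrA ler_wpM2l ?(ltW B0)//; apply: hpow; exact: ltW.
have h3 : (C * 2 ^+ n * expR (- (tau ^+ 2 / 4)) + `|wsum W l0 (coef W l0 g) n x0 - g x0|) ^+ 2 <=
    (C + B * 2 `^ nu) ^+ 2 * D `^ (- nu) ^+ 2.
  rewrite -exprMn lerXn2r ?nnegrE//.
    by rewrite addr_ge0// !mulr_ge0 ?expR_ge0 ?exprn_ge0// ltW.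
  by rewrite mulr_ge0// ltW.
apply: le_trans (lerD h1 h3) _.
have P0 := sqr_ge0 (D `^ (- nu)); move: P0; set P := _ ^+ 2 => P0.
have := sqr_ge0 (C + B * 2 `^ nu); have := sqr_ge0 B; set c2 := _ ^+ 2; set b2 := _ ^+ 2 => b20 c20'.
have -> : (2 * C + b2 + c2) * M * P = (2 * C * M + b2 * M + c2 * M) * P by ring.
have -> : C * ((1 + M) * P) + b2 * P = (C * (1 + M) + b2) * P by ring.
rewrite ler_wpM2r//.
exact: rate_constant (ltW C0) c20' b20 M1.
Qed.

Theorem global_upper : exists2 C, 0 < C & forall (s : setting R), valid s ->
  (minimax (besov_ball W alpha p q l0 rad) (@global_risk R s) <= C%:E)%E /\
  forall D M, solves_rate alpha s D -> 1 <= D -> 2 <= N s -> 1 <= M ->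
   (forall j : 'I_(servers s), u s D j * (8 * ln (N s)) <= M * ((nobs j)%:R ^+ 2 * eps j ^+ 2)) ->
   (minimax (besov_ball W alpha p q l0 rad) (@global_risk R s) <= (C * M * D `^ (- (2 * alpha)))%:E)%E.
Proof.
have al0 : 0 < alpha by exact: besov_alpha_gt0 hp hnu.
have [B B0 hB] := besov_expansion A0 hW hp hq hnu rad0.
have [C C0 hC] := protocol_risk B A0 hW.
pose b2 := 2 * C ^+ 2 + 2 * (B * 2 `^ (2 * alpha)).
have b20 : 0 <= b2 by rewrite addr_ge0// mulr_ge0 ?sqr_ge0// mulr_ge0 ?powR_ge0// ltW.
exists (2 * C + b2 + B ^+ 2); first by rewrite ltr_wpDr ?sqr_ge0// ltr_wpDr// mulr_gt0.
move=> s val; split.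
  apply: (minimax_le (zero_protocol_private val)) => f fb.
  have [g [[cg gB _ _] fg0]] := hB f fb.
  have B2 : 0 <= B ^+ 2 by exact: sqr_ge0.
  apply: le_trans (global_risk_le fg0 (bi_cst (B ^+ 2)) (fun x => @cst_continuous _ _ (B ^+ 2) x) (fun _ => B2) _) _.
    move=> x; under eq_integral do rewrite zero_protocolE sub0r sqrrN.
    by rewrite int_prob_cst lee_fin -[X in X <= _]real_normK ?num_real// lerXn2r ?nnegrE// ltW.
  by rewrite lee_fin (Int01_cst (B ^+ 2)) lerDr addr_ge0// mulr_ge0// ltW.
move=> D M rate D1 N2 M1 hM.
have lnN := ln_obs_ge N2.
have [tau t2 tauE] := clip_level lnN.
rewrite -tauE in hM.
have [n [w [w1 hvar hsmall hpow]]] := resolution_choice al0 val rate D1 (le_trans ler01 M1) tauE hM.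
have [Q pQ hQ] := hC s n tau w val t2 w1.
apply: (minimax_le pQ) => f fb.
have [g [[cg gB _ gl2] fg0]] := hB f fb.
have p0 : 0 < D `^ (- alpha) by rewrite powR_gt0// (lt_le_trans ltr01).
have pE : D `^ (- (2 * alpha)) = (D `^ (- alpha)) ^+ 2.
  by rewrite -[RHS]powR_mulrn ?powR_ge0// -powRrM; congr (_ `^ _); ring.
set V := \sum_j _ in hvar; set E := 2 ^+ n * expR _ in hsmall.
have E0 : 0 <= E by rewrite mulr_ge0 ?expR_ge0// exprn_ge0.
have V0 : 0 <= V.
  apply: sumr_ge0 => j _; apply: mulr_ge0; first exact: sqr_ge0.
  apply: addr_ge0; first by rewrite divr_ge0 ?exprn_ge0.
  by apply: divr_ge0; apply: mulr_ge0; exact: sqr_ge0.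
pose d x := g x - wsum W l0 (coef W l0 g) n x.
have cd : continuous d.
  by move=> x; apply: continuousB; [exact: cg | exact: (continuous_wsum A0 hW)].
(* The square of the bias is split, because the series error is of order [D ^ (- 2 alpha)] in mean
   square, whereas its sup bound only has exponent [nu]. *)
pose bnd x := (C * V + 2 * (C * E) ^+ 2) + 2 * d x ^+ 2.
have cb : continuous bnd.
  have c2 : continuous (fun x => 2 * d x ^+ 2).
    by apply: continuousZR => x; apply: (@continuousM _ _ d d); exact: cd.
  by move=> x; apply: (@continuousD _ _ _ (cst _) (fun x => 2 * d x ^+ 2)); [exact: cst_continuous | exact: c2].
have b0 x : 0 <= bnd x.
  apply: addr_ge0; last by apply: mulr_ge0 => //; exact: sqr_ge0.
  by apply: addr_ge0; apply: mulr_ge0 => //; [exact: ltW | exact: sqr_ge0].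
apply: le_trans (global_risk_le fg0 (bi_continuous cb) cb b0 _) _.
  move=> x; apply: le_trans (hQ f g cg gB fg0 x) _; rewrite lee_fin -/V /bnd -addrA lerD2l -mulrA -/E distrC -/(d x).
  rewrite -[d x ^+ 2]real_normK ?num_real//.
  by have := sqr_ge0 (C * E - `|d x|); rewrite sqrrB sqrrD; lra.
have bd2 : bi (fun x => d x ^+ 2) by apply: biX; exact: bi_continuous.
rewrite lee_fin /bnd Int01D; [|exact: bi_cst | by apply: (@biM _ (cst 2)) => //; exact: bi_cst].
rewrite (Int01_cst (C * V + 2 * (C * E) ^+ 2)) Int01Z//.
have h4 : Int01 (fun x => d x ^+ 2) <= B * 2 `^ (2 * alpha) * (D `^ (- alpha)) ^+ 2.
  apply: le_trans (gl2 n) _; rewrite -[X in _ <= X]mulrA ler_wpM2l ?(ltW B0)// -pE.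
  have := hpow (2 * alpha); rewrite mulr_ge0 ?(ltW al0)// => /(_ isT); apply: le_trans.
  by rewrite le_eqVlt; apply/orP; left; apply/eqP; congr (_ `^ _); ring.
have h5 : (C * E) ^+ 2 <= C ^+ 2 * (D `^ (- alpha)) ^+ 2.
  by rewrite exprMn ler_wpM2l ?sqr_ge0// lerXn2r ?nnegrE// ltW.
rewrite pE in hvar *.
have h1 := ler_wpM2l (ltW C0) hvar.
have P0 := sqr_ge0 (D `^ (- alpha)); move: P0 h1 h4 h5; set P := _ ^+ 2 => P0 h1 h4 h5.
apply: (@le_trans _ _ (C * ((1 + M) * P) + b2 * P)).
  have -> : C * ((1 + M) * P) + b2 * P = C * ((1 + M) * P) + 2 * (C ^+ 2 * P) + 2 * (B * 2 `^ (2 * alpha) * P) by rewrite /b2; ring.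
  by apply: lerD; [apply: lerD => //|]; rewrite ler_wpM2l.
have -> : (2 * C + b2 + B ^+ 2) * M * P = (2 * C * M + b2 * M + B ^+ 2 * M) * P by ring.
have -> : C * ((1 + M) * P) + b2 * P = (C * (1 + M) + b2) * P by ring.
rewrite ler_wpM2r//.
exact: rate_constant (ltW C0) b20 (sqr_ge0 B) M1.
Qed.

End upper_bounds.

(** * The sequence [M] and the final comparison *)

Section calibration.
Context {R : realType}.

(* The sequence [M] is read off the minimax risk itself, as its ratio to the rate. *)
Lemma calibrate (x : \bar R) (D g c C K : R) : 0 < D -> 0 <= g -> 0 < c -> 0 < C -> 1 <= K ->
  ((c * Num.min (D `^ (- g)) 1)%:E <= x)%E -> (x <= C%:E)%E ->
  (1 <= D -> (x <= (C * K * D `^ (- g))%:E)%E) ->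
  let M := Num.max 1 (fine x * D `^ g) in
  M <= Num.max 1 (C * K) /\ between (Num.min c 1) (Num.max C 1) x (Num.min (M * D `^ (- g)) 1).
Proof.
move=> D0 g0 c0 C0 K1.
case: x => [x| |]; rewrite ?leye_eq ?leeNy_eq//= !lee_fin => low up rate.
have p0 : 0 < D `^ g by rewrite powR_gt0.
have pp : D `^ g * D `^ (- g) = 1 by rewrite -powRD ?(gt_eqF D0) ?implybT// subrr powRr0.
have n0 : 0 < D `^ (- g) by rewrite powR_gt0.
have x0 : 0 <= x by apply: le_trans low; rewrite mulr_ge0 ?(ltW c0)// le_min ler01 ltW.
split.
  rewrite ge_max !le_max lexx/=; have [D1|D1] := leP 1 D.
    apply/orP; right; apply: le_trans (ler_wpM2r (ltW p0) (rate D1)) _.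
    by rewrite (_ : _ * D `^ g = C * K * (D `^ g * D `^ (- g))); [rewrite pp mulr1 | ring].
  have p1 : D `^ g <= 1.
    have e1 : 1 `^ g = 1 :> R by rewrite powR1.
    by rewrite -[X in _ <= X]e1; apply: (ge0_ler_powR g0) => //; rewrite ?nnegrE ltW.
  apply/orP; right; apply: le_trans (ler_pM x0 (ltW p0) up p1) _.
  by rewrite mulr1 ler_peMr// ltW.
(* Multiplied by the rate, the sequence becomes the larger of the rate and the risk; where the rate
   is larger, the lower bound on the risk is used. *)
have -> : Num.max 1 (x * D `^ g) * D `^ (- g) = Num.max (D `^ (- g)) x.
  by rewrite maxr_pMl ?(ltW n0)// mul1r -mulrA pp mulr1.
rewrite /between !lee_fin; apply/andP; split.
  have m0 : 0 <= Num.min c 1 by rewrite le_min ler01 ltW.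
  have [xn|nx] := leP x (D `^ (- g)).
    apply: le_trans low; rewrite ler_wpM2r ?ge_min ?lexx// le_min ler01 ltW//.
  apply: (@le_trans _ _ (1 * x)); last by rewrite mul1r.
  by apply: ler_pM => //; rewrite ?ge_min ?lexx ?orbT// le_min x0 ler01.
have C1 : 1 <= Num.max C 1 by rewrite le_max lexx orbT.
have CC : C <= Num.max C 1 by rewrite le_max lexx.
rewrite minr_pMr ?(le_trans ler01)// le_min mulr1 (le_trans up CC) andbT.
apply: (@le_trans _ _ (1 * x)); first by rewrite mul1r.
by apply: ler_pM => //; rewrite le_max lexx orbT.
Qed.

(** A single [delta] at most 1/2 makes the logarithm at least [ln 2], hence at least 1/2, so that a
    multiple of [ln N] fits under the product of the two logarithms. *)
Lemma log_inv_del_ge (s : setting R) (j : 'I_(servers s)) : (forall i : 'I_(servers s), 0 <= del i) ->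
  del j <= 2^-1 -> ((2^-1 : R)%:E <= log_inv_del s)%E.
Proof.
move=> d0 dj; rewrite /log_inv_del; set x := \big[_/_]_(_ < _) _.
have x0 : (0 <= x)%E by apply: le_bigmin => // i _; rewrite lee_fin.
have xj : (x <= (2^-1 : R)%:E)%E by apply: (bigmin_inf j).
have x2 : ((2 : R)%:E <= x^-1)%E.
  move: x0 xj; case: x => [r| |]//; rewrite !lee_fin inver => r0 r2; case: eqP => [_|/eqP rn].
    exact: leey.
  rewrite lee_fin -[X in X <= _]invrK lef_pV2 ?posrE ?invr_gt0// lt_def rn//.
apply: (@le_trans _ _ (lne (2 : R)%:E)).
  by rewrite lne_EFin// lee_fin; have := @ln_obs_ge R 2 (lexx _); lra.
by rewrite lee_lne ?in_itv/= ?leey ?andbT//; exact: le_trans x2.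
Qed.

End calibration.

Theorem theorem2p1 (R : realType) (alpha rad Ceps : R) (p q : \bar R)
    (A l0 : nat) (W : cdv_system R)
    (hp : (2%:E <= p)%E) (hq : (1%:E <= q)%E)
    (hnu : 1 / 2 < alpha - invp p)
    (hrad : 0 < rad) (hCeps : 0 < Ceps)
    (hA : alpha < A%:R) (hW : cdv_basis W A l0) :
  (forall kappa Cdel : R, 0 < kappa -> 0 < Cdel ->
   exists c C CM : R, [/\ 0 < c, 0 < C, 0 < CM &
   forall (s : nat -> setting R) (D : nat -> R),
     (forall t, valid_setting Ceps (s t)) ->
     total_obs (s t) @[t --> \oo] --> \oo ->
     (forall t, solves_rate alpha (s t) (D t)) ->
     (forall t (j : 'I_(servers (s t))),
        del j <= Cdel * (Num.sqrt (nobs j)%:R * eps j ^+ 2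
                         * (Num.max (D t) 1)^-1) `^ (1 + kappa)) ->
   exists M : nat -> R, (forall t, 1 <= M t) /\
     \forall t \near \oo,
       ((M t)%:E <= CM%:E *
          Order.max 1 ((ln (total_obs (s t))%:R)%:E * log_inv_del (s t)))%E /\
       between c C
         (minimax (besov_ball W alpha p q l0 rad) (@global_risk R (s t)))
         (Num.min (M t * D t `^ (- (2 * alpha))) 1)])
  /\
  (forall x0 : R, 0 < x0 < 1 ->
   exists c C CM : R, [/\ 0 < c, 0 < C, 0 < CM &
   forall (s : nat -> setting R) (D : nat -> R),
     (forall t, valid_setting Ceps (s t)) ->
     total_obs (s t) @[t --> \oo] --> \oo ->
     (forall t, solves_rate (alpha - invp p) (s t) (D t)) ->
     (\sum_(j < servers (s t)) (nobs j)%:R * del j) @[t --> \oo] --> (0 : R) ->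
   exists M : nat -> R, (forall t, 1 <= M t) /\
     \forall t \near \oo,
       M t <= CM * ln (total_obs (s t))%:R /\
       between c C
         (minimax (besov_ball_cont W alpha p q l0 rad)
                  (@pointwise_risk R x0 (s t)))
         (Num.min (M t * D t `^ (- (2 * (alpha - invp p)))) 1)]).
Proof.
have al0 : 0 < alpha := besov_alpha_gt0 hp hnu.
have nu0 : 0 < alpha - invp p by apply: lt_trans hnu; rewrite divr_gt0.
have A0 : (0 < A)%N by rewrite -(ltr_nat R); apply: lt_trans hA.
have valid s : valid_setting Ceps s ->
    forall j : 'I_(servers s), [/\ (0 < nobs j)%N, 0 < eps j & 0 <= del j].
  by move=> v j; have [? /andP[? ?] ?] := v j; split.
(* With [M] equal to [8 ln N], the condition that the upper bounds put on [M] holds for every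
   setting. *)
have min_le s (D L : R) (j : 'I_(servers s)) : 0 <= L ->
    Num.min ((nobs j)%:R ^+ 2 * eps j ^+ 2) ((nobs j)%:R * D) * L <= L * ((nobs j)%:R ^+ 2 * eps j ^+ 2).
  by move=> L0; rewrite mulrC ler_wpM2l// ge_min lexx.
split.
- move=> kappa Cdel ka0 Cd0.
  have [c0 c00 low] := global_lower A0 hW hp hq hnu hrad hCeps ka0 Cd0.
  have [C0 C00 up] := global_upper A0 hW hp hq hnu hrad.
  have ka1 : 0 < 1 + kappa by rewrite addr_gt0.
  (* Since [Cdel cd ^ (1 + kappa)] is 1/2, a server below this threshold would have [delta] at most
     1/2. *)
  pose cd := (2 * Cdel)^-1 `^ (1 + kappa)^-1.
  have cd0 : 0 < cd by rewrite powR_gt0// invr_gt0 mulr_gt0.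
  (* The constant of [loose_privacy], the price of the noise when every [delta] exceeds 1/2. *)
  pose K1 := Num.max 1 (8 * (2 * alpha + 1 + `|ln (Num.min cd 1)|) * Ceps ^+ 2 / cd ^+ 2).
  have K11 : 1 <= K1 by rewrite le_max lexx.
  (* [16 C0] rewrites [8 C0 ln N] in terms of half of [ln N], the half being the lower bound on the
     other logarithm; [C0 K1] covers loose privacy. *)
  exists (Num.min c0 1), (Num.max C0 1), (1 + 16 * C0 + C0 * K1); split.
  + by rewrite lt_min c00 ltr01.
  + by rewrite lt_max C00.
  + by rewrite !addr_gt0// mulr_gt0// (lt_le_trans ltr01).
  move=> s D val hN rate hdel.
  exists (fun t => Num.max 1 (fine (minimax (besov_ball W alpha p q l0 rad) (@global_risk R (s t))) * D t `^ (2 * alpha))).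
  split; first by move=> t; rewrite le_max lexx.
  have : \forall t \near \oo, (2 <= total_obs (s t))%N := hN _ (nbhs_infty_ge 2).
  apply: filterS => t N2.
  have N2' : 2 <= (total_obs (s t))%:R :> R by rewrite ler_nat.
  have lnN := ln_obs_ge N2'; set L := ln _ in lnN.
  have L0 : 0 <= 8 * L by lra.
  have [D0 _] := rate t.
  have [upc upr] := up _ (valid _ (val t)).
  have lo := low _ _ (val t) (rate t) (hdel t).
  have g0 : 0 <= 2 * alpha by rewrite mulr_ge0// ltW.
  have [[j dj]|nd] := pselect (exists j : 'I_(servers (s t)), del j <= 2^-1).
    have lid : ((2^-1 : R)%:E <= log_inv_del (s t))%E.
      by apply: (log_inv_del_ge (j := j)) => // i; have [] := val t i.
    have [] := @calibrate R _ (D t) (2 * alpha) c0 C0 (8 * L) D0 g0 c00 C00 _ lo upc _.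
    + lra.
    + move=> D1; apply: upr => //; first lra.
      by move=> i; exact: min_le.
    move=> ML bet; split => //.
    apply: (@le_trans _ _ ((1 + 16 * C0 + C0 * K1)%:E * (Num.max 1 (L * 2^-1))%:E)%E).
      rewrite -EFinM lee_fin; apply: (le_trans ML).
      have CK : 0 <= C0 * K1 by rewrite mulr_ge0 ?ltW// (lt_le_trans ltr01).
      have m1 : 1 <= Num.max 1 (L * 2^-1) by rewrite le_max lexx.
      have m2 : L * 2^-1 <= Num.max 1 (L * 2^-1) by rewrite le_max lexx orbT.
      move: (Num.max 1 (L * 2^-1)) m1 m2 => m m1 m2.
      move: CK C00 (ler_wpM2l CK m1) (ler_wpM2l (ltW C00) m2) (ler_wpM2l (ltW C00) m1) (m1); move: (K1) (L) => k l; clear.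
      by move=> *; rewrite ge_max; apply/andP; split; lra.
    apply: lee_wpmul2l; first by rewrite lee_fin !addr_ge0// mulr_ge0// ltW// (lt_le_trans ltr01).
    rewrite EFin_max; apply: (@le_trans _ _ (maxe 1 (L%:E * (2^-1 : R)%:E)))%E; first by rewrite -EFinM.
    rewrite ge_max !le_max lexx/=; apply/orP; right; apply: lee_wpmul2l => //.
    by rewrite lee_fin; lra.
  have hc (j : 'I_(servers (s t))) : cd <= Num.sqrt (nobs j)%:R * eps j ^+ 2 * (Num.max (D t) 1)^-1.
    rewrite leNgt; apply/negP => lt; apply: nd; exists j; apply: le_trans (hdel t j) _.
    have [n0 /andP[e0 _] d0] := val t j.
    have y0 : 0 <= Num.sqrt (nobs j)%:R * eps j ^+ 2 * (Num.max (D t) 1)^-1.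
      by apply: mulr_ge0; [rewrite mulr_ge0 ?sqrtr_ge0 ?sqr_ge0 | rewrite invr_ge0 le_max ler01 orbT].
    rewrite -ler_pdivlMl// [X in _ <= X]mulrC.
    have -> : 2^-1 / Cdel = cd `^ (1 + kappa).
      by rewrite /cd -powRrM mulVf ?gt_eqF// powRr1 ?invr_ge0 ?mulr_ge0 ?(ltW Cd0)// invfM.
    by apply: (ge0_ler_powR (ltW ka1)); rewrite ?nnegrE// ltW.
  have [] := @calibrate R _ (D t) (2 * alpha) c0 C0 K1 D0 g0 c00 C00 K11 lo upc _.
    move=> D1; apply: upr => //.
    have eC (j : 'I_(servers (s t))) : eps j <= Ceps by have [_ /andP[]] := val t j.
    have hc' (j : 'I_(servers (s t))) : cd * D t <= Num.sqrt (nobs j)%:R * eps j ^+ 2.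
      by have := hc j; rewrite max_l// ler_pdivlMr.
    move=> j; apply: le_trans (loose_privacy al0 (valid _ (val t)) (rate t) D1 cd0 hCeps eC hc' j) _.
    apply: ler_wpM2r; last by rewrite /K1 le_max lexx orbT.
    by apply: mulr_ge0; exact: sqr_ge0.
  move=> ML bet; split => //.
  apply: (@le_trans _ _ ((1 + 16 * C0 + C0 * K1)%:E * 1)%E).
    rewrite mule1 lee_fin; apply: (le_trans ML).
    have CK : 0 <= C0 * K1 by rewrite mulr_ge0 ?ltW// (lt_le_trans ltr01).
    by move: CK C00; move: (K1) => k; clear => *; rewrite ge_max; apply/andP; split; lra.
  apply: lee_wpmul2l; last by rewrite le_max lexx.
  by rewrite lee_fin !addr_ge0// mulr_ge0// ltW// (lt_le_trans ltr01).
- move=> x0 x01.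
  have [c0 [eta [c00 eta0 low]]] := pointwise_lower A0 hW hp hq hnu hrad hCeps x01.
  have [C0 C00 up] := pointwise_upper A0 hW hp hq hnu hrad x01.
  (* For [N >= 2] the logarithm is at least 1/2, so [2 ln N] covers the constant one. *)
  exists (Num.min c0 1), (Num.max C0 1), (2 + 8 * C0); split.
  + by rewrite lt_min c00 ltr01.
  + by rewrite lt_max C00.
  + by rewrite addr_gt0// mulr_gt0.
  move=> s D val hN rate hdel.
  exists (fun t => Num.max 1 (fine (minimax (besov_ball_cont W alpha p q l0 rad) (@pointwise_risk R x0 (s t))) * D t `^ (2 * (alpha - invp p)))).
  split; first by move=> t; rewrite le_max lexx.
  have n1 : \forall t \near \oo, (2 <= total_obs (s t))%N := hN _ (nbhs_infty_ge 2).
  have n2 : \forall t \near \oo, \sum_(j < servers (s t)) (nobs j)%:R * del j <= eta.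
    move/cvgrPdist_le : hdel => /(_ eta eta0); apply: filterS => t; rewrite sub0r normrN.
    exact: le_trans (ler_norm _).
  apply: filterS2 n1 n2 => t N2 dt.
  have N2' : 2 <= (total_obs (s t))%:R :> R by rewrite ler_nat.
  have lnN := ln_obs_ge N2'; set L := ln _ in lnN *.
  have L0 : 0 <= 8 * L by lra.
  have [D0 _] := rate t.
  have [upc upr] := up _ (valid _ (val t)).
  have lo := low _ _ (val t) (rate t) dt.
  have g0 : 0 <= 2 * (alpha - invp p) by rewrite mulr_ge0// ltW.
  have [] := @calibrate R _ (D t) (2 * (alpha - invp p)) c0 C0 (8 * L) D0 g0 c00 C00 _ lo upc _.
  + lra.
  + move=> D1; apply: upr => //; first lra.
    by move=> i; exact: min_le.
  move=> ML bet; split => //; apply: (le_trans ML).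
  rewrite -/L; move: (ler_wpM2l (ltW C00) lnN) (lnN) (C00); move: (L) => l; clear => *.
  by rewrite ge_max; apply/andP; split; lra.
Qed.
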